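(* The category of geometric vertex algebras is isomorphic to the category of $\mathbf{Z}$-graded vertex algebras. In detail: (1) There is a bijection $\Phi$ from geometric vertex algebras to $\mathbf{Z}$-graded vertex algebras which maps a geometric vertex algebra $(\mathcal{V},\mu)$ to the $\mathbf{Z}$-graded vertex algebra $\Phi(\mathcal{V},\mu)=(\mathcal{V},Y_\mu,T_\mu,|0\rangle_\mu)$ with the same underlying $\mathbf{Z}$-graded vector space, where for all $a,b\in\mathcal{V}$ \begin{align*} Y_\mu(a,x)b &= L[z\mapsto \mu(a,z,b,0)](x)\in\mathcal{V}[[x^{\pm1}]],\\ T_\mu a &= \partial_z\mu(a,z)|_{z=0},\\ |0\rangle_\mu &= \mu(\emptyset). \end{align*} (2) The inverse $\Psi$ of $\Phi$ is given by $\Psi(\mathcal{V},Y,T,|0\rangle)=(\mathcal{V},\mu_Y)$ where, for $m\ge 0$ and $a=a_1\otimes\dots\otimes a_m\in\mathcal{V}^{\otimes m}$, the function $\mu_Y(a)$ is the unique $\overline{\mathcal{V}}$-valued holomorphic function on $\mathbf{C}^m\setminus\Delta$ such that $$\mu_Y(a)(z)=Y(a_1,z_1)\cdots Y(a_m,z_m)|0\rangle$$ for all $z=(z_1,\dots,z_m)\in\mathbf{C}^m\setminus\Delta$ with $|z_1|>\dots>|z_m|$. (3) If $(\mathcal{V},\mu)$ and $(\mathcal{V}',\mu')$ are geometric vertex algebras and $f:\mathcal{V}\to\mathcal{V}'$ is a morphism of $\mathbf{Z}$-graded vector spaces, then $f$ is a morphism $(\mathcal{V},\mu)\to(\mathcal{V}',\mu')$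 of geometric vertex algebras if and only if $f$ is a morphism $\Phi(\mathcal{V},\mu)\to\Phi(\mathcal{V}',\mu')$ of $\mathbf{Z}$-graded vertex algebras.
   Context: All vector spaces are over $\mathbf{C}$. For $n\ge 0$, $\Delta=\Delta_n=\{(z_1,\dots,z_n)\in\mathbf{C}^n\mid z_i=z_j\text{ for some } i\ne j\}$; $\mathbf{C}^0\setminus\Delta$ is a point. For a $\mathbf{Z}$-graded vector space $\mathcal{V}=\bigoplus_{k\in\mathbf{Z}}\mathcal{V}_k$ put $\overline{\mathcal{V}}=\prod_{k\in\mathbf{Z}}\mathcal{V}_k\supseteq\mathcal{V}$, with projections $p_k:\overline{\mathcal{V}}\to\mathcal{V}_k$; $|v|$ is the degree of a homogeneous $v\in\mathcal{V}$. Morphisms of $\mathbf{Z}$-graded vector spaces are degree-preserving linear maps; such $f:\mathcal{V}\to\mathcal{V}'$ extends componentwise to $\overline{\mathcal{V}}\to\overline{\mathcal{V}'}$. Holomorphic functions and normal convergence. Let $U\subseteq\mathbf{C}^n$ be open and $X$ a vector space. A map $f:U\to X$ is holomorphic if every $p\in U$ has an open neighborhood $W$ and a finite-dimensional subspace $Y\subseteq X$ with $f(W)\subseteq Y$ and $f|_W:W\to Y$ holomorphic. $\mathcal{O}(U;\overline{\mathcal{V}})$ is the space of functions $f:U\to\overline{\mathcal{V}}$ all of whose components $p_k\circ f$ are holomorphic (''holomorphic $\overline{\mathcal{V}}$-valued functions''). A sum $\sum_{i\in I}f_i$ of holomorphic functions $U\to X$ is normally convergent if for all compact $K\subseteq U$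 there is a finite-dimensional subspace $Y\subseteq X$ with $f_i(K)\subseteq Y$ for all $i$ and $\sum_i\sup_{x\in K}\|f_i(x)\|_Y<\infty$ for a norm on $Y$. Geometric vertex algebra $(\mathcal{V},\mu)$: a $\mathbf{Z}$-graded vector space $\mathcal{V}$ with linear maps $\mu:\mathcal{V}^{\otimes n}\to\mathcal{O}(\mathbf{C}^n\setminus\Delta;\overline{\mathcal{V}})$ for $n\ge0$, written $\mu(a_1\otimes\dots\otimes a_n)(z_1,\dots,z_n)=\mu(a_1,z_1,\dots,a_n,z_n)$ (and $\mu(\emptyset)\in\overline{\mathcal{V}}$ for the image of $1$ when $n=0$), such that: - (permutation invariance) $\mu(a^\sigma,z^\sigma)=\mu(a,z)$ for $\sigma\in\Sigma_n$ (simultaneous permutation of the $a_i$ and $z_i$); - (insertion at zero) $\mu(a,0)=a$ for $a\in\mathcal{V}$; - (associativity) for $m,n\ge0$, $a_1,\dots,a_m,b_1,\dots,b_n\in\mathcal{V}$ and $l\in\mathbf{Z}$, on the set of $(z,w)\in(\mathbf{C}^{m+1}\setminus\Delta)\times(\mathbf{C}^n\setminus\Delta)$ with $\max_i|w_i|<\min_{1\le j\le m}|z_j-z_{m+1}|$ (no condition if $m=0$ or $n=0$), $$\sum_{k\in\mathbf{Z}}p_l\mu(a_1,z_1,\dots,a_m,z_m,p_k\mu(b_1,w_1,\dots,b_n,w_n),z_{m+1})=p_l\mu(a_1,z_1,\dots,a_m,z_m,b_1,w_1+z_{m+1},\dots,b_n,w_n+z_{m+1}),$$ where the sum of $\mathcal{V}_l$-valued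 functions of $(z,w)$ is normally convergent; - ($\mathbf{C}^\times$-equivariance) $z.\mu(a_1,w_1,\dots,a_n,w_n)=\mu(z.a_1,zw_1,\dots,z.a_n,zw_n)$ for $z\in\mathbf{C}^\times$, where $z$ acts on $\mathcal{V}$ and $\overline{\mathcal{V}}$ by $z^l$ on $\mathcal{V}_l$; - (meromorphicity) for all $a,b\in\mathcal{V}$ there is an integer $N$ such that $z^N\mu(a,z,b,0)$, $z\in\mathbf{C}\setminus\{0\}$, extends holomorphically to $z\in\mathbf{C}$. A morphism $(\mathcal{V},\mu)\to(\mathcal{V}',\mu')$ is a morphism $f$ of $\mathbf{Z}$-graded vector spaces with $f(\mu(a_1,z_1,\dots,a_n,z_n))=\mu'(f(a_1),z_1,\dots,f(a_n),z_n)$ for all $n\ge0$, $a_i\in\mathcal{V}$, $z\in\mathbf{C}^n\setminus\Delta$. $\mathbf{Z}$-graded vertex algebra $(\mathcal{V},Y,T,|0\rangle)$: a $\mathbf{Z}$-graded vector space $\mathcal{V}$; a linear map $Y:\mathcal{V}\to\mathrm{End}(\mathcal{V})[[x^{\pm1}]]$, $a\mapsto Y(a,x)=\sum_{k\in\mathbf{Z}}a_{(k)}x^{-k-1}$, where the mode $a_{(k)}$ is homogeneous of degree $|a|-k-1$ for homogeneous $a$; a degree $1$ endomorphism $T$ of $\mathcal{V}$; a vector $|0\rangle\in\mathcal{V}_0$; such that: - (locality) for all $a,b$ there is $N\in\mathbf{N}$ with $(x-y)^N[Y(a,x),Y(b,y)]=0$ in $\mathrm{End}(\mathcal{V})[[x^{\pm1},y^{\pm1}]]$;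 - (translation) $T|0\rangle=0$ and $[T,Y(a,x)]=\partial_xY(a,x)$; - (creation) $Y(a,x)|0\rangle\in a+x\mathcal{V}[[x]]$; - (vacuum) $Y(|0\rangle,x)=\mathrm{id}_{\mathcal{V}}$. A morphism of $\mathbf{Z}$-graded vertex algebras is a morphism $f$ of $\mathbf{Z}$-graded vector spaces with $f(Y(a,x)b)=Y'(f(a),x)f(b)$ for all $a,b$ and $f(|0\rangle)=|0\rangle'$. Notation. $L[f](x)$ is the Laurent expansion of a holomorphic $\overline{\mathcal{V}}$-valued function $f$ on $\mathbf{C}\setminus\{0\}$, taken componentwise, an element of $\prod_k(\mathcal{V}_k[[x^{\pm1}]])=\overline{\mathcal{V}}[[x^{\pm1}]]\supseteq\mathcal{V}[[x^{\pm1}]]$. Modes $a_{(k)}$ extend to $\overline{\mathcal{V}}\to\overline{\mathcal{V}}$ by $a_{(k)}b=\sum_{l}a_{(k)}p_lb$. For $|z_1|>\dots>|z_m|$, $$Y(a_1,z_1)\cdots Y(a_m,z_m)|0\rangle=\sum_{k_1\in\mathbf{Z}}{a_1}_{(k_1)}z_1^{-k_1-1}\cdots\sum_{k_m\in\mathbf{Z}}{a_m}_{(k_m)}z_m^{-k_m-1}|0\rangle=\sum_{k\in\mathbf{Z}^m}{a_1}_{(k_1)}\cdots{a_m}_{(k_m)}|0\rangle\, z_1^{-k_1-1}\cdots z_m^{-k_m-1},$$ with convergence in each component of $\overline{\mathcal{V}}$; since ${a_m}_{(k)}|0\rangle=0$ for $k\ge0$, only non-negative powers of $z_m$ occur, so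 $z_m=0$ is allowed. The isomorphism of categories sends a morphism to the same underlying morphism of $\mathbf{Z}$-graded vector spaces. *)

(* Defs.v *)
From HB Require Import structures.
From mathcomp Require Import all_boot all_order all_algebra all_fingroup.
From mathcomp Require Import all_classical all_reals all_analysis.
From mathcomp Require Import complex summability.

Set Implicit Arguments.
Unset Strict Implicit.
Unset Printing Implicit Defensive.

Import Order.TTheory GRing.Theory Num.Theory.
Import numFieldNormedType.Exports.

Local Open Scope classical_set_scope.
Local Open Scope ring_scope.

(* Typing the complex numbers as a [numFieldType] gives them, and the spaces
   ['rV_n] over them, the topology and norm of mathcomp-analysis. *)
Definition Cx (R : realType) : numFieldType := R[i].

Section Holomorphic.
Variable R : realType.
Local Notation C := (Cx R).

(* Finite-dimensional subspaces Y of a vector space X are given by a basis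
   e : 'I_d -> X; a point of Y is identified with its coordinates in 'rV[C]_d,
   from which Y gets its topology and its norm. *)
Definition lcomb (X : lmodType C) d (e : 'I_d -> X) (c : 'rV[C]_d) : X :=
  \sum_(j < d) c 0 j *: e j.

Definition lin_indep (X : lmodType C) d (e : 'I_d -> X) : Prop :=
  forall c : 'rV[C]_d, lcomb e c = 0 -> c = 0.

(* Several variables: complex Frechet differentiability at every point. *)
Definition holomorphic (E : normedModType C) (X : lmodType C)
    (U : set E) (f : E -> X) : Prop :=
  forall p, U p -> exists W : set E,
    [/\ open W, W p, W `<=` U &
        exists d (e : 'I_d -> X) (c : E -> 'rV[C]_d),
          [/\ lin_indep e,
              forall x, W x -> f x = lcomb e (c x) &
              forall x, W x -> differentiable c x]].

Definition normally_convergent (E : normedModType C) (X : lmodType C)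
    (I : choiceType) (U : set E) (f : I -> E -> X) : Prop :=
  (forall i, holomorphic U (f i)) /\
  forall K : set E, compact K -> K `<=` U ->
    exists d (e : 'I_d -> X) (c : I -> E -> 'rV[C]_d),
      [/\ lin_indep e,
          forall i x, K x -> f i x = lcomb e (c i x) &
          (\esum_(i in [set: I])
             ereal_sup [set (complex.Re (`|c i x| : C))%:E | x in K] < +oo)%E].

(* The sum of the family f is s: all terms lie in one finite-dimensional
   subspace, in which the net of finite partial sums converges to s (which is
   absolute convergence, as the subspace is finite-dimensional). *)
Definition has_sum (X : lmodType C) (I : choiceType) (f : I -> X) (s : X) :
    Prop :=
  exists d (e : 'I_d -> X) (c : I -> 'rV[C]_d) (t : 'rV[C]_d),
    [/\ lin_indep e,
        forall i, f i = lcomb e (c i),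
        s = lcomb e t &
        partial_sum c @ totally --> t].

Definition has_derivative (X : lmodType C) (f : C -> X) (x : C) (v : X) :
    Prop :=
  exists d (e : 'I_d -> X) (c : C -> 'rV[C]_d) (dc : 'rV[C]_d),
    [/\ lin_indep e,
        \forall t \near x, f t = lcomb e (c t),
        is_derive x 1 c dc &
        v = lcomb e dc].

(* sum_n x^n c_n is the Laurent expansion on C \ {0} of f *)
Definition is_laurent (X : lmodType C) (f : C -> X) (c : int -> X) : Prop :=
  forall z : C, z != 0 -> has_sum (fun n : int => z ^ n *: c n) (f z).

End Holomorphic.

Section Graded.
Variable R : realType.
Local Notation C := (Cx R).

Definition graded := int -> lmodType C.

(* [gbar V] is the product of the V k *)
Definition gbar (V : graded) : Type := forall k, V k.

Section Product.
Variable V : graded.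
Implicit Types u v : gbar V.

HB.instance Definition _ := gen_eqMixin (gbar V).
HB.instance Definition _ := gen_choiceMixin (gbar V).

Definition gbar_zero : gbar V := fun=> 0.
Definition gbar_opp u : gbar V := fun k => - u k.
Definition gbar_add u v : gbar V := fun k => u k + v k.
Definition gbar_scale (c : C) u : gbar V := fun k => c *: u k.

Fact gbar_addA : associative gbar_add.
Proof. by move=> u v w; apply: functional_extensionality_dep => k; exact: addrA. Qed.
Fact gbar_addC : commutative gbar_add.
Proof. by move=> u v; apply: functional_extensionality_dep => k; exact: addrC. Qed.
Fact gbar_add0 : left_id gbar_zero gbar_add.
Proof. by move=> u; apply: functional_extensionality_dep => k; exact: add0r. Qed.
Fact gbar_addN : left_inverse gbar_zero gbar_opp gbar_add.
Proof. by move=> u; apply: functional_extensionality_dep => k; exact: addNr. Qed.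

HB.instance Definition _ :=
  GRing.isZmodule.Build (gbar V) gbar_addA gbar_addC gbar_add0 gbar_addN.

Fact gbar_scaleA a b u : gbar_scale a (gbar_scale b u) = gbar_scale (a * b) u.
Proof. by apply: functional_extensionality_dep => k; exact: scalerA. Qed.
Fact gbar_scale1 : left_id 1 gbar_scale.
Proof. by move=> u; apply: functional_extensionality_dep => k; exact: scale1r. Qed.
Fact gbar_scaleDr : right_distributive gbar_scale +%R.
Proof. by move=> a u v; apply: functional_extensionality_dep => k; exact: scalerDr. Qed.
Fact gbar_scaleDl u : {morph gbar_scale^~ u : a b / a + b}.
Proof. by move=> a b; apply: functional_extensionality_dep => k; exact: scalerDl. Qed.

HB.instance Definition _ := GRing.Zmodule_isLmodule.Build C (gbar V)
  gbar_scaleA gbar_scale1 gbar_scaleDr gbar_scaleDl.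

(* [dsum V] is the direct sum of the V k, inside their product *)
Definition gsupp u : set int := [set k | u k <> 0].
Definition fin_supp : {pred gbar V} := fun u => `[< finite_set (gsupp u) >].

Fact fin_supp_submod : submod_closed fin_supp.
Proof.
split.
  apply/asboolP; suff -> : gsupp 0 = set0 by exact: finite_set0.
  by apply/seteqP; split => // k /(_ erefl).
move=> c u v /asboolP fu /asboolP fv; apply/asboolP.
apply: (@sub_finite_set _ _ (gsupp u `|` gsupp v)); last by rewrite finite_setU.
move=> k /= uvk; apply: contrapT => /not_orP[/contrapT uk /contrapT vk].
by apply: uvk; rewrite [LHS](_ : _ = c *: u k + v k)// uk vk scaler0 addr0.
Qed.
HB.instance Definition _ :=
  GRing.isSubmodClosed.Build C (gbar V) fin_supp fin_supp_submod.

Record dsum : Type := DSum { dval :> gbar V; _ : dval \in fin_supp }.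
HB.instance Definition _ := [isSub for dval].
HB.instance Definition _ := [Choice of dsum by <:].
HB.instance Definition _ := [SubChoice_isSubLmodule of dsum by <:].

Fact dinj_subproof k (v : V k) : (eqtype.dfwith (fun=> 0) v : gbar V) \in fin_supp.
Proof.
apply/asboolP; apply: (@sub_finite_set _ _ [set k]); last exact: finite_set1.
move=> j /= vj; apply: contrapT => /eqP; rewrite eq_sym => jk; apply: vj.
by rewrite eqtype.dfwith_out.
Qed.
Definition dinj k (v : V k) : dsum := DSum (dinj_subproof v).

Definition homogeneous (d : int) (v : dsum) : Prop :=
  forall k, k != d -> dval v k = 0.

End Product.

Record ghom (V V' : graded) : Type := GHom {
  gfun :> forall k, V k -> V' k;
  gfun_linear : forall k, linear (@gfun k) }.
Arguments gfun {V V'} g k v : rename.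

Lemma ghom_eq V V' (f g : ghom V V') : gfun f = gfun g -> f = g.
Proof.
by case: f g => [f lf] [g lg] /= fg; case: _ / fg lg => lg; congr GHom; exact: Prop_irrelevance.
Qed.

Definition gid V : ghom V V :=
  @GHom V V (fun k v => v) (fun k a u v => erefl).

Fact gcomp_subproof V1 V2 V3 (g : ghom V2 V3) (f : ghom V1 V2) k :
  linear (fun v => g k (f k v)).
Proof. by move=> a u v; rewrite !gfun_linear. Qed.
Definition gcomp V1 V2 V3 (g : ghom V2 V3) (f : ghom V1 V2) : ghom V1 V3 :=
  GHom (gcomp_subproof g f).

Definition bmap V V' (f : ghom V V') (v : gbar V) : gbar V' :=
  fun k => f k (v k).

Fact dmap_subproof V V' (f : ghom V V') (v : dsum V) :
  bmap f v \in @fin_supp V'.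
Proof.
case: v => v /= /asboolP fv; apply/asboolP; apply: sub_finite_set fv => k /= fvk v0.
apply: fvk; rewrite /bmap v0; have /= := gfun_linear f (-1) (0 : V k) 0.
by rewrite scaler0 addr0 scaleN1r addNr.
Qed.
Definition dmap V V' (f : ghom V V') (v : dsum V) : dsum V' :=
  DSum (dmap_subproof f v).

Fact cact_subproof (V : graded) (z : C) k : linear (fun v : V k => z ^ k *: v).
Proof. by move=> a u v; rewrite scalerDr !scalerA mulrC. Qed.
(* the action of z <> 0 by z^k on V k *)
Definition cact (V : graded) (z : C) : ghom V V := GHom (@cact_subproof V z).

Definition holomorphic_bar (E : normedModType C) (V : graded) (U : set E)
    (f : E -> gbar V) : Prop :=
  forall k, holomorphic U (fun x => f x k).

End Graded.

Section GeometricVertexAlgebra.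
Variable R : realType.
Local Notation C := (Cx R).

Definition diag n : set 'rV[C]_n :=
  [set z | exists i j : 'I_n, i != j /\ z 0 i = z 0 j].
Definition conf n : set 'rV[C]_n := ~` @diag n.

Definition row_upd (T : Type) n (a : 'rV[T]_n) (i : 'I_n) (x : T) : 'rV[T]_n :=
  \row_j (if j == i then x else a 0 j).

Section Structure.
Variable V : graded R.
Local Notation dV := (dsum V).

Section Conditions.
Variable mu : forall n, 'rV[dV]_n -> 'rV[C]_n -> gbar V.

(* mu(a, z) and mu(a, z, b, w) *)
Definition mu1 (a : dV) (z : C) : gbar V := mu (const_mx a : 'rV_1) (const_mx z).
Definition mu2 (a : dV) (z : C) (b : dV) (w : C) : gbar V :=
  mu (row_mx (const_mx a : 'rV_1) (const_mx b : 'rV_1))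
     (row_mx (const_mx z) (const_mx w)).

(* Linear maps on the n-fold tensor power are n-linear maps. *)
Definition mu_multilinear : Prop :=
  forall n (a : 'rV[dV]_n) (i : 'I_n) (c : C) (u v : dV) (z : 'rV[C]_n),
    conf z ->
    mu (row_upd a i (c *: u + v)) z =
      c *: mu (row_upd a i u) z + mu (row_upd a i v) z.

Definition mu_permutation : Prop :=
  forall n (s : 'S_n) (a : 'rV[dV]_n) (z : 'rV[C]_n), conf z ->
    mu (col_perm s a) (col_perm s z) = mu a z.

Definition mu_insertion : Prop := forall a : dV, mu1 a 0 = a.

(* z_(m+1) is the last coordinate of z *)
Definition assoc_dom m n : set ('rV[C]_(m + 1) * 'rV[C]_n) :=
  [set zw | [/\ conf zw.1, conf zw.2 &
     forall (i : 'I_n) (j : 'I_m),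
       `|zw.2 0 i| < `|zw.1 0 (lshift 1 j) - zw.1 0 (rshift m 0)|]].

Definition assoc_term m n (a : 'rV[dV]_m) (b : 'rV[dV]_n) (l k : int)
    (zw : 'rV[C]_(m + 1) * 'rV[C]_n) : V l :=
  mu (row_mx a (const_mx (dinj (mu b zw.2 k)) : 'rV_1)) zw.1 l.

Definition assoc_val m n (a : 'rV[dV]_m) (b : 'rV[dV]_n) (l : int)
    (zw : 'rV[C]_(m + 1) * 'rV[C]_n) : V l :=
  mu (row_mx a b)
     (row_mx (lsubmx zw.1) (zw.2 + const_mx (zw.1 0 (rshift m 0)))) l.

Definition mu_associativity : Prop :=
  forall m n (a : 'rV[dV]_m) (b : 'rV[dV]_n) (l : int),
    normally_convergent (@assoc_dom m n) (assoc_term a b l) /\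
    forall zw, assoc_dom zw ->
      has_sum (fun k => assoc_term a b l k zw) (assoc_val a b l zw).

Definition mu_equivariance : Prop :=
  forall n (z : C) (a : 'rV[dV]_n) (w : 'rV[C]_n), z != 0 -> conf w ->
    bmap (cact V z) (mu a w) = mu (map_mx (dmap (cact V z)) a) (z *: w).

Definition mu_meromorphicity : Prop :=
  forall a b : dV, exists (N : int) (g : C -> gbar V),
    holomorphic_bar [set: C] g /\
    forall z, z != 0 -> g z = z ^ N *: mu2 a z b 0.

End Conditions.

(* A function on C^n \ Delta is represented by its extension by 0 to C^n
   ([gmu_diag]), so that equality of functions is equality on C^n \ Delta. *)
Record geomVA : Type := GeomVA {
  gmu : forall n, 'rV[dV]_n -> 'rV[C]_n -> gbar V;
  gmu_diag : forall n (a : 'rV[dV]_n) z, diag z -> gmu a z = 0;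
  gmu_holomorphic : forall n (a : 'rV[dV]_n), holomorphic_bar (@conf n) (gmu a);
  gmu_multilinear : mu_multilinear gmu;
  gmu_permutation : mu_permutation gmu;
  gmu_insertion : mu_insertion gmu;
  gmu_associativity : mu_associativity gmu;
  gmu_equivariance : mu_equivariance gmu;
  gmu_meromorphicity : mu_meromorphicity gmu }.

End Structure.

Definition geom_morphism (V V' : graded R) (M : geomVA V) (M' : geomVA V')
    (f : ghom V V') : Prop :=
  forall n (a : 'rV[dsum V]_n) (z : 'rV[C]_n), conf z ->
    bmap f (gmu M a z) = gmu M' (map_mx (dmap f) a) z.

End GeometricVertexAlgebra.

Section VertexAlgebra.
Variable R : realType.
Local Notation C := (Cx R).

(* Formal distributions in x, resp. in x and y, are families of coefficients:
   F n is the coefficient of x^n, and F p q is that of x^p y^q. *)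
Definition mul_xsuby (X : zmodType) (F : int -> int -> X) : int -> int -> X :=
  fun p q => F (p - 1) q - F p (q - 1).

Section Structure.
Variable V : graded R.
Local Notation dV := (dsum V).

Section Conditions.
(* Y a n is the coefficient of x^n in Y(a, x). *)
Variables (Y : dV -> int -> dV -> dV) (T : dV -> dV) (vac : dV).

Definition mode (a : dV) (k : int) : dV -> dV := Y a (- k - 1).

Definition Y_bilinear : Prop :=
  (forall n b, linear (fun a => Y a n b)) /\ (forall a n, linear (Y a n)).

Definition Y_degree : Prop :=
  forall (d e k : int) (a b : dV), homogeneous d a -> homogeneous e b ->
    homogeneous (e + (d - k - 1)) (mode a k b).

Definition T_degree : Prop :=
  forall (d : int) (a : dV), homogeneous d a -> homogeneous (d + 1) (T a).

Definition Y_commutator (a b c : dV) (p q : int) : dV :=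
  Y a p (Y b q c) - Y b q (Y a p c).

Definition Y_locality : Prop :=
  forall a b : dV, exists N : nat, forall (c : dV) (p q : int),
    iter N (@mul_xsuby dV) (Y_commutator a b c) p q = 0.

Definition Y_translation : Prop :=
  T vac = 0 /\
  forall (a b : dV) (n : int),
    T (Y a n b) - Y a n (T b) = (n + 1)%:~R *: Y a (n + 1) b.

Definition Y_creation : Prop :=
  forall a : dV, Y a 0 vac = a /\ forall n : int, n < 0 -> Y a n vac = 0.

Definition Y_vacuum : Prop :=
  forall (n : int) (b : dV), Y vac n b = if n == 0 then b else 0.

End Conditions.

Record vertexVA : Type := VertexVA {
  vY : dV -> int -> dV -> dV;
  vT : dV -> dV;
  vvac : dV;
  vY_bilinear : Y_bilinear vY;
  vY_degree : Y_degree vY;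
  vT_linear : linear vT;
  vT_degree : T_degree vT;
  vvac_degree : homogeneous 0 vvac;
  vY_locality : Y_locality vY;
  vY_translation : Y_translation vY vT vvac;
  vY_creation : Y_creation vY vvac;
  vY_vacuum : Y_vacuum vY vvac }.

End Structure.

Definition vertex_morphism (V V' : graded R) (S : vertexVA V)
    (S' : vertexVA V') (f : ghom V V') : Prop :=
  (forall (a b : dsum V) (n : int),
     dmap f (vY S a n b) = vY S' (dmap f a) n (dmap f b)) /\
  dmap f (vvac S) = vvac S'.

(* v = Y(a_1, z_1) ... Y(a_m, z_m) |0>, as a sum over k in Z^m. If z_m = 0,
   the terms with k_m >= 0 vanish and, since 0 ^ n = 0 for n <> 0 and
   0 ^ 0 = 1, only the one of degree 0 in z_m remains. *)
Definition Y_product (V : graded R) (S : vertexVA V) m (a : 'rV[dsum V]_m)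
    (z : 'rV[C]_m) (v : gbar V) : Prop :=
  forall l : int, has_sum
    (fun k : 'rV[int]_m =>
       (\prod_(i < m) z 0 i ^ (- k 0 i - 1)) *:
       dval (foldr (fun i b => mode (vY S) (a 0 i) (k 0 i) b)
                   (vvac S) (enum 'I_m)) l)
    (v l).

End VertexAlgebra.

Section Correspondence.
Variable R : realType.
Local Notation C := (Cx R).
Variable V : graded R.

(* S = (V, Y_mu, T_mu, |0>_mu) *)
Definition is_vertex_of_geom (M : geomVA V) (S : vertexVA V) : Prop :=
  [/\ forall (a b : dsum V) (l : int),
        is_laurent (fun z => mu2 (@gmu _ _ M) a z b 0 l)
                   (fun n => dval (vY S a n b) l),
      forall (a : dsum V) (l : int),
        has_derivative (fun z => mu1 (@gmu _ _ M) a z l) 0 (dval (vT S a) l) &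
      dval (vvac S) = gmu M (0 : 'rV_0) 0].

(* the property defining mu_Y(a) on C^m \ Delta *)
Definition is_correlation (S : vertexVA V) m (a : 'rV[dsum V]_m)
    (g : 'rV[C]_m -> gbar V) : Prop :=
  holomorphic_bar (@conf R m) g /\
  forall z : 'rV[C]_m, conf z ->
    (forall i j : 'I_m, (i < j)%N -> `|z 0 j| < `|z 0 i|) ->
    Y_product S a z (g z).

End Correspondence.

Record category : Type := Category {
  cob :> Type;
  chom : cob -> cob -> Type;
  cid : forall A, chom A A;
  ccomp : forall A B D, chom B D -> chom A B -> chom A D;
  ccomp1l : forall A B (f : chom A B), ccomp (cid B) f = f;
  ccomp1r : forall A B (f : chom A B), ccomp f (cid A) = f;
  ccompA : forall A B D E (h : chom D E) (g : chom B D) (f : chom A B),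
    ccomp h (ccomp g f) = ccomp (ccomp h g) f }.

Record functor (A B : category) : Type := Functor {
  fob :> A -> B;
  fhom : forall X Y, chom X Y -> chom (fob X) (fob Y);
  fhom1 : forall X, fhom (cid X) = cid (fob X);
  fhomM : forall X Y Z (g : chom Y Z) (f : chom X Y),
    fhom (ccomp g f) = ccomp (fhom g) (fhom f) }.

Definition functor_id (A : category) : functor A A :=
  @Functor A A (fun X => X) (fun X Y f => f) (fun X => erefl)
    (fun X Y Z g f => erefl).

Section FunctorComp.
Variables (A B D : category) (G : functor B D) (F : functor A B).
Fact functor_comp1 X : fhom G (fhom F (cid X)) = cid (G (F X)).
Proof. by rewrite !fhom1. Qed.
Fact functor_compM X Y Z (g : chom Y Z) (f : chom X Y) :
  fhom G (fhom F (ccomp g f)) = ccomp (fhom G (fhom F g)) (fhom G (fhom F f)).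
Proof. by rewrite !fhomM. Qed.
Definition functor_comp : functor A D :=
  @Functor A D (fun X => G (F X)) (fun X Y f => fhom G (fhom F f))
    functor_comp1 functor_compM.
End FunctorComp.

Definition is_isomorphism (A B : category) (F : functor A B) : Prop :=
  exists G : functor B A,
    functor_comp G F = functor_id A /\ functor_comp F G = functor_id B.

Section Categories.
Variable R : realType.

Definition gradedCat : category :=
  @Category (graded R) (@ghom R) (@gid R) (@gcomp R)
    (fun A B f => @ghom_eq R A B (gcomp (gid B) f) f erefl)
    (fun A B f => @ghom_eq R A B (gcomp f (gid A)) f erefl)
    (fun A B D E h g f =>
       @ghom_eq R A E (gcomp h (gcomp g f)) (gcomp (gcomp h g) f) erefl).

(* Graded vector spaces with a structure of type [str]; the morphisms are those
   of graded vector spaces which satisfy [mor]. *)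
Section Structured.
Variables (str : graded R -> Type)
  (mor : forall V V', str V -> str V' -> ghom V V' -> Prop).
Hypothesis mor1 : forall V (M : str V), mor M M (gid V).
Hypothesis morM : forall V1 V2 V3 (M1 : str V1) (M2 : str V2) (M3 : str V3)
  (g : ghom V2 V3) (f : ghom V1 V2),
  mor M2 M3 g -> mor M1 M2 f -> mor M1 M3 (gcomp g f).

Definition sob : Type := {V : graded R & str V}.
Definition shom (A B : sob) : Type :=
  {f : ghom (projT1 A) (projT1 B) | mor (projT2 A) (projT2 B) f}.
Definition sid (A : sob) : shom A A := exist _ (gid _) (mor1 (projT2 A)).
Definition scomp (A B D : sob) (g : shom B D) (f : shom A B) : shom A D :=
  exist _ (gcomp (sval g) (sval f)) (morM (svalP g) (svalP f)).

Lemma shom_eq A B (f g : shom A B) : sval f = sval g -> f = g.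
Proof.
by case: f g => [f pf] [g pg] /= fg; case: _ / fg pg => pg; congr exist; exact: Prop_irrelevance.
Qed.

Definition structCat : category :=
  @Category sob shom sid scomp
    (fun A B f => @shom_eq A B (scomp (sid B) f) f (@ccomp1l gradedCat _ _ _))
    (fun A B f => @shom_eq A B (scomp f (sid A)) f (@ccomp1r gradedCat _ _ _))
    (fun A B D E h g f =>
       @shom_eq A E (scomp h (scomp g f)) (scomp (scomp h g) f)
         (@ccompA gradedCat _ _ _ _ _ _ _)).

Definition forget : functor structCat gradedCat :=
  @Functor structCat gradedCat (fun A => projT1 A) (fun A B f => sval f)
    (fun A => erefl) (fun A B D g f => erefl).

End Structured.

Lemma dmap_id (V : graded R) (a : dsum V) : dmap (gid V) a = a.
Proof. by apply: val_inj. Qed.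

Lemma dmap_comp (V1 V2 V3 : graded R) (g : ghom V2 V3) (f : ghom V1 V2) a :
  dmap (gcomp g f) a = dmap g (dmap f a).
Proof. by apply: val_inj. Qed.

Lemma geom_morphism_id (V : graded R) (M : geomVA V) : geom_morphism M M (gid V).
Proof.
move=> n a z _; rewrite [LHS](_ : _ = gmu M a z)//; congr (gmu M _ z).
by apply/matrixP => i j; rewrite mxE dmap_id.
Qed.

Lemma geom_morphism_comp (V1 V2 V3 : graded R) (M1 : geomVA V1) (M2 : geomVA V2)
    (M3 : geomVA V3) (g : ghom V2 V3) (f : ghom V1 V2) :
  geom_morphism M2 M3 g -> geom_morphism M1 M2 f ->
  geom_morphism M1 M3 (gcomp g f).
Proof.
move=> Hg Hf n a z cz.
rewrite [LHS](_ : _ = bmap g (bmap f (gmu M1 a z)))// Hf// Hg//.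
by congr (gmu M3 _ z); apply/matrixP => i j; rewrite !mxE dmap_comp.
Qed.

Lemma vertex_morphism_id (V : graded R) (S : vertexVA V) : vertex_morphism S S (gid V).
Proof. by split=> [a b n|]; rewrite !dmap_id. Qed.

Lemma vertex_morphism_comp (V1 V2 V3 : graded R) (S1 : vertexVA V1) (S2 : vertexVA V2)
    (S3 : vertexVA V3) (g : ghom V2 V3) (f : ghom V1 V2) :
  vertex_morphism S2 S3 g -> vertex_morphism S1 S2 f ->
  vertex_morphism S1 S3 (gcomp g f).
Proof.
move=> [gY g0] [fY f0]; split=> [a b n|]; rewrite !dmap_comp.
  by rewrite fY gY.
by rewrite f0 g0.
Qed.

Definition geomCat : category := structCat geom_morphism_id geom_morphism_comp.
Definition vertexCat : category :=
  structCat vertex_morphism_id vertex_morphism_comp.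
Definition geom_forget : functor geomCat gradedCat :=
  forget geom_morphism_id geom_morphism_comp.
Definition vertex_forget : functor vertexCat gradedCat :=
  forget vertex_morphism_id vertex_morphism_comp.

End Categories.

(* Main.v *)
(* From a geometric vertex algebra to a vertex algebra: equivariance makes
   mu(a, z, b, 0)_l a monomial in z for homogeneous a and b, whose coefficients
   are the modes. Locality follows by expanding x |-> mu(a, x, b, 1, c, 0) for
   |x| > 1, for |x| < 1 and near x = 1 through associativity and permutation
   invariance: after multiplication by (x - 1)^N the function is holomorphic on
   C \ {0}, so its two Laurent expansions agree (Cauchy's theorem). Translation
   compares first-order terms of two expansions of mu(a, 1 + u, b, u).

   Conversely, locality shows that a product of factors x_i - x_j, i < j, turns
   the formal series Y(a_1, x_1) ... Y(a_m, x_m)|0> into one that is polynomial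
   in each degree; dividing its values by that product gives mu_Y. Identities
   between correlation functions then become identities of formal series, and
   convergence is obtained by peeling off the factors x_i - x_j as geometric
   series. Associativity with insertion at z_(m+1) <> 0 is reduced to insertion
   at 0 by the translation covariance exp(uT).

   A geometric vertex algebra is determined by its two-point functions: where
   |z_1| exceeds the other |z_i|, associativity inserts those points around 0 and
   expresses mu(a, z) through fewer points; by the identity theorem along complex
   lines this determines mu(a, z) everywhere. This gives injectivity of Phi and
   the statement on morphisms. *)

Require Import Defs.
From HB Require Import structures.
From Stdlib Require Import JMeq.
From mathcomp Require Import all_boot all_order all_algebra all_fingroup finmap.
From mathcomp Require Import all_classical all_reals all_analysis.
From mathcomp Require Import complex summability.
From mathcomp Require Import zify ring lra.

Set Implicit Arguments.
Unset Strict Implicit.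
Unset Printing Implicit Defensive.

Import Order.TTheory GRing.Theory Num.Theory.
Import numFieldNormedType.Exports.

Local Open Scope classical_set_scope.
Local Open Scope ring_scope.

#[local] Existing Instance totally_filter.

(** * Linear functionals and unordered sums *)

(** Values lie in vector spaces of arbitrary dimension, without topology: convergence and holomorphy
    are confined to finite-dimensional subspaces, and identities are tested on linear functionals,
    which makes the complex analysis scalar. It rests on Goursat's theorem for rectangles; a lower
    bound for the modulus of the integral of dz/(z - w) replaces the value 2 pi i. The value
    attached to a formal series by clearing denominators does not depend on the factors chosen;
    hence the axioms for mu_Y are checked on coefficients, with as many factors as locality happens
    to require. The delicate axiom is associativity, since normal convergence asks for one
    finite-dimensional subspace and uniform bounds on a compact set. In each degree the numerators
    are polynomials, which provides the subspace; on a compact set the ratios of moduli stay below a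
    constant less than 1, which provides the bounds. Insertion at z_(m+1) fits this scheme because
    the degrees of the numerators are bounded below independently of the exponents: exp(uT) is cut
    off after a number of terms that depends neither on the point nor on the summation index. *)

Section LinearAlgebra.
Variables (K : fieldType) (X : lmodType K).

(** By Zorn's lemma there is a maximal subspace [H] missing [v]. It is a complement of the line
    through [v], and [phi] is the coordinate along [v]. *)
Lemma separating_functional (v : X) :
  v <> 0 -> exists phi : {scalar X}, phi v = 1.
Proof.
move=> v0.
pose P (H : set X) :=
  (forall c u w, H u -> H w -> H (c *: u + w)) /\ ~ H v.
have [F FP tF|H [[Hlin Hv] Hmax]] := @Zorn_bigcup X P.
  split=> [c u w [A FA Au] [B FB Bw]|[A FA Av]]; last by have [_] := FP _ FA; apply.
  have [AB|BA] := tF _ _ FA FB.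
    by exists B => //; apply: (FP _ FB).1 => //; exact: AB.
  by exists A => //; apply: (FP _ FA).1 => //; exact: BA.
(* The empty set satisfies [P], being the union of the empty chain. It is not maximal, since {0}
   also misses [v]. *)
have H0 : H 0.
  apply: contrapT => nH0.
  have He u : ~ H u.
    by move=> Hu; apply: nH0; have := Hlin (-1) _ _ Hu Hu; rewrite scaleN1r addNr.
  apply: (Hmax [set 0]); first by split=> [u /He//|H0]; exact: (He 0 (H0 0 erefl)).
  by split=> [c u w -> ->|vz]; [rewrite scaler0 addr0|exact: v0].
have HZ c u : H u -> H (c *: u) by move=> Hu; rewrite -[_ *: _]addr0; exact: Hlin.
have HD u w : H u -> H w -> H (u + w) by move=> Hu; rewrite -[u]scale1r; exact: Hlin.
have HN u : H u -> H (- u) by move=> /(HZ (-1)); rewrite scaleN1r.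
(* If [x] is not in [H], the span of [H] and [x] contains [v] by maximality, and the relation is
   solved for [x]. *)
have Hdec x : exists c, H (x - c *: v).
  have [Hx|nHx] := pselect (H x); first by exists 0; rewrite scale0r subr0.
  pose H' := [set y | exists2 c, H (y - c *: x) & True].
  have HH' : H `<` H'.
    split=> [y Hy|H'H]; first by exists 0 => //; rewrite scale0r subr0.
    by apply: nHx; apply: H'H; exists 1 => //; rewrite scale1r subrr.
  have [c Hc] : H' v.
    apply: contrapT => nv; apply: Hmax HH' _; split=> // c u w [d Hd _] [e He _].
    exists (c * d + e) => //.
    rewrite scalerDl -scalerA opprD addrACA -scalerBr.
    by apply: HD He; exact: HZ.
  have c0 : c != 0 by apply: contra_notN Hv => /eqP c0; move: Hc; rewrite c0 scale0r subr0.
  exists c^-1 => //; have := HZ (- c^-1) _ Hc.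
  by rewrite scalerBr !scaleNr scalerA mulVf// scale1r opprK addrC.
have [phi phiP] := choice Hdec.
have phiE c x : H (x - c *: v) -> phi x = c.
  move=> Hc; apply/eqP; rewrite -subr_eq0; apply: contra_notT Hv => dc.
  have : H ((phi x - c) *: v).
    have -> : (phi x - c) *: v = (x - c *: v) - (x - phi x *: v).
      by rewrite scalerBl opprB [RHS]addrC addrA subrK.
    by apply: HD => //; apply: HN.
  by move=> /(HZ (phi x - c)^-1); rewrite scalerA mulVf// scale1r.
have phil : GRing.linear_for *%R phi.
  move=> c u w; apply: phiE; rewrite scalerDl -scalerA opprD addrACA -scalerBr.
  by apply: HD => //; apply: HZ.
pose ml := GRing.isLinear.Build _ _ _ _ phi phil.
exists (HB.pack phi ml : {scalar X}).
by apply: phiE; rewrite scale1r subrr.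
Qed.

(** The bridge from scalar complex analysis to functions and sums with values in arbitrary vector
    spaces. *)
Lemma functional_ext (u v : X) : (forall phi : {scalar X}, phi u = phi v) -> u = v.
Proof.
move=> uv; apply: contrapT => nuv.
have [|phi] := @separating_functional (u - v).
  by move=> /eqP; rewrite subr_eq0 => /eqP.
by rewrite linearB /= uv subrr => /esym/eqP; rewrite oner_eq0.
Qed.
End LinearAlgebra.

Section Bases.
Variable R : realType.
Local Notation C := (Cx R).
Variable X : lmodType C.

Lemma lcombD d (e : 'I_d -> X) u v : lcomb e (u + v) = lcomb e u + lcomb e v.
Proof.
by rewrite /lcomb -big_split; apply: eq_bigr => j _; rewrite mxE scalerDl.
Qed.

Lemma lcombZ d (e : 'I_d -> X) a u : lcomb e (a *: u) = a *: lcomb e u.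
Proof.
by rewrite /lcomb scaler_sumr; apply: eq_bigr => j _; rewrite mxE scalerA.
Qed.

Lemma lcomb0 d (e : 'I_d -> X) : lcomb e 0 = 0.
Proof. by rewrite /lcomb big1// => j _; rewrite mxE scale0r. Qed.

Lemma lcomb_mul d d' (e : 'I_d' -> X) (v : 'I_d -> X) (M : 'M[C]_(d, d')) c :
  (forall i, v i = lcomb e (row i M)) -> lcomb v c = lcomb e (c *m M).
Proof.
move=> vM; rewrite /lcomb.
under eq_bigr do rewrite vM /lcomb scaler_sumr.
rewrite exchange_big/=; apply: eq_bigr => j _.
rewrite mxE scaler_suml; apply: eq_bigr => i _.
by rewrite mxE scalerA.
Qed.

(** Subspaces are given by bases in the definitions, while sums and products naturally produce
    spanning families. Coordinates are converted by one constant matrix, so convergence and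
    differentiability carry over. *)
Lemma basis_of_family d (v : 'I_d -> X) :
  exists d' (e : 'I_d' -> X) (M : 'M[C]_(d, d')),
    lin_indep e /\ forall c, lcomb v c = lcomb e (c *m M).
Proof.
suff [d' [e [M [ie vM]]]] : exists d' (e : 'I_d' -> X) (M : 'M[C]_(d, d')),
    lin_indep e /\ forall i, v i = lcomb e (row i M).
  by exists d', e, M; split=> // c; exact: lcomb_mul.
elim: d v => [|d IH] v.
  exists 0%N, (fun=> 0), 0; split=> [c _|[]//]; by apply/rowP => -[].
have [d' [e [M [ie vM]]]] := IH (fun i => v (lift ord0 i)).
have [[c vc]|nc] := pselect (exists c, v ord0 = lcomb e c).
  exists d', e, (\matrix_(i, j) oapp (fun i => M i j) (c 0 j) (unlift ord0 i)).
  split=> // i; have [j ->|->] := unliftP ord0 i; rewrite ?vM ?vc; congr lcomb;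
  by apply/rowP => k; rewrite !mxE ?liftK ?unlift_none.
pose e' j := oapp e (v ord0) (unlift ord0 j).
have e'E (c : 'rV_d'.+1) :
    lcomb e' c = c 0 ord0 *: v ord0 + lcomb e (\row_j c 0 (lift ord0 j)).
  rewrite /lcomb big_ord_recl /e' unlift_none; congr (_ + _).
  by apply: eq_bigr => j _; rewrite liftK mxE.
exists d'.+1, e', (\matrix_(i, j)
  oapp (fun i => oapp (M i) 0 (unlift ord0 j)) (j == ord0)%:R (unlift ord0 i)).
split=> [c|i].
  rewrite e'E => /eqP; rewrite addr_eq0 => /eqP vc.
  have c00 : c 0 ord0 = 0.
    apply: contra_notP nc => /eqP c0.
    exists (- (c 0 ord0)^-1 *: \row_j c 0 (lift ord0 j)).
    by rewrite lcombZ scaleNr -scalerN -vc scalerA mulVf// scale1r.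
  move: vc; rewrite c00 scale0r => /esym/eqP; rewrite oppr_eq0 => /eqP/ie c1.
  apply/rowP => i; rewrite mxE; have [j ->|->//] := unliftP ord0 i.
  by have /rowP/(_ j) := c1; rewrite !mxE.
rewrite e'E !mxE; have [j ->|->] := unliftP ord0 i.
  rewrite /= unlift_none/= scale0r add0r vM; congr lcomb.
  by apply/rowP => k; rewrite !mxE !liftK.
rewrite unlift_none/= scale1r (_ : \row_j _ = 0) ?lcomb0 ?addr0//.
by apply/rowP => k; rewrite !mxE unlift_none.
Qed.

Lemma lcomb_functional (phi : {scalar X}) d (e : 'I_d -> X) c :
  phi (lcomb e c) = \sum_(j < d) c 0 j * phi (e j).
Proof. by rewrite /lcomb linear_sum; apply: eq_bigr => j _; rewrite linearZ. Qed.

End Bases.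

Section Sums.
Variable R : realType.
Local Notation C := (Cx R).

Lemma cvg_sum_ord (T : Type) (F : set_system T) {FF : Filter F}
    (W : normedModType C) d (f : 'I_d -> T -> W) (l : 'I_d -> W) :
  (forall j, f j @ F --> l j) -> \sum_(j < d) f j x @[x --> F] --> \sum_(j < d) l j.
Proof.
move=> fl; elim: (index_enum _) => [|j s IH].
  by under eq_fun do rewrite big_nil; rewrite big_nil; exact: cvg_cst.
under eq_fun do rewrite big_cons; rewrite big_cons.
by apply: cvgD => //; exact: fl.
Qed.

Lemma cvg_coord (T : Type) (F : set_system T) {FF : Filter F} d (f : T -> 'rV[C]_d)
    (t : 'rV[C]_d) j : f @ F --> t -> f x 0 j @[x --> F] --> t 0 j.
Proof. by move=> ft; exact: (cvg_comp _ _ ft (@coord_continuous _ _ _ _ _ t)). Qed.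

Lemma cvg_row_lin (T : Type) (F : set_system T) {FF : Filter F} d
    (W : normedModType C) (w : 'I_d -> W) (f : T -> 'rV[C]_d) (t : 'rV[C]_d) :
  f @ F --> t ->
  \sum_(j < d) f x 0 j *: w j @[x --> F] --> \sum_(j < d) t 0 j *: w j.
Proof.
by move=> ft; apply: cvg_sum_ord => j; apply: cvgZr_tmp; exact: cvg_coord.
Qed.

Lemma cvg_row (T : Type) (F : set_system T) {FF : Filter F} d (f : T -> 'rV[C]_d) (t : 'rV[C]_d) :
  (forall j, f x 0 j @[x --> F] --> t 0 j) -> f @ F --> t.
Proof.
move=> ft.
rewrite (_ : f = fun x => \sum_(j < d) f x 0 j *: delta_mx 0 j); last first.
  by apply/funext => x; rewrite {1}[f x]row_sum_delta.
rewrite [t]row_sum_delta; by apply: cvg_sum_ord => j; apply: cvgZr_tmp; exact: ft.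
Qed.

Lemma partial_sumE (I : choiceType) (V : zmodType) (f : I -> V) A :
  partial_sum f A = \sum_(i <- A) f i.
Proof. by rewrite /partial_sum big_seq_fsetE. Qed.

(** The criterion behind [has_sum] without linear independence of the family. *)
Lemma has_sum_family (X : lmodType C) (I : choiceType) (f : I -> X) s d
    (v : 'I_d -> X) (c : I -> 'rV[C]_d) t :
  (forall i, f i = lcomb v (c i)) -> s = lcomb v t ->
  partial_sum c @ totally --> t -> has_sum f s.
Proof.
move=> fc st ct; have [d' [e [M [ie vM]]]] := basis_of_family v.
exists d', e, (fun i => c i *m M), (t *m M); split=> //.
- by move=> i; rewrite fc vM.
- by rewrite st vM.
rewrite (_ : partial_sum _ = fun A => \sum_(j < d) partial_sum c A 0 j *: row j M).
  by rewrite mulmx_sum_row; exact: cvg_row_lin.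
by apply/funext => A; rewrite !partial_sumE -mulmx_sum_row mulmx_suml.
Qed.

Lemma has_sum_functional (X : lmodType C) (I : choiceType) (f : I -> X) s
     :
  has_sum f s -> forall phi : {scalar X}, partial_sum (phi \o f) @ totally --> (phi s : C).
Proof.
move=> [d [e [c [t [_ fc -> ct]]]]] phi.
rewrite (_ : partial_sum _ =
    fun A => \sum_(j < d) partial_sum c A 0 j *: (phi (e j) : C^o)).
  by rewrite lcomb_functional; exact: (@cvg_row_lin _ _ _ _ (C^o)).
apply/funext => A /=; rewrite !partial_sumE.
rewrite (eq_bigr (fun i => \sum_(j < d) c i 0 j * phi (e j))); last first.
  by move=> i _; rewrite /= fc lcomb_functional.
rewrite exchange_big/=; apply: eq_bigr => j _.
by rewrite summxE [RHS]mulr_suml.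
Qed.

Lemma cvg_sum_uniq (I : choiceType) (f : I -> C) (s s' : C) :
  partial_sum f @ totally --> s -> partial_sum f @ totally --> s' -> s = s'.
Proof. by move=> fs fs'; exact: (norm_cvg_unique fs fs'). Qed.

Lemma has_sum_unique (X : lmodType C) (I : choiceType) (f : I -> X) s s' :
  has_sum f s -> has_sum f s' -> s = s'.
Proof.
move=> fs fs'; apply: functional_ext => phi.
apply: (@cvg_sum_uniq I (phi \o f) (phi s) (phi s')); exact: has_sum_functional.
Qed.

Lemma partial_sum_bij (V : zmodType) (I J : choiceType) (h : I -> J) (g : J -> I)
    (f : J -> V) : cancel h g -> cancel g h ->
  (forall (P : set V), (partial_sum f @ totally) P -> (partial_sum (f \o h) @ totally) P).
Proof.
move=> hK gK P [B _ BP]; exists (g @` B)%fset => // A /= gBA.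
suff -> : partial_sum (f \o h) A = partial_sum f (h @` A)%fset.
  apply: BP; apply/fsubsetP => j jB; apply/imfsetP; exists (g j); rewrite ?gK//=.
  by apply: (fsubsetP gBA); apply/imfsetP; exists j.
rewrite !partial_sumE big_imfset//= => i i' _ _; exact: can_inj hK _ _.
Qed.

Lemma cvg_sum_bij (I J : choiceType) (h : I -> J) (g : J -> I) (f : J -> C) (s : C) :
  cancel h g -> cancel g h ->
  partial_sum f @ totally --> s -> partial_sum (f \o h) @ totally --> s.
Proof. by move=> hK gK fs P /fs; exact: partial_sum_bij hK gK P. Qed.

Lemma cvg_sum_fin (W : normedModType C) (I : choiceType) (f : I -> W) (A : {fset I}) :
  (forall i, i \notin A -> f i = 0) ->
  partial_sum f @ totally --> \sum_(i <- A) f i.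
Proof.
move=> fA; apply: cvg_near_cst.
exists A => // B /= AB; rewrite partial_sumE; apply/esym; apply: big_fset_incl => //.
by move=> i _ /fA.
Qed.

Lemma has_sum_fin (X : lmodType C) (I : choiceType) (f : I -> X) (A : {fset I}) :
  (forall i, i \notin A -> f i = 0) -> has_sum f (\sum_(i <- A) f i).
Proof.
move=> fA.
pose c i : 'rV[C]_#|`A| := \row_(j < #|`A|) (i == nth i A j)%:R.
have fE i : f i = lcomb (fun j : 'I_#|`A| => f (nth i A j)) (c i).
  rewrite /lcomb; have [iA|iA] := boolP (i \in A); last first.
    rewrite fA// big1// => j _; rewrite mxE; case: eqP => [ij|_]; rewrite ?scale0r//.
    by move: iA; rewrite {1}ij mem_nth.
  have jlt : (index i A < #|`A|)%N by rewrite index_mem.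
  rewrite (bigD1 (Ordinal jlt))//= big1 => [|j jn].
    by rewrite mxE/= nth_index// eqxx scale1r addr0.
  rewrite mxE; case: eqP => [ij|_]; rewrite ?scale0r//.
  case/eqP: jn; apply: val_inj => /=; rewrite ij index_uniq//.
(* The point [i0] is only a default value for [nth]; [I] itself may be empty. *)
have [[i0 _]|nI] := pselect (exists i0 : I, i0 \in A); last first.
  have A0 : A = fset0 by apply/fsetP => i; rewrite inE; apply: contra_notF nI => iA; exists i.
  rewrite A0 big_seq_fset0.
  apply: (@has_sum_family _ _ _ _ 0 (fun=> 0) (fun=> 0) 0).
  - by move=> i; rewrite lcomb0 fA// A0 inE.
  - by rewrite lcomb0.
  - rewrite (_ : partial_sum _ = cst 0); first exact: cvg_cst.
    by apply/funext => B; rewrite partial_sumE big1.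
apply: (@has_sum_family _ _ _ _ _ (fun j : 'I_#|`A| => f (nth i0 A j)) c
  (\sum_(i <- A) c i)).
- move=> i; rewrite {1}fE; apply: eq_bigr => j _.
  by congr (_ *: f _); exact: set_nth_default.
- rewrite (big_morph (lcomb _) (lcombD _) (lcomb0 _)); apply: eq_bigr => i _.
  rewrite {1}fE; apply: eq_bigr => j _.
  by congr (_ *: f _); exact: set_nth_default.
- apply: cvg_sum_fin => i iA; apply/rowP => j; rewrite !mxE; case: eqP => // ij.
  by move: iA; rewrite {1}ij mem_nth.
Qed.

Lemma real_complex_cvg (T : Type) (F : set_system T) {FF : Filter F} (f : T -> R) (s : R) :
  (forall e, 0 < e -> \forall x \near F, `|s - f x| < e) ->
  ((f x)%:C : C)%C @[x --> F] --> ((s%:C)%C : C).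
Proof.
move=> fs; apply/cvgrPdist_lt => e e0.
have er : e = ((complex.Re e)%:C)%C by rewrite RRe_real// gtr0_real.
have Re0 : 0 < complex.Re e by move: e0; rewrite er ltcR.
apply: filterS (fs _ Re0) => x; rewrite er -rmorphB /= normc_def/= expr0n/= addr0.
by rewrite sqrtr_sqr ltcR.
Qed.

Lemma rsum_cvg (I : choiceType) (f : I -> R) (M : R) :
  (forall i, 0 <= f i) -> (forall A : {fset I}, \sum_(i <- A) f i <= M) ->
  exists s : R, partial_sum (fun i => (f i)%:C%C : C) @ totally --> ((s%:C)%C : C).
Proof.
move=> f0 fM; pose E := [set \sum_(i <- A) f i | A in [set: {fset I}]].
have hE : has_sup E.
  split; first by exists (\sum_(i <- fset0) f i), fset0.
  by exists M => _ [A _ <-].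
exists (sup E).
rewrite (_ : partial_sum _ = fun A => (\sum_(i <- A) f i)%:C%C); last first.
  by apply/funext => A; rewrite partial_sumE (rmorph_sum (real_complex R)).
apply: real_complex_cvg => e e0.
have [_ [A _ <-] Ae] := sup_adherent e0 hE.
exists A => // B /= AB.
have BE : \sum_(i <- B) f i <= sup E by apply: sup_upper_bound => //; exists B.
rewrite ger0_norm ?subr_ge0// ltrBlDl -ltrBlDr; apply: lt_le_trans Ae _.
rewrite [leRHS](big_fsetID _ (mem A))/=.
rewrite (_ : [fset x in B | x \in A]%fset = A) ?lerDl ?sumr_ge0//.
by apply/fsetP => i; rewrite !inE/=; apply/andP/idP => [[]//|iA]; split=> //; exact: (fsubsetP AB).
Qed.

(** [f] is a combination of the nonnegative families |Re f|, |Re f| - Re f, |Im f| and |Im f| - Im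
    f. Their partial sums are bounded, so each of them converges to the supremum of its partial
    sums. *)
Lemma csum_cvg (I : choiceType) (f : I -> C) (M : C) :
  (forall A : {fset I}, \sum_(i <- A) `|f i| <= M) ->
  exists s : C, partial_sum f @ totally --> s.
Proof.
move=> fM.
have H (p : I -> R) (k : nat) : (forall i, 0 <= p i) -> (forall i, ((p i)%:C)%C <= (`|f i| : C) *+ k) ->
    exists s : R, partial_sum (fun i => (p i)%:C%C : C) @ totally --> ((s%:C)%C : C).
  move=> p0 pf; apply: (@rsum_cvg _ _ (complex.Re (M *+ k))) => // A.
  have Mr : M *+ k \is Num.real.
    by apply: ger0_real; rewrite mulrn_wge0//; have := fM fset0; rewrite big_seq_fset0.
  rewrite -lecR (RRe_real Mr) (rmorph_sum (real_complex R)).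
  apply: (@le_trans _ _ (\sum_(i <- A) (`|f i| : C) *+ k)); first by apply: ler_sum => i _; exact: pf.
  by rewrite sumrMnl lerMn2r fM orbT.
have nR i : ((`|complex.Re (f i)|)%:C)%C <= `|f i| := normc_ge_Re _.
have nI i : ((`|complex.Im (f i)|)%:C)%C <= `|f i|.
  rewrite normc_def lecR -sqrtr_sqr ler_wsqrtr// lerDr sqr_ge0//.
have [s1 h1] := H (fun i => `|complex.Re (f i)|) 1 (fun i => normr_ge0 _) nR.
have [s2 h2] := H (fun i => `|complex.Im (f i)|) 1 (fun i => normr_ge0 _) nI.
have B2 (x : R) : `|x| - x <= `|x| *+ 2.
  by rewrite mulr2n lerD2l -normrN ler_norm.
have [s3 h3] : exists s : R, partial_sum
    (fun i => ((`|complex.Re (f i)| - complex.Re (f i))%:C)%C : C) @ totally --> ((s%:C)%C : C).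
  apply: (H _ 2) => i; first by rewrite subr_ge0 ler_norm.
  apply: (@le_trans _ _ ((`|complex.Re (f i)| *+ 2)%:C)%C); first by rewrite lecR B2.
  by rewrite rmorphMn lerMn2r nR orbT.
have [s4 h4] : exists s : R, partial_sum
    (fun i => ((`|complex.Im (f i)| - complex.Im (f i))%:C)%C : C) @ totally --> ((s%:C)%C : C).
  apply: (H _ 2) => i; first by rewrite subr_ge0 ler_norm.
  apply: (@le_trans _ _ ((`|complex.Im (f i)| *+ 2)%:C)%C); first by rewrite lecR B2.
  by rewrite rmorphMn lerMn2r nI orbT.
pose P (p : I -> R) : {fset I} -> C := partial_sum (fun i => ((p i)%:C)%C : C).
pose iC : C := Complex 0 1.
pose p1 i := `|complex.Re (f i)|; pose p2 i := `|complex.Im (f i)|.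
pose p3 i := p1 i - complex.Re (f i); pose p4 i := p2 i - complex.Im (f i).
have fE : partial_sum f = fun A => P p1 A - P p3 A + iC * (P p2 A - P p4 A).
  apply/funext => A; rewrite /P !partial_sumE -!sumrB mulr_sumr -big_split/=.
  apply: eq_bigr => i _; rewrite -!(rmorphB (real_complex R)) /p3 /p4 !subKr.
  exact: complexE.
exists (((s1%:C)%C : C) - (s3%:C)%C + iC * (((s2%:C)%C : C) - (s4%:C)%C)).
rewrite fE; apply: cvgD; first exact: (cvgB h1 h3).
apply: cvgM; first exact: cvg_cst.
exact: (cvgB h2 h4).
Qed.

Lemma sum_limit_le (I : choiceType) (f : I -> C) (s M : C) (A0 : {fset I}) :
  partial_sum f @ totally --> s ->
  (forall A : {fset I}, (A0 `<=` A)%fset -> `|\sum_(i <- A) f i| <= M) -> `|s| <= M.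
Proof.
move=> fs fM.
have Mr : M \is Num.real by apply: ger0_real; apply: le_trans (fM A0 (fsubset_refl _)).
have [//|Ms] := real_leP (normr_real s) Mr.
have /cvgrPdist_lt/(_ (`|s| - M)) := fs; rewrite subr_gt0 => /(_ Ms)[B _ BP].
have := BP (A0 `|` B)%fset; rewrite /= fsubsetUr => /(_ isT).
rewrite partial_sumE => h; have := fM (A0 `|` B)%fset (fsubsetUl _ _) => h2.
have := ler_normD (s - \sum_(i <- (A0 `|` B)%fset) f i) (\sum_(i <- (A0 `|` B)%fset) f i).
by rewrite subrK => /le_lt_trans/(_ (ltr_leD h h2)); rewrite subrK ltxx.
Qed.

Lemma sum_bound (I : choiceType) (f : I -> C) (s M : C) :
  partial_sum f @ totally --> s ->
  (forall A : {fset I}, \sum_(i <- A) `|f i| <= M) -> `|s| <= M.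
Proof.
move=> fs fM; apply: (sum_limit_le (A0 := fset0) fs) => A _.
exact: le_trans (ler_norm_sum _ _ _) (fM A).
Qed.

(** A term outside a set [A] adapted to the tolerance 1 is the difference of two partial sums that
    are both within 1 of [s]. Applied to a Laurent series at one point, this plays the role of
    Cauchy's estimates for the coefficients. *)
Lemma sum_terms_bounded (I : choiceType) (f : I -> C) (s : C) :
  partial_sum f @ totally --> s -> exists2 M, 0 < M & forall i, `|f i| <= M.
Proof.
move=> /cvgrPdist_lt/(_ 1 ltr01)[A _ AP].
exists (\sum_(i <- A) `|f i| + 2) => [|i]; first by rewrite ltr_wpDl// sumr_ge0.
have [iA|iA] := boolP (i \in A).
  rewrite (big_fsetD1 _ iA)/= -addrA lerDl addr_ge0// sumr_ge0//.
have := AP A (fsubset_refl _); have := AP (i |` A)%fset (fsubsetU1 _ _).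
rewrite !partial_sumE big_fsetU1//= => h1 h2.
have -> : f i = (s - \sum_(i <- A) f i) - (s - (f i + \sum_(i <- A) f i)).
  by rewrite opprB addrC addrA subrK addrK.
apply: le_trans (ler_normB _ _) _; rewrite ler_wpDl ?sumr_ge0//.
by rewrite (_ : 2 = 1 + 1) // lerD// ltW.
Qed.

End Sums.

(** * Contour integrals and uniqueness of Laurent coefficients *)
Section SegmentIntegral.
Variable R : realType.
Local Notation C := (Cx R).
Local Notation mu := (@lebesgue_measure R).

Definition rint (g : R -> R) a b : R := (\int[mu]_(t in `[a, b]) g t).

Definition rcont (g : R -> R) a b := forall t, a <= t <= b -> {for t, continuous g}.

Lemma rcont_integrable g a b : rcont g a b -> mu.-integrable `[a, b] (EFin \o g).
Proof.
move=> gc; apply: continuous_compact_integrable; first exact: segment_compact.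
apply: continuous_in_subspaceT => t; rewrite inE/= in_itv/=; exact: gc.
Qed.

Lemma rint_split g a b c : a <= c <= b -> rcont g a b ->
  rint g a b = rint g a c + rint g c b.
Proof.
move=> /andP[ac cb] gc.
have ig := rcont_integrable gc.
have := @Rintegral_itvB _ g (BLeft a) (BRight b) c ig.
rewrite !bnd_simp => /(_ ac cb).
rewrite Rintegral_itv_obnd_cbnd.
  by move=> /eqP; rewrite subr_eq addrC => /eqP.
apply: integrableS ig => //= t /=; rewrite !in_itv/= => /andP[ct tb].
by rewrite tb (le_trans ac (ltW ct)).
Qed.

Lemma rint_cst r a b : a <= b -> rint (fun=> r) a b = r * (b - a).
Proof.
move=> ab; rewrite /rint Rintegral_cst//= lebesgue_measure_itv/= lte_fin.
by move: ab; rewrite le_eqVlt => /orP[/eqP->|->]; rewrite ?ltxx ?subrr.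
Qed.

Lemma rintD g h a b : rcont g a b -> rcont h a b ->
  rint (fun t => g t + h t) a b = rint g a b + rint h a b.
Proof. by move=> gc hc; apply: RintegralD => //; exact: rcont_integrable. Qed.

Lemma rintZ r g a b : rcont g a b -> rint (fun t => r * g t) a b = r * rint g a b.
Proof. by move=> gc; apply: RintegralZl => //; exact: rcont_integrable. Qed.

Lemma rint_le g h a b : rcont g a b -> rcont h a b ->
  (forall t, a <= t <= b -> g t <= h t) -> rint g a b <= rint h a b.
Proof.
by move=> gc hc gh; apply: le_Rintegral; rewrite //=; try exact: rcont_integrable.
Qed.

Lemma rcont_cst r a b : rcont (fun=> r) a b.
Proof. by move=> t _; exact: cst_continuous. Qed.

Lemma rcontZ r g a b : rcont g a b -> rcont (fun t => r * g t) a b.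
Proof. by move=> gc t tab; apply: cvgM; [exact: cvg_cst|exact: gc]. Qed.

Lemma rint_abs g a b M : a <= b -> rcont g a b ->
  (forall t, a <= t <= b -> `|g t| <= M) -> `|rint g a b| <= M * (b - a).
Proof.
move=> ab gc gM; rewrite ler_norml -mulNr -!rint_cst//.
apply/andP; split; apply: rint_le => //; try exact: rcont_cst.
  by move=> t /gM; rewrite ler_norml => /andP[].
by move=> t /gM; rewrite ler_norml => /andP[].
Qed.

Definition pt (x y : R) : C := Complex x y.
Definition iC : C := Complex 0 1.
Definition rc (x : R) : C := (x%:C)%C.

Lemma ptE x y : pt x y = rc x + iC * rc y.
Proof. exact: (complexE (Complex x y)). Qed.

Lemma rcD x y : rc (x + y) = rc x + rc y. Proof. exact: rmorphD. Qed.
Lemma rcB x y : rc (x - y) = rc x - rc y. Proof. exact: rmorphB. Qed.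
Lemma rcM x y : rc (x * y) = rc x * rc y. Proof. exact: rmorphM. Qed.
Lemma rc_le x y : (rc x <= rc y) = (x <= y). Proof. exact: lecR. Qed.
Lemma rc_lt x y : (rc x < rc y) = (x < y). Proof. exact: ltcR. Qed.
Lemma rc0 : rc 0 = 0. Proof. by []. Qed.
Lemma norm_iC : `|iC| = 1.
Proof. by rewrite normc_def/= expr0n/= add0r expr1n sqrtr1. Qed.
Lemma norm_rc x : `|rc x| = rc `|x|.
Proof. by rewrite normc_def/= expr0n/= addr0 sqrtr_sqr. Qed.
Lemma rc_real (z : C) : z \is Num.real -> z = rc (complex.Re z).
Proof. by move=> zr; rewrite /rc RRe_real. Qed.
Lemma rc_ge0 x : (0 <= rc x) = (0 <= x). Proof. by rewrite -rc0 rc_le. Qed.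
Lemma rc_gt0 x : (0 < rc x) = (0 < x). Proof. by rewrite -rc0 rc_lt. Qed.

Lemma Re_norm (z : C) : rc `|complex.Re z| <= `|z|.
Proof. exact: normc_ge_Re. Qed.

Lemma Im_norm (z : C) : rc `|complex.Im z| <= `|z|.
Proof. by rewrite normc_def lecR -sqrtr_sqr ler_wsqrtr// lerDr sqr_ge0. Qed.

Lemma norm_pt x y : `|pt x y| <= rc (`|x| + `|y|).
Proof.
rewrite ptE rcD; apply: le_trans (ler_normD _ _) _.
by rewrite normrM norm_iC mul1r !norm_rc.
Qed.

(** The norm of [Cx R] takes values in [Cx R]; [nm] is the same number in [R], where estimates and
    integrals take place. *)
Definition nm (z : C) : R := complex.Re `|z|.

Lemma nmE z : `|z| = rc (nm z). Proof. exact: rc_real (normr_real z). Qed.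
Lemma nm_ge0 z : 0 <= nm z. Proof. by rewrite -rc_ge0 -nmE. Qed.
Lemma nmD z w : nm (z + w) <= nm z + nm w.
Proof. by rewrite -rc_le rcD -!nmE ler_normD. Qed.
Lemma nmN z : nm (- z) = nm z. Proof. by rewrite /nm normrN. Qed.
Lemma nmB z w : nm (z - w) <= nm z + nm w. Proof. by rewrite -(nmN w) nmD. Qed.
Lemma nmM z w : nm (z * w) = nm z * nm w.
Proof. by apply: (@complexI R); rewrite [RHS]rmorphM/= -![_%:C%C]nmE normrM. Qed.
Lemma nm0 : nm 0 = 0. Proof. by rewrite /nm normr0. Qed.
Lemma nm1 : nm 1 = 1. Proof. by rewrite /nm normr1. Qed.
Lemma nm_iC : nm iC = 1. Proof. by rewrite /nm norm_iC. Qed.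
Lemma nm_rc x : nm (rc x) = `|x|. Proof. by rewrite /nm norm_rc. Qed.
Lemma nm_eq0 z : (nm z == 0) = (z == 0).
Proof.
by apply/eqP/eqP => [h|->]; [apply/eqP; rewrite -normr_eq0 nmE h|exact: nm0].
Qed.
Lemma nm_gt0 z : (0 < nm z) = (z != 0).
Proof. by rewrite lt0r nm_ge0 andbT nm_eq0. Qed.
Lemma nmV z : nm z^-1 = (nm z)^-1.
Proof.
have [->|z0] := eqVneq z 0; first by rewrite invr0 nm0 invr0.
apply: (mulfI (x := nm z)); rewrite ?nm_eq0// -nmM !mulfV ?nm1// nm_eq0//.
Qed.
Lemma nmX z n : nm (z ^+ n) = nm z ^+ n.
Proof. by elim: n => [|n IH]; rewrite ?expr0 ?nm1// !exprS nmM IH. Qed.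
Lemma nm_Re z : `|complex.Re z| <= nm z.
Proof. by rewrite -rc_le -nmE; exact: Re_norm. Qed.
Lemma nm_Im z : `|complex.Im z| <= nm z.
Proof. by rewrite -rc_le -nmE; exact: Im_norm. Qed.
Lemma nm_pt x y : nm (pt x y) <= `|x| + `|y|.
Proof. by rewrite -rc_le -nmE; exact: norm_pt. Qed.
Lemma nm_dist z w : nm (z - w) = nm (w - z). Proof. by rewrite -nmN opprB. Qed.
Lemma ptB x y x' y' : pt x y - pt x' y' = pt (x - x') (y - y').
Proof. by []. Qed.
Lemma pt_surj z : z = pt (complex.Re z) (complex.Im z).
Proof. by case: z. Qed.

Lemma ReB (z w : C) : complex.Re (z - w) = complex.Re z - complex.Re w :> R.
Proof. by case: z w => [? ?] [? ?]. Qed.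
Lemma ImB (z w : C) : complex.Im (z - w) = complex.Im z - complex.Im w :> R.
Proof. by case: z w => [? ?] [? ?]. Qed.

(** Continuity is two-sided even at the endpoints, as [s] may leave [a, b]. Slices of functions that
    are differentiable in the plane at each point of the segment have this property. *)
Definition ccont (g : R -> C) a b := forall t, a <= t <= b ->
  forall e : R, 0 < e -> exists2 d, 0 < d & forall s, `|s - t| < d -> nm (g s - g t) < e.

Lemma ccont_Re g a b : ccont g a b -> rcont (fun t => complex.Re (g t)) a b.
Proof.
move=> gc t tab; apply/cvgrPdist_lt => e e0.
have [d d0 gd] := gc t tab e e0; apply/nbhs_ballP; exists d => //= s ts.
rewrite distrC -ReB.
apply: le_lt_trans (nm_Re _) _; apply: gd; by rewrite distrC.
Qed.

Lemma ccont_Im g a b : ccont g a b -> rcont (fun t => complex.Im (g t)) a b.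
Proof.
move=> gc t tab; apply/cvgrPdist_lt => e e0.
have [d d0 gd] := gc t tab e e0; apply/nbhs_ballP; exists d => //= s ts.
rewrite distrC -ImB.
apply: le_lt_trans (nm_Im _) _; apply: gd; by rewrite distrC.
Qed.

Lemma ccontZ c g a b : ccont g a b -> ccont (fun t => c * g t) a b.
Proof.
move=> gc t tab e e0.
have n0 : 0 < nm c + 1 by rewrite ltr_wpDl// nm_ge0.
have [d d0 gd] := gc t tab _ (divr_gt0 e0 n0).
exists d => // s /gd; rewrite ltr_pdivlMr// -mulrBr nmM => h.
apply: le_lt_trans h; rewrite mulrC ler_wpM2l ?nm_ge0// lerDl//.
Qed.

Definition cint (g : R -> C) a b : C :=
  pt (rint (fun t => complex.Re (g t)) a b) (rint (fun t => complex.Im (g t)) a b).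

Lemma cint_split g a b c : a <= c <= b -> ccont g a b ->
  cint g a b = cint g a c + cint g c b.
Proof.
move=> acb gc; rewrite /cint (rint_split acb (ccont_Re gc)).
by rewrite (rint_split acb (ccont_Im gc)).
Qed.

Lemma cint_cst r a b : a <= b -> cint (fun=> r) a b = r * rc (b - a).
Proof.
by move=> ab; rewrite /cint !rint_cst// ptE !rcM mulrA -mulrDl -ptE -pt_surj.
Qed.

Lemma cintD g h a b : ccont g a b -> ccont h a b ->
  cint (fun t => g t + h t) a b = cint g a b + cint h a b.
Proof.
move=> gc hc; rewrite /cint; congr pt; rewrite -rintD; try exact: ccont_Re;
  try exact: ccont_Im.
- by congr rint; apply/funext => t; case: (g t) (h t) => [? ?] [? ?].
- by congr rint; apply/funext => t; case: (g t) (h t) => [? ?] [? ?].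
Qed.

Lemma cintZ c g a b : ccont g a b -> cint (fun t => c * g t) a b = c * cint g a b.
Proof.
move=> gc; rewrite /cint; case: c => x y.
have gR := ccont_Re gc; have gI := ccont_Im gc.
rewrite (_ : (fun t => complex.Re _) =
  fun t => x * complex.Re (g t) + (- y) * complex.Im (g t)); last first.
  by apply/funext => t; case: (g t) => a1 b1 /=; rewrite mulNr.
rewrite (_ : (fun t => complex.Im _) =
  fun t => x * complex.Im (g t) + y * complex.Re (g t)); last first.
  by apply/funext => t; case: (g t) => a1 b1.
rewrite !rintD; try exact: rcontZ; rewrite !rintZ//.
by rewrite /pt mulNr.
Qed.

Lemma cintB g h a b : ccont g a b -> ccont h a b ->
  cint (fun t => g t - h t) a b = cint g a b - cint h a b.
Proof.
move=> gc hc; rewrite -[- cint h a b]mulN1r -cintZ// -cintD//; last exact: ccontZ.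
by congr cint; apply/funext => t; rewrite mulN1r.
Qed.

(** The factor 2 is the price of bounding the real and imaginary parts separately. *)
Lemma cint_abs g a b M : a <= b -> ccont g a b ->
  (forall t, a <= t <= b -> nm (g t) <= M) -> nm (cint g a b) <= 2 * (M * (b - a)).
Proof.
move=> ab gc gM; apply: le_trans (nm_pt _ _) _.
rewrite mulr_natl mulr2n lerD//; apply: rint_abs => //.
- exact: ccont_Re.
- by move=> t /gM; apply: le_trans; exact: nm_Re.
- exact: ccont_Im.
- by move=> t /gM; apply: le_trans; exact: nm_Im.
Qed.

Lemma cint_Im_ge g a b M : a <= b -> ccont g a b ->
  (forall t, a <= t <= b -> M <= complex.Im (g t)) -> M * (b - a) <= complex.Im (cint g a b).
Proof.
move=> ab gc gM; rewrite -rint_cst//=; apply: rint_le => //; first exact: rcont_cst.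
exact: ccont_Im.
Qed.

End SegmentIntegral.

(** * Goursat's theorem for rectangles *)

Section Goursat.
Variable R : realType.
Local Notation C := (Cx R).
Implicit Types (f : C -> C) (z w : C).

(** Complex differentiability with a real tolerance and a multiplicative remainder, the form in
    which the quadrisection argument consumes it; [cdiffP] identifies it with [differentiable]. *)
Definition cdiff f z := exists A : C, forall e : R, 0 < e ->
  exists2 d : R, 0 < d & forall w, nm (w - z) < d ->
    nm (f w - f z - A * (w - z)) <= e * nm (w - z).

Lemma differentiable_cdiff f z : differentiable (f : C -> C^o) z -> cdiff f z.
Proof.
move=> /derivable1_diffP/cvg_ex[/= A /cvgrPdist_le fA]; exists A => e e0.
have /fA : 0 < rc e by rewrite rc_gt0.
rewrite near_withinE => /nbhs_ballP[d /= d0 dP].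
have dE := rc_real (gtr0_real d0).
exists (complex.Re d) => [|w wd]; first by rewrite -rc_gt0 -dE.
have [->|wz] := eqVneq w z; first by rewrite !subrr mulr0 subr0 nm0 mulr0.
have wz0 : w - z != 0 by rewrite subr_eq0.
have := dP (w - z); rewrite /ball/= sub0r normrN nmE dE rc_lt => /(_ wd wz0).
rewrite [_ *: 1]mulr1 subrK nmE rc_le => h.
rewrite (_ : _ - _ = - ((w - z) * (A - (w - z)^-1 * (f w - f z)))); last first.
    have key (u v B : C) : u != 0 -> v - B * u = - (u * (B - u^-1 * v)) by move=> ?; field.
  exact: key.
by rewrite nmN nmM mulrC ler_wpM2r ?nm_ge0.
Qed.

Lemma cdiff_cont f z : cdiff f z -> forall e : R, 0 < e ->
  exists2 d, 0 < d & forall w, nm (w - z) < d -> nm (f w - f z) < e.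
Proof.
move=> [A fA] e e0; have [d d0 fd] := fA 1 ltr01.
have n0 : 0 < nm A + 1 by rewrite ltr_wpDl// nm_ge0.
exists (Num.min d (e / (nm A + 1))) => [|w]; first by rewrite lt_min d0 divr_gt0.
rewrite lt_min ltr_pdivlMr// => /andP[/fd]; rewrite mul1r => h1 h2.
have -> : f w - f z = (f w - f z - A * (w - z)) + A * (w - z) by rewrite subrK.
apply: le_lt_trans (nmD _ _) _; rewrite nmM.
lra.
Qed.

Definition hslice f y := fun t => f (pt t y).
Definition vslice f x := fun t => f (pt x t).

Definition rdiff f x0 x1 y0 y1 := forall x y, x0 <= x <= x1 -> y0 <= y <= y1 ->
  cdiff f (pt x y).

Lemma rdiffS f x0 x1 y0 y1 x0' x1' y0' y1' :
  x0 <= x0' -> x1' <= x1 -> y0 <= y0' -> y1' <= y1 ->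
  rdiff f x0 x1 y0 y1 -> rdiff f x0' x1' y0' y1'.
Proof.
move=> h1 h2 h3 h4 fd x y /andP[h5 h6] /andP[h7 h8]; apply: fd.
  by rewrite (le_trans h1 h5) (le_trans h6 h2).
by rewrite (le_trans h3 h7) (le_trans h8 h4).
Qed.

Lemma hslice_cont f x0 x1 y : (forall x, x0 <= x <= x1 -> cdiff f (pt x y)) ->
  ccont (hslice f y) x0 x1.
Proof.
move=> fd t tx e e0; have [d d0 fP] := cdiff_cont (fd t tx) e0.
exists d => // s st; apply: fP; rewrite ptB; apply: le_lt_trans (nm_pt _ _) _.
by rewrite subrr normr0 addr0.
Qed.

Lemma vslice_cont f x y0 y1 : (forall y, y0 <= y <= y1 -> cdiff f (pt x y)) ->
  ccont (vslice f x) y0 y1.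
Proof.
move=> fd t tx e e0; have [d d0 fP] := cdiff_cont (fd t tx) e0.
exists d => // s st; apply: fP; rewrite ptB; apply: le_lt_trans (nm_pt _ _) _.
by rewrite subrr normr0 add0r.
Qed.

(** The integral of f(z) dz along the boundary, counterclockwise: dz is dt on the horizontal sides
    and i dt on the vertical ones. *)
Definition rect f x0 x1 y0 y1 : C :=
  cint (hslice f y0) x0 x1 - cint (hslice f y1) x0 x1 +
  iC R * (cint (vslice f x1) y0 y1 - cint (vslice f x0) y0 y1).

Lemma rect_splitx f x0 x1 y0 y1 c : x0 <= c <= x1 -> y0 <= y1 ->
  (forall x, x0 <= x <= x1 -> cdiff f (pt x y0)) ->
  (forall x, x0 <= x <= x1 -> cdiff f (pt x y1)) ->
  rect f x0 x1 y0 y1 = rect f x0 c y0 y1 + rect f c x1 y0 y1.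
Proof.
move=> xc y01 d0 d1; rewrite /rect (cint_split xc (hslice_cont d0)).
by rewrite (cint_split xc (hslice_cont d1)); ring.
Qed.

Lemma rect_splity f x0 x1 y0 y1 c : y0 <= c <= y1 ->
  (forall y, y0 <= y <= y1 -> cdiff f (pt x0 y)) ->
  (forall y, y0 <= y <= y1 -> cdiff f (pt x1 y)) ->
  rect f x0 x1 y0 y1 = rect f x0 x1 y0 c + rect f x0 x1 c y1.
Proof.
move=> yc d0 d1; rewrite /rect (cint_split yc (vslice_cont d0)).
by rewrite (cint_split yc (vslice_cont d1)); ring.
Qed.

Lemma rect_abs f x0 x1 y0 y1 M : x0 <= x1 -> y0 <= y1 ->
  ccont (hslice f y0) x0 x1 -> ccont (hslice f y1) x0 x1 ->
  ccont (vslice f x0) y0 y1 -> ccont (vslice f x1) y0 y1 ->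
  (forall x, x0 <= x <= x1 -> nm (f (pt x y0)) <= M /\ nm (f (pt x y1)) <= M) ->
  (forall y, y0 <= y <= y1 -> nm (f (pt x0 y)) <= M /\ nm (f (pt x1 y)) <= M) ->
  nm (rect f x0 x1 y0 y1) <= 4 * (M * ((x1 - x0) + (y1 - y0))).
Proof.
move=> x01 y01 c1 c2 c3 c4 h v.
have i1 := cint_abs x01 c1 (fun t ht => (h t ht).1).
have i2 := cint_abs x01 c2 (fun t ht => (h t ht).2).
have i3 := cint_abs y01 c3 (fun t ht => (v t ht).1).
have i4 := cint_abs y01 c4 (fun t ht => (v t ht).2).
rewrite /rect; apply: le_trans (nmD _ _) _; rewrite nmM nm_iC mul1r.
apply: le_trans (lerD (nmB _ _) (nmB _ _)) _.
apply: le_trans (lerD (lerD i1 i2) (lerD i4 i3)) _.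
by rewrite le_eqVlt; apply/orP; left; apply/eqP; ring.
Qed.

(** On opposite sides an affine function differs by a constant. The horizontal and vertical pairs of
    sides contribute opposite multiples of i b (x1 - x0)(y1 - y0), so its integral vanishes. *)
Lemma rect_affine f a b x0 x1 y0 y1 : x0 <= x1 -> y0 <= y1 ->
  ccont (hslice f y0) x0 x1 -> ccont (hslice f y1) x0 x1 ->
  ccont (vslice f x0) y0 y1 -> ccont (vslice f x1) y0 y1 ->
  rect (fun z => f z - (a + b * z)) x0 x1 y0 y1 = rect f x0 x1 y0 y1.
Proof.
move=> x01 y01 c1 c2 c3 c4.
have ah y : ccont (hslice (fun z => a + b * z) y) x0 x1.
  move=> t _ e e0; have n0 : 0 < nm b + 1 by rewrite ltr_wpDl// nm_ge0.
  exists (e / (nm b + 1)) => [|s]; first by rewrite divr_gt0.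
  rewrite ltr_pdivlMr// /hslice opprD addrACA subrr add0r -mulrBr ptB nmM subrr => h.
  apply: le_lt_trans h; rewrite mulrC.
  apply: ler_pM; rewrite ?nm_ge0// ?lerDl//.
  by apply: le_trans (nm_pt _ _) _; rewrite normr0 addr0.
have av x : ccont (vslice (fun z => a + b * z) x) y0 y1.
  move=> t _ e e0; have n0 : 0 < nm b + 1 by rewrite ltr_wpDl// nm_ge0.
  exists (e / (nm b + 1)) => [|s]; first by rewrite divr_gt0.
  rewrite ltr_pdivlMr// /vslice opprD addrACA subrr add0r -mulrBr ptB nmM subrr => h.
  apply: le_lt_trans h; rewrite mulrC.
  apply: ler_pM; rewrite ?nm_ge0// ?lerDl//.
  by apply: le_trans (nm_pt _ _) _; rewrite normr0 add0r.
rewrite /rect.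
have hE y : hslice (fun z => f z - (a + b * z)) y =
   fun t => hslice f y t - hslice (fun z => a + b * z) y t by [].
have vE x : vslice (fun z => f z - (a + b * z)) x =
   fun t => vslice f x t - vslice (fun z => a + b * z) x t by [].
rewrite !hE !vE !cintB//.
have h1 : cint (hslice (fun z => a + b * z) y0) x0 x1 -
    cint (hslice (fun z => a + b * z) y1) x0 x1 = b * (iC R * rc (y0 - y1)) * rc (x1 - x0).
  rewrite -cintB// -(cint_cst (b * (iC R * rc (y0 - y1))))//.
  congr (cint _ _ _); apply/funext => t.
  by rewrite /hslice !ptE rcB; ring.
have h2 : cint (vslice (fun z => a + b * z) x1) y0 y1 -
    cint (vslice (fun z => a + b * z) x0) y0 y1 = b * rc (x1 - x0) * rc (y1 - y0).
  rewrite -cintB// -(cint_cst (b * rc (x1 - x0)))//.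
  congr (cint _ _ _); apply/funext => t.
  by rewrite /vslice !ptE rcB; ring.
move: h1 h2; rewrite !rcB => h1 h2.
transitivity (cint (hslice f y0) x0 x1 - cint (hslice f y1) x0 x1 +
  iC R * (cint (vslice f x1) y0 y1 - cint (vslice f x0) y0 y1) -
  ((cint (hslice (fun z => a + b * z) y0) x0 x1 -
    cint (hslice (fun z => a + b * z) y1) x0 x1) + iC R * (cint (vslice (fun z => a + b * z) x1) y0 y1 -
    cint (vslice (fun z => a + b * z) x0) y0 y1))); first by ring.
by rewrite h1 h2; ring.
Qed.

Lemma rdiff_sides f x0 x1 y0 y1 : x0 <= x1 -> y0 <= y1 -> rdiff f x0 x1 y0 y1 ->
  [/\ ccont (hslice f y0) x0 x1, ccont (hslice f y1) x0 x1,
      ccont (vslice f x0) y0 y1 & ccont (vslice f x1) y0 y1].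
Proof.
move=> x01 y01 fd; split; [apply: hslice_cont|apply: hslice_cont|
  apply: vslice_cont|apply: vslice_cont] => t ht; apply: fd;
  by rewrite ?lexx ?x01 ?y01.
Qed.

Lemma quarter_max (r q1 q2 q3 q4 s1 s2 : R) :
  s2 <= q3 + q4 -> s1 <= q1 + q2 -> r <= s1 + s2 ->
  [\/ r <= 4 * q1, r <= 4 * q2, r <= 4 * q3 | r <= 4 * q4].
Proof.
move=> h1 h2 h3; have [g1|g1] := leP r (4 * q1); first by constructor 1.
have [g2|g2] := leP r (4 * q2); first by constructor 2.
have [g3|g3] := leP r (4 * q3); first by constructor 3.
by constructor 4; lra.
Qed.

Lemma rect_quarter f x0 x1 y0 y1 : x0 <= x1 -> y0 <= y1 -> rdiff f x0 x1 y0 y1 ->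
  exists x0' x1' y0' y1', [/\ [/\ x0 <= x0', x1' <= x1, y0 <= y0' & y1' <= y1],
    x1' - x0' = (x1 - x0) / 2, y1' - y0' = (y1 - y0) / 2 &
    nm (rect f x0 x1 y0 y1) <= 4 * nm (rect f x0' x1' y0' y1')].
Proof.
move=> x01 y01 fd; pose xm := (x0 + x1) / 2; pose ym := (y0 + y1) / 2.
have xh : x0 <= xm <= x1 by apply/andP; split; rewrite /xm; lra.
have yh : y0 <= ym <= y1 by apply/andP; split; rewrite /ym; lra.
have /andP[xh1 xh2] := xh; have /andP[yh1 yh2] := yh.
have e : rect f x0 x1 y0 y1 = rect f x0 xm y0 ym + rect f x0 xm ym y1 +
    (rect f xm x1 y0 ym + rect f xm x1 ym y1).
  rewrite (@rect_splitx _ _ _ _ _ xm)//; last 2 first.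
  - by move=> x hx; apply: fd; rewrite ?lexx ?y01.
  - by move=> x hx; apply: fd; rewrite ?lexx ?y01.
  rewrite (@rect_splity _ x0 _ _ _ ym)//; last 2 first.
  - by move=> x hx; apply: fd; rewrite ?lexx ?x01.
  - by move=> x hx; apply: fd; rewrite ?xh.
  rewrite (@rect_splity _ xm _ _ _ ym)//.
  - by move=> x hx; apply: fd; rewrite ?xh.
  - by move=> x hx; apply: fd; rewrite ?lexx ?x01.
have hx1 : xm - x0 = (x1 - x0) / 2 by rewrite /xm; clear; lra.
have hx2 : x1 - xm = (x1 - x0) / 2 by rewrite /xm; clear; lra.
have hy1 : ym - y0 = (y1 - y0) / 2 by rewrite /ym; clear; lra.
have hy2 : y1 - ym = (y1 - y0) / 2 by rewrite /ym; clear; lra.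
have := nmD (rect f x0 xm y0 ym + rect f x0 xm ym y1) (rect f xm x1 y0 ym + rect f xm x1 ym y1).
rewrite -e => h.
have [q|q|q|q] := quarter_max (nmD (rect f xm x1 y0 ym) (rect f xm x1 ym y1))
  (nmD (rect f x0 xm y0 ym) (rect f x0 xm ym y1)) h.
- by exists x0, xm, y0, ym.
- by exists x0, xm, ym, y1.
- by exists xm, x1, y0, ym.
- by exists xm, x1, ym, y1.
Qed.

Lemma nested_point (a b : nat -> R) : (forall n, a n <= a n.+1) ->
  (forall n, b n.+1 <= b n) -> (forall n, a n <= b n) ->
  exists c, forall n, a n <= c <= b n.
Proof.
move=> an bn ab.
have amono n m : (n <= m)%N -> a n <= a m.
  by move: n m; exact/nondecreasing_seqP.
have bmono n m : (n <= m)%N -> b m <= b n.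
  by move: n m; exact/nonincreasing_seqP.
have anb n m : a n <= b m.
  by apply: le_trans (amono n _ (leq_maxl n m)) (le_trans (ab _) (bmono m _ (leq_maxr n m))).
have hs : has_sup (range a) by split; [exists (a 0%N), 0%N|exists (b 0%N) => _ [n _ <-]].
exists (sup (range a)) => n; apply/andP; split.
  by apply: sup_upper_bound => //; exists n.
by apply: ge_sup; [exists (a 0%N), 0%N|move=> _ [m _ <-]].
Qed.

(** Quadrisection: some quarter carries at least a quarter of the integral. Around the common point
    of the nested rectangles the linear approximation makes the n-th integral small compared with
    4^-n. *)
Theorem goursat f x0 x1 y0 y1 : x0 <= x1 -> y0 <= y1 -> rdiff f x0 x1 y0 y1 ->
  rect f x0 x1 y0 y1 = 0.
Proof.
move=> x01 y01 fd.
pose good (s : R * R * R * R) := let: (a, b, c, d) := s in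
  [/\ x0 <= a, b <= x1, y0 <= c & d <= y1] /\ (a <= b /\ c <= d).
(* [good s] is a premise inside [step], so that every [s] has a successor and [choice] applies. *)
pose step (s s' : R * R * R * R) := let: (a, b, c, d) := s in
  let: (a', b', c', d') := s' in
  good s -> [/\ good s', [/\ a <= a', b' <= b, c <= c' & d' <= d],
     b' - a' = (b - a) / 2, d' - c' = (d - c) / 2 &
    nm (rect f a b c d) <= 4 * nm (rect f a' b' c' d')].
have stepP : forall s, exists s', step s s'.
  move=> [[[a b] c] d].
  have [[[h1 h2 h3 h4] [ab cd]]|ng] := pselect (good (a, b, c, d)); last first.
    by exists (a, b, c, d) => /=.
  have fd' : rdiff f a b c d by apply: rdiffS fd.
  have [a' [b' [c' [d' [[k1 k2 k3 k4] e1 e2 e3]]]]] := rect_quarter ab cd fd'.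
  exists (a', b', c', d') => _; split=> //; split.
    by split; [exact: le_trans k1|exact: le_trans h2|exact: le_trans k3|exact: le_trans h4].
  by split; lra.
have [next nextP] := choice stepP.
pose S n := iter n next (x0, x1, y0, y1).
pose a n := (S n).1.1.1; pose b n := (S n).1.1.2; pose c n := (S n).1.2; pose d n := (S n).2.
have SE n : S n = (a n, b n, c n, d n) by rewrite /a /b /c /d; case: (S n) => [[[]]].
have Sg n : good (S n).
  elim: n => [|n IH]; first by rewrite /S/= !lexx.
  have := nextP (S n); rewrite -[next (S n)]/(S n.+1) !SE in IH *.
  by move=> /(_ IH)[].
have Ss n : [/\ [/\ a n <= a n.+1, b n.+1 <= b n, c n <= c n.+1 & d n.+1 <= d n],
     b n.+1 - a n.+1 = (b n - a n) / 2, d n.+1 - c n.+1 = (d n - c n) / 2 &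
    nm (rect f (a n) (b n) (c n) (d n)) <=
      4 * nm (rect f (a n.+1) (b n.+1) (c n.+1) (d n.+1))].
  have := nextP (S n); have := Sg n; rewrite -[next (S n)]/(S n.+1) !SE.
  by move=> g /(_ g)[].
have ab n : a n <= b n by have := Sg n; rewrite SE => -[_ []].
have cd n : c n <= d n by have := Sg n; rewrite SE => -[_ []].
have [p pP] : exists p, forall n, a n <= p <= b n.
  by apply: nested_point => // n; case: (Ss n) => -[].
have [q qP] : exists q, forall n, c n <= q <= d n.
  by apply: nested_point => // n; case: (Ss n) => -[].
pose L := (x1 - x0) + (y1 - y0).
have L0 : 0 <= L by rewrite /L; lra.
have LE n : (b n - a n) + (d n - c n) = L / 2 ^+ n.
  elim: n => [|n IH]; first by rewrite expr0 divr1.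
  have [_ -> -> _] := Ss n; rewrite -mulrDl IH exprS invfM mulrA mulrAC//.
have rE n : nm (rect f x0 x1 y0 y1) <= 4 ^+ n * nm (rect f (a n) (b n) (c n) (d n)).
  elim: n => [|n IH]; first by rewrite expr0 mul1r.
  have [_ _ _ h] := Ss n; apply: le_trans IH _.
  by rewrite exprSr -mulrA ler_wpM2l// exprn_ge0.
have [A fA] : cdiff f (pt p q) by apply: fd; [exact: (pP 0%N)|exact: (qP 0%N)].
apply/eqP; rewrite -nm_eq0 eq_le nm_ge0 andbT.
apply/ler_addgt0Pr => e e0; rewrite add0r.
(* The final bound is e (4 L L / K); the added 1 keeps [K] positive for a degenerate rectangle. *)
pose K := 4 * (L + 1) * (L + 1).
have K0 : 0 < K by rewrite /K; nra.
have [dl dl0 dP] := fA (e / K) (divr_gt0 e0 K0).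
have [n nP] : exists n, L / 2 ^+ n < dl.
  have [n nP] : exists n, L / dl < n%:R 
    by exists (Num.bound (L / dl)); apply: archi_boundP; rewrite divr_ge0// ltW.
  exists n; rewrite ltr_pdivrMr ?exprn_gt0// mulrC -ltr_pdivrMr//.
  by apply: lt_trans nP _; rewrite -natrX ltr_nat ltn_expl.
apply: le_trans (rE n) _.
have [k1 k2 k3 k4] : [/\ x0 <= a n, b n <= x1, y0 <= c n & d n <= y1].
  by have := Sg n; rewrite SE => -[].
have fdn : rdiff f (a n) (b n) (c n) (d n) by apply: rdiffS fd.
have [c1 c2 c3 c4] := rdiff_sides (ab n) (cd n) fdn.
(* Subtracting the linear approximation at the limit point does not change the integral, by
   [rect_affine], and leaves only the remainder. *)
pose g z := f z - (f (pt p q) - A * pt p q + A * z).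
have gE z : g z = f z - f (pt p q) - A * (z - pt p q) by rewrite /g; ring.
have gb x y : a n <= x <= b n -> c n <= y <= d n -> nm (g (pt x y)) <= e / K * (L / 2 ^+ n).
  move=> hx hy; rewrite gE.
  have hn : nm (pt x y - pt p q) <= L / 2 ^+ n.
    rewrite ptB; apply: le_trans (nm_pt _ _) _; rewrite -LE.
    have := pP n; have := qP n; move: hx hy => /andP[u1 u2] /andP[u3 u4] /andP[u5 u6] /andP[u7 u8].
    by apply: lerD; rewrite ler_norml; apply/andP; split; lra.
  apply: le_trans (dP _ (le_lt_trans hn nP)) _.
  by rewrite ler_wpM2l// divr_ge0// ltW.
have gdn : rdiff g (a n) (b n) (c n) (d n).
  move=> x y hx hy; have [B fB] := fdn x y hx hy.
  exists (B - A) => e' e'0; have [d' d'0 d'P] := fB e' e'0; exists d' => // w wd.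
  by apply: le_trans (d'P w wd); rewrite /g le_eqVlt; apply/orP; left; apply/eqP; congr nm; ring.
have [g1 g2 g3 g4] := rdiff_sides (ab n) (cd n) gdn.
rewrite -(@rect_affine f (f (pt p q) - A * pt p q) A)//.
have := @rect_abs g _ _ _ _ (e / K * (L / 2 ^+ n)) (ab n) (cd n) g1 g2 g3 g4.
rewrite LE => h.
apply: le_trans (ler_wpM2l _ (h _ _)) _.
- exact: exprn_ge0.
- by move=> x hx; split; apply: gb; rewrite ?lexx ?cd.
- by move=> y hy; split; apply: gb; rewrite ?lexx ?ab.
have -> : (4 : R) ^+ n = 2 ^+ n * 2 ^+ n by rewrite -exprMn -natrM.
have p0 : (2 : R) ^+ n != 0 by rewrite expf_neq0.
have aux (P Q : R) : P != 0 -> Q != 0 ->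
    P * P * (4 * (e / Q * (L / P) * (L / P))) = e * (4 * L * L / Q).
  by move=> P0 Q0; field; rewrite P0 Q0.
rewrite aux ?(gt_eqF K0)//.
rewrite -[leRHS]mulr1 ler_wpM2l ?(ltW e0)// ler_pdivrMr// mul1r /K; nra.
Qed.

Lemma cdiffP f z : cdiff f z <-> differentiable (f : C -> C^o) z.
Proof.
split; last exact: differentiable_cdiff.
move=> [A fA]; apply/derivable1_diffP/cvg_ex; exists A; apply/cvgrPdist_le => /= e e0.
have eE := rc_real (gtr0_real e0).
have [|d d0 dP] := fA (complex.Re e); first by rewrite -rc_gt0 -eE.
rewrite near_withinE; apply/nbhs_ballP; exists (rc d); rewrite /= ?rc_gt0// => h.
rewrite /ball/= sub0r normrN nmE rc_lt => hd h0.
rewrite [h%:A]mulr1 eE nmE rc_le -(ler_pM2r (x := nm h)) ?nm_gt0//.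
have := dP (h + z); rewrite addrK => /(_ hd); apply: le_trans.
rewrite le_eqVlt; apply/orP; left; apply/eqP; rewrite -nmM -nmN; congr nm.
have key (u v B : C) : u != 0 -> - ((B - u^-1 * v) * u) = v - B * u by move=> ?; field.
by rewrite -key.
Qed.

Lemma cdiff_cst c z : cdiff (fun=> c) z.
Proof. exact/cdiffP/differentiable_cst. Qed.
Lemma cdiff_id z : cdiff id z.
Proof. exact/cdiffP/(@ex_diff _ _ _ _ _ _ id). Qed.
Lemma cdiffD f g z : cdiff f z -> cdiff g z -> cdiff (fun z => f z + g z) z.
Proof. by move=> /cdiffP df /cdiffP dg; apply/cdiffP; exact: differentiableD. Qed.
Lemma cdiffB f g z : cdiff f z -> cdiff g z -> cdiff (fun z => f z - g z) z.
Proof. by move=> /cdiffP df /cdiffP dg; apply/cdiffP; exact: differentiableB. Qed.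
Lemma cdiffM f g z : cdiff f z -> cdiff g z -> cdiff (fun z => f z * g z) z.
Proof. by move=> /cdiffP df /cdiffP dg; apply/cdiffP; exact: differentiableM. Qed.
Lemma cdiffV f z : f z != 0 -> cdiff f z -> cdiff (fun z => (f z)^-1) z.
Proof. by move=> fz /cdiffP df; apply/cdiffP; exact: differentiableV. Qed.
Lemma cdiffX f n z : cdiff f z -> cdiff (fun z => f z ^+ n) z.
Proof.
move=> df; elim: n => [|n IH]; first exact: cdiff_cst.
by under eq_fun do rewrite exprS; exact: cdiffM.
Qed.
Lemma cdiff_sum (I : Type) (s : seq I) (P : pred I) (F : I -> C -> C) z :
  (forall i, P i -> cdiff (F i) z) -> cdiff (fun z => \sum_(i <- s | P i) F i z) z.
Proof.
move=> FP; elim: s => [|i s IH].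
  by under eq_fun do rewrite big_nil; exact: cdiff_cst.
under eq_fun do rewrite big_cons; have [Pi|//] := boolP (P i).
by apply: cdiffD => //; exact: FP.
Qed.
Lemma cdiff_near f g z (d : R) : 0 < d -> (forall w, nm (w - z) < d -> f w = g w) ->
  cdiff f z -> cdiff g z.
Proof.
move=> d0 fg [A fA]; exists A => e e0; have [d' d'0 d'P] := fA e e0.
exists (Num.min d d') => [|w]; first by rewrite lt_min d0.
rewrite lt_min => /andP[wd wd']; rewrite -fg// -fg ?subrr ?nm0//; exact: d'P.
Qed.
Lemma cdiff_expz (n : int) z : z != 0 -> cdiff (fun z => z ^ n) z.
Proof.
move=> z0; case: n => n; first exact: (cdiffX _ (cdiff_id _)).
by apply: cdiffV; [rewrite expf_neq0|exact: (cdiffX _ (cdiff_id _))].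
Qed.
Lemma cdiff_inv w z : z != w -> cdiff (fun z => (z - w)^-1) z.
Proof.
move=> zw; apply: cdiffV; first by rewrite subr_eq0.
by apply: cdiffB; [exact: cdiff_id|exact: cdiff_cst].
Qed.

End Goursat.

(** * Integrals around isolated singularities *)

Section Contours.
Variable R : realType.
Local Notation C := (Cx R).
Implicit Types (f g : C -> C) (z w : C).

(** Cutting off the left and right strips, then the bottom and top of the middle strip, leaves the
    inner rectangle. Every removed piece has integral 0 by [goursat]. *)
Lemma rect_annulus f x0 x1 y0 y1 a0 a1 b0 b1 :
  [/\ x0 <= a0, a0 <= a1 & a1 <= x1] -> [/\ y0 <= b0, b0 <= b1 & b1 <= y1] ->
  (forall x y, x0 <= x <= x1 -> y0 <= y <= y1 ->
     ~~ [&& a0 < x, x < a1, b0 < y & y < b1] -> cdiff f (pt x y)) ->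
  rect f x0 x1 y0 y1 = rect f a0 a1 b0 b1.
Proof.
move=> [xa aa ax] [yb bb by_] fd.
have x01 : x0 <= x1 by exact: le_trans (le_trans xa aa) ax.
have y01 : y0 <= y1 by exact: le_trans (le_trans yb bb) by_.
have yb1 := le_trans yb bb; have yb2 := le_trans bb by_.
have xa1 := le_trans xa aa; have xa2 := le_trans aa ax.
have side x y : [|| x <= a0, a1 <= x, y <= b0 | b1 <= y] ->
    ~~ [&& a0 < x, x < a1, b0 < y & y < b1].
  by move=> /or4P[] h; rewrite !negb_and -!leNgt h ?orbT.
have g x y : [|| x <= a0, a1 <= x, y <= b0 | b1 <= y] ->
    x0 <= x <= x1 -> y0 <= y <= y1 -> cdiff f (pt x y).
  by move=> h hx hy; apply: fd => //; exact: side.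
rewrite (@rect_splitx _ _ _ _ _ _ a0) ?xa ?y01//; last 2 first.
- by move=> x hx; apply: g; rewrite ?yb ?lexx ?y01 ?orbT.
- by move=> x hx; apply: g; rewrite ?by_ ?lexx ?y01 ?orbT.
rewrite (@goursat _ _ x0 a0)//; last first.
  move=> x y /andP[h1 h2] hy; apply: g; rewrite ?h2 ?h1//=.
  by rewrite (le_trans h2).
rewrite add0r (@rect_splitx _ _ a0 _ _ _ a1) ?aa ?y01//; last 2 first.
- move=> x /andP[h1 h2]; apply: g; rewrite ?yb ?lexx ?y01 ?orbT//.
  by rewrite (le_trans xa h1).
- move=> x /andP[h1 h2]; apply: g; rewrite ?by_ ?lexx ?y01 ?orbT//.
  by rewrite (le_trans xa h1).
rewrite (@goursat _ _ a1 x1)//; last first.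
  move=> x y /andP[h1 h2] hy; apply: g; rewrite ?h2 ?h1 ?orbT//=.
  by rewrite (le_trans _ h1).
rewrite addr0 (@rect_splity _ _ _ _ _ _ b0) ?yb ?yb2//; last 2 first.
- by move=> y hy; apply: g; rewrite ?lexx ?xa.
- by move=> y hy; apply: g; rewrite ?lexx ?xa1 ?orbT.
rewrite (@goursat _ _ a0 a1 y0)//; last first.
  move=> x y /andP[h1 h2] /andP[h3 h4]; apply: g; rewrite ?h4 ?orbT//.
    by rewrite (le_trans xa h1) (le_trans h2).
  by rewrite h3 (le_trans h4).
rewrite add0r (@rect_splity _ _ _ _ _ _ b1) ?bb//; last 2 first.
- by move=> y /andP[h1 h2]; apply: g; rewrite ?lexx ?xa// h2 (le_trans yb h1).
- by move=> y /andP[h1 h2]; apply: g; rewrite ?lexx ?xa1 ?orbT// h2 (le_trans yb h1).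
rewrite (@goursat _ _ a0 a1 b1)// ?addr0//.
move=> x y /andP[h1 h2] /andP[h3 h4]; apply: g; rewrite ?h3 ?orbT//.
  by rewrite (le_trans xa h1) (le_trans h2).
by rewrite h4 (le_trans _ h3).
Qed.

Definition sq f w r := rect f (complex.Re w - r) (complex.Re w + r)
  (complex.Im w - r) (complex.Im w + r).

(** A removable singularity contributes nothing: the contour shrinks to squares of half-side [r]
    around [w], on which the integral is at most 16 |M| r. *)
Lemma rect_bounded0 f w x0 x1 y0 y1 M d :
  x0 < complex.Re w < x1 -> y0 < complex.Im w < y1 ->
  (forall x y, x0 <= x <= x1 -> y0 <= y <= y1 -> pt x y != w -> cdiff f (pt x y)) ->
  0 < d -> (forall z, z != w -> nm (z - w) < d -> nm (f z) <= M) ->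
  rect f x0 x1 y0 y1 = 0.
Proof.
case: w => [a b] /= /andP[xa ax] /andP[yb by_] fd d0 fM.
pose m := Num.min (Num.min (a - x0) (x1 - a)) (Num.min (b - y0) (y1 - b)).
have m0 : 0 < m by rewrite !lt_min !subr_gt0 xa ax yb by_.
have mm : [/\ m <= a - x0, m <= x1 - a, m <= b - y0 & m <= y1 - b].
  by rewrite /m; split; rewrite !ge_min lexx ?orbT.
case: mm => m1 m2 m3 m4.
apply/eqP; rewrite -nm_eq0 eq_le nm_ge0 andbT; apply/ler_addgt0Pr => e e0; rewrite add0r.
pose K := 16 * `|M| + 1; have K0 : 0 < K by rewrite /K ltr_wpDl// mulr_ge0.
(* [m] keeps the square inside the rectangle; [d / 3] keeps it in the disc where [f] is bounded, its
   points being within 2 r of [w]; [e / K] makes the final estimate smaller than [e]. *)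
pose r := Num.min m (Num.min (d / 3) (e / K)).
have r0 : 0 < r by rewrite lt_min m0 lt_min !divr_gt0.
have rm : r <= m by rewrite /r ge_min lexx.
have rd : r <= d / 3 by rewrite /r !ge_min lexx orbT.
have re : r <= e / K by rewrite /r !ge_min lexx !orbT.
clearbody m r.
rewrite (@rect_annulus _ _ _ _ _ (a - r) (a + r) (b - r) (b + r)); last 3 first.
- by split; lra.
- by split; lra.
- move=> x y hx hy h; apply: fd => //; apply: contraNneq h => -[-> ->].
  by rewrite !ltrBlDr !ltrDl r0.
have fd' x y : a - r <= x <= a + r -> b - r <= y <= b + r ->
    (x != a) || (y != b) -> cdiff f (pt x y).
  move=> /andP[h1 h2] /andP[h3 h4] h; apply: fd; first (by apply/andP; split; lra);
    first by apply/andP; split; lra.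
  by apply: contraTneq h => -[-> ->]; rewrite !eqxx.
have fM' x y : a - r <= x <= a + r -> b - r <= y <= b + r ->
    (x != a) || (y != b) -> nm (f (pt x y)) <= `|M|.
  move=> /andP[h1 h2] /andP[h3 h4] h; apply: le_trans (ler_norm M); apply: fM.
    by apply: contraTneq h => -[-> ->]; rewrite !eqxx.
  rewrite (ptB x y a b); apply: le_lt_trans (nm_pt _ _) _.
  have : `|x - a| <= r by rewrite ler_norml; apply/andP; split; lra.
  have : `|y - b| <= r by rewrite ler_norml; apply/andP; split; lra.
  lra.
have b1 : b - r != b by rewrite lt_eqF//; lra.
have b2 : b + r != b by rewrite gt_eqF//; lra.
have a1 : a - r != a by rewrite lt_eqF//; lra.
have a2 : a + r != a by rewrite gt_eqF//; lra.
have bb1 : b - r <= b - r <= b + r by apply/andP; split; lra.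
have bb2 : b - r <= b + r <= b + r by apply/andP; split; lra.
have aa1 : a - r <= a - r <= a + r by apply/andP; split; lra.
have aa2 : a - r <= a + r <= a + r by apply/andP; split; lra.
apply: le_trans (rect_abs (M := `|M|) _ _ _ _ _ _ _ _) _.
- lra.
- lra.
- by apply: hslice_cont => t ht; apply: fd' => //; rewrite b1 orbT.
- by apply: hslice_cont => t ht; apply: fd' => //; rewrite b2 orbT.
- by apply: vslice_cont => t ht; apply: fd' => //; rewrite a1.
- by apply: vslice_cont => t ht; apply: fd' => //; rewrite a2.
- by move=> x hx; split; apply: fM'; rewrite ?b1 ?b2 ?orbT.
- by move=> x hx; split; apply: fM'; rewrite ?a1 ?a2.
move: re; rewrite ler_pdivlMr// /K => re.
rewrite (_ : 4 * _ = r * (16 * `|M|)); first nra.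
ring.
Qed.

Lemma rectB f g x0 x1 y0 y1 :
  ccont (hslice f y0) x0 x1 -> ccont (hslice f y1) x0 x1 ->
  ccont (vslice f x0) y0 y1 -> ccont (vslice f x1) y0 y1 ->
  ccont (hslice g y0) x0 x1 -> ccont (hslice g y1) x0 x1 ->
  ccont (vslice g x0) y0 y1 -> ccont (vslice g x1) y0 y1 ->
  rect (fun z => f z - g z) x0 x1 y0 y1 = rect f x0 x1 y0 y1 - rect g x0 x1 y0 y1.
Proof.
move=> f1 f2 f3 f4 g1 g2 g3 g4; rewrite /rect.
have hE y : hslice (fun z => f z - g z) y = fun t => hslice f y t - hslice g y t by [].
have vE x : vslice (fun z => f z - g z) x = fun t => vslice f x t - vslice g x t by [].
by rewrite !hE !vE !cintB//; ring.
Qed.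

Lemma rectZ c f x0 x1 y0 y1 :
  ccont (hslice f y0) x0 x1 -> ccont (hslice f y1) x0 x1 ->
  ccont (vslice f x0) y0 y1 -> ccont (vslice f x1) y0 y1 ->
  rect (fun z => c * f z) x0 x1 y0 y1 = c * rect f x0 x1 y0 y1.
Proof.
move=> f1 f2 f3 f4; rewrite /rect.
have hE y : hslice (fun z => c * f z) y = fun t => c * hslice f y t by [].
have vE x : vslice (fun z => c * f z) x = fun t => c * vslice f x t by [].
by rewrite !hE !vE !cintZ//; ring.
Qed.

(** Only the boundary of the square with centre [w] and half-side [r] is concerned, so that
    singularities inside are allowed. *)
Definition ring_diff f w r := forall x y, complex.Re w - r <= x <= complex.Re w + r ->
  complex.Im w - r <= y <= complex.Im w + r ->
  [|| x == complex.Re w - r, x == complex.Re w + r, y == complex.Im w - r |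
      y == complex.Im w + r] -> cdiff f (pt x y).

Lemma ring_diff_sides f w r : 0 < r -> ring_diff f w r ->
  [/\ ccont (hslice f (complex.Im w - r)) (complex.Re w - r) (complex.Re w + r),
      ccont (hslice f (complex.Im w + r)) (complex.Re w - r) (complex.Re w + r),
      ccont (vslice f (complex.Re w - r)) (complex.Im w - r) (complex.Im w + r) &
      ccont (vslice f (complex.Re w + r)) (complex.Im w - r) (complex.Im w + r)].
Proof.
case: w => a b /= r0 fd; rewrite /ring_diff/= in fd.
have bb1 : b - r <= b - r <= b + r by apply/andP; split; lra.
have bb2 : b - r <= b + r <= b + r by apply/andP; split; lra.
have aa1 : a - r <= a - r <= a + r by apply/andP; split; lra.
have aa2 : a - r <= a + r <= a + r by apply/andP; split; lra.
by split; [apply: hslice_cont|apply: hslice_cont|apply: vslice_cont|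
  apply: vslice_cont] => t ht; apply: fd; rewrite ?eqxx ?orbT.
Qed.

Lemma ring_nm w r x y : 0 < r -> complex.Re w - r <= x <= complex.Re w + r ->
  complex.Im w - r <= y <= complex.Im w + r ->
  [|| x == complex.Re w - r, x == complex.Re w + r, y == complex.Im w - r |
      y == complex.Im w + r] -> r <= nm (pt x y - w) <= 2 * r.
Proof.
case: w => a b /= r0 /andP[h1 h2] /andP[h3 h4] h.
have hx : `|x - a| <= r by rewrite ler_norml; apply/andP; split; lra.
have hy : `|y - b| <= r by rewrite ler_norml; apply/andP; split; lra.
have := nm_Re (pt (x - a) (y - b)); have := nm_Im (pt (x - a) (y - b)).
rewrite (ptB x y a b) /= => g1 g2; apply/andP; split.
  have e1 : a - r - a = - r by ring.
  have e2 : a + r - a = r by ring.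
  have e3 : b - r - b = - r by ring.
  have e4 : b + r - b = r by ring.
  by case/or4P: h => /eqP e; [apply: le_trans g2|apply: le_trans g2|apply: le_trans g1|
    apply: le_trans g1]; rewrite e ?e1 ?e2 ?e3 ?e4 ?normrN gtr0_norm.
by apply: le_trans (nm_pt _ _) _; lra.
Qed.

Lemma sq_abs f w r M : 0 < r -> ring_diff f w r ->
  (forall x y, complex.Re w - r <= x <= complex.Re w + r ->
     complex.Im w - r <= y <= complex.Im w + r ->
     [|| x == complex.Re w - r, x == complex.Re w + r, y == complex.Im w - r |
      y == complex.Im w + r] -> nm (f (pt x y)) <= M) ->
  nm (sq f w r) <= 16 * (M * r).
Proof.
move=> r0 fd fM; have [c1 c2 c3 c4] := ring_diff_sides r0 fd.
move: c1 c2 c3 c4 fM {fd}; rewrite /sq; case: w => a b /= c1 c2 c3 c4 fM.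
have bb1 : b - r <= b - r <= b + r by apply/andP; split; lra.
have bb2 : b - r <= b + r <= b + r by apply/andP; split; lra.
have aa1 : a - r <= a - r <= a + r by apply/andP; split; lra.
have aa2 : a - r <= a + r <= a + r by apply/andP; split; lra.
apply: le_trans (rect_abs (M := M) _ _ c1 c2 c3 c4 _ _) _; [lra|lra| | |].
- by move=> x hx; split; apply: fM; rewrite ?eqxx ?orbT.
- by move=> x hx; split; apply: fM; rewrite ?eqxx ?orbT.
by rewrite le_eqVlt; apply/orP; left; apply/eqP; ring.
Qed.

Lemma ring_diff_off f w r : 0 < r -> (forall z, z != w -> cdiff f z) -> ring_diff f w r.
Proof.
move=> r0 fd x y hx hy h; apply: fd; apply: contraTneq h => <- /=.
by rewrite !negb_or; apply/and4P; split; apply/eqP => e; lra.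
Qed.

Lemma ring_diff_inv w v r : 0 < r -> nm (v - w) < r -> ring_diff (fun z => (z - v)^-1) w r.
Proof.
move=> r0 vr x y hx hy h; apply: cdiff_inv; apply: contraTneq h => xyv.
have := le_lt_trans (nm_Re _) vr; have := le_lt_trans (nm_Im _) vr.
rewrite -xyv ReB ImB /= !ltr_norml => /andP[k1 k2] /andP[k3 k4].
rewrite !negb_or; apply/and4P; split; apply/eqP => e; lra.
Qed.

Lemma inv_pt (x y : R) : (pt x y)^-1 = pt (x / (x ^+ 2 + y ^+ 2)) (- (y / (x ^+ 2 + y ^+ 2))).
Proof. by []. Qed.

Lemma Im_sides (A B D E : C) : 1 <= complex.Im A -> 1 <= complex.Im (-1 * B) ->
  1 <= complex.Im (iC R * D) -> 1 <= complex.Im (- iC R * E) ->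
  4 <= complex.Im (A - B + iC R * (D - E)).
Proof. by case: A B D E => [? ?] [? ?] [? ?] [? ?] /=; lra. Qed.

(** A substitute for the value 2 pi i of this integral. On each of the four sides the integrand,
    multiplied by the direction of travel, has imaginary part at least 1/(2 r), over a length 2
    r. *)
Lemma sq_inv_Im w r : 0 < r -> 4 <= complex.Im (sq (fun z => (z - w)^-1) w r).
Proof.
move=> r0; have [|c1 c2 c3 c4] := @ring_diff_sides (fun z => (z - w)^-1) w r r0.
  by apply: ring_diff_inv => //; rewrite subrr nm0.
have est s : `|s| <= r -> (2 * r)^-1 <= r / (s ^+ 2 + r ^+ 2).
  move=> sr; have s2 : s ^+ 2 <= r ^+ 2 by rewrite -real_normK ?num_real// ler_pXn2r// nnegrE ltW.
  have r2 : 0 < r ^+ 2 by rewrite exprn_gt0.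
  rewrite ler_pdivlMr; last by rewrite ltr_wpDl// sqr_ge0.
  rewrite mulrC ler_pdivrMr; last by rewrite mulr_gt0.
  nra.
have len x : x + r - (x - r) = 2 * r by ring.
have two : (2 * r)^-1 * (2 * r) = 1 by rewrite mulVf// mulf_neq0// gt_eqF.
have N (z : C) : complex.Im (- z) = - complex.Im z by case: z.
have cN (h : R -> C) a b : ccont h a b -> ccont (fun t => -1 * h t) a b by exact: ccontZ.
have key (g : R -> C) a : ccont g (a - r) (a + r) ->
    (forall t, a - r <= t <= a + r -> (2 * r)^-1 <= complex.Im (g t)) ->
    1 <= complex.Im (cint g (a - r) (a + r)).
  move=> gc gE; have := cint_Im_ge _ gc gE; rewrite len two; apply; lra.
rewrite /sq; case: w c1 c2 c3 c4 => a b c1 c2 c3 c4; rewrite /= in c1 c2 c3 c4.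
have ab c t : c - r <= t <= c + r -> `|t - c| <= r.
  by move=> /andP[h1 h2]; rewrite ler_norml; apply/andP; split; lra.
have k1 := @key _ a c1 _; have k2 := @key _ a (cN _ _ _ c2) _.
have k4 := @key _ b (ccontZ (iC R) c4) _.
have k3 := @key _ b (ccontZ (- iC R) c3) _.
rewrite !cintZ// in k2 k3 k4.
rewrite /rect; apply: Im_sides.
- apply: k1 => t /ab ht; rewrite /hslice (ptB t _ a b) inv_pt /=.
  rewrite (_ : b - r - b = - r); last by ring.
  by rewrite mulNr opprK sqrrN; exact: est.
- apply: k2 => t /ab ht; rewrite /hslice (ptB t _ a b) inv_pt mulN1r /= opprK.
  rewrite (_ : b + r - b = r); last by ring.
  exact: est.
- apply: k4 => t /ab ht; rewrite /vslice (ptB _ t a b) inv_pt /=.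
  rewrite (_ : a + r - a = r); last by ring.
  by rewrite mul0r mul1r add0r [_ ^+ 2 + _]addrC; exact: est.
- apply: k3 => t /ab ht; rewrite /vslice (ptB _ t a b) inv_pt /=.
  rewrite (_ : a - r - a = - r); last by ring.
  by rewrite oppr0 mul0r add0r mulN1r mulNr opprK sqrrN [_ ^+ 2 + _]addrC; exact: est.
Qed.

Lemma sq_inv_nm w r : 0 < r -> 4 <= nm (sq (fun z => (z - w)^-1) w r).
Proof.
move=> r0; apply: le_trans (sq_inv_Im w r0) _.
by apply: le_trans (ler_norm _) _; exact: nm_Im.
Qed.

End Contours.

(** * Identity theorem, residues and tails of Laurent series *)

Section Uniqueness.
Variable R : realType.
Local Notation C := (Cx R).
Implicit Types (f g h : C -> C) (z w : C).

Lemma cvg_sum_lin (I : choiceType) (f g : I -> C) (a b s t : C) :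
  partial_sum f @ totally --> s -> partial_sum g @ totally --> t ->
  partial_sum (fun i => a * f i + b * g i) @ totally --> a * s + b * t.
Proof.
move=> fs gt.
rewrite (_ : partial_sum _ = fun A => a * partial_sum f A + b * partial_sum g A).
  apply: cvgD.
    by apply: cvgM; [exact: cvg_cst|exact: fs].
  by apply: cvgM; [exact: cvg_cst|exact: gt].
apply/funext => A; rewrite !partial_sumE !mulr_sumr -big_split/=.
exact: eq_bigr.
Qed.

Lemma ccont_bounded (g : R -> C) a b : a <= b -> ccont g a b ->
  exists M, forall t, a <= t <= b -> nm (g t) <= M.
Proof.
move=> ab gc; have gcn : {within `[a, b], continuous (fun t => nm (g t))}.
  apply: continuous_in_subspaceT => t; rewrite inE/= in_itv/= => tab.
  apply/cvgrPdist_lt => e e0; have [d d0 dP] := gc t tab e e0.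
  apply/nbhs_ballP; exists d => //= s ts.
  apply: le_lt_trans (dP s _); last by rewrite distrC.
  rewrite ler_norml.
  have := nmD (g s - g t) (g t); have := nmD (g t - g s) (g s).
  by rewrite !subrK (nm_dist (g t)) => h1 h2; apply/andP; split; lra.
have [c _ cP] := EVT_max ab gcn.
by exists (nm (g c)) => t tab; apply: cP; rewrite in_itv.
Qed.

Lemma ring_bounded f w r : 0 < r -> ring_diff f w r ->
  exists2 M, 0 <= M & forall x y, complex.Re w - r <= x <= complex.Re w + r ->
     complex.Im w - r <= y <= complex.Im w + r ->
     [|| x == complex.Re w - r, x == complex.Re w + r, y == complex.Im w - r |
      y == complex.Im w + r] -> nm (f (pt x y)) <= M.
Proof.
move=> r0 fd; have [c1 c2 c3 c4] := ring_diff_sides r0 fd.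
have h (x : R) : x - r <= x + r by lra.
have [M1 M1P] := ccont_bounded (h _) c1; have [M2 M2P] := ccont_bounded (h _) c2.
have [M3 M3P] := ccont_bounded (h _) c3; have [M4 M4P] := ccont_bounded (h _) c4.
exists (`|M1| + `|M2| + `|M3| + `|M4|) => [|x y hx hy]; first by rewrite !addr_ge0.
have n1 := ler_norm M1; have n2 := ler_norm M2; have n3 := ler_norm M3.
have n4 := ler_norm M4; have p1 := normr_ge0 M1; have p2 := normr_ge0 M2.
have p3 := normr_ge0 M3; have p4 := normr_ge0 M4.
case/or4P => /eqP e; [have := M3P y hy|have := M4P y hy|have := M1P x hx|have := M2P x hx];
  rewrite /vslice /hslice -e; lra.
Qed.

Lemma expr_small (q K e : R) : 0 <= q < 1 -> 0 < e -> exists n, K * q ^+ n < e.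
Proof.
move=> /andP[q0 q1] e0.
have n0 : 0 < `|K| + 1 by rewrite ltr_wpDl.
have /cvgrPdist_lt/(_ _ (divr_gt0 e0 n0)) : q ^+ n @[n --> \oo] --> (0 : R).
  by apply: cvg_expr; rewrite ger0_norm.
case=> n _ /(_ n (leqnn n)); rewrite /= sub0r normrN ger0_norm ?exprn_ge0//.
rewrite ltr_pdivlMr// => h; exists n; apply: le_lt_trans h.
rewrite mulrC ler_wpM2l ?exprn_ge0//; have := ler_norm K; lra.
Qed.

(* Cauchy's formula for [f / (z - p)^n], which is holomorphic as [f] vanishes
   near [p], bounds [f w] by a multiple of [(|w - p| / s)^n] for every [n]. *)
Lemma vanish_step f p (rho r0 : R) : 0 < rho -> 0 < r0 ->
  (forall z, nm (z - p) < rho -> cdiff f z) ->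
  (forall z, nm (z - p) < r0 -> f z = 0) ->
  forall w, nm (w - p) < rho / 3 -> f w = 0.
Proof.
move=> rho0 r00 fd f0 w wp; pose s := rho / 3.
have s0 : 0 < s by rewrite divr_gt0.
have [->|wnp] := eqVneq w p; first by apply: f0; rewrite subrr nm0.
have wp0 : 0 < nm (w - p) by rewrite nm_gt0 subr_eq0.
(* No singularity arises at [p]: near [p] the function [G n] vanishes together with [f]. *)
pose G n z := f z * (z - p) ^- n.
have Gd n z : nm (z - p) < rho -> cdiff (G n) z.
  move=> zp; have [zep|zp'] := eqVneq z p.
    apply: (@cdiff_near _ (fun=> 0) _ _ r0) => //; last exact: cdiff_cst.
    by move=> v; rewrite zep => vp; rewrite /G f0// mul0r.
  apply: cdiffM; first exact: fd.
  apply: cdiffV; first by rewrite expf_neq0// subr_eq0.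
  by apply: cdiffX; apply: cdiffB; [exact: cdiff_id|exact: cdiff_cst].
pose I := sq (fun z => (z - w)^-1) p s.
have box z : complex.Re p - s <= complex.Re z <= complex.Re p + s ->
    complex.Im p - s <= complex.Im z <= complex.Im p + s -> nm (z - p) < rho.
  case: z p {wp wp0 fd f0 wnp I G Gd} => [x y] [a b] /= /andP[h1 h2] /andP[h3 h4].
  rewrite (ptB x y a b); apply: le_lt_trans (nm_pt _ _) _.
  have : `|x - a| <= s by rewrite ler_norml; apply/andP; split; lra.
  have : `|y - b| <= s by rewrite ler_norml; apply/andP; split; lra.
  rewrite /s; lra.
have ringd n : ring_diff (G n) p s by move=> x y hx hy _; apply: Gd; apply: box.
have invd : ring_diff (fun z => (z - w)^-1) p s by apply: ring_diff_inv.
have cauchy n : sq (fun z => G n z * (z - w)^-1) p s = G n w * I.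
  have Hd : ring_diff (fun z => G n z * (z - w)^-1) p s.
    by move=> x y hx hy h; apply: cdiffM; [exact: ringd|exact: invd].
  have [a1 a2 a3 a4] := ring_diff_sides s0 Hd.
  have [b1 b2 b3 b4] := ring_diff_sides s0 invd.
  apply/eqP; rewrite -subr_eq0 /I /sq -rectZ// -rectB//; try exact: ccontZ.
  apply/eqP.
  have wr : nm (w - p) < rho by apply: lt_trans wp _; rewrite ltr_pdivrMr//; lra.
  have [A /(_ 1 ltr01)[d d0 dP]] := Gd n w wr.
  have RI : [/\ `|complex.Re (w - p)| < s & `|complex.Im (w - p)| < s].
    by split; [exact: le_lt_trans (nm_Re _) wp|exact: le_lt_trans (nm_Im _) wp].
  apply: (@rect_bounded0 _ _ w _ _ _ _ (nm A + 1) d) => //.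
  - by case: RI; rewrite ReB ltr_norml => /andP[h1 h2] _; apply/andP; split; lra.
  - by case: RI; rewrite ImB !ltr_norml => _ /andP[h1 h2]; apply/andP; split; lra.
  - move=> x y hx hy xyw; apply: cdiffB; apply: cdiffM.
    + by apply: Gd; apply: box.
    + exact: cdiff_inv.
    + exact: cdiff_cst.
    + exact: cdiff_inv.
  - move=> z zw zd; rewrite -mulrBl nmM nmV ler_pdivrMr ?nm_gt0 ?subr_eq0//.
    have -> : G n z - G n w = (G n z - G n w - A * (z - w)) + A * (z - w) by rewrite subrK.
    by apply: le_trans (nmD _ _) _; rewrite nmM mulrDl addrC lerD// dP.
have [M M0 MP] := ring_bounded s0 (ringd 0%N).
have [L L0 LP] := ring_bounded s0 invd.
(* The lower bound is available for squares centred at [w]; the square around [p] is shrunk to the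
   one of half-side s - |w - p| around [w]. *)
have I0 : 4 <= nm I.
  have := sq_inv_nm w (_ : 0 < (s - nm (w - p))); rewrite subr_gt0 => /(_ wp).
  set t := s - nm (w - p) => h.
  have t0 : 0 < t by rewrite subr_gt0.
  rewrite /I /sq (@rect_annulus _ _ _ _ _ _ (complex.Re w - t) (complex.Re w + t)
     (complex.Im w - t) (complex.Im w + t))//.
  - have := nm_Re (w - p); rewrite ReB ler_norml => /andP[h1 h2].
    by split; rewrite /t; try lra; rewrite -/t; lra.
  - have := nm_Im (w - p); rewrite ImB ler_norml => /andP[h1 h2].
    by split; rewrite /t; try lra; rewrite -/t; lra.
  - move=> x y hx hy; apply: contraNP => nd; have : pt x y = w.
      by apply: contra_notP nd => /eqP; exact: cdiff_inv.
    by move=> <- /=; rewrite !ltrBlDr !ltrDl t0.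
pose q := nm (w - p) / s.
have q01 : 0 <= q < 1.
  by rewrite divr_ge0 ?nm_ge0 ?ltW//= ltr_pdivrMr// mul1r.
apply/eqP; rewrite -nm_eq0 eq_le nm_ge0 andbT; apply/ler_addgt0Pr => e e0; rewrite add0r.
have [n nP] := expr_small (4 * (M * L * s)) q01 e0.
apply: le_trans (ltW nP).
have bd : nm (G n w * I) <= 16 * ((M * s ^- n * L) * s).
  rewrite -cauchy; apply: sq_abs => //.
    by move=> x y hx hy h; apply: cdiffM; [exact: ringd|exact: invd].
  move=> x y hx hy h; have /andP[nl _] := ring_nm s0 hx hy h.
  rewrite nmM; apply: ler_pM; rewrite ?nm_ge0//; last exact: LP.
  rewrite /G nmM nmV nmX; apply: ler_pM; rewrite ?nm_ge0 ?invr_ge0 ?exprn_ge0 ?nm_ge0//.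
    by have := MP x y hx hy h; rewrite /G expr0 invr1 mulr1.
  rewrite lef_pV2 ?posrE ?exprn_gt0 ?(lt_le_trans s0 nl)//.
  by rewrite lerXn2r ?nnegrE ?nm_ge0// ltW.
move: bd; rewrite nmM {1}/G nmM nmV nmX => bd.
have wn0 : 0 < nm (w - p) ^+ n by rewrite exprn_gt0.
have bd2 : nm (f w) / nm (w - p) ^+ n * 4 <= 16 * ((M * s ^- n * L) * s).
  by apply: le_trans bd; rewrite ler_wpM2l// divr_ge0 ?nm_ge0// ltW.
rewrite -(ler_pM2r (x := 4))// (_ : nm (f w) * 4 = (nm (f w) / nm (w - p) ^+ n * 4) * nm (w - p) ^+ n).
  apply: le_trans (ler_wpM2r (ltW wn0) bd2) _.
  have aux (X S M' L' s' : R) : S != 0 ->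
      16 * (M' / S * L' * s') * X = 4 * (M' * L' * s') * (X / S) * 4.
    by move=> S0; field.
  have S0 : s ^+ n != 0 by rewrite expf_neq0// gt_eqF.
  by rewrite /q (expr_div_n (nm (w - p)) s n) (aux _ _ _ _ _ S0).
by field; rewrite gt_eqF.
Qed.

(** Connectedness of [0, T]. Let [t0] be the infimum of the [t] such that [f] vanishes near every
    point of [t, T]; [vanish_step], applied at a point slightly above [t0], reaches below [t0]
    unless [t0] is 0. *)
Lemma vanish_on_ray f (T : R) : 0 <= T ->
  (forall t, 0 <= t <= T -> exists2 d : R, 0 < d & forall z, nm (z - rc t) < d -> cdiff f z) ->
  (exists2 d : R, 0 < d & forall z, nm (z - rc T) < d -> f z = 0) ->
  f 0 = 0.
Proof.
move=> T0 fd fT.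
pose V t := exists2 d : R, 0 < d & forall z, nm (z - rc t) < d -> f z = 0.
pose E := [set t | 0 <= t <= T /\ forall s, t <= s <= T -> V s].
have ET : E T by split=> [|s]; [rewrite T0 lexx|rewrite -eq_le => /eqP <-].
have hE : has_inf E by split; [exists T|exists 0 => t [/andP[]]].
pose t0 := inf E.
have t00 : 0 <= t0 by apply: lb_le_inf; [exists T|move=> t [/andP[]]].
have t0T : t0 <= T by apply: ge_inf => //; exists 0 => t [/andP[]].
have [r r0 rP] := fd t0 ltac:(by rewrite t00 t0T).
(* Differentiability on the disc of radius [r] around [t0] gives it on radius r/2 around a point
   [t1] at distance less than r/6, and [vanish_step] divides this radius by 3. *)
pose d := r / 6.
have d0 : 0 < d by rewrite divr_gt0.
have [t1 Et1 t1lt] := inf_adherent d0 hE.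
have t0t1 : t0 <= t1 by apply: ge_inf => //; exists 0 => t [/andP[]].
case: (Et1) => /andP[t1p t1T] t1V.
have [e e0 eP] := t1V t1 ltac:(by rewrite lexx t1T).
have key z : nm (z - rc t1) < r / 2 / 3 -> f z = 0.
  apply: (@vanish_step f (rc t1) (r / 2) e) => //; first by rewrite divr_gt0.
  move=> v vt; apply: rP.
  have -> : v - rc t0 = (v - rc t1) + rc (t1 - t0) by rewrite rcB; ring.
  apply: le_lt_trans (nmD _ _) _; rewrite nm_rc ger0_norm ?subr_ge0//.
  move: t1lt; rewrite -/t0 /d; lra.
have near s : `|s - t1| < r / 6 -> V s.
  move=> st; exists (r / 6 - `|s - t1|); first by rewrite subr_gt0.
  move=> z zs; apply: key.
  have -> : z - rc t1 = (z - rc s) + rc (s - t1) by rewrite rcB; ring.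
  apply: le_lt_trans (nmD _ _) _; rewrite nm_rc; lra.
have V0 : V 0.
  have [t0z|t0nz] := eqVneq t0 0.
    by apply: near; rewrite sub0r normrN ger0_norm//; move: t1lt; rewrite -/t0 t0z add0r.
  have t0pos : 0 < t0 by rewrite lt0r t0nz.
  (* A point strictly below [t0], truncated at 0, whose distance to [t1] is still less than [d]. *)
  pose t2 := Num.max 0 (t0 - (t0 + d - t1) / 2).
  have h2 : 0 <= t2 by rewrite /t2 le_max lexx.
  have h3 : t2 < t0.
    by rewrite /t2 gt_max t0pos /= ltrBlDr ltrDl divr_gt0// subr_gt0 -/t0.
  have h4 : t0 - (t0 + d - t1) / 2 <= t2 by rewrite /t2 le_max lexx orbT.
  suff Et2 : E t2.
    by have := ge_inf (proj2 hE) Et2; rewrite leNgt -/t0 h3.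
  split=> [|s /andP[s1 s2]]; first by rewrite h2 (le_trans (ltW h3) t0T).
  have [st1|st1] := leP t1 s; first by apply: t1V; rewrite st1.
  apply: near; rewrite ltr_norml; move: t1lt; rewrite -/t0 /d in h4 * => t1lt.
  by apply/andP; split; lra.
by have [e' e'0 e'P] := V0; apply: e'P; rewrite subrr nm0.
Qed.

(** The residues at 0 and at infinity agree: the integral of [H] over a large square is [c] times
    that of 1/z by the bound near 0, and [d] times it up to O(1/r) by the decay at infinity. The
    integral of 1/z has modulus at least 4. *)
Lemma laurent_match (H : C -> C) (c d : C) (M dl K R0 : R) :
  (forall z, z != 0 -> cdiff H z) -> 0 < dl ->
  (forall z, z != 0 -> nm z < dl -> nm (H z - c * z^-1) <= M) ->
  0 < R0 -> (forall z, R0 <= nm z -> nm (H z - d * z^-1) <= K / nm z ^+ 2) -> c = d.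
Proof.
move=> Hd dl0 Hc R00 HK; apply/eqP; rewrite -subr_eq0 -nm_eq0; apply: contraT => cd0.
have k0 : 0 < nm (c - d) by rewrite lt0r cd0 nm_ge0.
set k := nm (c - d) in k0 *.
(* With this [r] the product k r exceeds 16 |K|, against the bound 4 k r <= 16 K obtained below. *)
pose r := R0 + 16 * `|K| / k.
have r0 : 0 < r by rewrite ltr_wpDr// divr_ge0 ?mulr_ge0// ltW.
have invd : ring_diff (fun z : C => (z - 0)^-1) 0 r.
  by apply: ring_diff_inv => //; rewrite subrr nm0.
have Hrd : ring_diff H 0 r by apply: ring_diff_off.
have e1 : sq H 0 r = c * sq (fun z => (z - 0)^-1) 0 r.
  have [a1 a2 a3 a4] := ring_diff_sides r0 Hrd.
  have [b1 b2 b3 b4] := ring_diff_sides r0 invd.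
  apply/eqP; rewrite -subr_eq0 /sq -rectZ// -rectB//; try exact: ccontZ.
  apply/eqP; apply: (@rect_bounded0 _ _ 0 _ _ _ _ M dl) => //=.
  - by rewrite sub0r add0r oppr_lt0 r0.
  - by rewrite sub0r add0r oppr_lt0 r0.
  - move=> x y _ _ xy0; apply: cdiffB; first exact: Hd.
    by apply: cdiffM; [exact: cdiff_cst|exact: cdiff_inv].
  - by move=> z z0; rewrite !subr0; exact: Hc.
have : nm (sq H 0 r - d * sq (fun z => (z - 0)^-1) 0 r) <= 16 * (K / r ^+ 2 * r).
  have [a1 a2 a3 a4] := ring_diff_sides r0 Hrd.
  have [b1 b2 b3 b4] := ring_diff_sides r0 invd.
  rewrite /sq -rectZ// -rectB//; try exact: ccontZ.
  have K0 : 0 <= K.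
    have := HK (rc r); rewrite nm_rc gtr0_norm// => /(_ _)/(le_trans (nm_ge0 _)) h.
    have : 0 <= K / r ^+ 2 by apply: h; rewrite /r lerDl divr_ge0 ?mulr_ge0// ltW.
    by rewrite pmulr_lge0// invr_gt0 exprn_gt0.
  apply: sq_abs => //.
    move=> x y hx hy h; apply: cdiffB; first exact: Hrd.
    by apply: cdiffM; [exact: cdiff_cst|exact: invd].
  move=> x y hx hy h; have /andP[] := ring_nm r0 hx hy h; rewrite subr0 => h1 _.
  apply: le_trans (HK _ _) _; first by apply: le_trans h1; rewrite /r lerDl divr_ge0 ?mulr_ge0// ltW.
  rewrite ler_wpM2l// lef_pV2 ?posrE ?exprn_gt0 ?(lt_le_trans r0 h1)//.
  by rewrite lerXn2r ?nnegrE ?nm_ge0// ltW.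
rewrite e1 -mulrBl nmM -/k => h.
have h2 : k * 4 <= 16 * (K / r ^+ 2 * r).
  by apply: le_trans h; rewrite ler_wpM2l ?(ltW k0)//; exact: sq_inv_nm.
have h3 : k * 4 * r <= 16 * K.
  rewrite -(_ : 16 * (K / r ^+ 2 * r) * r = 16 * K); first by rewrite ler_wpM2r// ltW.
  by field; rewrite gt_eqF.
have h4 : k * r = k * R0 + 16 * `|K| by rewrite /r; field; rewrite gt_eqF.
have h5 := ler_norm K; have h6 := mulr_gt0 k0 R00; have h7 := normr_ge0 K.
exfalso; lra.
Qed.

Lemma ler_sum_uniq (I : choiceType) (F : I -> R) (A B : seq I) :
  uniq A -> uniq B -> {subset A <= B} -> (forall i, 0 <= F i) ->
  \sum_(i <- A) F i <= \sum_(i <- B) F i.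
Proof.
move=> uA uB AB F0.
rewrite [leRHS](bigID (mem A))/= -[X in _ <= X + _]big_filter.
have -> : \sum_(i <- [seq i <- B | i \in A]) F i = \sum_(i <- A) F i.
  apply/perm_big/uniq_perm => //; first exact: filter_uniq.
  by move=> i; rewrite mem_filter; apply/andP/idP => [[]//|iA]; split=> //; exact: AB.
by rewrite lerDl sumr_ge0.
Qed.

Lemma geometric_le (q : R) k : 0 <= q <= 1 / 2 -> \sum_(i < k) q ^+ i <= 2.
Proof.
move=> /andP[q0 q1]; suff : \sum_(i < k) q ^+ i <= 2 - 2 * q ^+ k.
  by move=> /le_trans; apply; rewrite gerBl mulr_ge0// exprn_ge0.
elim: k => [|k IH]; first by rewrite big_ord0 expr0; lra.
rewrite big_ord_recr/= exprS; have := exprn_ge0 k q0; nra.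
Qed.

Lemma fset_int_range (A : seq int) (N : int) : (forall n, n \in A -> N <= n) ->
  exists L : nat, {subset A <= [seq N + (i : nat)%:Z | i : 'I_L]}.
Proof.
move=> AN; exists (\max_(n <- A) `|n - N|%N).+1 => n nA.
have lt : (`|n - N| < (\max_(n <- A) `|n - N|%N).+1)%N.
  by rewrite ltnS (@leq_bigmax_seq _ A xpredT (fun n => `|n - N|%N) n nA).
apply/mapP; exists (Ordinal lt); rewrite ?mem_enum//=.
by have := AN n nA; lia.
Qed.

(** Boundedness of the terms at the point rho/2 bounds the coefficients by b (rho/2)^-n. For |z| <
    rho/4 the tail is then dominated by a geometric series of ratio at most 1/2, whence the factor
    2. *)
Lemma tail_bound h (c : int -> C) (n0 : int) (rho : R) : 0 < rho ->
  (forall n, n < n0 -> c n = 0) ->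
  (forall z, z != 0 -> nm z < rho ->
     partial_sum (fun n => z ^ n * c n : C) @ totally --> h z) ->
  forall k : nat, exists K : R, forall z, z != 0 -> nm z < rho / 4 ->
    nm (h z - \sum_(i < k) z ^ (n0 + i%:Z) * c (n0 + i%:Z)) <= K * nm z ^ (n0 + k%:Z).
Proof.
move=> rho0 cn0 hs k.
have rho2 : 0 < rho / 2 by rewrite divr_gt0.
have p1 : rc (rho / 2) != 0 by rewrite -nm_gt0 nm_rc gtr0_norm.
have p2 : nm (rc (rho / 2)) < rho by rewrite nm_rc gtr0_norm//; lra.
have [B B0 BP] := sum_terms_bounded (hs _ p1 p2).
pose b := complex.Re B; have BE : B = rc b by exact: rc_real (gtr0_real B0).
have b0 : 0 < b by rewrite -rc_gt0 -BE.
have nmXz z n : nm (z ^ n) = nm z ^ n.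
  by case: n => n; [exact: nmX|rewrite !NegzE -!exprnN nmV nmX].
have cb n : nm (c n) <= b / (rho / 2) ^ n.
  rewrite ler_pdivlMr ?exprz_gt0// mulrC.
  by have := BP n; rewrite BE nmE rc_le nmM nmXz nm_rc gtr0_norm.
exists (2 * (b / (rho / 2) ^ (n0 + k%:Z))) => z z0 zr.
have nz0 : 0 < nm z by rewrite nm_gt0.
pose q := nm z / (rho / 2).
have q0 : 0 < q by rewrite divr_gt0.
have q2 : q <= 1 / 2 by rewrite /q ler_pdivrMr//; lra.
have qE n : q ^ n = nm z ^ n / (rho / 2) ^ n.
  by case: n => n; rewrite /q /exprz expr_div_n// invfM.
have tb n : nm (z ^ n * c n) <= b * q ^ n.
  rewrite nmM nmXz mulrC; apply: le_trans (ler_wpM2r _ (cb n)) _.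
    by rewrite exprz_ge0// ltW.
  by rewrite qE mulrA mulrAC.
pose sh (i : 'I_k) : int := n0 + i%:Z.
pose T := [fset sh i | i in 'I_k]%fset.
have TE (F : int -> C) : \sum_(n <- T) F n = \sum_(i < k) F (n0 + i%:Z).
  rewrite big_imfset/=; first by rewrite big_enum.
  by move=> i j _ _ /addrI[] /val_inj.
have lim : partial_sum (fun n : int => if n \in T then 0 else z ^ n * c n : C) @ totally -->
    (h z - \sum_(i < k) z ^ (n0 + i%:Z) * c (n0 + i%:Z) : C).
  rewrite -(TE (fun n => z ^ n * c n)).
  have zrho : nm z < rho by apply: lt_trans zr _; lra.
  have h1 := hs z z0 zrho.
  have h2 : partial_sum (fun n : int => if n \in T then z ^ n * c n : C else 0) @ totally -->
      \sum_(n <- T) (z ^ n * c n : C).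
    rewrite (_ : \sum_(n <- T) _ = \sum_(n <- T) (if n \in T then z ^ n * c n : C else 0)).
      by apply: cvg_sum_fin => n /negbTE ->.
    by apply: eq_big_seq => n ->.
  have E : (fun n : int => 1 * (z ^ n * c n : C) + -1 * (if n \in T then z ^ n * c n : C else 0)) =
      (fun n : int => if n \in T then 0 else z ^ n * c n : C).
    by apply/funext => n; case: ifP => _; rewrite mul1r mulN1r ?subrr ?subr0.
  by rewrite -[h z]mul1r -mulN1r -E; exact: cvg_sum_lin h1 h2.
have := sum_bound lim (M := rc (2 * (b * q ^ (n0 + k%:Z)))).
rewrite nmE rc_le (_ : _ * _ * _ = 2 * (b * q ^ (n0 + k%:Z))); last first.
  by rewrite qE mulrA mulrA mulrAC -!mulrA.
apply=> A.
rewrite (eq_bigr (fun n => rc (nm (if n \in T then 0 else z ^ n * c n : C)))); last first.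
  by move=> n _; rewrite -nmE.
rewrite -(rmorph_sum (real_complex R)) lecR.
have F0 n : 0 <= b * q ^ n by rewrite mulr_ge0 ?exprz_ge0 ?ltW.
pose A' := [seq n <- A | n0 + k%:Z <= n].
apply: (@le_trans _ _ (\sum_(n <- A') b * q ^ n)).
  rewrite big_filter [leRHS]big_mkcond; apply: ler_sum => n _.
  have [nT|nT] := boolP (n \in T); first by rewrite nm0; case: ifP => // _; exact: F0.
  case: ifP => nk; first exact: tb.
  have [nn0|nn0] := ltP n n0; first by rewrite cn0// mulr0 nm0.
  case/negP: nT; apply/imfsetP => /=.
  have lt : (`|n - n0| < k)%N by move: nk nn0; clear; lia.
  by exists (Ordinal lt) => //=; rewrite /sh /=; move: nn0; clear; lia.
have [L LP] := @fset_int_range A' (n0 + k%:Z) (fun n => ltac:(by rewrite mem_filter => /andP[])).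
apply: le_trans (ler_sum_uniq _ _ LP F0) _.
- by rewrite filter_uniq.
- by rewrite map_inj_uniq ?enum_uniq// => i j /addrI[] /val_inj.
rewrite big_map big_enum/=.
under eq_bigr do rewrite expfzDr ?gt_eqF// mulrA.
rewrite -mulr_sumr mulrC ler_wpM2r//.
by apply: geometric_le; rewrite q2 ltW.
Qed.

End Uniqueness.

(** * Normally convergent families *)
Section NormalSums.
Variable R : realType.
Local Notation C := (Cx R).

(* [c q] ranges over coordinates with respect to a fixed finite family, and the
   sum over [q] of the suprema over [K] of the coordinates is finite. *)
Definition nsum (T : Type) (K : set T) (X : lmodType C) (I : choiceType)
    (b : I -> T -> X) : Prop :=
  exists d (v : 'I_d -> X) (c : I -> T -> 'rV[C]_d) (beta : I -> R) (M : R),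
    [/\ forall q x, K x -> b q x = lcomb v (c q x),
        forall q x j, K x -> nm (c q x 0 j) <= beta q,
        forall q, 0 <= beta q &
        forall A : {fset I}, \sum_(q <- A) beta q <= M].

Lemma lin_sum (X Y : lmodType C) (g : X -> Y) : linear g ->
  forall (J : Type) (s : seq J) (c : J -> C) (v : J -> X),
  g (\sum_(j <- s) c j *: v j) = \sum_(j <- s) c j *: g (v j).
Proof.
move=> gl J s c v; elim: s => [|j s IH]; last by rewrite !big_cons gl IH.
by rewrite !big_nil; have := gl (-1) 0 0; rewrite !scaleN1r !addNr.
Qed.

Section Theory.
Variables (T : Type) (K : set T) (X : lmodType C).

Lemma nsum_ext (I : choiceType) (b b' : I -> T -> X) :
  (forall q x, K x -> b q x = b' q x) -> nsum K b -> nsum K b'.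
Proof.
move=> bb [d [v [c [be [M [h1 h2 h3 h4]]]]]]; exists d, v, c, be, M; split=> //.
by move=> q x Kx; rewrite -bb// h1.
Qed.

Lemma nsum_bij (I J : choiceType) (h : I -> J) (b : J -> T -> X) :
  injective h -> nsum K b -> nsum K (b \o h).
Proof.
move=> hi [d [v [c [be [M [h1 h2 h3 h4]]]]]].
exists d, v, (c \o h), (be \o h), M; split=> [q x|q x j|q|A].
- exact: h1.
- exact: h2.
- exact: h3.
have := h4 (h @` A)%fset; rewrite big_imfset//= => i j _ _; exact: hi.
Qed.

(** The relation is solved by the geometric series of terms x^-1 (y/x)^k b'(sh^k q), which is finite
    at each index because [b] vanishes far along [sh]. Summability of [b'] thus passes to [b], at
    the cost of a factor r / (1 - th). *)
Lemma nsum_peel (I : choiceType) (sh : I -> I) (b b' : I -> T -> X) (x y : T -> C) (r th : R) :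
  injective sh -> nsum K b' ->
  (forall t, K t -> [/\ x t != 0, nm (x t)^-1 <= r & nm (y t / x t) <= th]) ->
  0 <= th < 1 ->
  (forall q t, K t -> x t *: b q t - y t *: b (sh q) t = b' q t) ->
  (forall q, exists k0, forall k t, (k0 <= k)%N -> K t -> b (iter k sh q) t = 0) ->
  nsum K b.
Proof.
move=> shi [d [v [c [be [M [h1 h2 h3 h4]]]]]] xy /andP[th0 th1] rel van.
have [ka kaP] := choice van.
have [[t0 Kt0]|nK] := pselect (exists t, K t); last first.
  exists 0%N, (fun=> 0), (fun _ _ => 0), (fun=> 0), 0; split=> //.
  - by move=> q t Kt; case: nK; exists t.
  - by move=> q t j Kt; case: nK; exists t.
  - by move=> A; rewrite big1.
have r0 : 0 <= r by have [_ + _] := xy _ Kt0; apply: le_trans; exact: nm_ge0.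
have it q t n : K t -> b q t = \sum_(k < n) ((x t)^-1 * (y t / x t) ^+ k) *: b' (iter k sh q) t
    + (y t / x t) ^+ n *: b (iter n sh q) t.
  move=> Kt; have [x0 _ _] := xy t Kt.
  have rel' q' : b q' t = (x t)^-1 *: b' q' t + (y t / x t) *: b (sh q') t.
    by rewrite -rel// scalerBr !scalerA mulVf// scale1r [_^-1 * _]mulrC subrK.
  elim: n => [|n IH]; first by rewrite big_ord0 expr0 scale1r add0r.
  rewrite IH big_ord_recr/= -addrA; congr (_ + _).
  by rewrite [in LHS]rel' scalerDr !scalerA -exprSr [_ * (x t)^-1]mulrC.
exists d, v, (fun q t => \sum_(k < ka q) ((x t)^-1 * (y t / x t) ^+ k) *: c (iter k sh q) t),
  (fun q => \sum_(k < ka q) r * th ^+ k * be (iter k sh q)), (r * (M / (1 - th))).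
have bt q : 0 <= \sum_(k < ka q) r * th ^+ k * be (iter k sh q).
  by apply: sumr_ge0 => k _; rewrite !mulr_ge0// exprn_ge0.
split=> // [q t Kt|q t j Kt|A].
- rewrite (it q t (ka q))// kaP// scaler0 addr0.
  rewrite (big_morph (lcomb v) (lcombD v) (lcomb0 v)); apply: eq_bigr => k _.
  by rewrite lcombZ -h1.
- rewrite summxE; have nmS (n : nat) (F : 'I_n -> C) : nm (\sum_(k < n) F k) <= \sum_(k < n) nm (F k).
    elim/big_ind2 : _ => // [|a b1 a' b2 ab ab']; first by rewrite nm0.
    by apply: le_trans (nmD _ _) _; exact: lerD.
  apply: le_trans (nmS _ _) _; apply: ler_sum => k _; rewrite mxE !nmM nmX.
  have [x0 xr yth] := xy t Kt.
  apply: ler_pM; rewrite ?nm_ge0// ?mulr_ge0 ?exprn_ge0 ?nm_ge0//; last exact: h2.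
  apply: ler_pM; rewrite ?nm_ge0 ?exprn_ge0 ?nm_ge0//.
  by rewrite lerXn2r ?nnegrE ?nm_ge0.
pose L := \max_(q <- A) ka q.
have M0 : 0 <= M by have := h4 fset0; rewrite big_seq_fset0.
apply: (@le_trans _ _ (\sum_(q <- A) \sum_(k < L) r * th ^+ k * be (iter k sh q))).
  rewrite big_seq [leRHS]big_seq; apply: ler_sum => q qA.
  have qL : (ka q <= L)%N by exact: (@leq_bigmax_seq _ _ xpredT ka q qA).
  rewrite (big_ord_widen L (fun k => r * th ^+ k * be (iter k sh q)) qL).
  rewrite big_mkcond/=; apply: ler_sum => k _; case: ifP => // _.
  by rewrite !mulr_ge0// exprn_ge0.
(* After the exchange, each power of [sh] is injective, so the sum of the k-th shifted bounds is
   again at most [M]. *)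
rewrite exchange_big/=.
apply: (@le_trans _ _ (\sum_(k < L) r * th ^+ k * M)).
  apply: ler_sum => k _; rewrite -mulr_sumr ler_wpM2l ?mulr_ge0 ?exprn_ge0//.
  have := h4 (iter k sh @` A)%fset; rewrite big_imfset//= => i j _ _.
  by elim: (nat_of_ord k) => // n IH /shi /IH.
rewrite -mulr_suml -mulr_sumr -mulrA ler_wpM2l// mulrC ler_wpM2l//.
have d0 : 0 < 1 - th by rewrite subr_gt0.
rewrite -[leRHS]mul1r ler_pdivlMr//.
have -> : (\sum_(i < L) th ^+ i) * (1 - th) = 1 - th ^+ L.
  by rewrite -{2}(expr1n _ L) subrXX mulrC; congr (_ * _); apply: eq_bigr => i _; rewrite expr1n mul1r.
by rewrite gerBl exprn_ge0.
Qed.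

Lemma nsum_has_sum (I : choiceType) (b : I -> T -> X) x : K x -> nsum K b ->
  exists s, has_sum (fun q => b q x) s.
Proof.
move=> Kx [d [v [c [be [M [h1 h2 h3 h4]]]]]].
have /choice[t tP] : forall j, exists t : C, partial_sum (fun q => c q x 0 j) @ totally --> t.
  move=> j; apply: (@csum_cvg _ _ _ (rc M)) => A.
  apply: (@le_trans _ _ (\sum_(q <- A) rc (be q))).
    by apply: ler_sum => q _; rewrite nmE rc_le h2.
  by rewrite -(rmorph_sum (real_complex R)) rc_le.
exists (lcomb v (\row_j t j)).
apply: (@has_sum_family _ _ _ _ _ _ v (fun q => c q x) (\row_j t j)) => //.
  by move=> q; exact: h1.
apply: cvg_row => j; rewrite mxE.
rewrite (_ : (fun A => _) = partial_sum (fun q => c q x 0 j)); first exact: tP.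
by apply/funext => A; rewrite !partial_sumE summxE.
Qed.

Lemma lcomb_row d d' (v : 'I_d -> X) (v' : 'I_d' -> X) c c' :
  lcomb (fun j => match fintype.split j with inl i => v i | inr i => v' i end) (row_mx c c') =
  lcomb v c + lcomb v' c'.
Proof.
rewrite /lcomb big_split_ord/=; congr (_ + _); apply: eq_bigr => j _.
  by rewrite row_mxEl (unsplitK (inl j)).
by rewrite row_mxEr (unsplitK (inr j)).
Qed.

Lemma nsum_add (I : choiceType) (b b' : I -> T -> X) :
  nsum K b -> nsum K b' -> nsum K (fun q x => b q x + b' q x).
Proof.
move=> [d [v [c [be [M [h1 h2 h3 h4]]]]]] [d' [v' [c' [be' [M' [h1' h2' h3' h4']]]]]].
exists (d + d')%N, (fun j => match fintype.split j with inl i => v i | inr i => v' i end),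
  (fun q x => row_mx (c q x) (c' q x)), (fun q => be q + be' q), (M + M').
split=> [q x Kx|q x j Kx|q|A].
- by rewrite lcomb_row h1// h1'.
- rewrite mxE; case: (fintype.split j) => i.
    by apply: le_trans (h2 _ _ _ Kx) _; rewrite lerDl.
  by apply: le_trans (h2' _ _ _ Kx) _; rewrite lerDr.
- by rewrite addr_ge0.
- by rewrite big_split lerD.
Qed.

Lemma nsum_scale (I : choiceType) (b : I -> T -> X) (g : T -> C) (r : R) :
  (forall x, K x -> nm (g x) <= r) -> nsum K b -> nsum K (fun q x => g x *: b q x).
Proof.
move=> gr [d [v [c [be [M [h1 h2 h3 h4]]]]]].
exists d, v, (fun q x => g x *: c q x), (fun q => `|r| * be q), (`|r| * M).
split=> [q x Kx|q x j Kx|q|A].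
- by rewrite lcombZ h1.
- rewrite mxE nmM; apply: ler_pM; rewrite ?nm_ge0 ?h2//.
  exact: le_trans (gr _ Kx) (ler_norm _).
- by rewrite mulr_ge0.
- by rewrite -mulr_sumr ler_wpM2l.
Qed.

Lemma nsum0 (I : choiceType) : nsum K (fun (q : I) (x : T) => 0 : X).
Proof.
exists 0%N, (fun=> 0), (fun _ _ => 0), (fun=> 0), 0; split=> //.
- by move=> q x _; rewrite lcomb0.
- by move=> q x [].
- by move=> A; rewrite big1.
Qed.

Lemma nsum_sum (I : choiceType) (J : Type) (s : seq J) (b : J -> I -> T -> X) :
  (forall j, nsum K (b j)) -> nsum K (fun q x => \sum_(j <- s) b j q x).
Proof.
move=> bj; elim: s => [|j s IH].
  by apply: nsum_ext (@nsum0 I) => q x _; rewrite big_nil.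
apply: nsum_ext (nsum_add (bj j) IH) => q x _; by rewrite big_cons.
Qed.

Definition bounded_span (f : T -> X) := exists d (v : 'I_d -> X) (c : T -> 'rV[C]_d) (M : R),
  (forall x, K x -> f x = lcomb v (c x)) /\ (forall x j, K x -> nm (c x 0 j) <= M).

Lemma nsum_fin (I : choiceType) (b : I -> T -> X) (A : {fset I}) :
  (forall q x, K x -> q \notin A -> b q x = 0) ->
  (forall q, q \in A -> bounded_span (b q)) -> nsum K b.
Proof.
move=> bA bs.
suff : nsum K (fun q x => \sum_(q0 <- A) if (q == q0) && (q0 \in A) then b q x else 0).
  apply: nsum_ext => q x Kx; have [qA|qA] := boolP (q \in A).
    rewrite (big_fsetD1 q qA)/= eqxx qA/= big1_fset ?addr0// => i.
    by rewrite !inE eq_sym => /andP[/negbTE->].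
  by rewrite big1 ?bA// => i _; case: ifP => // _; rewrite bA.
apply: nsum_sum => q0; have [q0A|q0A] := boolP (q0 \in A); last first.
  by apply: nsum_ext (@nsum0 I) => q x _; rewrite andbF.
have [d [v [c [M [h1 h2]]]]] := bs _ q0A.
exists d, v, (fun q x => if q == q0 then c x else 0), (fun q => if q == q0 then `|M| else 0), `|M|.
split=> [q x Kx|q x j Kx|q|B].
- by rewrite andbT; case: eqP => [->|_]; [exact: h1|rewrite lcomb0].
- by case: ifP => _; [apply: le_trans (h2 x j Kx) (ler_norm _)|rewrite mxE nm0].
- by case: ifP.
- have [q0B|q0B] := boolP (q0 \in B).
    by rewrite (big_fsetD1 q0 q0B)/= eqxx big1_fset ?addr0// => i; rewrite !inE => /andP[/negbTE->].
  by rewrite big1_fset// => i iB _; case: eqP => // e; move: q0B; rewrite -e iB.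
Qed.

Lemma bigcup_sum (I J : choiceType) (Q : J -> {fset I}) (deg : I -> J) (W : zmodType)
    (F : I -> W) (A : seq J) : uniq A ->
  (forall k q, q \in Q k -> deg q = k) ->
  \sum_(k <- A) \sum_(q <- Q k) F q = \sum_(q <- (\bigcup_(k <- A) Q k)%fset) F q.
Proof.
move=> uA Qd; elim: A uA => [_|k A IH /= /andP[kA uA]].
  have -> : (\bigcup_(k <- [::]) Q k)%fset = fset0 by rewrite big_nil.
  by rewrite !big_nil.
rewrite !big_cons IH//.
have E : perm_eq (enum_fset (Q k `|` \bigcup_(k <- A) Q k)%fset)
    (enum_fset (Q k) ++ enum_fset (\bigcup_(k <- A) Q k)%fset).
  apply: uniq_perm; first exact: fset_uniq.
    rewrite cat_uniq !fset_uniq/= andbT; apply/hasPn => q /bigfcupP[k' /andP[k'A _] qk'].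
    by apply/negP => /= qk; move: kA; rewrite -(Qd _ _ qk) (Qd _ _ qk') k'A.
  by move=> q; rewrite inE mem_cat.
by rewrite (perm_big _ E) big_cat.
Qed.

(** The function [deg] makes the blocks [Q k] pairwise disjoint, so a bound for all finite sums over
    [I] also bounds the finite sums of blocks. *)
Lemma nsum_group (I J : choiceType) (b : I -> T -> X) (Q : J -> {fset I}) (deg : I -> J) :
  (forall k q, q \in Q k -> deg q = k) -> nsum K b ->
  nsum K (fun k x => \sum_(q <- Q k) b q x).
Proof.
move=> Qd [d [v [c [be [M [h1 h2 h3 h4]]]]]].
exists d, v, (fun k x => \sum_(q <- Q k) c q x), (fun k => \sum_(q <- Q k) be q), M.
split=> [k x Kx|k x j Kx|k|A].
- rewrite (big_morph (lcomb v) (lcombD v) (lcomb0 v)); apply: eq_bigr => q _; exact: h1.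
- rewrite summxE; elim: (enum_fset (Q k)) => [|q s IH]; first by rewrite !big_nil nm0.
  by rewrite !big_cons; apply: le_trans (nmD _ _) _; apply: lerD => //; exact: h2.
- by apply: sumr_ge0.
by rewrite (bigcup_sum _ (fset_uniq A) Qd).
Qed.

Lemma csum_group (I J : choiceType) (f : I -> C) (s : C) (Q : J -> {fset I}) (deg : I -> J) :
  (forall k q, q \in Q k -> deg q = k) -> (forall q, q \notin Q (deg q) -> f q = 0) ->
  partial_sum f @ totally --> s ->
  partial_sum (fun k => \sum_(q <- Q k) f q) @ totally --> s.
Proof.
move=> Qd f0 fs P /fs [B0 _ BP]; exists (deg @` B0)%fset => // A /= BA.
rewrite /= partial_sumE (bigcup_sum _ (fset_uniq A) Qd).
suff -> : \sum_(q <- (\bigcup_(k <- A) Q k)%fset) f q =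
    partial_sum f (B0 `|` \bigcup_(k <- A) Q k)%fset.
  by apply: BP; rewrite /= fsubsetUl.
rewrite partial_sumE; apply: big_fset_incl; first exact: fsubsetUr.
move=> q; rewrite inE => /orP[qB|->//] qn; apply: f0; apply: contraNN qn => qQ.
apply/bigfcupP; exists (deg q) => //; rewrite andbT.
by apply: (fsubsetP BA); apply/imfsetP; exists q.
Qed.

End Theory.

Lemma nsum_lin (T : Type) (K : set T) (X Y : lmodType C) (g : X -> Y) (I : choiceType)
    (b : I -> T -> X) : linear g -> nsum K b -> nsum K (fun q x => g (b q x)).
Proof.
move=> gl [d [v [c [be [M [h1 h2 h3 h4]]]]]]; exists d, (g \o v), c, be, M; split=> //.
move=> q x Kx; rewrite h1//.
by rewrite /lcomb (lin_sum gl).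
Qed.

Lemma has_sum_group (X : lmodType C) (I J : choiceType) (f : I -> X) (s s' : X)
    (Q : J -> {fset I}) (deg : I -> J) :
  (forall k q, q \in Q k -> deg q = k) -> (forall q, q \notin Q (deg q) -> f q = 0) ->
  has_sum f s -> has_sum (fun k => \sum_(q <- Q k) f q) s' -> s' = s.
Proof.
move=> Qd f0 fs fs'; apply: functional_ext => phi.
apply: (@cvg_sum_uniq _ _ (phi \o (fun k => \sum_(q <- Q k) f q)) (phi s') (phi s)).
  exact: has_sum_functional.
rewrite (_ : _ \o _ = fun k => \sum_(q <- Q k) (phi \o f) q); last first.
  by apply/funext => k /=; rewrite linear_sum.
apply: (@csum_group _ _ (phi \o f) (phi s : C) Q deg Qd); last exact: has_sum_functional.
by move=> q qn; rewrite /= f0// linear0.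
Qed.

(** An unordered sum is unchanged by the bijection [sh], so the relation can be summed term by
    term. *)
Lemma has_sum_peel (X : lmodType C) (I : choiceType) (b b' : I -> X) (sh sh' : I -> I)
    (x y : C) (s s' : X) : cancel sh sh' -> cancel sh' sh ->
  (forall q, x *: b q - y *: b (sh q) = b' q) -> has_sum b s -> has_sum b' s' ->
  (x - y) *: s = s'.
Proof.
move=> sK sK' rel bs bs'; apply: functional_ext => phi.
apply: (@cvg_sum_uniq _ _ (phi \o b') (phi ((x - y) *: s)) (phi s')); last exact: has_sum_functional.
rewrite (_ : _ \o _ = fun q => x * (phi \o b) q + (- y) * ((phi \o b) \o sh) q); last first.
  apply/funext => q; rewrite /= -rel linearB/= !linearZ/=.
  by rewrite [_ *: - _]mulrN [in RHS]mulNr.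
have -> : phi ((x - y) *: s) = x * phi s + - y * phi s by rewrite linearZ/= [LHS]mulrDl.
apply: cvg_sum_lin; first exact: has_sum_functional.
by apply: cvg_sum_bij sK sK' _; exact: has_sum_functional.
Qed.

Lemma mx_norm_le d (c : 'rV[C]_d) (r : R) : 0 <= r ->
  (forall j, nm (c 0 j) <= r) -> complex.Re (`|c| : C) <= r.
Proof.
move=> r0 cr; rewrite -rc_le -rc_real ?normr_real//.
have [c0|c0] := eqVneq (mx_norm c) 0; first by rewrite (_ : `|c| = mx_norm c)// c0 rc_ge0.
have [[i j] cE] := mx_norm_neq0 c0.
by rewrite (_ : `|c| = mx_norm c)// cE nmE rc_le /= ord1.
Qed.

Lemma nsum_normal (E : normedModType C) (K : set E) (X : lmodType C) (I : choiceType)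
    (b : I -> E -> X) : nsum K b ->
  exists d (e : 'I_d -> X) (c : I -> E -> 'rV[C]_d),
      [/\ lin_indep e,
          forall i x, K x -> b i x = lcomb e (c i x) &
          (\esum_(i in [set: I])
             ereal_sup [set (complex.Re (`|c i x| : C))%:E | x in K] < +oo)%E].
Proof.
move=> [d [v [c [be [M [h1 h2 h3 h4]]]]]].
have [d' [e [B [ie vB]]]] := basis_of_family v.
exists d', e, (fun q x => c q x *m B); split=> [//|q x Kx|]; first by rewrite h1.
pose k := \sum_(j < d) \sum_(i < d') nm (B j i).
have k0 : 0 <= k by rewrite !sumr_ge0// => j _; rewrite sumr_ge0// => i _; exact: nm_ge0.
apply: (@le_lt_trans _ _ (k * M)%:E); last exact: ltry.
apply: ub_ereal_sup => _ [A [finA _] <-].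
rewrite fsbig_finite//=.
apply: (@le_trans _ _ (\sum_(i <- fset_set A) (k * be i)%:E)%E).
  apply: lee_sum => q _; apply: ub_ereal_sup => _ [x Kx <-]; rewrite lee_fin.
  apply: mx_norm_le => [|j]; first by rewrite mulr_ge0.
  rewrite mxE; apply: (@le_trans _ _ (\sum_(i < d) nm (c q x 0 i * B i j))).
    elim/big_ind2 : _ => [|a a' a1 a1' l1 l2|//]; first by rewrite nm0.
    by apply: le_trans (nmD _ _) _; exact: lerD.
  rewrite /k mulr_suml; apply: ler_sum => i _; rewrite nmM mulrC ler_pM ?nm_ge0//; last exact: h2.
  by rewrite (bigD1 j)//= lerDl sumr_ge0// => i' _; exact: nm_ge0.
by rewrite sumEFin lee_fin -mulr_sumr ler_wpM2l.
Qed.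

(** One family of vectors and scalar coordinates for the whole of [U], where [holomorphic] only asks
    for this locally. Correlation functions have this form in each degree, and it is stable under
    composition and linear operations. *)
Definition fhol (E : normedModType C) (U : set E) (X : lmodType C) (f : E -> X) : Prop :=
  exists d (v : 'I_d -> X) (c : 'I_d -> E -> C),
    (forall x, U x -> f x = \sum_(j < d) c j x *: v j) /\
    forall j x, U x -> differentiable (c j : E -> C^o) x.

Section Fhol.
Variables (E : normedModType C) (U : set E).

Lemma fhol_holomorphic (X : lmodType C) (f : E -> X) : open U -> fhol U f -> holomorphic U f.
Proof.
move=> oU [d [v [c [fc cd]]]] p Up; exists U; split=> //.
have [d' [e [B [ie vB]]]] := basis_of_family v.
exists d', e, (fun x => \sum_(j < d) c j x *: row j B); split=> // x Ux.
  rewrite fc// -[RHS](_ : lcomb e ((\row_j c j x) *m B) = _); last first.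
    by congr lcomb; rewrite mulmx_sum_row; apply: eq_bigr => j _; rewrite mxE.
  by rewrite -vB /lcomb; apply: eq_bigr => j _; rewrite mxE.
rewrite (_ : (fun x => _) = \sum_(j < d) (fun x => c j x *: row j B)); last first.
  by apply/funext => y; rewrite fct_sumE.
by apply: differentiable_sum => j; apply: differentiableZl; exact: cd.
Qed.

Lemma fhol_ext (X : lmodType C) (f g : E -> X) : (forall x, U x -> f x = g x) ->
  fhol U f -> fhol U g.
Proof.
by move=> fg [d [v [c [fc cd]]]]; exists d, v, c; split=> // x Ux; rewrite -fg// fc.
Qed.

Lemma fhol0 (X : lmodType C) : fhol U (fun=> 0 : X).
Proof. by exists 0%N, (fun=> 0), (fun _ _ => 0); split=> [x _|[]//]; rewrite big_ord0. Qed.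

Lemma fhol1 (X : lmodType C) (g : E -> C) (v : X) :
  (forall x, U x -> differentiable (g : E -> C^o) x) -> fhol U (fun x => g x *: v).
Proof.
by move=> gd; exists 1%N, (fun=> v), (fun=> g); split=> // x _; rewrite big_ord1.
Qed.

Lemma fholD (X : lmodType C) (f g : E -> X) : fhol U f -> fhol U g ->
  fhol U (fun x => f x + g x).
Proof.
move=> [d [v [c [fc cd]]]] [d' [v' [c' [fc' cd']]]].
exists (d + d')%N, (fun j => match fintype.split j with inl i => v i | inr i => v' i end),
  (fun j => match fintype.split j with inl i => c i | inr i => c' i end); split=> [x Ux|j x Ux].
  rewrite big_split_ord fc// fc'//; congr (_ + _); apply: eq_bigr => j _.
    by rewrite (unsplitK (inl j)).
  by rewrite (unsplitK (inr j)).
by case: (fintype.split j) => i; [exact: cd|exact: cd'].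
Qed.

Lemma fhol_sum (X : lmodType C) (J : Type) (s : seq J) (f : J -> E -> X) :
  (forall j, fhol U (f j)) -> fhol U (fun x => \sum_(j <- s) f j x).
Proof.
move=> fj; elim: s => [|j s IH].
  by apply: fhol_ext (@fhol0 X) => x _; rewrite big_nil.
by apply: fhol_ext (fholD (fj j) IH) => x _; rewrite big_cons.
Qed.

Lemma fholZ (X : lmodType C) (g : E -> C) (f : E -> X) :
  (forall x, U x -> differentiable (g : E -> C^o) x) -> fhol U f ->
  fhol U (fun x => g x *: f x).
Proof.
move=> gd [d [v [c [fc cd]]]]; exists d, v, (fun j x => g x * c j x); split=> [x Ux|j x Ux].
  by rewrite fc// scaler_sumr; apply: eq_bigr => j _; rewrite scalerA.
by apply: differentiableM; [exact: gd|exact: cd].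
Qed.

End Fhol.

Lemma fhol_comp (E E' : normedModType C) (U : set E) (U' : set E') (h : E' -> E)
    (X : lmodType C) (f : E -> X) : (forall x, U' x -> U (h x)) ->
  (forall x, U' x -> differentiable h x) -> fhol U f -> fhol U' (fun x => f (h x)).
Proof.
move=> hU hd [d [v [c [fc cd]]]]; exists d, v, (fun j x => c j (h x)).
split=> [x U'x|j x U'x]; first by rewrite fc//; exact: hU.
by apply: differentiable_comp; [exact: hd|apply: cd; exact: hU].
Qed.

Lemma compact_nm_bounded (E : normedModType C) (K : set E) (g : E -> C) : compact K ->
  (forall x, K x -> {for x, continuous (g : E -> C^o)}) ->
  exists M : R, forall x, K x -> nm (g x) <= M.
Proof.
move=> cK gc; have [[x0 Kx0]|nK] := pselect (exists x, K x); last first.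
  by exists 0 => x Kx; case: nK; exists x.
have [||c _ cP] := @compact_EVT_max E R (fun x => nm (g x)) K _ cK.
- by exists x0.
- apply: continuous_in_subspaceT => x; rewrite inE => Kx.
  apply/cvgrPdist_lt => e e0.
  have /cvgrPdist_lt/(_ (rc e)) := gc x Kx; rewrite rc_gt0 => /(_ e0).
  apply: filterS => y; rewrite nmE rc_lt; apply: le_lt_trans.
  rewrite ler_norml; have := nmD (g x - g y) (g y); have := nmD (g y - g x) (g x).
  by rewrite !subrK (nm_dist (g y)) => h1 h2; apply/andP; split; lra.
by exists (nm (g c)) => x Kx; apply: cP; rewrite inE.
Qed.

Lemma fhol_bounded_span (E : normedModType C) (U K : set E) (X : lmodType C) (f : E -> X) :
  compact K -> K `<=` U -> fhol U f -> bounded_span K f.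
Proof.
move=> cK KU [d [v [c [fc cd]]]].
have /choice[m mP] : forall j, exists M : R, forall x, K x -> nm (c j x) <= M.
  move=> j; apply: compact_nm_bounded => // x /KU Ux.
  exact: differentiable_continuous (cd j x Ux).
exists d, v, (fun x => \row_j c j x), (\sum_(j < d) `|m j|); split=> [x Kx|x j Kx].
  by rewrite (fc x (KU x Kx)) /lcomb; apply: eq_bigr => j _; rewrite mxE.
rewrite mxE; apply: le_trans (mP j x Kx) _; apply: le_trans (ler_norm _) _.
by rewrite (bigD1 j)//= lerDl sumr_ge0.
Qed.

End NormalSums.

(** * Formal series and their rational values *)
Section LatticeFamilies.
Variable R : realType.
Local Notation C := (Cx R).

Section Fixed.
Variable m : nat.
Local Notation I := 'rV[int]_m.

Definition unit_row (i : 'I_m) : I := delta_mx 0 i.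

Lemma unit_rowE i j : unit_row i 0 j = (j == i)%:R.
Proof. by rewrite mxE eqxx. Qed.

(* If [z 0 i = 0], a factor with [n 0 i < 0] is [0], as [0^-1 = 0]. *)
Definition monom (z : 'rV[C]_m) (n : I) : C := \prod_(i < m) z 0 i ^ n 0 i.

Definition lform (al z : 'rV[C]_m) : C := \sum_(i < m) al 0 i * z 0 i.

Section Ops.
Variable X : lmodType C.
Implicit Types (f g : I -> X) (al : 'rV[C]_m) (t : seq 'rV[C]_m).

(* [f] is a formal series [\sum_n f n x^n]; [Lop al f] is its product with the
   linear form [\sum_i al_i x_i]. *)
Definition Lop al f : I -> X := fun n => \sum_(i < m) al 0 i *: f (n - unit_row i).

Definition Lops t f : I -> X := foldl (fun g al => Lop al g) f t.

Lemma LopC al be f : Lop al (Lop be f) = Lop be (Lop al f).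
Proof.
apply/funext => n; rewrite /Lop.
under eq_bigr => i _ do rewrite scaler_sumr.
rewrite exchange_big/=; apply: eq_bigr => j _; rewrite scaler_sumr; apply: eq_bigr => i _.
by rewrite !scalerA mulrC -!addrA [- _ - _]addrC.
Qed.

Lemma Lops_Lop t al f : Lops t (Lop al f) = Lop al (Lops t f).
Proof. by elim: t f => [//|be t IH] f /=; rewrite LopC IH. Qed.

Lemma Lops_cat t t' f : Lops (t ++ t') f = Lops t' (Lops t f).
Proof. by rewrite /Lops foldl_cat. Qed.

Lemma LopsC t t' f : Lops t (Lops t' f) = Lops t' (Lops t f).
Proof. by elim: t' f => [//|al t' IH] f /=; rewrite IH Lops_Lop. Qed.

Lemma Lop_lc al (c : C) f g :
  Lop al (fun n => c *: f n + g n) = fun n => c *: Lop al f n + Lop al g n.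
Proof.
apply/funext => n; rewrite /Lop scaler_sumr -big_split/=; apply: eq_bigr => i _.
by rewrite scalerDr !scalerA mulrC.
Qed.

Lemma Lops_lc t (c : C) f g :
  Lops t (fun n => c *: f n + g n) = fun n => c *: Lops t f n + Lops t g n.
Proof. by elim: t f g => [//|al t IH] f g /=; rewrite Lop_lc IH. Qed.

Lemma Lops0 t : Lops t (fun=> 0 : X) = fun=> 0.
Proof.
elim: t => [//|al t IH] /=; rewrite -[RHS]IH; congr (Lops _ _); apply/funext => n.
by rewrite /Lop big1// => i _; rewrite scaler0.
Qed.

Lemma Lops_sub t f g : Lops t (fun n => f n - g n) = fun n => Lops t f n - Lops t g n.
Proof.
rewrite (_ : (fun n => f n - g n) = fun n => (-1) *: g n + f n).
  by rewrite Lops_lc; apply/funext => n; rewrite scaleN1r addrC.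
by apply/funext => n; rewrite scaleN1r addrC.
Qed.

Definition zero_below (i : 'I_m) f := forall n : I, n 0 i < 0 -> f n = 0.

Lemma zero_below_Lop i al f : zero_below i f -> zero_below i (Lop al f).
Proof.
move=> f0 n ni; rewrite /Lop big1// => j _; rewrite f0 ?scaler0//.
by rewrite !mxE; case: eqP => _ /=; lia.
Qed.

Lemma zero_below_Lops i t f : zero_below i f -> zero_below i (Lops t f).
Proof. by elim: t f => [//|al t IH] f f0; apply: IH; exact: zero_below_Lop. Qed.

Definition fin_fam f := exists A : {fset I}, forall n, n \notin A -> f n = 0.

(** The series that are polynomials. Excluding negative exponents makes evaluation compatible with
    multiplication by the variables even where a coordinate is 0. *)
Definition poly_fam f := fin_fam f /\ forall i, zero_below i f.

Lemma fin_fam_shift f d : fin_fam f -> fin_fam (fun n => f (n - d)).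
Proof.
move=> [A fA]; exists [fset (n + d)%R | n in A]%fset => n nA; apply: fA.
by apply: contraNN nA => nA; apply/imfsetP; exists (n - d) => //; rewrite subrK.
Qed.

Lemma fin_fam_sum (J : Type) (s : seq J) (c : J -> C) (f : J -> I -> X) :
  (forall j, fin_fam (f j)) -> fin_fam (fun n => \sum_(j <- s) c j *: f j n).
Proof.
move=> ff; elim: s => [|j s [A IH]]; first by exists fset0 => n _; rewrite big_nil.
have [B fB] := ff j; exists (A `|` B)%fset => n; rewrite inE negb_or => /andP[nA nB].
by rewrite big_cons IH// addr0 fB// scaler0.
Qed.

Lemma fin_fam_Lop al f : fin_fam f -> fin_fam (Lop al f).
Proof. by move=> ff; apply: fin_fam_sum => i; exact: fin_fam_shift. Qed.

Lemma poly_fam_Lop al f : poly_fam f -> poly_fam (Lop al f).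
Proof. by move=> [ff f0]; split=> [|i]; [exact: fin_fam_Lop|exact: zero_below_Lop]. Qed.

Lemma poly_fam_Lops t f : poly_fam f -> poly_fam (Lops t f).
Proof. by elim: t f => [//|al t IH] f pf; apply: IH; exact: poly_fam_Lop. Qed.

Lemma poly_fam_lc (c : C) f g : poly_fam f -> poly_fam g -> poly_fam (fun n => c *: f n + g n).
Proof.
move=> [[A fA] f0] [[B gB] g0]; split=> [|i n ni]; last by rewrite (f0 i)// (g0 i)// scaler0 addr0.
exists (A `|` B)%fset => n; rewrite inE negb_or => /andP[nA nB].
by rewrite fA// gB// scaler0 addr0.
Qed.

Definition evalf f (z : 'rV[C]_m) : X := \sum_(n \in [set: I]) monom z n *: f n.

Lemma evalfE f z (A : {fset I}) : (forall n, n \notin A -> f n = 0) ->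
  evalf f z = \sum_(n <- A) monom z n *: f n.
Proof. by move=> fA; rewrite /evalf (fsbigTE A)// => n nA; rewrite fA// scaler0. Qed.

Lemma evalf0 z : evalf (fun=> 0) z = 0.
Proof. by rewrite (@evalfE _ _ fset0)// big_seq_fset0. Qed.

Lemma evalf_lc (c : C) f g z : fin_fam f -> fin_fam g ->
  evalf (fun n => c *: f n + g n) z = c *: evalf f z + evalf g z.
Proof.
move=> [A fA] [B gB]; have fAB n : n \notin (A `|` B)%fset -> f n = 0 /\ g n = 0.
  by rewrite inE negb_or => /andP[nA nB]; rewrite fA// gB.
rewrite !(@evalfE _ _ (A `|` B)%fset).
- rewrite scaler_sumr -big_split/=; apply: eq_bigr => n _.
  by rewrite scalerDr !scalerA mulrC.
- by move=> n /fAB[].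
- by move=> n /fAB[].
- by move=> n /fAB[-> ->]; rewrite scaler0 addr0.
Qed.

Lemma evalf_sum (J : Type) (s : seq J) (c : J -> C) (f : J -> I -> X) z :
  (forall j, fin_fam (f j)) ->
  evalf (fun n => \sum_(j <- s) c j *: f j n) z = \sum_(j <- s) c j *: evalf (f j) z.
Proof.
move=> ff; elim: s => [|j s IH].
  by rewrite big_nil -[RHS](evalf0 z); congr evalf; apply/funext => n; rewrite big_nil.
rewrite big_cons -IH -evalf_lc//; last exact: fin_fam_sum.
by congr evalf; apply/funext => n; rewrite big_cons.
Qed.

Lemma monom_unit (z : 'rV[C]_m) (n : I) i : 0 <= n 0 i -> monom z (n + unit_row i) = z 0 i * monom z n.
Proof.
move=> n0; rewrite /monom (bigD1 i)//= [in RHS](bigD1 i)//= mulrA; congr (_ * _).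
  by rewrite !mxE !eqxx/=; case: (n 0 i) n0 => // k _; rewrite -PoszD addn1 -exprS.
by apply: eq_bigr => j ji; rewrite !mxE (negbTE ji) andbF addr0.
Qed.

Lemma monom_unit_neq0 (z : 'rV[C]_m) (n : I) i : z 0 i != 0 -> monom z (n + unit_row i) = z 0 i * monom z n.
Proof.
move=> z0; rewrite /monom (bigD1 i)//= [in RHS](bigD1 i)//= mulrA; congr (_ * _).
  by rewrite !mxE !eqxx/= addrC expfzDr// expr1z.
by apply: eq_bigr => j ji; rewrite !mxE (negbTE ji) andbF addr0.
Qed.

Lemma evalf_shift f z i : poly_fam f ->
  evalf (fun n => f (n - unit_row i)) z = z 0 i *: evalf f z.
Proof.
move=> [[A fA] f0]; rewrite (evalfE _ fA) (@evalfE _ _ [fset (n + unit_row i)%R | n in A]%fset); last first.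
  move=> n nA; apply: fA; apply: contraNN nA => nA.
  by apply/imfsetP; exists (n - unit_row i) => //; rewrite subrK.
rewrite big_imfset/=; last by move=> x y _ _ /addIr.
rewrite scaler_sumr; apply: eq_bigr => n _; rewrite addrK scalerA.
have [n0|n0] := ltP (n 0 i) 0; first by rewrite (f0 i)// !scaler0.
by rewrite monom_unit.
Qed.

Lemma evalf_Lop al f z : poly_fam f -> evalf (Lop al f) z = lform al z *: evalf f z.
Proof.
move=> pf; rewrite evalf_sum; last by move=> i; apply: fin_fam_shift; case: pf.
by rewrite scaler_suml; apply: eq_bigr => i _; rewrite evalf_shift// scalerA.
Qed.

Definition lforms t z : C := \prod_(al <- t) lform al z.

Lemma evalf_Lops t f z : poly_fam f -> evalf (Lops t f) z = lforms t z *: evalf f z.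
Proof.
elim: t f => [|al t IH] f pf /=; first by rewrite /lforms big_nil scale1r.
by rewrite IH ?evalf_Lop ?scalerA; [rewrite /lforms big_cons mulrC|exact|exact: poly_fam_Lop].
Qed.

(* [v] is the value at [z] of the rational function with Laurent-type expansion
   [f]: a product of linear forms, nonzero at [z], turns [f] into a polynomial. *)
Definition rat_value f z (v : X) := exists t, [/\ lforms t z != 0, poly_fam (Lops t f) &
  v = (lforms t z)^-1 *: evalf (Lops t f) z].

(** Two choices of linear forms are compared through their product, since multiplication operators
    commute. *)
Lemma rat_value_uniq f z v v' : rat_value f z v -> rat_value f z v' -> v = v'.
Proof.
move=> [t [t0 pt ->]] [t' [t0' pt' ->]].
apply: (@scalerI _ _ (lforms t z * lforms t' z)); first by rewrite mulf_neq0.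
rewrite !scalerA mulfK// [_ * _ / _]mulrAC mulfV// mul1r.
by rewrite -(evalf_Lops _ _ pt) -(evalf_Lops _ _ pt') LopsC.
Qed.

Lemma lforms_cat t t' z : lforms (t ++ t') z = lforms t z * lforms t' z.
Proof. by rewrite /lforms big_cat. Qed.

Lemma rat_value_ext t f z v : lforms t z != 0 -> rat_value f z v -> rat_value (Lops t f) z (lforms t z *: v).
Proof.
move=> t0 [s [s0 ps ->]]; exists s; split=> //; first by rewrite LopsC; exact: poly_fam_Lops.
by rewrite LopsC (evalf_Lops _ _ ps) !scalerA mulrC.
Qed.

Lemma rat_value_strip t f z v : lforms t z != 0 -> rat_value (Lops t f) z (lforms t z *: v) -> rat_value f z v.
Proof.
move=> t0 [s [s0 ps vE]]; exists (t ++ s); rewrite Lops_cat lforms_cat; split=> //.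
  by rewrite mulf_neq0.
by rewrite invfM -scalerA -vE scalerA mulVf// scale1r.
Qed.

(** Locality identifies two series only after multiplication by linear forms; their values where
    these forms do not vanish are nevertheless the same. *)
Lemma rat_value_eqv t f g z v : lforms t z != 0 -> Lops t f = Lops t g ->
  rat_value f z v -> rat_value g z v.
Proof.
move=> t0 fg /(rat_value_ext t0); rewrite fg; exact: rat_value_strip.
Qed.

Lemma rat_value_lc (c : C) f g z v w : rat_value f z v -> rat_value g z w ->
  rat_value (fun n => c *: f n + g n) z (c *: v + w).
Proof.
move=> [t [t0 pt ->]] [t' [t0' pt' ->]]; exists (t ++ t').
have pf : poly_fam (Lops (t ++ t') f) by rewrite Lops_cat; exact: poly_fam_Lops.
have pg : poly_fam (Lops (t ++ t') g) by rewrite Lops_cat LopsC; exact: poly_fam_Lops.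
rewrite Lops_lc lforms_cat; split; [by rewrite mulf_neq0|exact: poly_fam_lc|].
rewrite evalf_lc; [|by case: pf|by case: pg].
rewrite !Lops_cat [Lops t' (Lops t g)]LopsC (evalf_Lops _ _ pt) (evalf_Lops _ _ pt').
have aux (a b : C) : a != 0 -> b != 0 -> ((a * b)^-1 * (c * b) = c * a^-1) * ((a * b)^-1 * a = b^-1).
  by move=> a0 b0; split; field; rewrite a0 b0.
by rewrite scalerDr !scalerA !(aux _ _ t0 t0').
Qed.

Lemma rat_value0 z : rat_value (fun=> 0) z 0.
Proof.
exists [::]; split; [by rewrite /lforms big_nil oner_neq0| |by rewrite evalf0 scaler0].
by split; [exists fset0|].
Qed.

Lemma rat_value_sum (J : Type) (s : seq J) (c : J -> C) (f : J -> I -> X) z v :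
  (forall j, rat_value (f j) z (v j)) ->
  rat_value (fun n => \sum_(j <- s) c j *: f j n) z (\sum_(j <- s) c j *: v j).
Proof.
move=> fv; elim: s => [|j s IH].
  rewrite big_nil (_ : (fun n => _) = fun=> 0); first exact: rat_value0.
  by apply/funext => n; rewrite big_nil.
rewrite big_cons (_ : (fun n => _) = fun n => c j *: f j n + \sum_(j <- s) c j *: f j n).
  exact: rat_value_lc.
by apply/funext => n; rewrite big_cons.
Qed.

Lemma Lops_shift t f d : Lops t (fun n => f (n - d)) = fun n => Lops t f (n - d).
Proof.
elim: t f => [//|al t IH] f /=; rewrite -IH; congr (Lops _ _); apply/funext => n.
by apply: eq_bigr => i _; rewrite -!addrA [- _ - d]addrC.
Qed.

Lemma rat_value_shift f z v i : rat_value f z v ->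
  rat_value (fun n => f (n - unit_row i)) z (z 0 i *: v).
Proof.
move=> [t [t0 pt ->]]; exists t; rewrite Lops_shift; split=> //.
  split; first by apply: fin_fam_shift; case: pt.
  move=> j n nj; case: pt => _ p0; apply: (p0 j); rewrite !mxE.
  by case: eqP => _ /=; lia.
by rewrite evalf_shift// !scalerA mulrC.
Qed.

End Ops.

Lemma Lop_lin (X Y : lmodType C) (g : X -> Y) al (f : I -> X) : linear g ->
  Lop al (fun n => g (f n)) = fun n => g (Lop al f n).
Proof. by move=> gl; apply/funext => n; rewrite /Lop (lin_sum gl). Qed.

Lemma Lops_lin (X Y : lmodType C) (g : X -> Y) t (f : I -> X) : linear g ->
  Lops t (fun n => g (f n)) = fun n => g (Lops t f n).
Proof. by move=> gl; elim: t f => [//|al t IH] f /=; rewrite (Lop_lin _ _ gl) IH. Qed.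

Lemma lin0 (X Y : lmodType C) (g : X -> Y) : linear g -> g 0 = 0.
Proof. by move=> gl; have := gl (-1) 0 0; rewrite !scaleN1r !addNr. Qed.

Lemma linB (X Y : lmodType C) (g : X -> Y) : linear g -> forall u v, g (u - v) = g u - g v.
Proof. by move=> gl u v; have := gl (-1) v u; rewrite !scaleN1r [- v + u]addrC => ->; rewrite addrC. Qed.

Lemma linZ (X Y : lmodType C) (g : X -> Y) : linear g -> forall c v, g (c *: v) = c *: g v.
Proof. by move=> gl c v; have := gl c v 0; rewrite !addr0 (lin0 gl) addr0. Qed.

Lemma linD (X Y : lmodType C) (g : X -> Y) : linear g -> forall u v, g (u + v) = g u + g v.
Proof. by move=> gl u v; have := gl 1 u v; rewrite !scale1r. Qed.

Lemma poly_fam_lin (X Y : lmodType C) (g : X -> Y) (f : I -> X) : linear g ->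
  poly_fam f -> poly_fam (fun n => g (f n)).
Proof.
move=> gl [[A fA] f0]; split; last by move=> i n ni; rewrite (f0 i)// lin0.
by exists A => n nA; rewrite fA// lin0.
Qed.

Lemma evalf_lin (X Y : lmodType C) (g : X -> Y) (f : I -> X) z : linear g ->
  fin_fam f -> evalf (fun n => g (f n)) z = g (evalf f z).
Proof.
move=> gl [A fA]; rewrite (evalfE _ fA) (@evalfE _ _ _ A); last by move=> n nA; rewrite fA// lin0.
by rewrite (lin_sum gl).
Qed.

Lemma rat_value_lin (X Y : lmodType C) (g : X -> Y) (f : I -> X) z v : linear g ->
  rat_value f z v -> rat_value (fun n => g (f n)) z (g v).
Proof.
move=> gl [t [t0 pt ->]]; exists t; rewrite (Lops_lin _ _ gl); split=> //.
  exact: poly_fam_lin.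
by rewrite (linZ gl) evalf_lin//; case: pt.
Qed.

Lemma monom_differentiable (n : I) z : (forall i, 0 <= n 0 i) ->
  differentiable ((monom^~ n : _ -> C) : 'rV[C]_m -> C^o) z.
Proof.
move=> n0; rewrite /monom.
have -> : (fun z : 'rV[C]_m => \prod_(i < m) z 0 i ^ n 0 i) =
    \prod_(i < m) ((fun z : 'rV[C]_m => z 0 i ^+ `|n 0 i|) : 'rV[C]_m -> C^o).
  apply/funext => y; rewrite fct_prodE; apply: eq_bigr => i _.
  by case: (n 0 i) (n0 i).
elim/big_ind : _ => [|f g fd gd|i _].
- exact: differentiable_cst.
- exact: differentiableM.
- elim: (absz (n 0 i)) => [|k IH]; first exact: differentiable_cst.
  rewrite (_ : (fun _ => _) = (fun z : 'rV[C]_m => (z 0 i : C^o)) * (fun z => z 0 i ^+ k)); last first.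
    by apply/funext => y; rewrite exprS.
  by apply: differentiableM IH; exact: differentiable_coord.
Qed.

Lemma evalf_fhol (X : lmodType C) (U : set 'rV[C]_m) (f : I -> X) :
  poly_fam f -> fhol U (evalf f).
Proof.
move=> [[A fA] f0].
apply: (@fhol_ext _ _ _ _ (fun z => \sum_(n <- A) monom z n *: f n)).
  by move=> z _; rewrite (evalfE _ fA).
apply: fhol_sum => n; have [n0|/existsNP[i /negP n0]] := pselect (forall i, 0 <= n 0 i).
  by apply: fhol1 => z _; exact: monom_differentiable.
by apply: fhol_ext (fhol0 U X) => z _; rewrite (f0 i) ?scaler0// ltNge.
Qed.

Lemma lform_differentiable al z : differentiable ((lform al : _ -> C) : 'rV[C]_m -> C^o) z.
Proof.
rewrite /lform.
have -> : (fun z : 'rV[C]_m => \sum_(i < m) al 0 i * z 0 i) =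
    \sum_(i < m) ((fun z : 'rV[C]_m => al 0 i * z 0 i) : 'rV[C]_m -> C^o).
  by apply/funext => y; rewrite fct_sumE.
apply: differentiable_sum => i; apply: differentiableM; first exact: differentiable_cst.
exact: differentiable_coord.
Qed.

Lemma lforms_differentiable t z : differentiable ((lforms t : _ -> C) : 'rV[C]_m -> C^o) z.
Proof.
elim: t => [|al t IH].
  rewrite (_ : lforms [::] = fun=> 1); first exact: differentiable_cst.
  by apply/funext => y; rewrite /lforms big_nil.
rewrite (_ : lforms (al :: t) = fun z => lform al z * lforms t z).
  by apply: differentiableM; [exact: lform_differentiable|exact: IH].
by apply/funext => y; rewrite /lforms big_cons.
Qed.

End Fixed.

End LatticeFamilies.

(** * Correlation functions of a vertex algebra *)
Section DirectSum.
Variables (R : realType) (V : graded R).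
Local Notation C := (Cx R).
Local Notation dV := (dsum V).

Lemma dval_linear l : linear (fun a : dV => dval a l).
Proof. by []. Qed.

Lemma dval_sum (J : Type) (s : seq J) (f : J -> dV) l :
  dval (\sum_(j <- s) f j) l = \sum_(j <- s) dval (f j) l.
Proof. by elim: s => [|j s IH]; rewrite ?big_nil// !big_cons -IH. Qed.

Lemma dsum_eq (a b : dV) : (forall l, dval a l = dval b l) -> a = b.
Proof. by move=> ab; apply/val_inj/functional_extensionality_dep. Qed.

Lemma dinj_in k (v : V k) : dval (dinj v) k = v.
Proof. by rewrite /= eqtype.dfwith_in. Qed.

Lemma dinj_out k (v : V k) l : l != k -> dval (dinj v) l = 0.
Proof. by move=> lk; rewrite /= eqtype.dfwith_out// eq_sym. Qed.

Lemma dinj_homogeneous k (v : V k) : homogeneous k (dinj v).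
Proof. by move=> l; exact: dinj_out. Qed.

Lemma dinj_linear k : linear (@dinj R V k).
Proof.
move=> c u v; apply: dsum_eq => l; have [->|lk] := eqVneq l k.
  by rewrite dinj_in dval_linear !dinj_in.
by rewrite dinj_out// dval_linear !dinj_out// scaler0 addr0.
Qed.

Lemma homogeneous_dinj k (a : dV) : homogeneous k a -> dinj (dval a k) = a.
Proof.
move=> ha; apply: dsum_eq => l; have [->|lk] := eqVneq l k; first by rewrite dinj_in.
by rewrite dinj_out// ha.
Qed.

Definition dsupp (a : dV) : {fset int} := fset_set (gsupp (dval a)).

Lemma dsuppP (a : dV) k : (k \in dsupp a) <-> dval a k <> 0.
Proof.
have fa : finite_set (gsupp (dval a)) by apply/asboolP; exact: (valP a).
by rewrite in_fset_set// inE.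
Qed.

Lemma dsupp_out (a : dV) k : k \notin dsupp a -> dval a k = 0.
Proof. by move=> /negP ka; apply: contrapT => /dsuppP. Qed.

Lemma dsum_decomp (a : dV) : a = \sum_(k <- dsupp a) dinj (dval a k).
Proof.
apply: dsum_eq => l; rewrite dval_sum; have [la|la] := boolP (l \in dsupp a).
  rewrite (big_fsetD1 l la) dinj_in big1_fset; first by rewrite [RHS]addr0.
  move=> k; rewrite !inE => /andP[kl _] _.
  by rewrite dinj_out// eq_sym.
rewrite dsupp_out// big1_fset// => k ka _.
by rewrite dinj_out//; apply: contraNneq la => ->.
Qed.

Lemma homogeneous_sum (J : eqType) (s : seq J) k (f : J -> dV) :
  (forall j, j \in s -> homogeneous k (f j)) -> homogeneous k (\sum_(j <- s) f j).
Proof.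
move=> fk l lk; rewrite dval_sum big_seq big1// => j js; exact: fk.
Qed.

Definition degree_ge k (a : dV) := forall l, l < k -> dval a l = 0.

Lemma degree_ge_exists a : exists k, degree_ge k a.
Proof.
have [k kP] : exists k, forall l, l \in dsupp a -> k <= l.
  elim/finSet_rect: (dsupp a) => A IH; have [->|[x xA]] := fset_0Vmem A.
    by exists 0 => l; rewrite inE.
  have [k kP] := IH (A `\ x)%fset (fproperD1 xA).
  exists (Num.min k x) => l lA; have [->|lx] := eqVneq l x; first by rewrite ge_min lexx orbT.
  by rewrite ge_min kP// !inE lx.
exists k => l lk; apply: dsupp_out; apply/negP => /kP; lia.
Qed.

Lemma degree_ge_sum (J : eqType) (s : seq J) k (f : J -> dV) :
  (forall j, j \in s -> degree_ge k (f j)) -> degree_ge k (\sum_(j <- s) f j).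
Proof.
move=> fk l lk; rewrite dval_sum big_seq big1// => j js; exact: fk.
Qed.

Lemma degree_geZ k (c : C) (a : dV) : degree_ge k a -> degree_ge k (c *: a).
Proof. by move=> ak l lk; rewrite -[LHS]/(c *: dval a l) ak// scaler0. Qed.

Lemma degree_ge_le k k' (a : dV) : k' <= k -> degree_ge k a -> degree_ge k' a.
Proof. by move=> kk ak l lk; apply: ak; lia. Qed.

End DirectSum.

(** * Products of modes, locality and common denominators *)

Section VertexWords.
Variables (R : realType) (V : graded R) (S : vertexVA V).
Local Notation C := (Cx R).
Local Notation dV := (dsum V).
Local Notation Y := (vY S).
Local Notation vac := (vvac S).

Lemma Y_linl n b : linear (fun a => Y a n b).
Proof. exact: (vY_bilinear S).1. Qed.

Lemma Y_linr a n : linear (Y a n).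
Proof. exact: (vY_bilinear S).2. Qed.

Lemma linear_sumf (X W : lmodType C) (g : X -> W) (J : Type) (s : seq J) (f : J -> X) : linear g ->
  g (\sum_(j <- s) f j) = \sum_(j <- s) g (f j).
Proof.
move=> gl; elim: s => [|j s IH]; first by rewrite !big_nil (lin0 gl).
by rewrite !big_cons (linD gl) IH.
Qed.

Lemma Y_homogeneous d e n a b : homogeneous d a -> homogeneous e b ->
  homogeneous (d + e + n) (Y a n b).
Proof.
move=> ha hb; have := @vY_degree _ _ S d e (- n - 1) a b ha hb.
have -> : e + (d - (- n - 1) - 1) = d + e + n by lia.
by rewrite /mode (_ : - (- n - 1) - 1 = n)//; lia.
Qed.

Lemma Y_decomp a n b : Y a n b =
  \sum_(d <- dsupp a) \sum_(e <- dsupp b) Y (dinj (dval a d)) n (dinj (dval b e)).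
Proof.
rewrite {1}[a]dsum_decomp (linear_sumf _ _ (Y_linl n b)); apply: eq_bigr => d _.
by rewrite {1}[b]dsum_decomp (linear_sumf _ _ (Y_linr _ n)).
Qed.

Lemma Y_degree_ge ka kb n a b : degree_ge ka a -> degree_ge kb b ->
  degree_ge (ka + kb + n) (Y a n b).
Proof.
move=> ha hb; rewrite Y_decomp; apply: degree_ge_sum => d /dsuppP ad.
apply: degree_ge_sum => e /dsuppP be l lk.
have kd : ka <= d by rewrite leNgt; apply/negP => /ha.
have ke : kb <= e by rewrite leNgt; apply/negP => /hb.
have /(_ l) := @Y_homogeneous d e n _ _ (dinj_homogeneous (dval a d)) (dinj_homogeneous (dval b e)).
by apply; lia.
Qed.

Lemma iter_xsuby0 (X : lmodType C) k p q : iter k (@mul_xsuby X) (fun _ _ => 0) p q = 0.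
Proof. by elim: k p q => [//|k IH] p q; rewrite /= /mul_xsuby !IH subrr. Qed.

(** Lower truncation is extracted from locality on the vacuum. In the coefficient of x^p y^0 with p
    < 0, creation kills the product in the opposite order; as no negative power of y occurs in Y(b,
    y)|0>, all that remains of (x - y)^N Y(a, x) Y(b, y)|0> is the coefficient of x^(p - N) in Y(a,
    x) b. *)
Lemma Y_truncated a b : exists N : nat, forall n, n < - N%:Z -> Y a n b = 0.
Proof.
have [N NP] := vY_locality S a b; exists N => n nN.
pose H p q := Y a p (Y b q vac).
have Y0 c k : Y c k 0 = 0 by rewrite (lin0 (Y_linr c k)).
have Hq k p q : q < 0 -> iter k (@mul_xsuby dV) H p q = 0.
  elim: k p q => [|k IH] p q q0; first by rewrite /= /H (vY_creation S b).2.
  by rewrite /= /mul_xsuby !IH ?subrr//; lia.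
have H0 k p : iter k (@mul_xsuby dV) H p 0 = H (p - k%:Z) 0.
  elim: k p => [|k IH] p; first by rewrite subr0.
  by rewrite /= /mul_xsuby IH Hq// subr0; congr H; lia.
have HF k p q : p < 0 ->
    iter k (@mul_xsuby dV) (Y_commutator Y a b vac) p q = iter k (@mul_xsuby dV) H p q.
  elim: k p q => [|k IH] p q p0.
    by rewrite /= /Y_commutator (vY_creation S a).2// Y0 subr0.
  by rewrite /= /mul_xsuby !IH//; lia.
have := NP vac (n + N%:Z) 0; rewrite HF ?H0; last by lia.
by rewrite /H addrK (vY_creation S b).1.
Qed.

Section Letters.
Variables (m : nat) (a : 'rV[dV]_m).
Local Notation I := 'rV[int]_m.

(** The letters are positions in [a], and each exponent stays attached to its position. Words in
    different orders are therefore coefficients of the same monomials and can be compared as formal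
    series. *)
Definition word (s : seq 'I_m) (c : dV) (n : I) : dV :=
  foldr (fun i b => Y (a 0 i) (n 0 i) b) c s.

Lemma word_cat u v c n : word (u ++ v) c n = word u (word v c n) n.
Proof. by rewrite /word foldr_cat. Qed.

Lemma word_ext s c (n n' : I) : (forall i, i \in s -> n 0 i = n' 0 i) -> word s c n = word s c n'.
Proof.
elim: s => [//|i s IH] nn /=; rewrite nn ?inE ?eqxx//; congr (Y _ _ _).
by apply: IH => j js; apply: nn; rewrite inE js orbT.
Qed.

Lemma word_linear s n : linear (fun c => word s c n).
Proof. by elim: s => [//|i s IH] c u v /=; rewrite IH Y_linr. Qed.

(** The linear form x_i - x_j for p = (i, j). *)
Definition pdiff (p : 'I_m * 'I_m) : 'rV[C]_m := \row_k ((k == p.1)%:R - (k == p.2)%:R).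

Lemma Lop_pdiff (X : lmodType C) (f : I -> X) i j n :
  Lop (pdiff (i, j)) f n = f (n - unit_row i) - f (n - unit_row j).
Proof.
rewrite /Lop; under eq_bigr => k _ do rewrite mxE scalerBl.
rewrite sumrB; congr (_ - _).
  rewrite (bigD1 i)//= eqxx scale1r big1 ?addr0// => k /negbTE->; exact: scale0r.
rewrite (bigD1 j)//= eqxx scale1r big1 ?addr0// => k /negbTE->; exact: scale0r.
Qed.

Lemma lform_pdiff i j z : lform (pdiff (i, j)) z = z 0 i - z 0 j.
Proof.
rewrite /lform; under eq_bigr => k _ do rewrite mxE mulrBl.
rewrite sumrB; congr (_ - _).
  rewrite (bigD1 i)//= eqxx mul1r big1 ?addr0// => k /negbTE->; exact: mul0r.
rewrite (bigD1 j)//= eqxx mul1r big1 ?addr0// => k /negbTE->; exact: mul0r.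
Qed.

Lemma word_shift s c n i : i \notin s -> word s c (n - unit_row i) = word s c n.
Proof.
move=> si; apply: word_ext => j js; rewrite mxE [X in _ + X]mxE unit_rowE.
by case: eqP => [ji|_]; [rewrite -ji js in si|rewrite subr0].
Qed.

(** The variables x_i and x_j occur only in the two adjacent letters, so multiplication by x_i - x_j
    acts inside the word and locality applies there. *)
Lemma word_swap u i j v c : uniq (u ++ i :: j :: v) -> exists N,
  Lops (nseq N (pdiff (i, j))) (word (u ++ i :: j :: v) c) =
  Lops (nseq N (pdiff (i, j))) (word (u ++ j :: i :: v) c).
Proof.
move=> un; have [N NP] := vY_locality S (a 0 i) (a 0 j); exists N.
have [ij iu iv ju jv] : [/\ i != j, i \notin u, i \notin v, j \notin u & j \notin v].
  move: un; rewrite cat_uniq /= !inE !negb_or.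
  by move=> /and3P[_ /and3P[-> -> _] /and3P[/andP[-> ->] ->]].
have E k : Lops (nseq k (pdiff (i, j))) (fun n =>
      word (u ++ i :: j :: v) c n - word (u ++ j :: i :: v) c n) = fun n =>
    word u (iter k (@mul_xsuby dV)
      (Y_commutator Y (a 0 i) (a 0 j) (word v c n)) (n 0 i) (n 0 j)) n.
  elim: k => [|k IH].
    by apply/funext => n /=; rewrite !word_cat -(linB (word_linear u n)).
  rewrite -[in nseq _ _](addn1 k) nseqD Lops_cat IH; apply/funext => n /=.
  rewrite Lop_pdiff !word_shift// -(linB (word_linear u n)).
  rewrite /mul_xsuby !mxE !eqxx/= [j == i]eq_sym (negbTE ij)/= !subr0.
  by [].
apply/funext => n; apply/eqP; rewrite -subr_eq0; apply/eqP.
have := congr1 (@^~ n) (E N); rewrite Lops_sub => ->.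
by rewrite NP (lin0 (word_linear u n)).
Qed.

(** Repeated swaps. The record of the factors used, x_i - x_j with j in [v], later gives both their
    nonvanishing and their orientation. *)
Lemma word_move u i v w c : uniq (u ++ i :: v ++ w) -> exists t : seq ('I_m * 'I_m),
  [/\ all (fun p => (p.1 == i) && (p.2 \in v)) t &
  Lops (map pdiff t) (word (u ++ i :: v ++ w) c) =
  Lops (map pdiff t) (word (u ++ v ++ i :: w) c)].
Proof.
elim: v u => [|j v IH] u un; first by exists [::].
have [N NP] := word_swap c (un : uniq (u ++ i :: j :: (v ++ w))).
have [|t [tP tE]] := IH (rcons u j).
  rewrite cat_rcons; move: un; apply: etrans; apply: perm_uniq.
  by rewrite perm_cat2l /= (perm_catCA [:: j] [:: i]).
exists (nseq N (i, j) ++ t); split.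
  rewrite all_cat; apply/andP; split.
    by apply/allP => p; rewrite mem_nseq => /andP[_ /eqP->]/=; rewrite inE !eqxx.
  by apply: sub_all tP => p /andP[->]/=; rewrite inE orbC => ->.
rewrite map_cat !Lops_cat map_nseq NP LopsC.
by rewrite -cat_rcons tE cat_rcons LopsC.
Qed.

Lemma word_perm s s' c : uniq s -> perm_eq s s' -> exists t : seq ('I_m * 'I_m),
  [/\ all (fun p => p.1 != p.2) t &
  Lops (map pdiff t) (word s c) = Lops (map pdiff t) (word s' c)].
Proof.
suff H u : uniq (u ++ s) -> perm_eq s s' -> exists t : seq ('I_m * 'I_m),
  [/\ all (fun p => p.1 != p.2) t &
  Lops (map pdiff t) (word (u ++ s) c) = Lops (map pdiff t) (word (u ++ s') c)].
  exact: (H [::]).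
elim: s s' u => [|x s IH] s' u un ss'.
  by move: ss'; rewrite perm_sym => /perm_nilP ->; exists [::].
have xs' : x \in s' by rewrite -(perm_mem ss') inE eqxx.
case/splitPr: s' / xs' ss' => s1 s2 ss'.
have ss1 : perm_eq s (s1 ++ s2).
  by rewrite -(perm_cons x); apply: perm_trans ss' _; rewrite -cat1s perm_catCA.
have [|t [tP tE]] := IH _ (rcons u x) _ ss1; first by rewrite cat_rcons.
have un' : uniq (u ++ x :: s1 ++ s2).
  by move: un; apply: etrans; apply: perm_uniq; rewrite perm_cat2l perm_cons perm_sym.
have [t' [tP' tE']] := word_move c un'.
exists (t ++ t'); split.
  rewrite all_cat tP; apply: sub_all tP' => p /andP[/eqP-> p2].
  apply/eqP => xp; rewrite -xp in p2; move: un'; rewrite cat_uniq /= mem_cat p2.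
  by rewrite !andbF.
by rewrite map_cat !Lops_cat -cat_rcons tE cat_rcons LopsC tE' LopsC.
Qed.

(** Once letter i stands next to the vacuum, creation removes its negative exponents. In an
    increasing word it only passes letters j > i, so the factors are x_i - x_j with i < j, whose
    inverses expand where |z_i| > |z_j|. *)
Lemma word_den (s r : seq 'I_m) : pairwise (fun i j : 'I_m => i < j)%N s -> {subset r <= s} ->
  exists t : seq ('I_m * 'I_m),
  [/\ all (fun p => [&& p.1 \in r, p.2 \in s & (p.1 < p.2)%N]) t &
  forall i, i \in r -> zero_below i (Lops (map pdiff t) (word s vac))].
Proof.
move=> ps rs.
have us : uniq s by apply: pairwise_uniq ps => i; rewrite ltnn.
elim: r rs => [|i r IH] rs; first by exists [::].
have [|t [tP t0]] := IH; first by move=> j jr; apply: rs; rewrite inE jr orbT.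
have [u [v sE]] : exists u v, s = u ++ i :: v.
  by case/splitPr: (rs i (mem_head _ _)) => u v; exists u, v.
have un : uniq (u ++ i :: v ++ [::]) by rewrite cats0 -sE.
have [t' [tP' tE']] := word_move vac un.
exists (t ++ t'); split.
  rewrite all_cat; apply/andP; split.
    by apply: sub_all tP => p /andP[pr ->]; rewrite inE pr orbT.
  apply/allP => -[p q] /(allP tP')/= /andP[/eqP-> qv]; rewrite inE eqxx/=.
  have qs : q \in s by rewrite sE mem_cat inE qv !orbT.
  rewrite qs/=; move: ps; rewrite sE pairwise_cat/= => /and3P[_ _ /andP[+ _]].
  by move/allP; apply.
move=> j; rewrite inE map_cat Lops_cat => /predU1P[->|jr]; last first.
  by apply: zero_below_Lops; exact: t0.
rewrite LopsC; apply: zero_below_Lops.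
have -> : word s vac = word (u ++ i :: v ++ [::]) vac by rewrite cats0 -sE.
rewrite tE'; apply: zero_below_Lops => n ni; rewrite !word_cat/= (vY_creation S _).2//.
by rewrite (lin0 (word_linear v n)) (lin0 (word_linear u n)).
Qed.

Definition total_deg (n : I) : int := \sum_(i < m) n 0 i.

Lemma total_unit n i : total_deg (n - unit_row i) = total_deg n - 1.
Proof.
rewrite /total_deg; under eq_bigr => j _ do rewrite mxE [X in _ + X]mxE unit_rowE.
rewrite sumrB; congr (_ - _).
by rewrite (bigD1 i)//= eqxx big1 ?addr0// => j /negbTE->.
Qed.

Lemma Lop_degree_ge (k : int) al (f : I -> dV) : (forall n, degree_ge (k + total_deg n) (f n)) ->
  forall n, degree_ge (k - 1 + total_deg n) (Lop al f n).
Proof.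
move=> fk n; apply: degree_ge_sum => i _; apply: degree_geZ.
by apply: degree_ge_le (fk _); rewrite total_unit; lia.
Qed.

Lemma Lops_degree_ge (k : int) t (f : I -> dV) : (forall n, degree_ge (k + total_deg n) (f n)) ->
  forall n, degree_ge (k - (size t)%:Z + total_deg n) (Lops t f n).
Proof.
elim: t k f => [|al t IH] k f fk n /=; first by rewrite subr0.
apply: (degree_ge_le _ (IH _ _ (Lop_degree_ge al fk) n)); rewrite intS opprD addrA; exact: lexx.
Qed.

Lemma Lop_homogeneous (k : int) al (f : I -> dV) : (forall n, homogeneous (k + total_deg n) (f n)) ->
  forall n, homogeneous (k - 1 + total_deg n) (Lop al f n).
Proof.
move=> fk n; apply: homogeneous_sum => i _ l lk.
rewrite -[LHS]/(_ *: dval (f (n - unit_row i)) l) fk ?scaler0//.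
by rewrite total_unit; lia.
Qed.

Lemma Lops_homogeneous (k : int) t (f : I -> dV) : (forall n, homogeneous (k + total_deg n) (f n)) ->
  forall n, homogeneous (k - (size t)%:Z + total_deg n) (Lops t f n).
Proof.
elim: t k f => [|al t IH] k f fk n /=; first by rewrite subr0.
have := IH _ _ (Lop_homogeneous al fk) n.
by have -> : k - 1 - (size t)%:Z + total_deg n = k - (size t).+1%:Z + total_deg n by lia.
Qed.

Lemma word_degree_ge : exists k : int, forall n, degree_ge (k + total_deg n) (word (enum 'I_m) vac n).
Proof.
have /choice[k kP] : forall i, exists k : int, degree_ge k (a 0 i) by move=> i; exact: degree_ge_exists.
exists (\sum_(i < m) k i) => n; rewrite /total_deg -big_split/=.
rewrite -[index_enum _]enumT; elim: (enum 'I_m) => [|i s IH].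
  by rewrite big_nil => l l0 /=; rewrite vvac_degree//; lia.
by rewrite big_cons/=; apply: (degree_ge_le _ (@Y_degree_ge _ _ (n 0 i) _ _ (kP i) IH)); lia.
Qed.

Lemma word_homogeneous d : (forall i, homogeneous (d i) (a 0 i)) ->
  forall n, homogeneous (\sum_(i < m) d i + total_deg n) (word (enum 'I_m) vac n).
Proof.
move=> dP n; rewrite /total_deg -big_split/= -[index_enum _]enumT; elim: (enum 'I_m) => [|i s IH].
  by rewrite big_nil; exact: vvac_degree.
have := @Y_homogeneous _ _ (n 0 i) _ _ (dP i) IH.
by rewrite big_cons addrAC.
Qed.

Lemma bounded_fset (M : nat) : exists A : {fset I}, forall n : I,
  (forall i, 0 <= n 0 i <= M%:Z) -> n \in A.
Proof.
exists [fset map_mx (fun o : 'I_M.+1 => (o : nat)%:Z) x | x in [set: 'rV['I_M.+1]_m]%SET]%fset => n nM.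
apply/imfsetP; exists (\row_i inord (absz (n 0 i))); first by rewrite inE.
apply/rowP => i; rewrite !mxE; have := nM i; case: (n 0 i) => // k /= kM.
by rewrite inordK//; lia.
Qed.

(** In degree [l] the total exponent is at most l - k; with nonnegative exponents this leaves
    finitely many monomials. *)
Lemma poly_fam_degree (k : int) (f : I -> dV) l : (forall n, degree_ge (k + total_deg n) (f n)) ->
  (forall i, zero_below i f) -> poly_fam (fun n => dval (f n) l).
Proof.
move=> fk f0; split; last by move=> i n ni; rewrite (f0 i).
have [A AP] := bounded_fset (absz (l - k)); exists A => n nA.
have [[i ni]|nn] := pselect (exists i, n 0 i < 0); first by rewrite (f0 i).
have n0 i : 0 <= n 0 i by rewrite leNgt; apply/negP => ni; apply: nn; exists i.
apply: fk; rewrite ltNge; apply: contraNN nA => kl; apply: AP => i; rewrite n0/=.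
have nit : n 0 i <= total_deg n by rewrite /total_deg (bigD1 i)//= lerDl sumr_ge0.
rewrite abszE; apply: le_trans (ler_norm _); rewrite lerBrDl; apply: le_trans kl.
by rewrite lerD2l.
Qed.

Lemma enum_pairwise : pairwise (fun i j : 'I_m => i < j)%N (enum 'I_m).
Proof.
have : pairwise ltn (map val (enum 'I_m)).
  by rewrite val_enum_ord -sorted_pairwise; [exact: iota_ltn_sorted|exact: ltn_trans].
by rewrite pairwise_map.
Qed.

Lemma correlation_den : exists t : seq ('I_m * 'I_m),
  all (fun p : 'I_m * 'I_m => (p.1 < p.2)%N) t /\
  forall l, poly_fam (fun n => dval (Lops (map pdiff t) (word (enum 'I_m) vac) n) l).
Proof.
have [|t [tP t0]] := @word_den (enum 'I_m) (enum 'I_m) enum_pairwise; first by [].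
have [k kP] := word_degree_ge.
exists t; split; first by apply: sub_all tP => p /and3P[].
move=> l; refine (@poly_fam_degree _ _ l (Lops_degree_ge kP) _) => i.
by apply: t0; rewrite mem_enum.
Qed.

(** A denominator fixed once for each [a]; by [rat_value_uniq] the values of [corr] do not depend on
    the choice. *)
Definition corr_den : seq 'rV[C]_m := map pdiff (projT1 (cid correlation_den)).

Definition corr (z : 'rV[C]_m) : gbar V := fun l =>
  if `[< diag z >] then 0 else
  (lforms corr_den z)^-1 *: evalf (fun n => dval (Lops corr_den (word (enum 'I_m) vac) n) l) z.

Lemma lforms_pdiff_neq0 t z : all (fun p => p.1 != p.2) t -> conf z -> lforms (map pdiff t) z != 0.
Proof.
move=> tP cz; elim: t tP => [_|[i j] t IH /andP[/= ij tP]]; first by rewrite /lforms big_nil oner_neq0.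
rewrite /lforms big_cons mulf_neq0//; last exact: IH.
by rewrite lform_pdiff subr_eq0; apply/eqP => zij; apply: cz; exists i, j.
Qed.

Lemma corr_den_neq0 z : conf z -> lforms corr_den z != 0.
Proof.
move=> cz; apply: lforms_pdiff_neq0 => //.
have [+ _] := projT2 (cid correlation_den); apply: sub_all => p.
by apply: contraTneq => ->; rewrite ltnn.
Qed.

Lemma corr_rat l z : conf z ->
  rat_value (fun n => dval (word (enum 'I_m) vac n) l) z (corr z l).
Proof.
move=> cz; exists corr_den; rewrite (Lops_lin corr_den _ (@dval_linear _ V l)); split.
- exact: corr_den_neq0.
- by have [_ ] := projT2 (cid correlation_den); exact.
- by rewrite /corr; case: asboolP.
Qed.

(** The way in which the pointwise axioms are reduced to coefficients: a claimed value only has to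
    be a rational value of the same formal series. *)
Lemma corr_eq l z v : conf z ->
  rat_value (fun n => dval (word (enum 'I_m) vac n) l) z v -> corr z l = v.
Proof. by move=> cz; apply: rat_value_uniq; exact: corr_rat. Qed.

Lemma corr_diag z : diag z -> corr z = 0.
Proof.
by move=> dz; apply: functional_extensionality_dep => l; rewrite /corr; case: asboolP.
Qed.

Lemma corr_fhol l : fhol (@conf R m) (fun z => corr z l).
Proof.
have [_ pf] := projT2 (cid correlation_den).
apply: (@fhol_ext _ _ _ _ (fun z => (lforms corr_den z)^-1 *:
   evalf (fun n => dval (Lops corr_den (word (enum 'I_m) vac) n) l) z)).
  by move=> z cz; rewrite /corr; case: asboolP.
apply: fholZ; last exact: evalf_fhol (pf l).
by move=> z cz; apply: differentiableV; [exact: lforms_differentiable|exact: corr_den_neq0].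
Qed.

End Letters.
End VertexWords.

(** * Normally convergent families together with their sums *)

Section Summable.
Variable R : realType.
Local Notation C := (Cx R).

Lemma has_sum_bij (X : lmodType C) (I J : choiceType) (h : I -> J) (g : J -> I) (f : J -> X) s :
  cancel h g -> cancel g h -> has_sum f s -> has_sum (f \o h) s.
Proof.
move=> hK gK [d [e [c [t [ie fc st ct]]]]].
exists d, e, (c \o h), t; split=> // [i|P /ct]; first exact: fc.
exact: partial_sum_bij hK gK P.
Qed.

(** Uniform summability and the pointwise value are kept together, because associativity demands
    both and the same operations preserve both. *)
Definition nhas (T : Type) (K : set T) (X : lmodType C) (I : choiceType)
    (b : I -> T -> X) (s : T -> X) : Prop :=
  nsum K b /\ forall x, K x -> has_sum (b^~ x) (s x).

Section Theory.
Variables (T : Type) (K : set T) (X : lmodType C).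

Lemma nhas_ext (I : choiceType) (b b' : I -> T -> X) s s' :
  (forall q x, K x -> b q x = b' q x) -> (forall x, K x -> s x = s' x) ->
  nhas K b s -> nhas K b' s'.
Proof.
move=> bb ss [bn bs]; split; first exact: nsum_ext bb bn.
move=> x Kx; rewrite -ss// (_ : b'^~ x = b^~ x); first exact: bs.
by apply/funext => q; rewrite bb.
Qed.

Lemma nhas_bij (I J : choiceType) (h : I -> J) (g : J -> I) (b : J -> T -> X) s :
  cancel h g -> cancel g h -> nhas K b s -> nhas K (fun i => b (h i)) s.
Proof.
move=> hK gK [bn bs]; split; first by apply: nsum_bij bn; exact: can_inj hK.
by move=> x Kx; apply: (@has_sum_bij _ _ _ h g (b^~ x)) => //; exact: bs.
Qed.

Lemma nhas_peel (I : choiceType) (sh sh' : I -> I) (b b' : I -> T -> X) s' (x y : T -> C) (r th : R) :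
  cancel sh sh' -> cancel sh' sh -> nhas K b' s' ->
  (forall t, K t -> [/\ x t != 0, nm (x t)^-1 <= r & nm (y t / x t) <= th]) ->
  0 <= th < 1 ->
  (forall q t, K t -> x t *: b q t - y t *: b (sh q) t = b' q t) ->
  (forall q, exists k0, forall k t, (k0 <= k)%N -> K t -> b (iter k sh q) t = 0) ->
  nhas K b (fun t => (x t - y t)^-1 *: s' t).
Proof.
move=> shK shK' [bn bs] xy th01 rel van.
have bn' : nsum K b by apply: nsum_peel bn xy th01 rel van; exact: can_inj shK.
split=> // t Kt; have [s ss] := nsum_has_sum Kt bn'.
have [x0 _ yx] := xy t Kt.
have xy0 : x t - y t != 0.
  apply/eqP => /eqP; rewrite subr_eq0 => /eqP xyE; move: yx; rewrite -xyE mulfV// nm1.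
  by case/andP: th01 => _ th1; rewrite leNgt th1.
rewrite -(has_sum_peel shK shK' (fun q => rel q t Kt) ss (bs t Kt)) scalerA mulVf// scale1r.
exact: ss.
Qed.

(** The existence premise supplies a common finite-dimensional subspace; functionals then identify
    the value. *)
Lemma has_sum_lc (I : choiceType) (c : C) (f g : I -> X) s t : has_sum f s -> has_sum g t ->
  (exists u, has_sum (fun i => c *: f i + g i) u) -> has_sum (fun i => c *: f i + g i) (c *: s + t).
Proof.
move=> fs gt [u us]; rewrite (_ : c *: s + t = u)//; apply: functional_ext => phi.
apply: (@cvg_sum_uniq _ _ (phi \o (fun i => c *: f i + g i))); last exact: has_sum_functional.
rewrite (_ : _ \o _ = fun q => c * (phi \o f) q + 1 * (phi \o g) q); last first.
  by apply/funext => q; rewrite /= linearD linearZ/= mul1r.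
have -> : phi (c *: s + t) = c * phi s + 1 * phi t by rewrite linearD linearZ/= mul1r.
by apply: cvg_sum_lin; exact: has_sum_functional.
Qed.

Lemma nhas_lc (I : choiceType) (g : T -> C) (r : R) (b b' : I -> T -> X) s s' :
  (forall x, K x -> nm (g x) <= r) -> nhas K b s -> nhas K b' s' ->
  nhas K (fun q x => g x *: b q x + b' q x) (fun x => g x *: s x + s' x).
Proof.
move=> gr [bn bs] [bn' bs'].
have n : nsum K (fun q x => g x *: b q x + b' q x).
  by apply: nsum_add => //; exact: nsum_scale gr bn.
split=> // x Kx; apply: has_sum_lc; [exact: bs|exact: bs'|exact: nsum_has_sum n].
Qed.

Lemma nhas0 (I : choiceType) : nhas K (fun (q : I) (x : T) => 0 : X) (fun=> 0).
Proof.
split=> [|x _]; first exact: nsum0.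
have := @has_sum_fin R X I (fun=> 0) fset0; rewrite big_seq_fset0; exact.
Qed.

Lemma nhas_scale (I : choiceType) (g : T -> C) (r : R) (b : I -> T -> X) s :
  (forall x, K x -> nm (g x) <= r) -> nhas K b s ->
  nhas K (fun q x => g x *: b q x) (fun x => g x *: s x).
Proof.
move=> gr bs; apply: nhas_ext (nhas_lc gr bs (nhas0 I)) => [q x _|x _]; exact: addr0.
Qed.

Lemma nhas_sum (I : choiceType) (J : Type) (js : seq J) (b : J -> I -> T -> X) s :
  (forall j, nhas K (b j) (s j)) ->
  nhas K (fun q x => \sum_(j <- js) b j q x) (fun x => \sum_(j <- js) s j x).
Proof.
move=> bs; elim: js => [|j js IH].
  by apply: nhas_ext (nhas0 I) => [q x _|x _]; rewrite big_nil.
apply: nhas_ext (@nhas_lc _ (fun=> 1) (nm 1) _ _ _ _ _ (bs j) IH) => [q x _|x _|//].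
- by rewrite big_cons scale1r.
- by rewrite big_cons scale1r.
Qed.

Lemma nhas_fin (I : choiceType) (b : I -> T -> X) (A : {fset I}) :
  (forall q x, K x -> q \notin A -> b q x = 0) ->
  (forall q, q \in A -> bounded_span K (b q)) -> nhas K b (fun x => \sum_(q <- A) b q x).
Proof.
move=> bA bs; split; first exact: nsum_fin bA bs.
by move=> x Kx; apply: has_sum_fin => q qA; apply: bA.
Qed.

End Theory.

Lemma nhas_lin (T : Type) (K : set T) (X Y : lmodType C) (g : X -> Y) (I : choiceType)
    (b : I -> T -> X) s : linear g -> nhas K b s -> nhas K (fun q x => g (b q x)) (fun x => g (s x)).
Proof.
move=> gl [bn bs]; split=> [|x Kx]; first exact: nsum_lin gl bn.
have [d [e [c [t [_ fc st ct]]]]] := bs x Kx.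
apply: (@has_sum_family _ _ _ _ _ _ (g \o e) c t) => //.
  by move=> q; rewrite fc /lcomb (lin_sum gl).
by rewrite st /lcomb (lin_sum gl).
Qed.

End Summable.

(** * Expansion in the domain |z_1| > ... > |z_m| *)

Section CorrelationExpansion.
Variable R : realType.
Local Notation C := (Cx R).
Variables (m : nat) (X : lmodType C) (z : 'rV[C]_m).
Local Notation I := 'rV[int]_m.

Lemma monom_scale (f : I -> X) n i : (z 0 i = 0 -> zero_below i f) ->
  monom z (n + unit_row i) *: f n = z 0 i *: (monom z n *: f n).
Proof.
move=> f0; rewrite scalerA; have [z0|z0] := eqVneq (z 0 i) 0; last by rewrite monom_unit_neq0.
have [n0|n0] := ltP (n 0 i) 0; first by rewrite f0// !scaler0.
by rewrite monom_unit.
Qed.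

(** Moving exponent from x_j to x_i with i < j eventually leaves the support. This makes division by
    x_i - x_j, expanded in powers of x_j / x_i, a finite sum in every coefficient. *)
Definition truncated (f : I -> X) := forall i j : 'I_m, (i < j)%N -> forall q,
  exists k0, forall k, (k0 <= k)%N -> f (q + (unit_row i - unit_row j) *+ k) = 0.

Lemma truncated_Lop al f : truncated f -> truncated (Lop al f).
Proof.
move=> ft i j ij q.
have /choice[k kP] : forall l, exists k0, forall k, (k0 <= k)%N ->
    f (q - unit_row l + (unit_row i - unit_row j) *+ k) = 0 by move=> l; exact: ft.
exists (\max_l k l) => k' kk; rewrite /Lop big1// => l _.
by rewrite addrAC kP ?scaler0//; apply: leq_trans kk; exact: leq_bigmax.
Qed.

(** The factors are removed one at a time by [nhas_peel], each inverse being a geometric series in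
    z_j / z_i; when none is left, the series is a finite sum. *)
Lemma expansion_sum (t : seq ('I_m * 'I_m)) (f : I -> X) :
  (forall i j : 'I_m, (i < j)%N -> nm (z 0 j) < nm (z 0 i)) ->
  all (fun p : 'I_m * 'I_m => (p.1 < p.2)%N) t ->
  (forall i, z 0 i = 0 -> zero_below i f) -> truncated f ->
  poly_fam (Lops (map (pdiff R (m := m)) t) f) ->
  nhas [set tt] (fun n _ => monom z n *: f n)
    (fun _ => (lforms (map (pdiff R (m := m)) t) z)^-1 *: evalf (Lops (map (pdiff R (m := m)) t) f) z).
Proof.
move=> zlt; elim: t f => [|[i j] t IH] f /=.
  move=> _ _ _ [[A fA] _].
  apply: nhas_ext (@nhas_fin _ _ _ _ _ (fun n _ => monom z n *: f n) A _ _) => //.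
  - by move=> _ _; rewrite /lforms big_nil invr1 scale1r (evalfE _ fA).
  - by move=> n _ _ nA; rewrite fA// scaler0.
  - move=> n _; exists 1%N, (fun=> f n), (fun _ => const_mx (monom z n)), (nm (monom z n)).
    by split=> [x _|x k _]; rewrite ?mxE// /lcomb big_ord1 mxE.
move=> /andP[ij tP] f0 ft pf.
have zi0 : z 0 i != 0.
  by apply/eqP => zi; have := zlt _ _ ij; rewrite zi nm0 ltNge nm_ge0.
have {IH} := IH (Lop (pdiff R (i, j)) f) tP _ (truncated_Lop _ ft) pf.
move=> /(_ (fun k zk => zero_below_Lop _ (f0 k zk))) H.
(* The coefficient of the product at q + e_i involves [f] at q and at q + e_i - e_j, so the family
   is reindexed by e_i. *)
have := nhas_bij (addrK (unit_row i)) (subrK (unit_row i)) H.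
move=> {}H.
have := @nhas_peel _ _ _ _ _ (fun q => q + (unit_row i - unit_row j))
  (fun q => q - (unit_row i - unit_row j)) (fun n _ => monom z n *: f n) _ _ (fun=> z 0 i) (fun=> z 0 j)
  (nm (z 0 i)^-1) (nm (z 0 j / z 0 i)) (addrK _) (subrK _) H.
move=> /(_ (fun t _ => And3 zi0 (lexx _) (lexx _))).
rewrite nm_ge0/= nmM nmV ltr_pdivrMr ?nm_gt0// mul1r zlt// => /(_ isT) {}H.
apply: nhas_ext (H _ _) => //.
- move=> _ _; rewrite scalerA; congr (_ *: _).
  by rewrite /lforms big_cons lform_pdiff invfM.
- move=> q _ _; rewrite Lop_pdiff addrK scalerBr; congr (_ - _).
    by rewrite monom_scale//; exact: f0.
  by rewrite -monom_scale ?addrA; [rewrite subrK|exact: f0].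
- move=> q; have [k0 k0P] := ft _ _ ij q; exists k0 => k _ kk _.
  have -> : iter k (fun q0 : I => q0 + (unit_row i - unit_row j)) q = q + (unit_row i - unit_row j) *+ k.
    by elim: k {kk} => [|k IHk]; [rewrite mulr0n addr0|rewrite iterS IHk [in RHS]mulrSr [RHS]addrA].
  by rewrite k0P// scaler0.
Qed.

End CorrelationExpansion.

(** * The axioms other than associativity for the correlation functions *)

Section CorrelationFunctions.
Variables (R : realType) (V : graded R) (S : vertexVA V).
Local Notation C := (Cx R).
Local Notation dV := (dsum V).
Local Notation Y := (vY S).
Local Notation vac := (vvac S).

Lemma conf_open m : open (@conf R m).
Proof.
rewrite openE => z cz; rewrite /interior.
have H (p : 'I_m * 'I_m) : \forall y \near z, p.1 != p.2 -> (y : 'rV[C]_m) 0 p.1 - y 0 p.2 != 0.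
  have [_|ij] := eqVneq p.1 p.2; first by near=> y.
  have zij : z 0 p.1 - z 0 p.2 != 0.
    by rewrite subr_eq0; apply/eqP => zij; apply: cz; exists p.1, p.2.
  have : (y : 'rV[C]_m) 0 p.1 - y 0 p.2 @[y --> z] --> z 0 p.1 - z 0 p.2.
    have cc i : (y : 'rV[C]_m) 0 i @[y --> z] --> z 0 i := @coord_continuous _ _ _ _ _ z.
    exact: cvgB (cc _) (cc _).
  by move=> /cvgr_neq0 /(_ zij); apply: filterS => y yij _; exact: yij.
apply: filterS (filter_forall _ H) => y {}H [i [j [ij yij]]].
by have := H (i, j) ij; rewrite /= yij subrr eqxx.
Unshelve. all: by end_near.
Qed.

Lemma word_zero_below m (a : 'rV[dV]_m) (u : seq 'I_m) i :
  zero_below i (word S a (rcons u i) vac).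
Proof.
move=> n ni; rewrite -cats1 word_cat /= (vY_creation S _).2//.
by rewrite (lin0 (word_linear S a u n)).
Qed.

Lemma int_sub_lt (x : int) (N k : nat) : (N + absz x < k)%N -> x - k%:Z < - N%:Z.
Proof. lia. Qed.

(** The letters to the right of j do not involve i, so they form a fixed vector while the exponent
    of j decreases; lower truncation then applies. *)
Lemma word_truncated m (a : 'rV[dV]_m) : truncated (word S a (enum 'I_m) vac).
Proof.
move=> i j ij q; have ep := enum_pairwise m.
have jm : j \in enum 'I_m by rewrite mem_enum.
case/splitPr: jm ep => u v.
rewrite pairwise_cat/= => /and3P[_ _ /andP[jv _]].
have [N NP] := Y_truncated S (a 0 j) (word S a v vac q).
exists (N + absz (q 0 j)).+1 => k kN; rewrite word_cat/=.
have nE l : (q + (unit_row i - unit_row j) *+ k) 0 l = q 0 l + ((l == i)%:R - (l == j)%:R) *+ k.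
  by rewrite mxE mulmxnE !mxE !eqxx.
rewrite (_ : word S a v vac _ = word S a v vac q); last first.
  apply: word_ext => l lv; rewrite nE.
  have jl := allP jv l lv.
  have /negbTE-> : l != i by apply/eqP => li; rewrite li in jl; move: (ltn_trans ij jl); rewrite ltnn.
  have /negbTE-> : l != j by apply/eqP => lj; rewrite lj ltnn in jl.
  by rewrite subrr mul0rn addr0.
rewrite NP ?(lin0 (word_linear S a u _))// nE eqxx.
have /negbTE-> : j != i by apply/eqP => ji; rewrite ji ltnn in ij.
rewrite sub0r mulNrn natz; exact: int_sub_lt.
Qed.

Lemma corr_is_correlation m (a : 'rV[dV]_m) : is_correlation S a (corr S a).
Proof.
split=> [k|z cz zlt l]; first by apply: fhol_holomorphic (corr_fhol S a k); exact: conf_open.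
have zlt' (i j : 'I_m) : (i < j)%N -> nm (z 0 j) < nm (z 0 i).
  by move=> ij; rewrite -rc_lt -!nmE; exact: zlt.
have [t12 pf] := projT2 (cid (correlation_den S a)).
(* Only the last coordinate can be 0, and there creation excludes negative exponents. *)
have z0 i : z 0 i = 0 -> zero_below i (fun n => dval (word S a (enum 'I_m) vac n) l).
  move=> zi n ni; have ep := enum_pairwise m; have : i \in enum 'I_m by rewrite mem_enum.
  case: (lastP (enum 'I_m)) ep => [//|u j]; rewrite -cats1 pairwise_cat/= => /and3P[uj _ _].
  rewrite mem_cat => /orP[iu|]; last first.
    by rewrite inE => /eqP <-; rewrite cats1 word_zero_below.
  suff ij : (i < j)%N by have := zlt' i j ij; rewrite zi nm0 ltNge nm_ge0.
  by move/allrelP : uj; apply=> //; rewrite inE.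
have tr : truncated (fun n => dval (word S a (enum 'I_m) vac n) l).
  move=> i j ij q; have [k0 k0P] := word_truncated a ij q.
  by exists k0 => k kk; rewrite k0P.
have := @expansion_sum _ _ _ z _ (fun n => dval (word S a (enum 'I_m) vac n) l) zlt' t12 z0 tr.
rewrite (Lops_lin _ _ (@dval_linear _ V l)) => /(_ (pf l)) [_ /(_ tt erefl)] H.
rewrite /corr; case: asboolP => // _.
(* Passage from the exponent n of x to the mode k with n = - k - 1. *)
have hK : involutive (fun k : 'rV[int]_m => \row_i (- k 0 i - 1)).
  by move=> k; apply/rowP => i; rewrite !mxE; lia.
have := has_sum_bij hK hK H; rewrite (_ : _ \o _ = fun k : 'rV[int]_m =>
       (\prod_(i < m) z 0 i ^ (- k 0 i - 1)) *:
       dval (foldr (fun i b => mode Y (a 0 i) (k 0 i) b) vac (enum 'I_m)) l)//.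
apply/funext => k /=; congr (_ *: _).
  by apply: eq_bigr => i _; rewrite mxE.
congr (dval _ l); elim: (enum 'I_m) => [//|i s IH] /=.
by rewrite IH mxE.
Qed.

Lemma row_updE (T : Type) m (a : 'rV[T]_m) i x j : row_upd a i x 0 j = if j == i then x else a 0 j.
Proof. by rewrite mxE. Qed.

Lemma word_upd0 m (a : 'rV[dV]_m) i x s c n : i \notin s ->
  word S (row_upd a i x) s c n = word S a s c n.
Proof.
elim: s => [//|j s IH]; rewrite inE negb_or => /andP[ij si] /=.
by rewrite IH// row_updE eq_sym (negbTE ij).
Qed.

Lemma word_upd_linear m (a : 'rV[dV]_m) i s c n : uniq s -> i \in s ->
  linear (fun x => word S (row_upd a i x) s c n).
Proof.
elim: s => [//|j s IH] /andP[js us]; rewrite inE => /predU1P[->|si] k x y.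
  have F x' : word S (row_upd a j x') (j :: s) c n = Y x' (n 0 j) (word S a s c n).
    by rewrite /= word_upd0// row_updE eqxx.
  by have := Y_linl S (n 0 j) (word S a s c n) k x y; rewrite -!F.
have /negbTE ji : j != i by apply: contraNneq js => ->.
have F x' : word S (row_upd a i x') (j :: s) c n = Y (a 0 j) (n 0 j) (word S (row_upd a i x') s c n).
  by rewrite /= row_updE ji.
have := Y_linr S (a 0 j) (n 0 j) k (word S (row_upd a i x) s c n) (word S (row_upd a i y) s c n).
by rewrite -IH// -!F.
Qed.

Lemma corr_multilinear : mu_multilinear (@corr R V S).
Proof.
move=> n a i c u v z cz; apply: functional_extensionality_dep => l.
apply: corr_eq => //.
have := rat_value_lc c (corr_rat S (row_upd a i u) l cz) (corr_rat S (row_upd a i v) l cz).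
rewrite (_ : (fun n0 => _) = fun n0 => dval (word S (row_upd a i (c *: u + v)) (enum 'I_n) vac n0) l)//.
apply/funext => n0; rewrite (word_upd_linear a vac n0 (enum_uniq _) (mem_enum _ i)).
by rewrite dval_linear.
Qed.

Lemma conf_perm m (s : 'S_m) (z : 'rV[C]_m) : conf z -> conf (col_perm s z).
Proof.
move=> cz [i [j [ij]]]; rewrite !mxE => zij; apply: cz; exists (s i), (s j); split=> //.
by rewrite (inj_eq perm_inj).
Qed.

Section Relabel.
Variables (m : nat) (s : 'S_m) (X : lmodType C).
Local Notation I := 'rV[int]_m.

Lemma col_permK : cancel (col_perm s : I -> I) (col_perm s^-1%g).
Proof. by move=> n; apply/rowP => i; rewrite !mxE permKV. Qed.

Lemma col_permVK : cancel (col_perm s^-1%g : I -> I) (col_perm s).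
Proof. by move=> n; apply/rowP => i; rewrite !mxE permK. Qed.

Lemma Lops_relabel t (f : I -> X) :
  Lops (map (col_perm s) t) (fun n => f (col_perm s^-1%g n)) =
  fun n => Lops t f (col_perm s^-1%g n).
Proof.
elim: t f => [//|al t IH] f /=; rewrite -IH; congr (Lops _ _); apply/funext => n.
rewrite /Lop (reindex_inj (@perm_inj _ s^-1%g))/=; apply: eq_bigr => i _.
rewrite mxE permKV; congr (_ *: f _); apply/rowP => j; rewrite !mxE !eqxx/=.
by rewrite (inj_eq perm_inj).
Qed.

Lemma lform_relabel al z : lform (col_perm s al) (col_perm s z) = lform al z :> C.
Proof.
rewrite /lform [RHS](reindex_inj (@perm_inj _ s))/=; apply: eq_bigr => i _.
by rewrite !mxE.
Qed.

Lemma evalf_relabel (f : I -> X) z : fin_fam f ->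
  evalf (fun n => f (col_perm s^-1%g n)) (col_perm s z) = evalf f z.
Proof.
move=> [A fA]; rewrite (evalfE z fA) (@evalfE _ _ _ _ _ [fset col_perm s n | n in A]%fset); last first.
  move=> n nA; apply: fA; apply: contraNN nA => nA.
  by apply/imfsetP; exists (col_perm s^-1%g n) => //; rewrite col_permVK.
rewrite big_imfset/=; last by move=> x y _ _; exact: (can_inj col_permK).
apply: eq_bigr => n _; rewrite col_permK; congr (_ *: _).
rewrite /monom [RHS](reindex_inj (@perm_inj _ s))/=; apply: eq_bigr => i _.
by rewrite !mxE.
Qed.

Lemma rat_value_relabel (f : I -> X) z v : rat_value f z v ->
  rat_value (fun n => f (col_perm s^-1%g n)) (col_perm s z) v.
Proof.
move=> [t [t0 pt ->]]; exists (map (col_perm s) t).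
have tE : lforms (map (col_perm s) t) (col_perm s z) = lforms t z.
  by rewrite /lforms big_map; apply: eq_bigr => al _; exact: lform_relabel.
rewrite tE Lops_relabel; split=> //.
  case: pt => [[A fA] f0]; split; last first.
    by move=> i n ni; apply: (f0 (s i)); rewrite mxE permK.
  exists [fset col_perm s n | n in A]%fset => n nA; apply: fA; apply: contraNN nA => nA.
  by apply/imfsetP; exists (col_perm s^-1%g n) => //; rewrite col_permVK.
by rewrite evalf_relabel//; case: pt.
Qed.

End Relabel.

(** By locality the words in the original and in the permuted order have the same rational values,
    and relabelling the variables turns the second one into the word of the permuted data. *)
Lemma corr_permutation : mu_permutation (@corr R V S).
Proof.
move=> m s a z cz; apply: functional_extensionality_dep => l.
apply: corr_eq; first exact: conf_perm.
have un : uniq (map s (enum 'I_m)) by rewrite map_inj_uniq ?enum_uniq//; exact: perm_inj.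
have pe : perm_eq (enum 'I_m) (map s (enum 'I_m)).
  apply: uniq_perm => //; first exact: enum_uniq.
  move=> i; rewrite mem_enum; apply/esym/mapP; exists (s^-1%g i); first by rewrite mem_enum.
  by rewrite permKV.
have [t [t12 tE]] := word_perm S a vac (enum_uniq _) pe.
have tE' : Lops (map (pdiff R (m := m)) t) (fun n => dval (word S a (enum 'I_m) vac n) l) =
    Lops (map (pdiff R (m := m)) t) (fun n => dval (word S a (map s (enum 'I_m)) vac n) l).
  by rewrite !(Lops_lin _ _ (@dval_linear _ V l)) tE.
have := rat_value_eqv (lforms_pdiff_neq0 t12 cz) tE' (corr_rat S a l cz).
move=> /(rat_value_relabel s).
rewrite (_ : (fun n => _) = fun n => dval (word S (col_perm s a) (enum 'I_m) vac n) l)//.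
apply/funext => n; congr (dval _ l); elim: (enum 'I_m) => [//|i r IH] /=.
by rewrite IH !mxE permK.
Qed.

Lemma evalf_at0 m (X : lmodType C) (f : 'rV[int]_m -> X) : poly_fam f -> evalf f 0 = f 0.
Proof.
move=> [[A fA] f0]; have fA' n : n \notin (0 |` A)%fset -> f n = 0.
  by rewrite inE negb_or => /andP[_]; exact: fA.
rewrite (evalfE _ fA') (big_fsetD1 0)/=; last exact: fset1U1.
rewrite big1_fset ?addr0; last first.
  move=> n; rewrite !inE => /andP[n0 _] _.
  have [i ni] : exists i, n 0 i != 0.
    apply: contrapT => /forallNP H; move/eqP: n0; apply; apply/rowP => i; rewrite mxE.
    by apply/eqP; rewrite -[_ == _]negbK; apply/negP; exact: H.
  by rewrite /monom (bigD1 i)//= mxE exp0rz (negbTE ni) mul0r scale0r.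
by rewrite /monom big1 ?scale1r// => i _; rewrite !mxE.
Qed.

Lemma enum_I1 : enum 'I_1 = [:: ord0].
Proof. by rewrite enum_ordSl enum_ord0. Qed.

Lemma conf1 (z : 'rV[C]_1) : conf z.
Proof. by move=> [i [j [ij _]]]; rewrite !ord1 eqxx in ij. Qed.

Lemma corr_insertion : mu_insertion (@corr R V S).
Proof.
move=> a; apply: functional_extensionality_dep => l; rewrite /mu1.
apply: corr_eq; first exact: conf1.
have pf : poly_fam (fun n => dval (word S (const_mx a : 'rV_1) (enum 'I_1) vac n) l).
  have [k kP] := word_degree_ge S (const_mx a : 'rV_1).
  apply: poly_fam_degree kP _ => i n ni; rewrite enum_I1/= !mxE.
  by rewrite (vY_creation S a).2//; move: ni; rewrite ord1.
exists [::]; split; [by rewrite /lforms big_nil oner_neq0|exact: pf|].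
rewrite /lforms big_nil invr1 scale1r (_ : const_mx 0 = 0)// evalf_at0//.
by rewrite enum_I1/= !mxE (vY_creation S a).1.
Qed.

Lemma dmap_linear (z : C) : linear (dmap (cact V z)).
Proof. by move=> c u v; apply: dsum_eq => l; exact: (gfun_linear (cact V z) c (dval u l) (dval v l)). Qed.

Lemma dmap_homogeneous z k (a : dV) : homogeneous k a -> dmap (cact V z) a = z ^ k *: a.
Proof.
move=> ha; apply: dsum_eq => l; rewrite -[LHS]/(z ^ l *: dval a l) -[RHS]/(z ^ k *: dval a l).
by have [->//|lk] := eqVneq l k; rewrite ha// !scaler0.
Qed.

Lemma Y_equivariant z n a b : z != 0 ->
  dmap (cact V z) (Y a n b) = z ^ n *: Y (dmap (cact V z) a) n (dmap (cact V z) b).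
Proof.
move=> z0; rewrite (Y_decomp S a n b) {3}[a]dsum_decomp {3}[b]dsum_decomp.
have dl := dmap_linear z.
rewrite (linear_sumf _ _ dl) (linear_sumf _ _ dl) (linear_sumf _ _ (Y_linl S n _)) scaler_sumr.
apply: eq_bigr => d _; rewrite !(linear_sumf _ _ dl) (linear_sumf _ _ (Y_linr S _ n)) scaler_sumr.
apply: eq_bigr => e _; rewrite !(dmap_homogeneous z (@dinj_homogeneous _ _ _ _)).
rewrite (dmap_homogeneous z (@Y_homogeneous _ _ S d e n _ _ (@dinj_homogeneous _ _ _ _) (@dinj_homogeneous _ _ _ _))).
rewrite (linZ (Y_linl S n _)) (linZ (Y_linr S _ n)) !scalerA; congr (_ *: _).
by rewrite !expfzDr// mulrC mulrA.
Qed.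

Lemma word_equivariant m (a : 'rV[dV]_m) z n : z != 0 ->
  dmap (cact V z) (word S a (enum 'I_m) vac n) =
  z ^ total_deg n *: word S (map_mx (dmap (cact V z)) a) (enum 'I_m) vac n.
Proof.
move=> z0; rewrite /total_deg -[index_enum _]enumT; elim: (enum 'I_m) => [|i s IH].
  by rewrite big_nil (dmap_homogeneous _ (vvac_degree S)).
rewrite /= Y_equivariant// IH (linZ (Y_linr S _ _)) scalerA big_cons expfzDr//.
by rewrite mxE.
Qed.

(** Replacing w by z w multiplies the monomial of exponent n by z to the power |n|, which the
    rescaled coefficients compensate. *)
Lemma rat_value_scale m (X : lmodType C) (f : 'rV[int]_m -> X) (z : C) w v : z != 0 ->
  rat_value f w v -> rat_value (fun n => z ^ (- total_deg n) *: f n) (z *: w) v.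
Proof.
move=> z0 [t [t0 pt ->]].
have LE t' (f' : 'rV[int]_m -> X) : Lops t' (fun n => z ^ (- total_deg n) *: f' n) =
    fun n => z ^+ size t' *: (z ^ (- total_deg n) *: Lops t' f' n).
  elim: t' f' => [|al t' IH] f' /=; first by apply/funext => n; rewrite scale1r.
  rewrite (_ : Lop al _ = fun n => z *: (z ^ (- total_deg n) *: Lop al f' n) + 0); last first.
    apply/funext => n; rewrite addr0 /Lop !scaler_sumr; apply: eq_bigr => i _.
    rewrite total_unit opprB addrC expfzDr// expr1z !scalerA; congr (_ *: _).
    by rewrite [RHS]mulrC [_ * z]mulrC.
  rewrite Lops_lc IH Lops0; apply/funext => n; by rewrite addr0 !scalerA exprS.
have lE al : lform al (z *: w) = z * lform al w.
  by rewrite /lform mulr_sumr; apply: eq_bigr => i _; rewrite mxE mulrCA.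
have lsE t' : lforms t' (z *: w) = z ^+ size t' * lforms t' w.
  elim: t' => [|al t' IH]; first by rewrite /lforms !big_nil mul1r.
  by rewrite /lforms !big_cons -/(lforms _ _) IH lE exprS mulrACA.
case: (pt) => [[A fA] f0].
have fin' : fin_fam (fun n => z ^ (- total_deg n) *: Lops t f n).
  by exists A => n nA; rewrite fA// scaler0.
have zt : z ^+ size t != 0 by rewrite expf_neq0.
exists t; rewrite lsE LE; split; first by rewrite mulf_neq0.
  split; last by move=> i n ni; rewrite (f0 i)// !scaler0.
  by exists A => n nA; rewrite fA// !scaler0.
have -> : evalf (fun n => z ^+ size t *: (z ^ (- total_deg n) *: Lops t f n)) (z *: w) =
    z ^+ size t *: evalf (Lops t f) w.
  rewrite (@evalfE _ _ _ _ _ A); last by move=> n nA; rewrite fA// !scaler0.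
  rewrite (evalfE _ fA) scaler_sumr; apply: eq_bigr => n _; rewrite !scalerA; congr (_ *: _).
  have -> : monom (z *: w) n = z ^ total_deg n * monom w n.
    rewrite /monom /total_deg; under eq_bigr => i _ do rewrite mxE expfzMl.
    rewrite big_split/=; congr (_ * _); rewrite (big_morph (fun k => z ^ k) (id1 := 1) (op1 := *%R))//.
    by move=> x y; rewrite expfzDr.
  have zz : z ^ total_deg n * z ^ (- total_deg n) = 1 by rewrite -expfzDr// addrN.
  by rewrite mulrAC [_ * _ * z ^ (- _)]mulrAC zz mul1r mulrC.
rewrite scalerA; congr (_ *: _).
by rewrite invfM mulrAC mulVf// mul1r.
Qed.

Lemma conf_scale m (z : C) (w : 'rV[C]_m) : z != 0 -> conf w -> conf (z *: w).
Proof.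
move=> z0 cw [i [j [ij]]]; rewrite !mxE => /(mulfI z0) wij; apply: cw; by exists i, j.
Qed.

Lemma corr_equivariance : mu_equivariance (@corr R V S).
Proof.
move=> m z a w z0 cw; apply/esym/functional_extensionality_dep => l.
apply: corr_eq; first exact: conf_scale.
have := rat_value_lin (@cact_subproof R V z l) (rat_value_scale z0 (corr_rat S a l cw)).
rewrite (_ : (fun n => _) = fun n => dval (word S (map_mx (dmap (cact V z)) a) (enum 'I_m) vac n) l)//.
apply/funext => n; have := congr1 (fun b => dval b l) (word_equivariant a n z0).
rewrite -[X in X = _]/(z ^ l *: dval (word S a (enum 'I_m) vac n) l) scalerA mulrC -scalerA => ->.
rewrite -[X in _ *: X]/(z ^ total_deg n *: dval _ l) scalerA -expfzDr// addNr.
by rewrite scale1r.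
Qed.

Lemma pair_conf (z : C) : z != 0 -> conf (row_mx (const_mx z : 'rV_1) (const_mx 0 : 'rV_1)).
Proof.
move=> z0 [i [j [ij]]]; rewrite !mxE.
case: (fintype.split i) (splitK i) => k iE; case: (fintype.split j) (splitK j) => k' jE; rewrite !mxE ?ord1.
- by move: ij; rewrite -iE -jE !ord1 eqxx.
- by move/eqP; rewrite (negbTE z0).
- by move/esym/eqP; rewrite (negbTE z0).
- by move: ij; rewrite -iE -jE !ord1 eqxx.
Qed.

Lemma row_pair_differentiable (w : C) z :
  differentiable ((fun z : C => row_mx (const_mx z : 'rV_1) (const_mx w : 'rV_1)) : C^o -> 'rV[C]_(1 + 1)) z.
Proof.
rewrite (_ : (fun z : C => _) = fun z : C^o => z *: row_mx (const_mx 1) (const_mx 0) + row_mx (const_mx 0) (const_mx w)).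
  by apply: differentiableD; [exact: differentiableZl|exact: differentiable_cst].
apply/funext => y; rewrite scale_row_mx add_row_mx.
by congr row_mx; apply/rowP => i; rewrite !mxE ?mulr1 ?mulr0 ?addr0 ?add0r.
Qed.

Lemma corr_meromorphicity : mu_meromorphicity (@corr R V S).
Proof.
move=> a b; pose ab := row_mx (const_mx a : 'rV[dV]_1) (const_mx b : 'rV[dV]_1).
have [t12 pf] := projT2 (cid (correlation_den S ab)).
set t := projT1 _ in t12 pf.
(* For two points every factor of the denominator is x_1 - x_2, which is z at (z, 0). The
   holomorphic extension is the polynomial numerator. *)
exists (size t)%:Z, (fun z l => evalf (fun n => dval (Lops (corr_den S ab) (word S ab (enum 'I_(1 + 1)) vac) n) l)
   (row_mx (const_mx z) (const_mx 0))); split=> [l|z z0].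
  apply: fhol_holomorphic; first exact: openT.
  apply: (@fhol_comp _ _ _ setT _ (fun z : C^o => row_mx (const_mx z : 'rV_1) (const_mx 0 : 'rV_1))).
  - by [].
  - by move=> z _; exact: row_pair_differentiable.
  - exact: evalf_fhol (pf l).
apply: functional_extensionality_dep => l.
rewrite -[RHS]/(z ^ _ *: corr S ab (row_mx (const_mx z) (const_mx 0)) l).
rewrite /corr; case: asboolP => [dz|_]; first by case: (pair_conf z0).
rewrite scalerA (_ : _ * _ = 1) ?scale1r//.
suff -> : lforms (corr_den S ab) (row_mx (const_mx z) (const_mx 0)) = z ^+ size t.
  by rewrite mulfV// expf_neq0.
rewrite /corr_den -/t; elim: t t12 {pf} => [|[i j] t IH] /= => [_|/andP[ij tP]].
  by rewrite /lforms big_nil.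
rewrite /lforms big_cons -/(lforms _ _) IH// exprS lform_pdiff; congr (_ * _).
have i0 : i = lshift 1 ord0 by apply: val_inj; case: i ij => [[|[|]]//=]; case: j => [[|[|]]//=].
have j1 : j = rshift 1 ord0 by apply: val_inj; case: i ij {i0} => [[|[|]]//=]; case: j => [[|[|]]//=].
by rewrite i0 j1 row_mxEl row_mxEr !mxE subr0.
Qed.

End CorrelationFunctions.

(** * Taylor expansion along the diagonal direction and translation covariance *)

Section Taylor.
Variables (R : realType) (m : nat).
Local Notation C := (Cx R).
Local Notation I := 'rV[int]_m.

(* The derivation [\sum_i d/dx_i] of the formal series [\sum_n f n x^n]. *)
Definition dop (X : lmodType C) (f : I -> X) : I -> X := fun n =>
  \sum_(i < m) (n 0 i + 1)%:~R *: f (n + unit_row i).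

Lemma dop_lin (X Y : lmodType C) (g : X -> Y) (f : I -> X) : linear g ->
  dop (fun n => g (f n)) = fun n => g (dop f n).
Proof. by move=> gl; apply/funext => n; rewrite /dop (lin_sum gl). Qed.

(** The derivation annihilates a linear form whose coefficients sum to 0, in particular a difference
    of variables, so it commutes with multiplication by that form. *)
Lemma Lop_dop (X : lmodType C) (f : I -> X) (al : 'rV[C]_m) : \sum_(i < m) al 0 i = 0 ->
  Lop al (dop f) = dop (Lop al f).
Proof.
move=> al0; apply/funext => n; rewrite /Lop /dop.
under eq_bigr => i _ do rewrite scaler_sumr.
under [RHS]eq_bigr => i _ do rewrite scaler_sumr.
rewrite [RHS]exchange_big/=.
have E : \sum_(i < m) \sum_(k < m) (al 0 i * (k == i)%:R) *: f n = 0.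
  transitivity (\sum_(i < m) al 0 i *: f n); last by rewrite -scaler_suml al0 scale0r.
  apply: eq_bigr => i _; rewrite (bigD1 i)//= eqxx mulr1 big1 ?addr0// => k /negbTE->.
  by rewrite mulr0 scale0r.
rewrite -[LHS]addr0 -[X in _ + X]E -big_split/=; apply: eq_bigr => i _.
rewrite -big_split/=; apply: eq_bigr => k _.
have -> : n - unit_row i + unit_row k = n + unit_row k - unit_row i by rewrite addrAC.
rewrite scalerA.
have -> : ((n - unit_row i) 0 k + 1)%:~R = (n 0 k + 1)%:~R - (k == i)%:R :> C.
  by rewrite mxE [X in _ + X + _]mxE unit_rowE addrAC intrB; case: (k == i).
rewrite scalerA; have [->|ki] := eqVneq k i.
  by rewrite addrK -scalerDl mulrC; congr (_ *: _); ring.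
by rewrite mulr0 scale0r addr0 subr0 mulrC.
Qed.

Lemma Lops_dop (X : lmodType C) (f : I -> X) (t : seq ('I_m * 'I_m)) :
  Lops (map (pdiff R (m := m)) t) (dop f) = dop (Lops (map (pdiff R (m := m)) t) f).
Proof.
elim: t f => [//|p t IH] f /=; rewrite Lop_dop ?IH//.
under eq_bigr => k _ do rewrite mxE.
rewrite sumrB (bigD1 p.1)//= (bigD1 (P := xpredT) p.2)//= !eqxx.
by rewrite !big1 ?addr0 ?subrr// => k /negbTE->.
Qed.

Lemma poly_fam_dop (X : lmodType C) (f : I -> X) : poly_fam f -> poly_fam (dop f).
Proof.
move=> [[A fA] f0]; split; last first.
  move=> i n ni; rewrite /dop big1// => k _; have [ki|ki] := eqVneq k i.
    rewrite ki; have [->|n1] := eqVneq (n 0 i) (-1); first by rewrite addNr scale0r.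
    by rewrite (f0 i) ?scaler0// mxE unit_rowE eqxx /=; lia.
  by rewrite (f0 i) ?scaler0// mxE unit_rowE eq_sym (negbTE ki) addr0.
have := @fin_fam_sum R m X 'I_m (index_enum _) (fun=> 1) (fun i n => (n 0 i + 1)%:~R *: f (n + unit_row i)).
case=> [i|B BP]; last first.
  by exists B => n /BP nB; rewrite -[RHS]nB /dop; apply: eq_bigr => i _; rewrite scale1r.
have [B BP] : fin_fam (fun n : I => f (n - (- unit_row i))) by apply: fin_fam_shift; exists A.
by exists B => n /BP; rewrite opprK => ->; rewrite scaler0.
Qed.

Lemma deriv_prod_seq (s : seq 'I_m) (q : 'I_m -> {poly C}) : uniq s ->
  (\prod_(i <- s) q i)^`() = \sum_(i <- s) (q i)^`() * \prod_(j <- s | j != i) q j.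
Proof.
elim: s => [|x s IH] /=; first by rewrite !big_nil derivC.
move=> /andP[xs us]; rewrite !big_cons derivM IH// eqxx /=; congr (_ * _ + _).
  rewrite [RHS]big_seq_cond [LHS]big_seq; apply: eq_bigl => j.
  by case: (boolP (j \in s)) => // js; rewrite /= (memPn xs).
rewrite mulr_sumr big_seq [RHS]big_seq; apply: eq_bigr => i is_.
by rewrite big_cons eq_sym (memPn xs)// mulrCA.
Qed.

Variable z : 'rV[C]_m.

(** The monomial of exponent [n] at z + (u, ..., u), as a polynomial in u; it is meant for
    nonnegative exponents. *)
Definition monom_line (n : I) : {poly C} := \prod_(i < m) ('X + (z 0 i)%:P) ^+ absz (n 0 i).

Lemma monom_line_horner (n : I) u : (forall i, 0 <= n 0 i) -> (monom_line n).[u] = monom (z + const_mx u) n.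
Proof.
move=> n0; rewrite /monom_line horner_prod; apply: eq_bigr => i _.
rewrite horner_exp hornerD hornerX hornerC !mxE addrC.
by case: (n 0 i) (n0 i).
Qed.

Lemma absz_pred (x : int) : 0 <= x -> x != 0 -> (absz x).-1 = absz (x - 1).
Proof. lia. Qed.

Lemma deriv_monom_line (n : I) : (forall i, 0 <= n 0 i) ->
  (monom_line n)^`() = \sum_(i < m) (n 0 i)%:~R *: monom_line (n - unit_row i).
Proof.
move=> n0; rewrite /monom_line deriv_prod_seq ?index_enum_uniq//; apply: eq_bigr => i _.
rewrite deriv_exp derivD derivX derivC addr0 mul1r.
have [ni|ni] := eqVneq (n 0 i) 0; first by rewrite ni/= mulr0n mul0r scale0r.
rewrite [in RHS](bigD1 i)//= -scaler_nat -scalerAl.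
have -> : (n 0 i)%:~R = (absz (n 0 i))%:R :> C by case: (n 0 i) (n0 i).
congr (_ *: (_ * _)).
  congr (_ ^+ _); rewrite mxE [X in _ + X]mxE unit_rowE eqxx.
  exact: absz_pred.
apply: eq_bigr => j /negbTE ji; congr (_ ^+ _).
by rewrite mxE [X in _ + X]mxE unit_rowE ji subr0.
Qed.

Definition line_poly (g : I -> C^o) : {poly C} := \sum_(n \in [set: I]) g n *: monom_line n.

Lemma line_polyE (g : I -> C^o) (A : {fset I}) : (forall n, n \notin A -> g n = 0) ->
  line_poly g = \sum_(n <- A) g n *: monom_line n.
Proof. by move=> gA; rewrite /line_poly (fsbigTE A)// => n nA; rewrite gA// scale0r. Qed.

Lemma line_poly_horner (g : I -> C^o) u : poly_fam g -> (line_poly g).[u] = evalf g (z + const_mx u).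
Proof.
move=> [[A gA] g0]; rewrite (line_polyE gA) (evalfE _ gA) horner_sum; apply: eq_bigr => n _.
rewrite hornerZ; have [n0|/existsNP[i /negP n0]] := pselect (forall i, 0 <= n 0 i).
  by rewrite monom_line_horner// mulrC.
by rewrite (g0 i) ?scaler0 ?mul0r// ltNge.
Qed.

Lemma deriv_line_poly (g : I -> C^o) : poly_fam g -> (line_poly g)^`() = line_poly (dop g).
Proof.
move=> pg; case: (pg) => [[A gA] g0].
have [[B BP] d0] := poly_fam_dop pg.
pose D := (A `|` B `|` \bigcup_(i <- enum 'I_m) [fset (n - unit_row i)%R | n in A])%fset.
have AD n : n \notin D -> n \notin A by apply: contraNN => nA; rewrite !inE nA.
have BD n : n \notin D -> n \notin B by apply: contraNN => nA; rewrite !inE nA orbT.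
have SD n i : n \in A -> n - unit_row i \in D.
  move=> nA; rewrite inE; apply/orP; right; apply/bigfcupP; exists i; rewrite ?mem_enum//.
  by apply/imfsetP; exists n.
rewrite (line_polyE gA) (line_polyE (A := D)); last by move=> n /BD /BP.
rewrite linear_sum/=.
under [RHS]eq_bigr => n _ do rewrite /dop scaler_suml.
rewrite [RHS]exchange_big/=.
have E i : \sum_(n <- D) ((n 0 i + 1)%:~R *: g (n + unit_row i)) *: monom_line n =
    \sum_(n <- A) (n 0 i)%:~R *: (g n *: monom_line (n - unit_row i)).
  have -> : \sum_(n <- A) (n 0 i)%:~R *: (g n *: monom_line (n - unit_row i)) =
      \sum_(k <- [fset (n - unit_row i)%R | n in A]%fset)
        (k 0 i + 1)%:~R *: (g (k + unit_row i) *: monom_line k).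
    rewrite big_imfset/=; last by move=> x y _ _; apply: addIr.
    apply: eq_bigr => n _; rewrite subrK; congr (_%:~R *: _).
    by rewrite mxE [X in _ + X + _]mxE unit_rowE eqxx subrK.
  apply/esym; under [RHS]eq_bigr => n _ do rewrite -scalerA.
  apply: big_fset_incl; first by apply/fsubsetP => k /imfsetP[n nA ->]; exact: SD.
  move=> k _ kA; rewrite gA ?scale0r ?scaler0//; apply: contraNN kA => kA.
  by apply/imfsetP; exists (k + unit_row i); rewrite ?addrK.
under [RHS]eq_bigr => i _ do rewrite E.
rewrite exchange_big/=; apply: eq_bigr => n _; rewrite derivZ.
have [n0|/existsNP[i /negP n0]] := pselect (forall i, 0 <= n 0 i); last first.
  have gn : g n = 0 by apply: (g0 i); rewrite ltNge.
  by rewrite gn scale0r big1// => j _; rewrite scale0r scaler0.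
rewrite deriv_monom_line// scaler_sumr; apply: eq_bigr => i _.
by rewrite !scalerA mulrC.
Qed.

Lemma iter_deriv_line_poly (g : I -> C^o) j : poly_fam g ->
  poly_fam (iter j (@dop C^o) g) /\ (line_poly g)^`(j) = line_poly (iter j (@dop C^o) g).
Proof.
move=> pg; elim: j => [//|j [pj dj]]; split; first exact: poly_fam_dop.
by rewrite derivnS dj deriv_line_poly.
Qed.

Lemma line_poly_taylor (g : I -> C^o) J u : poly_fam g -> (size (line_poly g) <= J)%N ->
  evalf g (z + const_mx u) = \sum_(j < J) (u ^+ j / j`!%:R) *: evalf (iter j (@dop C^o) g) z.
Proof.
move=> pg gJ; rewrite -line_poly_horner// -[u in LHS]add0r.
rewrite (nderiv_taylor_wide (mulrC _ _) gJ).
apply: eq_bigr => j _; have [pj dj] := iter_deriv_line_poly j pg.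
have := line_poly_horner 0 pj; rewrite (_ : z + const_mx 0 = z); last by rewrite addr0.
move=> <-; rewrite -dj nderivn_def hornerMn.
have j0 : (j`!%:R : C) != 0 by rewrite pnatr_eq0 -lt0n fact_gt0.
transitivity ((u ^+ j / j`!%:R) * ((line_poly g)^`N(j).[0] * j`!%:R)); last by rewrite mulr_natr.
by rewrite mulrCA divfK.
Qed.

End Taylor.

Section Taylor2.
Variables (R : realType) (m : nat).
Local Notation C := (Cx R).
Local Notation I := 'rV[int]_m.

Lemma iter_dop_lin (X Y : lmodType C) (g : X -> Y) j (f : I -> X) : linear g ->
  iter j (@dop R m Y) (fun n => g (f n)) = fun n => g (iter j (@dop R m X) f n).
Proof. by move=> gl; elim: j => [//|j IH]; rewrite !iterS IH (dop_lin _ gl). Qed.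

Lemma iter_dop_poly (X : lmodType C) j (f : I -> X) : poly_fam f -> poly_fam (iter j (@dop R m X) f).
Proof. by move=> pf; elim: j => [//|j IH]; exact: poly_fam_dop. Qed.

(** The scalar Taylor formula on each functional. The bound [J0] comes from the monomials in the
    support, so one bound serves all functionals. *)
Lemma evalf_taylor (X : lmodType C) (f : I -> X) z : poly_fam f -> exists J0, forall J u, (J0 <= J)%N ->
  evalf f (z + const_mx u) = \sum_(j < J) (u ^+ j / j`!%:R) *: evalf (iter j (@dop R m X) f) z.
Proof.
move=> pf; case: (pf) => [[A fA] _].
exists (\max_(n <- A) size (monom_line z n)) => J u AJ; apply: functional_ext => phi.
have pl : linear (phi : X -> C^o) by move=> c x y; rewrite linearP.
have pp : poly_fam (fun n => phi (f n) : C^o) by exact: poly_fam_lin pl pf.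
have sJ : (size (line_poly z (fun n => phi (f n) : C^o)) <= J)%N.
  rewrite (@line_polyE _ _ _ _ A); last by move=> n nA; rewrite fA// (lin0 pl).
  rewrite big_seq; elim/big_ind : _ => [|p q pJ qJ|n nA]; first by rewrite size_poly0.
    by apply: leq_trans (size_polyD _ _) _; rewrite geq_max pJ.
  apply: leq_trans (size_scale_leq _ _) _; apply: leq_trans AJ.
  exact: (@leq_bigmax_seq _ _ xpredT (fun n => size (monom_line z n))).
rewrite -(evalf_lin _ pl (proj1 pf)) (line_poly_taylor _ pp sJ).
rewrite (lin_sum pl); apply: eq_bigr => j _; congr (_ *: _).
by rewrite (iter_dop_lin _ _ pl) (evalf_lin _ pl (proj1 (iter_dop_poly j pf))).
Qed.

End Taylor2.

Section Translation.
Variables (R : realType) (V : graded R) (S : vertexVA V).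
Local Notation C := (Cx R).
Local Notation dV := (dsum V).
Local Notation Y := (vY S).
Local Notation T := (vT S).
Local Notation vac := (vvac S).

Lemma iterT_linear j : linear (iter j T).
Proof. by elim: j => [//|j IH] c u v; rewrite !iterS IH vT_linear. Qed.

Lemma iterT_homogeneous j d a : homogeneous d a -> homogeneous (d + j%:Z) (iter j T a).
Proof.
move=> ha; elim: j => [|j IH]; first by rewrite addr0.
have -> : d + j.+1%:Z = d + j%:Z + 1 by lia.
by rewrite iterS; exact: vT_degree.
Qed.

(** The j-th power of T between single components. It can be applied to elements of the product, on
    which [vT S] is not defined. *)
Definition Tpow j l (v : V (l - j%:Z)) : V l := dval (iter j T (dinj v)) l.

Lemma Tpow_linear j l : linear (@Tpow j l).
Proof. by move=> c u v; rewrite /Tpow dinj_linear iterT_linear. Qed.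

Lemma TpowE j l a : dval (iter j T a) l = Tpow (dval a (l - j%:Z)).
Proof.
rewrite {1}[a]dsum_decomp (linear_sumf _ _ (iterT_linear j)) dval_sum.
have off d : d != l - j%:Z -> dval (iter j T (dinj (dval a d))) l = 0.
  move=> dl; have /(_ l) := @iterT_homogeneous j _ _ (@dinj_homogeneous _ _ _ (dval a d)); apply.
  by apply: contraNneq dl => ->; rewrite addrK.
have [la|la] := boolP (l - j%:Z \in dsupp a).
  rewrite (big_fsetD1 _ la) big1_fset ?[LHS]addr0// => d; rewrite !inE => /andP[dl _] _.
  exact: off.
rewrite big1_fset; last by move=> d da _; apply: off; apply: contraNneq la => <-.
by rewrite (dsupp_out la) (lin0 (@Tpow_linear j l)).
Qed.

Lemma T_word m (a : 'rV[dV]_m) s n : uniq s -> T (word S a s vac n) =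
  \sum_(i <- s) (n 0 i + 1)%:~R *: word S a s vac (n + unit_row i).
Proof.
elim: s => [_|i s IH /= /andP[is_ us]]; first by rewrite big_nil; exact: (vY_translation S).1.
have := (vY_translation S).2 (a 0 i) (word S a s vac n) (n 0 i).
move/eqP; rewrite subr_eq => /eqP ->; rewrite big_cons; congr (_ + _).
  rewrite mxE unit_rowE eqxx; congr (_ *: Y _ _ _); apply: word_ext => j js.
  rewrite mxE unit_rowE; case: eqP => [ji|]; last by rewrite addr0.
  by rewrite ji (negbTE is_) in js.
rewrite IH// (lin_sum (Y_linr S _ _)) big_seq [RHS]big_seq; apply: eq_bigr => j js.
rewrite mxE unit_rowE; case: eqP => [ij|]; last by rewrite addr0.
by rewrite -ij (negbTE is_) in js.
Qed.

Section Fixed.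
Variables (m : nat) (a : 'rV[dV]_m).

Lemma dop_word : dop (word S a (enum 'I_m) vac) = fun n => T (word S a (enum 'I_m) vac n).
Proof. by apply/funext => n; rewrite T_word ?enum_uniq// big_enum. Qed.

Let F := Lops (corr_den S a) (word S a (enum 'I_m) vac).

Lemma iter_dop_corr j : iter j (@dop R m dV) F = fun n => iter j T (F n).
Proof.
elim: j => [//|j IH]; rewrite iterS IH (dop_lin _ (iterT_linear j)) /F /corr_den -Lops_dop.
apply/funext => n; rewrite dop_word (Lops_lin _ _ (vT_linear S)) -iterSr.
by [].
Qed.

Lemma lforms_pdiff_shift t z u :
  lforms (map (pdiff R (m := m)) t) (z + const_mx u) = lforms (map (pdiff R (m := m)) t) z.
Proof.
rewrite /lforms !big_map; apply: eq_bigr => -[i j] _; rewrite !lform_pdiff !mxE.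
by rewrite opprD addrACA subrr addr0.
Qed.

Lemma conf_shift z u : conf z -> conf (z + const_mx u : 'rV[C]_m).
Proof.
by move=> cz [i [j [ij]]]; rewrite !mxE => /addIr zij; apply: cz; exists i, j.
Qed.

(** This is exp(uT) in degree [l]. The denominator is invariant under translation and the numerator
    is polynomial, so the sum is finite; any length from [J0] on is allowed, which lets expansions
    of different lengths be matched. *)
Lemma corr_translate z l : conf z -> exists J0, forall J u, (J0 <= J)%N ->
  corr S a (z + const_mx u) l = \sum_(j < J) (u ^+ j / j`!%:R) *: Tpow (corr S a z (l - j%:Z)).
Proof.
move=> cz; have [_ pf] := projT2 (cid (correlation_den S a)).
have [J0 JP] := evalf_taylor z (pf l); exists J0 => J u JJ.
rewrite /corr; case: asboolP => [|_]; first by move=> dz; case: (@conf_shift z u cz dz).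
rewrite lforms_pdiff_shift (JP J u JJ) scaler_sumr; apply: eq_bigr => j _.
case: asboolP => // _; rewrite (linZ (@Tpow_linear _ _)) !scalerA [X in X *: _]mulrC.
congr (_ *: _).
rewrite (iter_dop_lin _ _ (@dval_linear _ V l)) -[Lops _ _]/F iter_dop_corr.
rewrite -(evalf_lin _ (@Tpow_linear _ _)); last by case: (pf (l - j%:Z)).
by congr evalf; apply/funext => n; rewrite TpowE.
Qed.

End Fixed.
End Translation.

(** * Associativity of the correlation functions *)
Section TwoGroups.
Variables (R : realType) (m n : nat).
Local Notation C := (Cx R).
Local Notation pd := (pdiff R (m := m + n)).

Lemma unit_row_lshift (i : 'I_m) : unit_row (lshift n i) = row_mx (unit_row i) 0.
Proof.
apply/rowP => k; rewrite unit_rowE mxE; case: splitP => j kj.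
  by rewrite unit_rowE -val_eqE/= kj val_eqE.
by rewrite mxE -val_eqE/= kj; case: eqP => // e; have := ltn_ord i; lia.
Qed.

Lemma unit_row_rshift (j : 'I_n) : unit_row (rshift m j) = row_mx 0 (unit_row j).
Proof.
apply/rowP => k; rewrite unit_rowE mxE; case: splitP => j' kj.
  by rewrite mxE -val_eqE/= kj; case: eqP => // e; have := ltn_ord j'; lia.
by rewrite unit_rowE -val_eqE/= kj eqn_add2l val_eqE.
Qed.

Section Ops.
Variable X : lmodType C.
Implicit Types (G : 'rV[int]_(m + n) -> X) (V : 'rV[int]_n -> X) (z : 'rV[C]_m).

Lemma Lop_row al G p q : Lop al G (row_mx p q) =
  \sum_(i < m) al 0 (lshift n i) *: G (row_mx (p - unit_row i) q) +
  \sum_(j < n) al 0 (rshift m j) *: G (row_mx p (q - unit_row j)).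
Proof.
rewrite /Lop big_split_ord/=; congr (_ + _); apply: eq_bigr => i _; congr (_ *: G _).
  by rewrite unit_row_lshift opp_row_mx add_row_mx subr0.
by rewrite unit_row_rshift opp_row_mx add_row_mx subr0.
Qed.

(* Multiplication by a linear form in which the first group of variables has
   been evaluated at [z]. *)
Definition Mop (al : 'rV[C]_(m + n)) z V : 'rV[int]_n -> X := fun q =>
  (\sum_(i < m) al 0 (lshift n i) * z 0 i) *: V q +
  \sum_(j < n) al 0 (rshift m j) *: V (q - unit_row j).

Definition Mops t z V := foldl (fun V al => Mop al z V) V t.

Lemma rat_value_Mop al G z V :
  (forall q, rat_value (fun p => G (row_mx p q)) z (V q)) ->
  forall q, rat_value (fun p => Lop al G (row_mx p q)) z (Mop al z V q).
Proof.
move=> GV q.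
have r1 : rat_value (fun p => \sum_(j < n) al 0 (rshift m j) *: G (row_mx p (q - unit_row j))) z
    (\sum_(j < n) al 0 (rshift m j) *: V (q - unit_row j)).
  by apply: rat_value_sum => j; exact: GV.
have r2 : rat_value (fun p => \sum_(i < m) al 0 (lshift n i) *: G (row_mx (p - unit_row i) q)) z
    (\sum_(i < m) al 0 (lshift n i) *: (z 0 i *: V q)).
  by apply: rat_value_sum => i; exact: (rat_value_shift i (GV q)).
have := rat_value_lc 1 r2 r1; rewrite scale1r.
have -> : \sum_(i < m) al 0 (lshift n i) *: (z 0 i *: V q) =
    (\sum_(i < m) al 0 (lshift n i) * z 0 i) *: V q.
  by rewrite scaler_suml; apply: eq_bigr => i _; rewrite scalerA.
rewrite (_ : (fun p => _) = fun p => Lop al G (row_mx p q))//.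
by apply/funext => p; rewrite Lop_row scale1r.
Qed.

Lemma rat_value_Mops t G z V :
  (forall q, rat_value (fun p => G (row_mx p q)) z (V q)) ->
  forall q, rat_value (fun p => Lops t G (row_mx p q)) z (Mops t z V q).
Proof. by elim: t G V => [//|al t IH] G V GV q /=; apply: IH; exact: rat_value_Mop. Qed.

Lemma Lops_row0 t G p q : Lops (map (row_mx (0 : 'rV[C]_m)) t) G (row_mx p q) =
  Lops t (fun q => G (row_mx p q)) q.
Proof.
elim: t G q => [//|al t IH] G q /=; rewrite IH; congr (Lops _ _ _); apply/funext => q'.
rewrite Lop_row big1 ?add0r; last by move=> i _; rewrite row_mxEl mxE scale0r.
by apply: eq_bigr => j _; rewrite row_mxEr.
Qed.

Lemma Mop_zero_below al z V j : zero_below j V -> zero_below j (Mop al z V).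
Proof.
move=> V0 q qj; rewrite /Mop V0// scaler0 add0r big1// => k _.
by rewrite V0 ?scaler0// mxE [X in _ + X]mxE unit_rowE; case: eqP => _ /=; lia.
Qed.

Lemma Mop_pdiffl i i' z V q : Mop (pd (lshift n i, lshift n i')) z V q = (z 0 i - z 0 i') *: V q.
Proof.
rewrite /Mop [X in _ + X]big1 ?addr0; last first.
  by move=> j _; rewrite mxE !eq_rlshift subrr scale0r.
congr (_ *: _); under eq_bigr => k _ do rewrite mxE !eq_lshift mulrBl.
rewrite sumrB; congr (_ - _).
  by rewrite (bigD1 i)//= eqxx mul1r big1 ?addr0// => k /negbTE->; rewrite mul0r.
by rewrite (bigD1 i')//= eqxx mul1r big1 ?addr0// => k /negbTE->; rewrite mul0r.
Qed.

Lemma Mop_pdiffr i j z V q : Mop (pd (lshift n i, rshift m j)) z V q =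
  z 0 i *: V q - V (q - unit_row j).
Proof.
rewrite /Mop; congr (_ *: _ + _).
  under eq_bigr => k _ do rewrite mxE eq_lshift eq_lrshift subr0.
  by rewrite (bigD1 i)//= eqxx mul1r big1 ?addr0// => k /negbTE->; rewrite mul0r.
under eq_bigr => k _ do rewrite mxE eq_rlshift eq_rshift sub0r.
by rewrite (bigD1 j)//= eqxx scaleN1r big1 ?addr0// => k /negbTE->; rewrite oppr0 scale0r.
Qed.

(** Factors x_i - x_j with x_i in the first group. Those within the second group belong to the
    denominator of the inserted correlation function. *)
Definition from_left (p : 'I_(m + n) * 'I_(m + n)) := (p.1 < m)%N && (p.1 != p.2).

Lemma from_leftP p : from_left p ->
  (exists i i', i != i' /\ p = (lshift n i, lshift n i')) \/
  (exists i j, p = (lshift n i, rshift m j)).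
Proof.
case: p => k k' /andP[/= km kk'].
case: (splitP k) => i ki; last by move: km; rewrite ki; lia.
have kE : k = lshift n i by apply: val_inj.
case: (splitP k') => i' ki'.
  left; exists i, i'; split; last by congr (_, _) => //; apply: val_inj.
  by apply: contraNneq kk' => ii; rewrite kE ii; apply/eqP/esym/val_inj.
by right; exists i, i'; congr (_, _) => //; apply: val_inj.
Qed.

(* The recursion [z_i V(q) = V(q - e_j)] and [V = 0] for [q_j < 0] force [V = 0]. *)
Lemma Mops_eq0 (t : seq ('I_(m + n) * 'I_(m + n))) z V : all from_left t ->
  (forall i, z 0 i != 0) -> conf z -> (forall j, zero_below j V) ->
  (forall q, Mops (map pd t) z V q = 0) -> forall q, V q = 0.
Proof.
move=> + z0 cz; elim: t V => [//|p t IH] V /= /andP[pl tl] V0 M0.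
have {}IH := IH _ tl (fun j => @Mop_zero_below (pd p) z V j (V0 j)) M0.
case/from_leftP: pl => [[i [i' [ii pE]]]|[i [j pE]]] q.
  have := IH q; rewrite pE Mop_pdiffl => /eqP; rewrite scaler_eq0 subr_eq0 => /orP[/eqP zz|/eqP//].
  by case: cz; exists i, i'.
have E q' : V q' = (z 0 i)^-1 *: V (q' - unit_row j).
  have := IH q'; rewrite pE Mop_pdiffr => /eqP; rewrite subr_eq0 => /eqP <-.
  by rewrite scalerA mulVf// scale1r.
have E' k : V q = (z 0 i)^-1 ^+ k *: V (q - unit_row j *+ k).
  elim: k => [|k IHk]; first by rewrite expr0 scale1r mulr0n subr0.
  by rewrite IHk E scalerA -exprSr mulrSr opprD addrA.
rewrite (E' (absz (q 0 j)).+1) (V0 j) ?scaler0//.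
rewrite mxE [X in _ + X]mxE mulmxnE unit_rowE eqxx.
by move: (q 0 j) => x; rewrite mulr1n natz; lia.
Qed.

End Ops.

Section Peel.
Variables (X : lmodType C) (T : Type) (K : set T) (zz : T -> 'rV[C]_m) (ww : T -> 'rV[C]_n).
Hypothesis zzP : forall i i', i != i' -> exists r : R, forall x, K x ->
  zz x 0 i - zz x 0 i' != 0 /\ nm (zz x 0 i - zz x 0 i')^-1 <= r.
Hypothesis zwP : forall i j, exists r th : R, 0 <= th < 1 /\ forall x, K x ->
  [/\ zz x 0 i != 0, nm (zz x 0 i)^-1 <= r & nm (ww x 0 j / zz x 0 i) <= th].

(** A difference within the first group is a nonzero scalar after evaluation. A difference between
    the groups is inverted by a geometric series in w_j / z_i, uniformly on [K]. *)
Lemma nhas_Mops (t : seq ('I_(m + n) * 'I_(m + n))) (V : 'rV[int]_n -> T -> X) s :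
  all from_left t -> (forall j (q : 'rV[int]_n) x, K x -> q 0 j < 0 -> V q x = 0) ->
  nhas K (fun q x => monom (ww x) q *: Mops (map pd t) (zz x) (V^~ x) q) s ->
  nhas K (fun q x => monom (ww x) q *: V q x)
    (fun x => (lforms (map pd t) (row_mx (zz x) (ww x)))^-1 *: s x).
Proof.
elim: t V => [|p t IH] V /=.
  by move=> _ _; apply: nhas_ext => // x _; rewrite /lforms big_nil invr1 scale1r.
move=> /andP[pl tl] V0 H.
have {IH H} := IH (fun q x => Mop (pd p) (zz x) (V^~ x) q) tl _ H.
have V0' j x : K x -> zero_below j (V^~ x) by move=> Kx q; exact: V0.
move=> /(_ (fun j q x Kx => @Mop_zero_below _ (pd p) (zz x) (V^~ x) j (V0' j x Kx) q)) H.
case/from_leftP: pl => [[i [i' [ii pE]]]|[i [j pE]]]; rewrite {}pE in H *.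
  have [r rP] := zzP ii.
  have := nhas_scale (fun x Kx => proj2 (rP x Kx)) H; apply: nhas_ext => [q x Kx|x Kx].
    by rewrite Mop_pdiffl !scalerA mulrAC mulVf ?mul1r//; have [] := rP x Kx.
  by rewrite scalerA /lforms big_cons -/(lforms _ _) lform_pdiff !row_mxEl invfM.
have [r [th [th01 rP]]] := zwP i j.
have H' := @nhas_peel _ _ K _ _ (fun q => q - unit_row j) (fun q => q + unit_row j)
  (fun q x => monom (ww x) q *: V q x) _ _ (fun x => zz x 0 i) (fun x => ww x 0 j) r th
  (subrK _) (addrK _) H rP th01.
apply: nhas_ext (H' _ _) => //.
- move=> x Kx; rewrite scalerA /lforms big_cons -/(lforms _ _) lform_pdiff.
  by rewrite row_mxEl row_mxEr invfM.
- move=> q x Kx; rewrite Mop_pdiffr scalerBr; congr (_ - _); first by rewrite !scalerA mulrC.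
  by rewrite -(@monom_scale _ _ _ _ (V^~ x)) ?subrK// => _; exact: V0'.
- move=> q; exists (absz (q 0 j)).+1 => k x kk Kx.
  have -> : iter k (fun q0 => q0 - unit_row j) q = q - unit_row j *+ k.
    elim: k {kk} => [|k IHk]; first by rewrite mulr0n subr0.
    by rewrite iterS IHk mulrSr opprD addrA.
  rewrite (V0 j) ?scaler0// mxE [X in _ + X]mxE mulmxnE unit_rowE eqxx.
  by move: kk; move: (q 0 j) => y kk; rewrite mulr1n natz; lia.
Qed.

End Peel.

Section Restrict.
Variable X : lmodType C.

Lemma monom_row (z : 'rV[C]_m) (w : 'rV[C]_n) p q :
  monom (row_mx z w) (row_mx p q) = monom z p * monom w q.
Proof.
rewrite /monom big_split_ord/=; congr (_ * _); apply: eq_bigr => i _.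
  by rewrite !row_mxEl.
by rewrite !row_mxEr.
Qed.

Lemma poly_fam_row (F : 'rV[int]_(m + n) -> X) q : poly_fam F -> poly_fam (fun p => F (row_mx p q)).
Proof.
move=> [[A FA] F0]; split; last by move=> i p pi; apply: (F0 (lshift n i)); rewrite row_mxEl.
exists [fset lsubmx k | k in A]%fset => p pA; apply: FA; apply: contraNN pA => pA.
by apply/imfsetP; exists (row_mx p q) => //; rewrite row_mxKl.
Qed.

Lemma evalf_row (F : 'rV[int]_(m + n) -> X) q z w : poly_fam F ->
  evalf (fun k => if rsubmx k == q then F k else 0) (row_mx z w) =
  monom w q *: evalf (fun p => F (row_mx p q)) z.
Proof.
move=> pF; have [[A' FA'] _] := poly_fam_row q pF.
rewrite (evalfE _ FA') (@evalfE _ _ _ _ _ [fset row_mx p q | p in A']%fset); last first.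
  move=> k kA; case: eqP => // kq; rewrite -[k]hsubmxK kq FA'//; apply: contraNN kA => kA.
  by apply/imfsetP; exists (lsubmx k) => //; rewrite -kq hsubmxK.
rewrite big_imfset/=; last by move=> x y _ _ /eq_row_mx[].
rewrite scaler_sumr; apply: eq_bigr => p _.
by rewrite row_mxKr eqxx monom_row scalerA mulrC.
Qed.

Lemma evalf_fubini (F : 'rV[int]_(m + n) -> X) (B : {fset 'rV[int]_n}) z w : poly_fam F ->
  (forall k, rsubmx k \notin B -> F k = 0) ->
  evalf F (row_mx z w) = \sum_(q <- B) monom w q *: evalf (fun p => F (row_mx p q)) z.
Proof.
move=> pF FB; transitivity (evalf (fun k => \sum_(q <- B) 1 *: (if rsubmx k == q then F k else 0)) (row_mx z w)).
  congr evalf; apply/funext => k; have [kB|kB] := boolP (rsubmx k \in B); last first.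
    by rewrite FB// big1// => q _; rewrite if_same scaler0.
  rewrite (big_fsetD1 _ kB)/= eqxx scale1r big1_fset ?addr0// => q.
  by rewrite !inE eq_sym => /andP[/negbTE-> _]; rewrite scaler0.
rewrite evalf_sum; last first.
  by move=> q; case: pF => [[A FA] _]; exists A => k kA; rewrite FA// if_same.
by apply: eq_bigr => q _; rewrite scale1r evalf_row.
Qed.

End Restrict.

End TwoGroups.

Section RestrictAtZero.
Variables (R : realType) (m : nat).
Local Notation C := (Cx R).

(** Setting the last variable to 0 keeps the coefficients of exponent 0 in it and drops the last
    entry of each linear form. *)
Lemma rat_value_restrict (X : lmodType C) (f : 'rV[int]_(m + 1) -> X) z v :
  zero_below (rshift m 0) f -> rat_value f (row_mx z 0) v ->
  rat_value (fun p => f (row_mx p 0)) z v.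
Proof.
move=> f0 [t [t0 pt ->]].
have LE (g : 'rV[int]_(m + 1) -> X) : zero_below (rshift m 0) g -> forall p,
    Lops t g (row_mx p 0) = Lops (map lsubmx t) (fun p => g (row_mx p 0)) p.
  elim: t {t0 pt} g => [//|al t IH] g g0 p /=; rewrite IH; last exact: zero_below_Lop.
  congr (Lops _ _ _); apply/funext => p'; rewrite Lop_row big_ord1 g0 ?scaler0 ?addr0.
    by apply: eq_bigr => i _; rewrite mxE.
  by rewrite row_mxEr mxE [X in _ + X]mxE unit_rowE !mxE eqxx.
have lE : lforms (map lsubmx t) z = lforms t (row_mx z 0).
  rewrite /lforms big_map; apply: eq_bigr => al _; rewrite /lform big_split_ord/= big_ord1.
  rewrite row_mxEr mxE mulr0 addr0; apply: eq_bigr => i _; by rewrite row_mxEl mxE.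
have FE : (fun p => Lops t f (row_mx p 0)) = Lops (map lsubmx t) (fun p => f (row_mx p 0)).
  by apply/funext => p; exact: LE.
exists (map lsubmx t); rewrite lE -FE; split=> //; first exact: poly_fam_row.
congr (_ *: _); case: (pt) => [[A FA] F0].
pose B := (0 |` [fset rsubmx k | k in A])%fset.
rewrite (@evalf_fubini _ _ _ _ _ B) => [||k kB]; [|by []|]; last first.
  apply: FA; apply: contraNN kB => kA; rewrite inE; apply/orP; right.
  by apply/imfsetP; exists k.
rewrite (big_fsetD1 0)/=; last exact: fset1U1.
rewrite big1_fset ?addr0.
  by rewrite /monom big_ord1 !mxE scale1r.
move=> q; rewrite !inE => /andP[q0 _] _.
have [q00|q00] := eqVneq (q 0 0) 0.
  by case/eqP: q0; apply/rowP => i; rewrite ord1 mxE.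
by rewrite /monom big_ord1 mxE exp0rz (negbTE q00) scale0r.
Qed.

End RestrictAtZero.

(** * Uniform estimates on compact sets *)

Section Preliminaries.
Variable R : realType.
Local Notation C := (Cx R).

Lemma nm_cvg (T : Type) (F : set_system T) {FF : Filter F} (g : T -> C) (l : C) :
  g @ F --> l -> nm (g x) @[x --> F] --> nm l.
Proof.
move=> gl; apply/cvgrPdist_lt => e e0.
have /cvgrPdist_lt/(_ (rc e)) := gl; rewrite rc_gt0 => /(_ e0).
apply: filterS => y; rewrite nmE rc_lt; apply: le_lt_trans.
rewrite ler_norml; have := nmD (l - g y) (g y); have := nmD (g y - l) l.
by rewrite !subrK (nm_dist (g y)) => h1 h2; apply/andP; split; lra.
Qed.

Lemma compact_nm_lt1 (E : normedModType C) (K : set E) (g : E -> C) : compact K ->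
  (forall x, K x -> {for x, continuous (g : E -> C^o)}) -> (forall x, K x -> nm (g x) < 1) ->
  exists th : R, 0 <= th < 1 /\ forall x, K x -> nm (g x) <= th.
Proof.
move=> cK gc g1; have [[x0 Kx0]|nK] := pselect (exists x, K x); last first.
  by exists 0; rewrite lexx ltr01; split=> // x Kx; case: nK; exists x.
have [||c Kc cP] := @compact_EVT_max E R (fun x => nm (g x)) K _ cK.
- by exists x0.
- by apply: continuous_in_subspaceT => x; rewrite inE => Kx; apply: nm_cvg; exact: gc.
exists (nm (g c)); rewrite nm_ge0 g1; last by rewrite inE in Kc.
by split=> // x Kx; apply: cP; rewrite inE.
Qed.

Lemma compact_inv_bounded (E : normedModType C) (K : set E) (g : E -> C) : compact K ->
  (forall x, K x -> {for x, continuous (g : E -> C^o)}) -> (forall x, K x -> g x != 0) ->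
  exists r : R, forall x, K x -> g x != 0 /\ nm (g x)^-1 <= r.
Proof.
move=> cK gc g0; have [|r rP] := @compact_nm_bounded _ _ K (fun x => (g x)^-1) cK.
  by move=> x Kx; apply: cvgV; [exact: g0|exact: gc].
by exists r => x Kx; split; [exact: g0|exact: rP].
Qed.

Lemma differentiable_row (E : normedModType C) d (h : E -> 'rV[C]_d) x :
  (forall k, differentiable (fun x => h x 0 k : C^o) x) -> differentiable h x.
Proof.
move=> hd; rewrite (_ : h = \sum_(k < d) (fun x => h x 0 k *: delta_mx 0 k)).
  by apply: differentiable_sum => k; apply: differentiableZl; exact: hd.
by apply/funext => y; rewrite fct_sumE {1}[h y]row_sum_delta.
Qed.

Lemma differentiable_fst (E F : normedModType C) (x : E * F) : differentiable (fun x : E * F => x.1) x.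
Proof.
apply: (@linear_differentiable _ _ _ (fst : {linear (E * F)%type -> E})) => y.
exact: cvg_fst.
Qed.

Lemma differentiable_snd (E F : normedModType C) (x : E * F) : differentiable (fun x : E * F => x.2) x.
Proof.
apply: (@linear_differentiable _ _ _ (snd : {linear (E * F)%type -> F})) => y.
exact: cvg_snd.
Qed.

Lemma sum_ord_truncate (X : zmodType) (F : nat -> X) J J' : (J <= J')%N ->
  (forall j, (J <= j)%N -> F j = 0) -> \sum_(j < J') F j = \sum_(j < J) F j.
Proof.
move=> JJ F0; rewrite (big_ord_widen J' F JJ) [RHS]big_mkcond; apply: eq_bigr => j _.
by case: ltnP => // /F0.
Qed.

Lemma nhas_group (T : Type) (K : set T) (X : lmodType C) (I J : choiceType) (b : I -> T -> X) s
    (Q : J -> {fset I}) (deg : I -> J) :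
  (forall k q, q \in Q k -> deg q = k) -> (forall q x, K x -> q \notin Q (deg q) -> b q x = 0) ->
  nhas K b s -> nhas K (fun k x => \sum_(q <- Q k) b q x) s.
Proof.
move=> Qd b0 [bn bs]; have gn := nsum_group Qd bn; split=> // x Kx.
have [u us] := nsum_has_sum Kx gn.
by rewrite -(has_sum_group Qd (fun q => b0 q x Kx) (bs x Kx) us).
Qed.

Lemma enum_row m n : enum 'I_(m + n) = map (lshift n) (enum 'I_m) ++ map (@rshift m n) (enum 'I_n).
Proof.
have E k : map (@nat_of_ord k) (enum 'I_k) = iota 0 k by exact: val_enum_ord.
apply: (inj_map (@ord_inj (m + n))); rewrite map_cat -(map_comp _ (lshift n)) -(map_comp _ (@rshift m n)).
transitivity (iota 0 (m + n)); first exact: E.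
rewrite iotaD; congr (_ ++ _).
  by rewrite -(E m); apply: eq_map.
by rewrite add0n -[in iota m](addn0 m) iotaDl -(E n) -map_comp; apply: eq_map.
Qed.

Lemma ord_split (m n : nat) (i : 'I_(m + n)) : (exists j, i = lshift n j) \/ (exists j, i = rshift m j).
Proof.
by case: (fintype.splitP i) => j ij; [left|right]; exists j; apply: val_inj.
Qed.

Lemma lforms_row0 m n (t : seq 'rV[C]_n) (z : 'rV[C]_m) w :
  lforms (map (row_mx (0 : 'rV[C]_m)) t) (row_mx z w) = lforms t w.
Proof.
rewrite /lforms big_map; apply: eq_bigr => al _; rewrite /lform big_split_ord/=.
rewrite big1 ?add0r; last by move=> i _; rewrite row_mxEl mxE mul0r.
by apply: eq_bigr => j _; rewrite !row_mxEr.
Qed.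

Lemma rat_value_poly m (X : lmodType C) (f : 'rV[int]_m -> X) z : poly_fam f -> rat_value f z (evalf f z).
Proof.
by move=> pf; exists [::]; rewrite /lforms big_nil invr1 scale1r oner_neq0.
Qed.

End Preliminaries.

(** * The associativity axiom *)

Section Associativity.
Variables (R : realType) (V : graded R) (S : vertexVA V).
Local Notation C := (Cx R).
Local Notation dV := (dsum V).
Local Notation vac := (vvac S).

Section RowWords.
Variables (m n : nat) (a : 'rV[dV]_m) (b : 'rV[dV]_n).

Lemma word_row c p q : word S (row_mx a b) (enum 'I_(m + n)) c (row_mx p q) =
  word S a (enum 'I_m) (word S b (enum 'I_n) c q) p.
Proof.
have wl s c' : word S (row_mx a b) (map (lshift n) s) c' (row_mx p q) = word S a s c' p.
  by elim: s => [//|i s IH] /=; rewrite IH !row_mxEl.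
have wr s c' : word S (row_mx a b) (map (@rshift m n) s) c' (row_mx p q) = word S b s c' q.
  by elim: s => [//|i s IH] /=; rewrite IH !row_mxEr.
transitivity (word S (row_mx a b) (map (lshift n) (enum 'I_m) ++ map (@rshift m n) (enum 'I_n)) c (row_mx p q)).
  by rewrite -enum_row.
by rewrite word_cat wr wl.
Qed.

End RowWords.

Section LastLinear.
Variables (m : nat) (a : 'rV[dV]_m).

Definition corr_last z l (c : dV) := corr S (row_mx a (const_mx c : 'rV_1)) z l.

Lemma corr_last_linear z l : conf z -> linear (corr_last z l).
Proof.
move=> cz k u v.
have E x : row_mx a (const_mx x : 'rV_1) = row_upd (row_mx a (const_mx 0)) (rshift m 0) x.
  apply/rowP => i; rewrite row_updE; case: (@ord_split _ _ i) => -[j ->].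
    by rewrite eq_lrshift !row_mxEl.
  by rewrite !row_mxEr ord1 eqxx mxE.
rewrite /corr_last (E (k *: u + v)) (E u) (E v).
by rewrite corr_multilinear.
Qed.

(** By creation the constant term of Y(c, x)|0> is [c]: inserting [c] at 0 replaces the vacuum at
    the end of the word by [c]. *)
Lemma corr_last_rat z l c : conf (row_mx z (0 : 'rV_1)) ->
  rat_value (fun p => dval (word S a (enum 'I_m) c p) l) z (corr_last (row_mx z 0) l c).
Proof.
move=> cz; have := corr_rat S (row_mx a (const_mx c : 'rV_1)) l cz.
have wE p r : word S (row_mx a (const_mx c : 'rV_1)) (enum 'I_(m + 1)) vac (row_mx p r) =
    word S a (enum 'I_m) (vY S c (r 0 0) vac) p.
  by rewrite word_row enum_I1 /= mxE.
move/rat_value_restrict; rewrite (_ : (fun p => dval (word S a _ c p) l) = fun p =>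
  dval (word S (row_mx a (const_mx c : 'rV_1)) (enum 'I_(m + 1)) vac (row_mx p 0)) l).
  apply=> k; rewrite -[k]hsubmxK row_mxEr wE => k0.
  by rewrite (vY_creation S c).2// (lin0 (word_linear S a _ _)).
by apply/funext => p; rewrite wE mxE (vY_creation S c).1.
Qed.

End LastLinear.

Section Homogeneous.
Variables (m n : nat) (a : 'rV[dV]_m) (b : 'rV[dV]_n) (d : 'I_n -> int).
Hypothesis hb : forall j, homogeneous (d j) (b 0 j).
Local Notation pd := (pdiff R (m := m + n)).
Let ab := row_mx a b.
Let db := corr_den S b.
(** [fb q] is the coefficient of w^q in the numerator of [corr S b]. Each component of [corr S b w]
    is a combination of components of these vectors, so associativity becomes a statement about a
    sum over [q]. *)
Let fb := Lops db (word S b (enum 'I_n) vac).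
Let G := Lops (map (row_mx (0 : 'rV[C]_m)) db) (word S ab (enum 'I_(m + n)) vac).

Lemma fb_poly l : poly_fam (fun q => dval (fb q) l).
Proof. by have [_ pf] := projT2 (cid (correlation_den S b)); exact: pf. Qed.

Lemma fb_zero_below j : zero_below j fb.
Proof. by move=> q qj; apply: dsum_eq => l; have [_ f0] := fb_poly l; exact: (f0 j). Qed.

Lemma G_row p q : G (row_mx p q) = word S a (enum 'I_m) (fb q) p.
Proof.
rewrite /G Lops_row0; under [X in Lops _ X]funext => q' do rewrite word_row.
by rewrite (Lops_lin _ _ (word_linear S a _ p)).
Qed.

(** The bound [k0] does not depend on the exponents: degrees grow with the total exponent, and
    negative exponents do not occur in the product. It provides the uniform cut-off of exp(uT). *)
Lemma assoc_den : exists (t : seq ('I_(m + n) * 'I_(m + n))) (k0 : int),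
  [/\ all (@from_left m n) t, forall l, poly_fam (fun k => dval (Lops (map pd t) G k) l) &
      forall k, degree_ge k0 (Lops (map pd t) G k)].
Proof.
have [|t [tP t0]] := @word_den _ _ S _ ab (enum 'I_(m + n)) (map (lshift n) (enum 'I_m)) (enum_pairwise _).
  by move=> i _; rewrite mem_enum.
have [k kP] := word_degree_ge S ab.
have Fz i : zero_below i (Lops (map pd t) G).
  case: (@ord_split _ _ i) => -[j ->].
    by rewrite /G LopsC; apply: zero_below_Lops; apply: t0; rewrite map_f ?mem_enum.
  apply: zero_below_Lops => k'; rewrite -[k']hsubmxK row_mxEr G_row => kj.
  by rewrite (fb_zero_below kj) (lin0 (word_linear S a _ _)).
have Fd := Lops_degree_ge (t := map pd t) (Lops_degree_ge (t := map (row_mx 0) db) kP).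
exists t, (k - (size (map (row_mx (0 : 'rV[C]_m)) db))%:Z - (size (map pd t))%:Z); split; last first.
- move=> k'; have [[i ki]|nn] := pselect (exists i, k' 0 i < 0).
    by rewrite (Fz i)// => l _.
  apply: (degree_ge_le _ (Fd k')); rewrite lerDl /total_deg sumr_ge0// => i _.
  by rewrite leNgt; apply/negP => ki; apply: nn; exists i.
- by move=> l; exact: (poly_fam_degree l Fd Fz).
apply: sub_all tP => -[i j] /and3P[/mapP[i' _ /= ->] _ ij].
rewrite /from_left/= ltn_ord/=; apply/eqP => e; by rewrite -e ltnn in ij.
Qed.

Let t := projT1 (cid assoc_den).
Let k0 := projT1 (cid (projT2 (cid assoc_den))).
Let F := Lops (map pd t) G.

Lemma F_spec : [/\ all (@from_left m n) t, forall l, poly_fam (fun k => dval (F k) l) &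
      forall k, degree_ge k0 (F k)].
Proof. exact: (projT2 (cid (projT2 (cid assoc_den)))). Qed.

Let W l q z := corr_last a (row_mx z 0) l (fb q).

Lemma W_zero_below l z j : conf (row_mx z (0 : 'rV_1)) -> zero_below j (fun q => W l q z).
Proof. by move=> cz q qj; rewrite /W (fb_zero_below qj) (lin0 (corr_last_linear a l cz)). Qed.

Lemma W_Mops l z q : conf (row_mx z (0 : 'rV_1)) ->
  Mops (map pd t) z (fun q => W l q z) q = evalf (fun p => dval (F (row_mx p q)) l) z.
Proof.
move=> cz; have [_ pF _] := F_spec.
apply: (rat_value_uniq _ (rat_value_poly z (poly_fam_row q (pF l)))).
have := @rat_value_Mops _ _ _ _ (map pd t) (fun k => dval (G k) l) z (fun q => W l q z) _ q.
rewrite (Lops_lin _ _ (@dval_linear _ V l)); apply=> q'.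
have := corr_last_rat a l (fb q') cz.
by rewrite (_ : (fun p => dval (G _) l) = fun p => dval (word S a (enum 'I_m) (fb q') p) l)//;
  apply/funext => p; rewrite G_row.
Qed.

Lemma conf_row0 (z : 'rV[C]_m) : conf (row_mx z (0 : 'rV_1)) -> conf z /\ forall i, z 0 i != 0.
Proof.
move=> cz; split=> [[i [j [ij zij]]]|i].
  by apply: cz; exists (lshift 1 i), (lshift 1 j); rewrite !row_mxEl eq_lshift.
apply/eqP => zi; apply: cz; exists (lshift 1 i), (rshift m 0).
by rewrite row_mxEl row_mxEr mxE eq_lrshift.
Qed.

(** [corr_translate] gives a length that may vary with the point and with [q]; this vanishing makes
    it uniform. The numerator is 0 below [k0], and [Mops_eq0] carries this back through the
    factors. *)
Lemma W_vanish l q z : conf (row_mx z (0 : 'rV_1)) -> l < k0 -> W l q z = 0.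
Proof.
move=> cz lk; have [tl _ Fk] := F_spec; have [cz' z0] := conf_row0 cz.
apply: (Mops_eq0 tl z0 cz' (fun j => W_zero_below l (j := j) cz)) => q'.
rewrite W_Mops// (_ : (fun p => _) = fun=> 0) ?evalf0//.
by apply/funext => p; exact: Fk.
Qed.

Lemma corr_F l z w : conf (row_mx z w) ->
  corr S ab (row_mx z w) l =
  (lforms db w)^-1 *: ((lforms (map pd t) (row_mx z w))^-1 *: evalf (fun k => dval (F k) l) (row_mx z w)).
Proof.
move=> czw; have [tl pF _] := F_spec; apply: corr_eq => //.
have LE : Lops (map (row_mx (0 : 'rV[C]_m)) db ++ map pd t)
    (fun k => dval (word S ab (enum 'I_(m + n)) vac k) l) = fun k => dval (F k) l.
  by rewrite Lops_cat !(Lops_lin _ _ (@dval_linear _ V l)).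
exists (map (row_mx (0 : 'rV[C]_m)) db ++ map pd t); rewrite LE lforms_cat lforms_row0; split=> //.
  rewrite mulf_neq0//.
    apply: corr_den_neq0 => -[i [j [ij wij]]]; apply: czw.
    by exists (rshift m i), (rshift m j); rewrite !row_mxEr eq_rshift.
  apply: lforms_pdiff_neq0 => //; apply: sub_all tl => p; by case/andP.
by rewrite invfM scalerA.
Qed.

Lemma corr_vanish l z w : conf (row_mx z w) -> l < k0 -> corr S ab (row_mx z w) l = 0.
Proof.
move=> czw lk; have [_ _ Fk] := F_spec.
rewrite corr_F// (_ : (fun k => _) = fun=> 0) ?evalf0 ?scaler0//.
by apply/funext => k; exact: Fk.
Qed.

(** Associativity for insertion at 0, multiplied by the denominator of [b] and not yet grouped by
    degree. The parameter [T] allows the points to be read off from a larger configuration. *)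
Lemma W_sum (T : Type) (K : set T) (zz : T -> 'rV[C]_m) (ww : T -> 'rV[C]_n) l :
  (forall i i', i != i' -> exists r : R, forall x, K x ->
    zz x 0 i - zz x 0 i' != 0 /\ nm (zz x 0 i - zz x 0 i')^-1 <= r) ->
  (forall i j, exists r th : R, 0 <= th < 1 /\ forall x, K x ->
    [/\ zz x 0 i != 0, nm (zz x 0 i)^-1 <= r & nm (ww x 0 j / zz x 0 i) <= th]) ->
  (forall x, K x -> conf (row_mx (zz x) (0 : 'rV_1)) /\ conf (row_mx (zz x) (ww x))) ->
  (forall f : 'rV[int]_(m + n) -> V l, poly_fam f ->
     bounded_span K (fun x => evalf f (row_mx (zz x) (ww x)))) ->
  nhas K (fun q x => monom (ww x) q *: W l q (zz x))
    (fun x => lforms db (ww x) *: corr S ab (row_mx (zz x) (ww x)) l).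
Proof.
move=> zzP zwP cK bK; have [tl pF _] := F_spec.
have [[A FA] F0] := pF l.
pose B := [fset rsubmx k | k in A]%fset.
have FB k : rsubmx k \notin B -> dval (F k) l = 0.
  by move=> kB; apply: FA; apply: contraNN kB => kA; apply/imfsetP; exists k.
have H : nhas K (fun q x => monom (ww x) q *: Mops (map pd t) (zz x) (fun q => W l q (zz x)) q)
    (fun x => evalf (fun k => dval (F k) l) (row_mx (zz x) (ww x))).
  apply: (@nhas_ext _ _ K _ _ (fun q x => monom (ww x) q *: evalf (fun p => dval (F (row_mx p q)) l) (zz x)) _
    (fun x => \sum_(q <- B) monom (ww x) q *: evalf (fun p => dval (F (row_mx p q)) l) (zz x))).
  - by move=> q x Kx; rewrite W_Mops//; have [] := cK x Kx.
  - by move=> x Kx; rewrite (evalf_fubini _ _ (pF l) FB).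
  apply: nhas_fin => [q x Kx qB|q qB].
    rewrite (_ : (fun p => _) = fun=> 0) ?evalf0 ?scaler0//.
    by apply/funext => p; apply: FB; rewrite row_mxKr.
  have pq : poly_fam (fun k => if rsubmx k == q then dval (F k) l else 0).
    split; last by move=> i k ki; rewrite (F0 i)// if_same.
    by exists A => k kA; rewrite FA// if_same.
  have [e [v [c [M [h1 h2]]]]] := bK _ pq; exists e, v, c, M; split=> // x Kx.
  by rewrite -h1// (evalf_row _ _ _ (pF l)).
apply: nhas_ext (nhas_Mops zzP zwP tl _ H) => //; last first.
- by move=> j q x Kx qj; have [cz _] := cK x Kx; exact: (W_zero_below l cz qj).
- move=> x Kx; have [_ czw] := cK x Kx; rewrite corr_F// [RHS]scalerA mulfV ?scale1r//.
  apply: corr_den_neq0 => -[i [j [ij wij]]]; apply: czw.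
  by exists (rshift m i), (rshift m j); rewrite !row_mxEr eq_rshift.
Qed.

Section OnCompact.
Variables (l : int) (K : set ('rV[C]_(m + 1) * 'rV[C]_n)).
Hypotheses (cK : compact K) (KD : K `<=` @assoc_dom R m n).
Local Notation E := ('rV[C]_(m + 1) * 'rV[C]_n)%type.
(** [uu] is the insertion point z_(m+1), and [zz] are the other points seen from it, so that
    inserting at [uu] becomes inserting at 0. *)
Let uu (x : E) : C := x.1 0 (rshift m 0).
Let zz (x : E) : 'rV[C]_m := lsubmx x.1 - const_mx (uu x).
Let ww (x : E) : 'rV[C]_n := x.2.

Lemma fst_coord_differentiable i (x : E) : differentiable ((fun x : E => x.1 0 i) : E -> C^o) x.
Proof.
apply: (@differentiable_comp _ _ _ _ (fun x : E => x.1) (fun z : 'rV[C]_(m + 1) => z 0 i : C^o)).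
  exact: differentiable_fst.
exact: differentiable_coord.
Qed.

Lemma snd_coord_differentiable j (x : E) : differentiable ((fun x : E => x.2 0 j) : E -> C^o) x.
Proof.
apply: (@differentiable_comp _ _ _ _ (fun x : E => x.2) (fun z : 'rV[C]_n => z 0 j : C^o)).
  exact: differentiable_snd.
exact: differentiable_coord.
Qed.

Lemma zzE x i : zz x 0 i = x.1 0 (lshift 1 i) - uu x.
Proof. by rewrite !mxE. Qed.

Lemma zz_differentiable i (x : E) : differentiable ((fun x : E => zz x 0 i) : E -> C^o) x.
Proof.
rewrite (_ : (fun x : E => zz x 0 i) = fun x : E => x.1 0 (lshift 1 i) - x.1 0 (rshift m 0)).
  by apply: differentiableB; exact: fst_coord_differentiable.
by apply/funext => y; rewrite zzE.
Qed.

Lemma dom_confs x : assoc_dom x -> [/\ conf (row_mx (zz x) (0 : 'rV_1)),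
  conf (row_mx (zz x) (ww x)) & conf (ww x)].
Proof.
move=> [c1 c2 lt]; split=> //.
  rewrite (_ : row_mx _ _ = x.1 + const_mx (- uu x)); first exact: conf_shift.
  apply/rowP => i; rewrite [RHS]mxE [X in _ = _ + X]mxE; case: (@ord_split _ _ i) => -[j ->].
    by rewrite row_mxEl zzE.
  by rewrite row_mxEr ord1 mxE subrr.
move=> [i [j [ij]]]; case: (@ord_split _ _ i) ij => -[i' ->]; case: (@ord_split _ _ j) => -[j' ->].
- rewrite eq_lshift !row_mxEl !zzE => ij /addIr zij; apply: c1.
  by exists (lshift 1 i'), (lshift 1 j'); rewrite eq_lshift.
- rewrite row_mxEl row_mxEr zzE => _ zw; have := lt j' i'.
  by rewrite -/(ww x) -zw -/(uu x) ltxx.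
- rewrite row_mxEl row_mxEr zzE => _ zw; have := lt i' j'.
  by rewrite -/(ww x) zw -/(uu x) ltxx.
- rewrite eq_rshift !row_mxEr => ij wij; apply: c2; by exists i', j'.
Qed.

(** The cut-off is common to all [q] and [x]: for j > l - k0 the component of degree l - j lies
    below [k0] and vanishes. *)
Lemma W_expand q x : assoc_dom x -> corr_last a x.1 l (fb q) =
  \sum_(j < (absz (l - k0)).+1) (uu x ^+ j / j`!%:R) *: Tpow S (W (l - j%:Z) q (zz x)).
Proof.
move=> dx; have [c0 _ _] := dom_confs dx.
have [J0 JP] := corr_translate S (row_mx a (const_mx (fb q) : 'rV_1)) l c0.
have xE : x.1 = row_mx (zz x) (0 : 'rV_1) + const_mx (uu x).
  apply/rowP => i; rewrite [RHS]mxE [X in _ = _ + X]mxE; case: (@ord_split _ _ i) => -[j ->].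
    by rewrite row_mxEl zzE subrK.
  by rewrite row_mxEr ord1 mxE add0r.
rewrite /corr_last {1}xE (JP (maxn J0 (absz (l - k0)).+1) (uu x) (leq_maxl _ _)).
rewrite (@sum_ord_truncate _ (fun j => (uu x ^+ j / j`!%:R) *:
  Tpow S (corr S (row_mx a (const_mx (fb q) : 'rV_1)) (row_mx (zz x) 0) (l - j%:Z)))
  (absz (l - k0)).+1)//; first exact: leq_maxr.
move=> j jl; rewrite -[corr _ _ _ _]/(W (l - j%:Z) q (zz x)) W_vanish// ?(lin0 (@Tpow_linear _ _ S _ _)) ?scaler0//.
by move: jl; move: k0 => y jl; lia.
Qed.

Lemma corr_expand x : assoc_dom x -> corr S ab (row_mx (zz x) (ww x) + const_mx (uu x)) l =
  \sum_(j < (absz (l - k0)).+1) (uu x ^+ j / j`!%:R) *: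
    Tpow S (corr S ab (row_mx (zz x) (ww x)) (l - j%:Z)).
Proof.
move=> dx; have [_ c0 _] := dom_confs dx.
have [J0 JP] := corr_translate S ab l c0.
rewrite (JP (maxn J0 (absz (l - k0)).+1) (uu x) (leq_maxl _ _)).
rewrite (@sum_ord_truncate _ (fun j => (uu x ^+ j / j`!%:R) *:
  Tpow S (corr S ab (row_mx (zz x) (ww x)) (l - j%:Z))) (absz (l - k0)).+1)//; first exact: leq_maxr.
move=> j jl; rewrite corr_vanish// ?(lin0 (@Tpow_linear _ _ S _ _)) ?scaler0//.
by move: jl; move: k0 => y jl; lia.
Qed.

Lemma W_sum_compact l' : nhas K (fun q x => monom (ww x) q *: W l' q (zz x))
    (fun x => lforms db (ww x) *: corr S ab (row_mx (zz x) (ww x)) l').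
Proof.
apply: W_sum => [i i' ii|i j|x /KD /dom_confs[]//|f pf].
- apply: (@compact_inv_bounded _ _ K (fun x => zz x 0 i - zz x 0 i') cK) => x Kx.
    apply: (@differentiable_continuous _ _ _ x (fun x : E => zz x 0 i - zz x 0 i' : C^o)).
    by apply: differentiableB; exact: zz_differentiable.
  rewrite subr_eq0; apply/eqP => zE; have [+ _ _] := dom_confs (KD Kx); apply.
  by exists (lshift 1 i), (lshift 1 i'); rewrite !row_mxEl eq_lshift.
- have z0 x : K x -> zz x 0 i != 0.
    by move=> Kx; have [c _ _] := dom_confs (KD Kx); have [_] := conf_row0 c; apply.
  have [r rP] := @compact_inv_bounded _ _ K (fun x => zz x 0 i) cK
    (fun x _ => differentiable_continuous (zz_differentiable i x)) z0.
  have [|x Kx|th [th01 thP]] := @compact_nm_lt1 _ _ K (fun x => ww x 0 j / zz x 0 i) cK.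
  + move=> x Kx; apply: (@differentiable_continuous _ _ _ x (fun x : E => ww x 0 j / zz x 0 i : C^o)).
    apply: differentiableM; first exact: snd_coord_differentiable.
    by apply: differentiableV; [exact: zz_differentiable|exact: z0].
  + rewrite nmM nmV ltr_pdivrMr ?nm_gt0 ?z0// mul1r.
    by have [_ _ lt] := KD Kx; rewrite -rc_lt -!nmE zzE; exact: lt.
  by exists r, th; split=> // x Kx; have [h1 h2] := rP x Kx; split=> //; exact: thP.
apply: (@fhol_bounded_span _ _ setT) => //.
apply: (@fhol_comp _ _ _ setT _ (fun x : E => row_mx (zz x) (ww x))) => //; last exact: evalf_fhol.
move=> x _; apply: differentiable_row => k; case: (@ord_split _ _ k) => -[j ->].
  rewrite (_ : (fun x => _) = fun x : E => zz x 0 j); first exact: zz_differentiable.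
  by apply/funext => y; rewrite row_mxEl.
rewrite (_ : (fun x => _) = fun x : E => x.2 0 j); first exact: snd_coord_differentiable.
by apply/funext => y; rewrite row_mxEr.
Qed.

Lemma corr_last_sum : nhas K (fun q x => monom (ww x) q *: corr_last a x.1 l (fb q))
    (fun x => lforms db (ww x) *: corr S ab (row_mx (lsubmx x.1) (ww x + const_mx (uu x))) l).
Proof.
have H : nhas K (fun q x => \sum_(j < (absz (l - k0)).+1) (uu x ^+ j / j`!%:R) *:
      Tpow S (monom (ww x) q *: W (l - j%:Z) q (zz x)))
    (fun x => \sum_(j < (absz (l - k0)).+1) (uu x ^+ j / j`!%:R) *:
      Tpow S (lforms db (ww x) *: corr S ab (row_mx (zz x) (ww x)) (l - j%:Z))).
  apply: nhas_sum => j.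
  have [|r rP] := @compact_nm_bounded _ _ K (fun x => uu x ^+ j / j`!%:R) cK.
    move=> x Kx; apply: (@differentiable_continuous _ _ _ x (fun x : E => uu x ^+ j / j`!%:R : C^o)).
    apply: differentiableM; last exact: differentiable_cst.
    elim: (nat_of_ord j) => [|k IH]; first exact: differentiable_cst.
    rewrite (_ : (fun x => _) = fun x : E => x.1 0 (rshift m 0) * (uu x ^+ k)).
      by apply: differentiableM IH; exact: fst_coord_differentiable.
    by apply/funext => y; rewrite exprS.
  apply: (nhas_scale rP); apply: nhas_lin; [exact: Tpow_linear|exact: W_sum_compact].
apply: nhas_ext H => [q x Kx|x Kx].
  rewrite (W_expand q (KD Kx)) scaler_sumr; apply: eq_bigr => j _.
  by rewrite (linZ (@Tpow_linear _ _ S _ _)) !scalerA [in LHS]mulrC.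
have -> : row_mx (lsubmx x.1) (ww x + const_mx (uu x)) = row_mx (zz x) (ww x) + const_mx (uu x).
  apply/rowP => i; rewrite [RHS]mxE [X in _ = _ + X]mxE; case: (@ord_split _ _ i) => -[j ->].
    by rewrite !row_mxEl zzE subrK mxE.
  by rewrite !row_mxEr !mxE.
rewrite (corr_expand (KD Kx)) scaler_sumr; apply: eq_bigr => j _.
by rewrite (linZ (@Tpow_linear _ _ S _ _)) !scalerA [in LHS]mulrC.
Qed.

(** For homogeneous entries [fb q] has degree kb + |q|. Grouping the sum over [q] by this degree and
    dividing by the denominator of [b] turns it into the sum over [k] of insertions of p_k mu(b,
    w). *)
Lemma assoc_homogeneous : nhas K (assoc_term (@corr R V S) a b l) (assoc_val (@corr R V S) a b l).
Proof.
pose kb := \sum_j d j - (size db)%:Z.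
have fbh q : homogeneous (kb + total_deg q) (fb q).
  exact: Lops_homogeneous (word_homogeneous S hb) q.
have [AA AAP] := choice (@bounded_fset n).
(* Nonnegative exponents of given total are bounded by that total, so each block is finite and
   contains every contributing [q]. *)
pose Q k := [fset q in AA (absz (k - kb)) | total_deg q == k - kb]%fset.
pose deg q := kb + @total_deg n q.
have Qd k q : q \in Q k -> deg q = k.
  by rewrite !inE => /andP[_ /eqP qk]; rewrite /deg qk; lia.
have Q0 q : q \notin Q (deg q) -> fb q = 0.
  move=> qQ; have [[i qi]|nn] := pselect (exists i, q 0 i < 0); first exact: (fb_zero_below qi).
  have q0 i : 0 <= q 0 i by rewrite leNgt; apply/negP => qi; apply: nn; exists i.
  case/negP: qQ; rewrite !inE /deg addrAC subrr add0r eqxx andbT; apply: AAP => i.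
  rewrite q0/= abszE ger0_norm; last by rewrite sumr_ge0.
  by rewrite /total_deg (bigD1 i)//= lerDl sumr_ge0.
have off q x : K x -> q \notin Q (deg q) -> monom (ww x) q *: corr_last a x.1 l (fb q) = 0.
  move=> Kx qQ; rewrite (Q0 q qQ) (lin0 (corr_last_linear a l _)) ?scaler0//.
  by have [] := KD Kx.
have H := nhas_group Qd off corr_last_sum.
have db0 x : K x -> lforms db (ww x) != 0.
  by move=> Kx; apply: corr_den_neq0; have [_ _] := dom_confs (KD Kx).
have [|r rP] := @compact_inv_bounded _ _ K (fun x => lforms db (ww x)) cK _ db0.
  move=> x _; apply: (@differentiable_continuous _ _ _ x (fun x : E => lforms db x.2 : C^o)).
  apply: (@differentiable_comp _ _ _ _ (fun x : E => x.2) (lforms db : _ -> C^o)).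
    exact: differentiable_snd.
  exact: lforms_differentiable.
apply: nhas_ext (nhas_scale (fun x Kx => proj2 (rP x Kx)) H) => [k x Kx|x Kx].
  have [c1 c2 _] := KD Kx; have cl := corr_last_linear a l c1.
  rewrite -[RHS]/(corr_last a x.1 l (dinj (corr S b x.2 k))).
  have -> : dinj (corr S b x.2 k) = (lforms db (ww x))^-1 *: \sum_(q <- Q k) monom (ww x) q *: fb q.
    rewrite /corr; case: asboolP => // _; rewrite -/db -/fb.
    rewrite (linZ (@dinj_linear _ _ k)); congr (_ *: _).
    rewrite (@evalfE _ _ _ _ _ (Q k)); last first.
      move=> q qQ; have [qk|qk] := eqVneq (deg q) k; first by rewrite Q0 ?qk.
      by apply: fbh; rewrite eq_sym.
    rewrite (lin_sum (@dinj_linear _ _ k)) big_seq [RHS]big_seq; apply: eq_bigr => q qQ.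
    congr (_ *: _); apply: homogeneous_dinj; rewrite -(Qd _ _ qQ); exact: fbh.
  by rewrite (linZ cl) (lin_sum cl).
by rewrite scalerA mulVf ?db0// scale1r.
Qed.

End OnCompact.

End Homogeneous.

(** The list [s] contains the entries that may be inhomogeneous; it is emptied by decomposing one
    entry at a time, both sides being additive in each entry. *)
Lemma assoc_compact m n (a : 'rV[dV]_m) (b : 'rV[dV]_n) l K : compact K -> K `<=` @assoc_dom R m n ->
  nhas K (assoc_term (@corr R V S) a b l) (assoc_val (@corr R V S) a b l).
Proof.
move=> cK KD.
suff H (s : seq 'I_n) (b' : 'rV[dV]_n) : (forall i, i \notin s -> exists d, homogeneous d (b' 0 i)) ->
    nhas K (assoc_term (@corr R V S) a b' l) (assoc_val (@corr R V S) a b' l).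
  by apply: (H (enum 'I_n)) => i; rewrite mem_enum.
elim: s b' => [|i s IH] b' hb.
  have [d dP] := choice (fun i => hb i isT).
  exact: assoc_homogeneous dP _ _ cK KD.
pose P x := nhas K (assoc_term (@corr R V S) a (row_upd b' i x) l)
  (assoc_val (@corr R V S) a (row_upd b' i x) l).
have Ph d x : homogeneous d x -> P x.
  move=> hx; apply: IH => j js; rewrite row_updE; case: eqP => [_|/eqP ji]; first by exists d.
  by apply: hb; rewrite inE negb_or ji.
have PD x y : P x -> P y -> P (x + y).
  move=> Px Py; have := @nhas_lc _ _ K _ _ (fun=> 1) (nm 1) _ _ _ _ (fun _ _ => lexx _) Px Py.
  apply: nhas_ext => [k zw /KD [c1 c2 _]|zw /KD dzw].
    have cl := corr_last_linear a l c1.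
    rewrite /assoc_term -!/(corr_last a zw.1 l _) scale1r -(linD cl) -(linD (@dinj_linear _ _ k)).
    congr (corr_last _ _ _ (dinj _)).
    have := @corr_multilinear _ _ S _ b' i 1 x y zw.2 c2; rewrite !scale1r => ->.
    by [].
  have E x' : row_mx a (row_upd b' i x') = row_upd (row_mx a b') (rshift m i) x'.
    apply/rowP => k; rewrite row_updE; case: (@ord_split _ _ k) => -[j ->].
      by rewrite eq_lrshift !row_mxEl.
    by rewrite eq_rshift !row_mxEr row_updE.
  rewrite /assoc_val (E (x + y)) (E x) (E y).
  have := @corr_multilinear _ _ S _ (row_mx a b') (rshift m i) 1 x y.
  move=> /(_ (row_mx (lsubmx zw.1) (zw.2 + const_mx (zw.1 0 (rshift m 0)))) _).
  rewrite !scale1r => ->//.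
  have [_ c _] := dom_confs dzw; move: (conf_shift (u := zw.1 0 (rshift m 0)) c).
  congr conf; apply/rowP => k; rewrite [LHS]mxE [X in _ + X = _]mxE.
  case: (@ord_split _ _ k) => -[j ->]; first by rewrite !row_mxEl zzE subrK mxE.
  by rewrite !row_mxEr !mxE.
have -> : b' = row_upd b' i (\sum_(k <- dsupp (b' 0 i)) dinj (dval (b' 0 i) k)).
  by apply/rowP => j; rewrite row_updE -dsum_decomp; case: eqP => [->|].
rewrite -/(P _); elim: (enum_fset _) => [|k ks IHk].
  by rewrite big_nil; apply: (Ph 0) => ? _.
by rewrite big_cons; apply: PD IHk; exact: Ph (@dinj_homogeneous _ _ _ _).
Qed.

Lemma assoc_dom_open m n : open (@assoc_dom R m n).
Proof.
rewrite openE => zw [c1 c2 lt]; rewrite /interior.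
have o1 : \forall y \near zw, conf y.1.
  have : open_nbhs zw.1 (@conf R (m + 1)) by split; [exact: conf_open|].
  move/open_nbhs_nbhs; exact: (@cvg_fst _ _ (nbhs zw.1) (nbhs zw.2) _).
have o2 : \forall y \near zw, conf y.2.
  have : open_nbhs zw.2 (@conf R n) by split; [exact: conf_open|].
  move/open_nbhs_nbhs; exact: (@cvg_snd _ _ (nbhs zw.1) (nbhs zw.2) _).
have o3 (p : 'I_n * 'I_m) : \forall y \near zw,
    nm ((y : 'rV[C]_(m + 1) * 'rV[C]_n).2 0 p.1) < nm (y.1 0 (lshift 1 p.2) - y.1 0 (rshift m 0)).
  case: p => i j /=.
  have g1 : nm ((y : 'rV[C]_(m + 1) * 'rV[C]_n).1 0 (lshift 1 j) - y.1 0 (rshift m 0)) - nm (y.2 0 i) @[y --> zw] -->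
      nm (zw.1 0 (lshift 1 j) - zw.1 0 (rshift m 0)) - nm (zw.2 0 i).
    apply: cvgB; apply: nm_cvg.
      apply: (@differentiable_continuous _ _ _ zw (fun x : 'rV[C]_(m + 1) * 'rV[C]_n =>
        x.1 0 (lshift 1 j) - x.1 0 (rshift m 0) : C^o)).
      by apply: differentiableB; exact: fst_coord_differentiable.
    exact: (differentiable_continuous (snd_coord_differentiable i zw)).
  have pos : 0 < nm (zw.1 0 (lshift 1 j) - zw.1 0 (rshift m 0)) - nm (zw.2 0 i).
    by rewrite subr_gt0 -rc_lt -!nmE; exact: lt.
  have G := cvgr_gt _ g1 _ pos.
  by near=> y; rewrite -subr_gt0; near: y; exact: G.
apply: filterS3 o1 o2 (filter_forall _ o3) => y y1 y2 y3; split=> // i j.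
by rewrite !nmE rc_lt; exact: (y3 (i, j)).
Unshelve. all: by end_near.
Qed.

Lemma assoc_term_fhol m n (a : 'rV[dV]_m) (b : 'rV[dV]_n) l k :
  fhol (@assoc_dom R m n) (assoc_term (@corr R V S) a b l k).
Proof.
have [e [v [c [cE cd]]]] := corr_fhol S b k.
apply: (@fhol_ext _ _ _ _ (fun zw => \sum_(j < e) c j zw.2 *: corr_last a zw.1 l (dinj (v j)))).
  move=> zw [c1 c2 _]; have cl := corr_last_linear a l c1.
  rewrite /assoc_term -/(corr_last a zw.1 l _) cE//.
  by rewrite (lin_sum (@dinj_linear _ _ k)) (lin_sum cl).
apply: fhol_sum => j; apply: fholZ.
  move=> zw [_ c2 _].
  apply: (@differentiable_comp _ _ _ _ (fun x : 'rV[C]_(m + 1) * 'rV[C]_n => x.2) (c j : _ -> C^o)).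
    exact: differentiable_snd.
  exact: cd.
apply: (@fhol_comp _ _ _ (@conf R (m + 1)) _ (fun x : 'rV[C]_(m + 1) * 'rV[C]_n => x.1) _
  (fun z => corr_last a z l (dinj (v j)))).
- by move=> zw [].
- by move=> zw _; exact: differentiable_fst.
- exact: corr_fhol.
Qed.

Lemma corr_associativity : mu_associativity (@corr R V S).
Proof.
move=> m n a b l; split.
  split=> [k|K cK KD]; first by apply: fhol_holomorphic (assoc_term_fhol a b l k); exact: assoc_dom_open.
  have [bn _] := assoc_compact a b l cK KD; exact: nsum_normal bn.
move=> zw dzw; have K1 : compact [set zw] by exact: compact_set1.
have [|_] := assoc_compact a b l K1; first by move=> _ ->.
by apply.
Qed.

End Associativity.

(** * Determination by two-point functions *)
Section Lines.
Variable R : realType.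
Local Notation C := (Cx R).

Lemma near_nm (t : C) (P : set C) : nbhs t P ->
  exists2 d : R, 0 < d & forall w, nm (w - t) < d -> P w.
Proof.
move=> /nbhs_ballP[e /= e0 eP]; have er := rc_real (gtr0_real e0).
exists (complex.Re e); first by rewrite -rc_gt0 -er.
move=> w wt; apply: eP; rewrite -ball_normE /ball_/= nmE er rc_lt.
by rewrite nm_dist.
Qed.

Lemma scalar_linear (X : lmodType C) (phi : {scalar X}) : linear (phi : X -> C^o).
Proof. by move=> c u v; rewrite linearP. Qed.

(* Scalar functionals reduce holomorphy of vector-valued functions to complex
   differentiability along curves. *)
Lemma holomorphic_curve (E : normedModType C) (U : set E) (X : lmodType C) (F : E -> X)
    (g : C -> E) t (phi : X -> C) : linear (phi : X -> C^o) -> holomorphic U F -> U (g t) ->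
  differentiable (g : C^o -> E) t -> cdiff (fun s => phi (F (g s)) : C) t.
Proof.
move=> pl hF Ut gd; have [W [oW Wt WU [d [e [c [ie Fc cd]]]]]] := hF _ Ut.
have : nbhs t (fun s => W (g s)).
  have := differentiable_continuous gd; apply.
  by apply: open_nbhs_nbhs; split.
move=> /near_nm[r r0 rP].
apply: (@cdiff_near _ (fun s => \sum_(j < d) c (g s) 0 j * phi (e j)) _ _ r r0).
  by move=> w /rP Ww; rewrite Fc// /lcomb (lin_sum pl).
apply: cdiff_sum => j _; apply: cdiffM; last exact: cdiff_cst.
apply: differentiable_cdiff.
apply: (@differentiable_comp _ _ _ _ (fun s : C^o => c (g s)) (fun v : 'rV[C]_d => v 0 j : C^o)).
  by apply: differentiable_comp; [exact: gd|exact: cd].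
exact: differentiable_coord.
Qed.

Lemma line_differentiable (E : normedModType C) (z v : E) (t : C) :
  differentiable ((fun s : C => z + s *: v) : C^o -> E) t.
Proof. by apply: differentiableD; [exact: differentiable_cst|exact: differentiableZl]. Qed.

Lemma has_sum_lin (X Y : lmodType C) (g : X -> Y) (I : choiceType) (f : I -> X) s : linear g ->
  has_sum f s -> has_sum (fun i => g (f i)) (g s).
Proof.
move=> gl [d [e [c [t [_ fc st ct]]]]].
apply: (@has_sum_family _ _ _ _ _ _ (g \o e) c t) => //.
  by move=> q; rewrite fc /lcomb (lin_sum gl).
by rewrite st /lcomb (lin_sum gl).
Qed.

Section Ordered.
Variable m : nat.

Definition ordered : set 'rV[C]_m :=
  [set z | forall i j : 'I_m, (i < j)%N -> `|z 0 j| < `|z 0 i|].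

Lemma ordered_open : open ordered.
Proof.
rewrite openE => z lt; rewrite /interior.
have o (p : 'I_m * 'I_m) : \forall y \near z, (p.1 < p.2)%N ->
    nm ((y : 'rV[C]_m) 0 p.2) < nm (y 0 p.1).
  case: p => i j /=; have [ij|ij] := boolP (i < j)%N; last by near=> y.
  have cc k : (y : 'rV[C]_m) 0 k @[y --> z] --> z 0 k := @coord_continuous _ _ _ _ _ z.
  have g1 : nm ((y : 'rV[C]_m) 0 i) - nm (y 0 j) @[y --> z] --> nm (z 0 i) - nm (z 0 j).
    exact: cvgB (nm_cvg (cc i)) (nm_cvg (cc j)).
  have pos : 0 < nm (z 0 i) - nm (z 0 j) by rewrite subr_gt0 -rc_lt -!nmE lt.
  have G := cvgr_gt _ g1 _ pos.
  by near=> y => _; rewrite -subr_gt0; near: y; exact: G.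
apply: filterS (filter_forall _ o) => y yP i j ij.
by rewrite !nmE rc_lt; exact: (yP (i, j)).
Unshelve. all: by end_near.
Qed.

(* A complex slope avoiding the finitely many real directions [z_i - z_j]. *)
Lemma ray_exists (z : 'rV[C]_m) : conf z -> exists (v : 'rV[C]_m) (T : R), [/\ 0 <= T,
  forall t : R, 0 <= t -> conf (z + rc t *: v) & ordered (z + rc T *: v)].
Proof.
move=> cz.
(* [ka] exceeds the slope Im/Re of every difference z_i - z_j. A purely imaginary difference, for
   which the quotient is 0 by convention, is not a nonzero real multiple of [tau] either. *)
pose ka : R := 1 + \sum_i \sum_j `|complex.Im (z 0 i - z 0 j) / complex.Re (z 0 i - z 0 j)|.
pose tau : C := pt 1 ka.
pose v : 'rV[C]_m := \row_i (tau * rc (m%:R - i%:R)).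
pose M := \sum_i nm (z 0 i).
have M0 : 0 <= M by rewrite sumr_ge0// => i _; exact: nm_ge0.
have MP i : nm (z 0 i) <= M.
  by rewrite /M (bigD1 i)//= lerDl sumr_ge0// => j _; exact: nm_ge0.
(* The moduli of two entries of T v differ by at least T = 2 M + 1, more than |z_i| + |z_j|, so they
   dictate the order of the sums. *)
exists v, (2 * M + 1); split; first by lra.
  move=> t t0 [i [j [ij]]]; rewrite !mxE => zE.
  have sE : z 0 i - z 0 j = pt (t * (i%:R - j%:R)) (ka * (t * (i%:R - j%:R))).
    have -> : pt (t * (i%:R - j%:R)) (ka * (t * (i%:R - j%:R))) =
        rc t * (tau * rc (m%:R - j%:R)) - rc t * (tau * rc (m%:R - i%:R)).
      by apply/eqP; rewrite eq_complex /=; apply/andP; split; apply/eqP; ring.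
    by apply/eqP; rewrite subr_eq addrAC [_ + z 0 j]addrC -zE addrK.
  have s0 : z 0 i - z 0 j != 0.
    by rewrite subr_eq0; apply/eqP => zij; apply: cz; exists i, j.
  pose r := t * (i%:R - j%:R); have r0 : r != 0.
    by apply: contraNneq s0 => r0; rewrite sE -/r r0 mulr0.
  have kaE : ka = complex.Im (z 0 i - z 0 j) / complex.Re (z 0 i - z 0 j).
    by rewrite sE /= -/r mulfK.
  have le : `|complex.Im (z 0 i - z 0 j) / complex.Re (z 0 i - z 0 j)| <=
      \sum_i \sum_j `|complex.Im (z 0 i - z 0 j) / complex.Re (z 0 i - z 0 j)|.
    rewrite (bigD1 i)//= (bigD1 j)//= -addrA lerDl addr_ge0 ?sumr_ge0// => k _.
    by rewrite sumr_ge0.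
  have lt : ka < 1 + ka by rewrite ltrDr ltr01.
  have := ler_norm ka; rewrite {2}kaE => /le_trans /(_ le).
  by rewrite /ka leNgt ltrDr ltr01.
move=> i j ij; rewrite !nmE rc_lt !mxE.
have nt : 1 <= nm tau by have := nm_Re tau; rewrite /= normr1.
set T := 2 * M + 1.
have vE k : (k <= m)%N -> nm (rc T * (tau * rc (m%:R - k%:R))) = T * (nm tau * (m%:R - k%:R)).
  move=> km; rewrite !nmM !nm_rc !ger0_norm//; first by rewrite subr_ge0 ler_nat.
  by rewrite /T; lra.
have hi := vE i (ltnW (ltn_ord i)); have hj := vE j (ltnW (ltn_ord j)).
have up : nm (z 0 j + rc T * (tau * rc (m%:R - j%:R))) <= nm (z 0 j) + T * (nm tau * (m%:R - j%:R)).
  by rewrite -hj nmD.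
have lo : T * (nm tau * (m%:R - i%:R)) <= nm (z 0 i + rc T * (tau * rc (m%:R - i%:R))) + nm (z 0 i).
  rewrite -hi; have := nmD (z 0 i + rc T * (tau * rc (m%:R - i%:R))) (- z 0 i).
  by rewrite nmN addrAC subrr add0r.
have ji : 1 <= (j%:R - i%:R : R) by rewrite lerBrDr addrC natr1 ler_nat.
have : T * 1 <= T * (nm tau * (j%:R - i%:R)).
  by rewrite ler_wpM2l ?mulr_ege1//; rewrite /T; lra.
have := MP i; have := MP j; move: lo up; rewrite mulr1 /T.
set A := nm (_ + _); set B := nm (_ + _); nra.
Qed.

End Ordered.
End Lines.

(** * Uniqueness of the correlation functions *)

Section Psi.
Variables (R : realType) (V : graded R) (S : vertexVA V).
Local Notation C := (Cx R).
Local Notation dV := (dsum V).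

Lemma corr_holomorphic n (a : 'rV[dV]_n) : holomorphic_bar (@conf R n) (corr S a).
Proof. exact: (corr_is_correlation S a).1. Qed.

Definition geom_of_vertex : geomVA V :=
  GeomVA (@corr_diag R V S) corr_holomorphic (@corr_multilinear R V S) (@corr_permutation R V S)
    (@corr_insertion R V S) (@corr_associativity R V S) (@corr_equivariance R V S)
    (@corr_meromorphicity R V S).

(** The ordered domain, where both functions have the same expansion, is joined to any configuration
    by a ray inside the configuration space; [vanish_on_ray] carries the equality back to its
    origin. *)
Lemma correlation_unique m (a : 'rV[dV]_m) (g : 'rV[C]_m -> gbar V) z :
  is_correlation S a g -> conf z -> g z = corr S a z.
Proof.
move=> [gh gs] cz; apply: functional_extensionality_dep => l; apply: functional_ext => phi.
have [ch cs] := corr_is_correlation S a.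
have gc y : conf y -> ordered y -> g y = corr S a y.
  move=> cy oy; apply: functional_extensionality_dep => k.
  exact: has_sum_unique (gs y cy oy k) (cs y cy oy k).
have [v [T [T0 cl oT]]] := ray_exists cz.
pose f s : C := phi (g (z + s *: v) l) - phi (corr S a (z + s *: v) l).
have nbh t (U : set 'rV[C]_m) : open U -> U (z + rc t *: v) ->
    exists2 d : R, 0 < d & forall s, nm (s - rc t) < d -> U (z + s *: v).
  move=> oU Ut; apply: near_nm.
  have := differentiable_continuous (line_differentiable z v (rc t)); apply.
  by apply: open_nbhs_nbhs; split.
have : f 0 = 0.
  apply: (@vanish_on_ray _ f T T0) => [t /andP[t0 tT]|].
    have [d d0 dP] := nbh t _ (@conf_open _ m) (cl t t0).
    exists d => // s /dP cs'; apply: cdiffB.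
      exact: (@holomorphic_curve _ _ _ _ (fun x => g x l) (fun s => z + s *: v) s phi (scalar_linear phi) (gh l) cs'
        (line_differentiable z v s)).
    exact: (@holomorphic_curve _ _ _ _ (fun x => corr S a x l) (fun s => z + s *: v) s phi (scalar_linear phi) (ch l) cs'
        (line_differentiable z v s)).
  have [d1 d10 d1P] := nbh T _ (@conf_open _ m) (cl T T0).
  have [d2 d20 d2P] := nbh T _ (@ordered_open _ m) oT.
  exists (Num.min d1 d2); first by rewrite lt_min d10.
  by move=> s; rewrite lt_min => /andP[/d1P s1 /d2P s2]; rewrite /f gc// subrr.
by rewrite /f scale0r addr0 => /eqP; rewrite subr_eq0 => /eqP.
Qed.

End Psi.

Section Determination.
Variables (R : realType) (V V' : graded R) (M : geomVA V) (M' : geomVA V') (f : ghom V V').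
Local Notation C := (Cx R).
Local Notation dV := (dsum V).
Hypothesis f_mu2 : forall a b z, z != 0 ->
  bmap f (mu2 (@gmu _ _ M) a z b 0) = mu2 (@gmu _ _ M') (dmap f a) z (dmap f b) 0.
Hypothesis f_vac : bmap f (gmu M (0 : 'rV_0) 0) = gmu M' (0 : 'rV_0) 0.

Lemma dmap_dinj k (v : V k) : dmap f (dinj v) = dinj (f k v).
Proof.
apply: dsum_eq => l; rewrite -[LHS]/(f l (dval (dinj v) l)); have [->|lk] := eqVneq l k.
  by rewrite !dinj_in.
by rewrite !dinj_out// (lin0 (@gfun_linear _ _ _ f l)).
Qed.

(* At such points [mu(a, z)] is obtained from two-point functions by inserting
   the other points around [0]. *)
Lemma morphism_dominant n (a : 'rV[dV]_n.+1) (z : 'rV[C]_n.+1) :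
  (forall (b : 'rV[dV]_n) (w : 'rV[C]_n), conf w ->
     bmap f (gmu M b w) = gmu M' (map_mx (dmap f) b) w) ->
  conf z -> z 0 0 != 0 -> (forall j, j != 0 -> `|z 0 j| < `|z 0 0|) ->
  bmap f (gmu M a z) = gmu M' (map_mx (dmap f) a) z.
Proof.
move=> IH cz z0 lt; apply: functional_extensionality_dep => l.
pose a1 : 'rV[dV]_1 := lsubmx (a : 'rV_(1 + n)); pose b : 'rV[dV]_n := rsubmx (a : 'rV_(1 + n)).
pose z1 : 'rV[C]_1 := lsubmx (z : 'rV_(1 + n)); pose w : 'rV[C]_n := rsubmx (z : 'rV_(1 + n)).
have z1E : z1 = const_mx (z 0 0).
  by apply/rowP => i; rewrite !mxE ord1; congr (z 0 _); exact: val_inj.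
have a1E : a1 = const_mx (a 0 0).
  by apply/rowP => i; rewrite !mxE ord1; congr (a 0 _); exact: val_inj.
pose zw : 'rV[C]_(1 + 1) * 'rV[C]_n := (row_mx z1 0, w).
have cw : conf w.
  by move=> [i [j [ij]]]; rewrite !mxE => wij; apply: cz; exists (rshift 1 i), (rshift 1 j); split=> //; apply: contraNneq ij => /rshift_inj ->.
have dzw : assoc_dom zw.
  split=> //=.
    by rewrite z1E (_ : 0 = const_mx 0)//; exact: pair_conf.
  move=> i j; rewrite row_mxEl row_mxEr z1E !mxE subr0; apply: lt.
  by rewrite -val_eqE.
have [_ hs] := @gmu_associativity _ _ M 1 n a1 b l.
have [_ hs'] := @gmu_associativity _ _ M' 1 n (map_mx (dmap f) a1) (map_mx (dmap f) b) l.
have := has_sum_lin (@gfun_linear _ _ _ f l) (hs zw dzw).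
rewrite (_ : (fun k => _) = fun k => assoc_term (@gmu _ _ M') (map_mx (dmap f) a1) (map_mx (dmap f) b) l k zw).
  move=> /has_sum_unique /(_ (hs' zw dzw)); rewrite /assoc_val /= row_mxKl row_mxEr mxE.
  rewrite (_ : w + const_mx 0 = w); last by apply/rowP => i; rewrite !mxE addr0.
  by rewrite -map_row_mx !hsubmxK.
apply/funext => k; rewrite /assoc_term /= -IH// a1E z1E.
have := f_mu2 (a 0 0) (dinj (gmu M b w k)) z0; rewrite dmap_dinj => /(congr1 (fun v => v l)).
rewrite /mu2 -[X in X = _ -> _]/(f l _) (_ : const_mx 0 = 0)// => ->; congr (gmu M' (row_mx _ _) _ l).
by apply/rowP => i; rewrite !mxE.
Qed.

(** In a general configuration several points may share the largest modulus. One of them is pushed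
    outward along its own direction, or away from 0 if it is 0: for every real t > 0 it dominates,
    and continuity gives the equality at t = 0. *)
Lemma morphism_of_mu2 : geom_morphism M M' f.
Proof.
elim=> [|n IH] a z cz.
  rewrite (_ : a = 0); last by apply/rowP => -[].
  rewrite (_ : z = 0); last by apply/rowP => -[].
  by rewrite f_vac; congr (gmu M' _ _); apply/rowP => -[].
have dominant (a' : 'rV[dV]_n.+1) (y : 'rV[C]_n.+1) i : conf y -> y 0 i != 0 ->
    (forall j, j != i -> `|y 0 j| < `|y 0 i|) ->
    bmap f (gmu M a' y) = gmu M' (map_mx (dmap f) a') y.
  move=> cy yi lt; pose s := tperm 0 i.
  rewrite -(gmu_permutation M s a' cy) -(gmu_permutation M' s _ cy) -map_col_perm.
  apply: morphism_dominant => //.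
  - exact: conf_perm.
  - by rewrite mxE tpermL.
  - move=> j j0; rewrite !mxE tpermL; apply: lt.
    by rewrite -[X in _ != X](tpermL 0 i) (inj_eq perm_inj).
have [i iP] : exists i, forall j, nm (z 0 j) <= nm (z 0 i).
  by have [i _ iP] := @arg_maxP _ _ _ 0 xpredT (fun j => nm (z 0 j)) isT; exists i => j; exact: iP.
pose v : 'rV[C]_n.+1 := \row_j (if j == i then (if z 0 i == 0 then 1 else z 0 i) else 0).
have yE (t : R) j : (z + rc t *: v) 0 j = if j == i then
    (if z 0 i == 0 then rc t else (1 + rc t) * z 0 i) else z 0 j.
  rewrite !mxE; case: eqP => [->|_]; last by rewrite mulr0 addr0.
  by case: eqP => [->|_]; rewrite ?mulr1 ?add0r// mulrDl mul1r.
have big (t : R) : 0 < t -> nm (z 0 i) < nm ((z + rc t *: v) 0 i).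
  move=> t0; rewrite yE eqxx; case: eqP => [->|/eqP zi]; first by rewrite nm0 nm_rc normr_gt0 gt_eqF.
  rewrite nmM -rcD nm_rc gtr0_norm; last by lra.
  by rewrite ltr_pMl ?nm_gt0//; lra.
have lt (t : R) j : 0 < t -> j != i -> nm ((z + rc t *: v) 0 j) < nm ((z + rc t *: v) 0 i).
  by move=> t0 ji; rewrite yE (negbTE ji); apply: le_lt_trans (iP j) (big t t0).
have ct (t : R) : 0 <= t -> conf (z + rc t *: v).
  rewrite le_eqVlt => /orP[/eqP <-|t0]; first by rewrite (_ : rc 0 = 0)// scale0r addr0.
  move=> [j [k [jk]]]; have [jE|ji] := eqVneq j i; have [kE|ki] := eqVneq k i.
  - by rewrite jE kE eqxx in jk.
  - by move=> e; have := lt t k t0 ki; rewrite -jE e ltxx.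
  - by move=> e; have := lt t j t0 ji; rewrite -kE e ltxx.
  - by rewrite !yE (negbTE ji) (negbTE ki) => e; apply: cz; exists j, k.
apply: functional_extensionality_dep => l; apply: functional_ext => phi.
have phif : linear (fun u => phi (f l u) : C^o).
  by move=> c x y; rewrite gfun_linear linearP.
pose psi u : C := phi (f l u).
pose h s : C := psi (gmu M a (z + s *: v) l) - phi (gmu M' (map_mx (dmap f) a) (z + s *: v) l).
have cz0 : conf (z + 0 *: v) by rewrite scale0r addr0.
have hd : cdiff h 0.
  apply: cdiffB.
    exact: (@holomorphic_curve _ _ _ _ (fun x => gmu M a x l) (fun s => z + s *: v) 0 psi
      phif (gmu_holomorphic M a l) cz0 (line_differentiable z v 0)).
  exact: (@holomorphic_curve _ _ _ _ (fun x => gmu M' (map_mx (dmap f) a) x l) (fun s => z + s *: v) 0 phi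
      (scalar_linear phi) (gmu_holomorphic M' _ l) cz0 (line_differentiable z v 0)).
have h0 (t : R) : 0 < t -> h (rc t) = 0.
  move=> t0; have := @dominant a (z + rc t *: v) i (ct t (ltW t0)).
  have zi : (z + rc t *: v) 0 i != 0 by rewrite -nm_gt0; apply: le_lt_trans (big t t0); exact: nm_ge0.
  move=> /(_ zi) E; rewrite /h -[psi _]/(phi (bmap f (gmu M a (z + rc t *: v)) l)) E ?subrr//.
  by move=> j ji; rewrite !nmE rc_lt lt.
suff : h 0 = 0.
  by rewrite /h scale0r addr0 => /eqP; rewrite subr_eq0 => /eqP.
apply/eqP; rewrite -nm_eq0; apply: contraT => hn.
have hp : 0 < nm (h 0) by rewrite lt0r hn nm_ge0.
have [d d0 dP] := cdiff_cont hd hp.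
have := dP (rc (d / 2)); rewrite subr0 nm_rc gtr0_norm ?divr_gt0// h0 ?divr_gt0// sub0r nmN ltxx.
by move=> ->//; lra.
Qed.

End Determination.

(** * Few-point functions of a geometric vertex algebra *)
Section Rows.
Variable T : Type.

Definition tri (x y z : T) : 'rV[T]_3 :=
  \row_i (if i == 0 then x else if i == lift ord0 ord0 then y else z).

Lemma tri_row x y z :
  row_mx (const_mx x : 'rV_1) (row_mx (const_mx y : 'rV_1) (const_mx z : 'rV_1)) = tri x y z.
Proof.
apply/rowP => i; rewrite [RHS]mxE; case: (@ord_split 1 (1 + 1) i) => -[j ->].
  by rewrite row_mxEl mxE ord1.
rewrite row_mxEr; case: (@ord_split 1 1 j) => -[k ->].
  by rewrite row_mxEl mxE ord1.
by rewrite row_mxEr mxE ord1.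
Qed.

Lemma tri_swap01 x y z : col_perm (tperm 0 (lift ord0 ord0)) (tri x y z) = tri y x z.
Proof.
apply/rowP => i; rewrite !mxE; case: tpermP => [->|->|] //.
by move=> /eqP/negbTE -> /eqP/negbTE ->.
Qed.

Lemma tri_swap12 x y z : col_perm (tperm (lift ord0 ord0) ord_max) (tri x y z) = tri x z y.
Proof.
apply/rowP => i; rewrite !mxE; case: tpermP => [->|->|] //.
case: i => -[|[|[|]]] //= hi i1 i2.
  by case: i1; apply: val_inj.
by case: i2; apply: val_inj.
Qed.

Lemma row0_row n (a : 'rV[T]_0) (b : 'rV[T]_n) : row_mx a b = b.
Proof.
apply/rowP => i; case: (@ord_split 0 n i) => -[j ->]; first by case: j.
by rewrite row_mxEr; congr (b 0 _); apply: val_inj.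
Qed.

Lemma row_row0 (a : 'rV[T]_1) (b : 'rV[T]_0) : row_mx a b = a.
Proof.
apply/rowP => i; case: (@ord_split 1 0 i) => -[j ->]; last by case: j.
by rewrite row_mxEl; congr (a 0 _); apply: val_inj.
Qed.

Lemma pair0 (x y : T) (i : 'I_(1 + 1)) : i = 0 :> nat ->
  row_mx (const_mx x : 'rV_1) (const_mx y : 'rV_1) 0 i = x.
Proof.
move=> i0; have -> : i = lshift 1 0 by apply: val_inj.
by rewrite row_mxEl mxE.
Qed.

Lemma pair1 (x y : T) (i : 'I_(1 + 1)) : i = 1 :> nat ->
  row_mx (const_mx x : 'rV_1) (const_mx y : 'rV_1) 0 i = y.
Proof.
move=> i0; have -> : i = rshift 1 0 by apply: val_inj.
by rewrite row_mxEr mxE.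
Qed.

Lemma pair_swap (x y : T) :
  col_perm (tperm 0 ord_max) (row_mx (const_mx x : 'rV_1) (const_mx y : 'rV_1)) =
  row_mx (const_mx y : 'rV_1) (const_mx x).
Proof.
apply/rowP => i; rewrite mxE; case: tpermP => [->|->|].
- by rewrite pair1// pair0.
- by rewrite pair0// pair1.
case: i => -[|[|//]] hi i1 i2; first by case: i1; apply: val_inj.
by case: i2; apply: val_inj.
Qed.

End Rows.

Section FewPoints.
Variables (R : realType) (V : graded R) (M : geomVA V).
Local Notation C := (Cx R).
Local Notation dV := (dsum V).

Definition one_pt := mu1 (@gmu _ _ M).
Definition two_pt := mu2 (@gmu _ _ M).
Definition three_pt (a : dV) (x : C) (b : dV) (y : C) (c : dV) (z : C) : gbar V :=
  gmu M (tri a b c) (tri x y z).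
Definition no_pt : gbar V := gmu M (0 : 'rV_0) 0.

Lemma conf2 (z w : C) : conf (row_mx (const_mx z : 'rV_1) (const_mx w : 'rV_1)) <-> z <> w.
Proof.
split=> [c zw|zw [i [j [ij]]]].
  apply: c; exists (lshift 1 0), (rshift 1 0); split; first by rewrite eq_lrshift.
  by rewrite row_mxEl row_mxEr !mxE.
case: (@ord_split 1 1 i) ij => -[i' ->]; case: (@ord_split 1 1 j) => -[j' ->]; rewrite !ord1.
- by rewrite eqxx.
- by rewrite row_mxEl row_mxEr !mxE.
- by rewrite row_mxEl row_mxEr !mxE => _ /esym.
- by rewrite eqxx.
Qed.

Lemma conf_tri (x y z : C) : conf (tri x y z) <-> [/\ x <> y, y <> z & x <> z].
Proof.
split=> [c|[xy yz xz] [i [j [ij]]]].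
  split=> e; apply: c.
  - by exists 0, (lift ord0 ord0); rewrite !mxE.
  - by exists (lift ord0 ord0), ord_max; rewrite !mxE.
  - by exists 0, ord_max; rewrite !mxE.
rewrite !mxE; case: i j ij => -[|[|[|]]]//= hi [] [|[|[|]]]//= hj ij; by [|move/esym].
Qed.

Lemma two_pt_linl z b w : z <> w -> linear (fun a => two_pt a z b w).
Proof.
move=> zw k u v; have E x : row_mx (const_mx x : 'rV_1) (const_mx b : 'rV_1) =
    row_upd (row_mx (const_mx 0 : 'rV_1) (const_mx b : 'rV_1)) (lshift 1 0) x.
  apply/rowP => i; rewrite row_updE; case: (@ord_split 1 1 i) => -[j ->]; rewrite ord1.
    by rewrite eqxx row_mxEl mxE.
  by rewrite eq_rlshift !row_mxEr.
rewrite /two_pt /mu2 (E (k *: u + v)) (E u) (E v) gmu_multilinear//; exact/conf2.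
Qed.

Lemma two_pt_linr a z w : z <> w -> linear (fun b => two_pt a z b w).
Proof.
move=> zw k u v; have E x : row_mx (const_mx a : 'rV_1) (const_mx x : 'rV_1) =
    row_upd (row_mx (const_mx a : 'rV_1) (const_mx 0 : 'rV_1)) (rshift 1 0) x.
  apply/rowP => i; rewrite row_updE; case: (@ord_split 1 1 i) => -[j ->]; rewrite ord1.
    by rewrite eq_lrshift !row_mxEl.
  by rewrite eqxx row_mxEr mxE.
rewrite /two_pt /mu2 (E (k *: u + v)) (E u) (E v) gmu_multilinear//; exact/conf2.
Qed.

Lemma one_pt_linear z : linear (fun a => one_pt a z).
Proof.
move=> k u v; have E (x : dV) : const_mx x = row_upd (const_mx 0 : 'rV_1) 0 x.
  by apply/rowP => i; rewrite row_updE ord1 eqxx mxE.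
by rewrite /one_pt /mu1 (E (k *: u + v)) (E u) (E v) gmu_multilinear//; exact: conf1.
Qed.

Lemma two_pt_sym a z b w : z <> w -> two_pt a z b w = two_pt b w a z.
Proof.
move=> zw; rewrite /two_pt /mu2 -(gmu_permutation M (tperm 0 ord_max)); last exact/conf2.
by rewrite !pair_swap.
Qed.

Lemma three_pt_swap01 a x b y c z : conf (tri x y z) ->
  three_pt a x b y c z = three_pt b y a x c z.
Proof.
move=> cf; rewrite /three_pt -(gmu_permutation M (tperm 0 (lift ord0 ord0)) _ cf).
by rewrite !tri_swap01.
Qed.

Lemma three_pt_swap12 a x b y c z : conf (tri x y z) ->
  three_pt a x b y c z = three_pt a x c z b y.
Proof.
move=> cf; rewrite /three_pt -(gmu_permutation M (tperm (lift ord0 ord0) ord_max) _ cf).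
by rewrite !tri_swap12.
Qed.

(** Associativity enters the construction of the vertex algebra through the four cases (m, n) = (1,
    2), (0, 2), (1, 1) and (1, 0), specialized here and below. *)
Lemma assoc_three a x b y c z u l : x <> u -> y <> z -> `|y| < `|x - u| -> `|z| < `|x - u| ->
  has_sum (fun k => two_pt a x (dinj (two_pt b y c z k)) u l) (three_pt a x b (y + u) c (z + u) l).
Proof.
move=> xu yz yx zx.
have [_ /(_ (row_mx (const_mx x : 'rV_1) (const_mx u : 'rV_1),
   row_mx (const_mx y : 'rV_1) (const_mx z : 'rV_1)))] := gmu_associativity M
  (const_mx a : 'rV_1) (row_mx (const_mx b : 'rV_1) (const_mx c : 'rV_1)) l.
rewrite /assoc_val /assoc_term /= row_mxKl !row_mxEr mxE.
have -> : row_mx (const_mx y : 'rV_1) (const_mx z : 'rV_1) + const_mx u =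
    row_mx (const_mx (y + u) : 'rV_1) (const_mx (z + u) : 'rV_1).
  apply/rowP => i; rewrite mxE [X in _ + X]mxE; case: (@ord_split 1 1 i) => -[j ->].
    by rewrite !row_mxEl !mxE.
  by rewrite !row_mxEr !mxE.
rewrite !tri_row; apply; split=> /=; [exact/conf2|exact/conf2|].
move=> i j; rewrite row_mxEl row_mxEr [const_mx x _ _]mxE [const_mx u _ _]mxE.
case: (@ord_split 1 1 i) => -[k ->]; first by rewrite row_mxEl mxE.
by rewrite row_mxEr mxE.
Qed.

Lemma assoc_translate a z b w u l : z <> w ->
  has_sum (fun k => one_pt (dinj (two_pt a z b w k)) u l) (two_pt a (z + u) b (w + u) l).
Proof.
move=> zw.
have [_ /(_ (const_mx u, row_mx (const_mx z : 'rV_1) (const_mx w : 'rV_1)))] :=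
  gmu_associativity M (0 : 'rV_0) (row_mx (const_mx a : 'rV_1) (const_mx b : 'rV_1)) l.
rewrite /assoc_val /assoc_term /= mxE.
have -> : row_mx (const_mx z : 'rV_1) (const_mx w : 'rV_1) + const_mx u =
    row_mx (const_mx (z + u) : 'rV_1) (const_mx (w + u) : 'rV_1).
  apply/rowP => i; rewrite mxE [X in _ + X]mxE; case: (@ord_split 1 1 i) => -[j ->].
    by rewrite !row_mxEl !mxE.
  by rewrite !row_mxEr !mxE.
rewrite !row0_row (_ : (fun k => _) = fun k => one_pt (dinj (two_pt a z b w k)) u l).
  apply; split=> /=; [exact: conf1|exact/conf2|by move=> ? []].
by apply/funext => k; rewrite row0_row.
Qed.

Lemma assoc_two a x b y u l : x <> u -> `|y| < `|x - u| ->
  has_sum (fun k => two_pt a x (dinj (one_pt b y k)) u l) (two_pt a x b (y + u) l).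
Proof.
move=> xu yx.
have [_ /(_ (row_mx (const_mx x : 'rV_1) (const_mx u : 'rV_1), const_mx y))] :=
  gmu_associativity M (const_mx a : 'rV_1) (const_mx b : 'rV_1) l.
rewrite /assoc_val /assoc_term /= row_mxKl !row_mxEr mxE.
have -> : const_mx y + const_mx u = const_mx (y + u) :> 'rV[C]_1.
  by apply/rowP => i; rewrite !mxE.
apply; split=> /=; [exact/conf2|exact: conf1|].
by move=> i j; rewrite row_mxEl row_mxEr !mxE.
Qed.

Lemma assoc_vacuum a x u l : x <> u ->
  has_sum (fun k => two_pt a x (dinj (no_pt k)) u l) (one_pt a x l).
Proof.
move=> xu.
have [_ /(_ (row_mx (const_mx x : 'rV_1) (const_mx u : 'rV_1), 0))] :=
  gmu_associativity M (const_mx a : 'rV_1) (0 : 'rV_0) l.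
rewrite /assoc_val /assoc_term /= row_mxKl !row_row0.
apply; split=> /=; [exact/conf2|by move=> [[]]|by move=> []].
Qed.

Lemma two_pt_equivariant z a w b k l : z != 0 -> w <> k ->
  z ^ l *: two_pt a w b k l =
  two_pt (dmap (cact V z) a) (z * w) (dmap (cact V z) b) (z * k) l.
Proof.
move=> z0 wk; have /conf2 c := wk.
have E := congr1 (fun v : gbar V => v l)
  (gmu_equivariance M (row_mx (const_mx a : 'rV_1) (const_mx b : 'rV_1)) z0 c).
apply: etrans E _; rewrite map_row_mx !map_const_mx scale_row_mx.
by congr (gmu M _ (row_mx _ _) l); apply/rowP => i; rewrite !mxE.
Qed.

Lemma conf0 (z : 'rV[C]_0) : conf z.
Proof. by move=> [[]]. Qed.

Lemma expz2_neq1 (k : int) : k != 0 -> (2 : C) ^ k != 1.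
Proof.
have P n : (1 : C) < 2 ^ n.+1%:Z by rewrite -exprnP exprn_egt1// ltr1n.
case: k => -[|n] // _; first by rewrite gt_eqF.
  by rewrite NegzE -invr_expz invr_eq1 gt_eqF// (P 0%N).
by rewrite NegzE -invr_expz invr_eq1 gt_eqF// P.
Qed.

(** Equivariance under z = 2 multiplies this component by 2^k and fixes it, while 2^k is 1 only for
    k = 0. *)
Lemma no_pt_degree k : k != 0 -> no_pt k = 0.
Proof.
move=> k0; have two0 : (2 : C) != 0 by rewrite pnatr_eq0.
have E := congr1 (fun v : gbar V => v k) (gmu_equivariance M (0 : 'rV_0) two0 (@conf0 0)).
have E1 : map_mx (dmap (cact V 2)) (0 : 'rV[dV]_0) = 0 by apply/rowP => -[].
have E2 : 2 *: (0 : 'rV[C]_0) = 0 by apply/rowP => -[].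
rewrite E1 E2 in E.
have F : (2 : C) ^ k *: no_pt k = no_pt k by exact: E.
have : (2 ^ k - 1) *: no_pt k = 0 by rewrite scalerBl scale1r F subrr.
by move=> /eqP; rewrite scaler_eq0 subr_eq0 (negbTE (expz2_neq1 k0)) => /eqP.
Qed.

End FewPoints.

(** * The vertex algebra of a geometric vertex algebra *)
Section Derivatives.
Variable R : realType.
Local Notation C := (Cx R).

Lemma is_derive_cvg (W : normedModType C) (f : C -> W) (x : C) (df : W) :
  h^-1 *: (f (h + x) - f x) @[h --> 0^'] --> df -> is_derive x 1 f df.
Proof.
move=> H; have E : (fun h : C => h^-1 *: ((f \o shift x) (h *: 1) - f x)) =
    fun h => h^-1 *: (f (h + x) - f x) by apply/funext => h /=; rewrite /shift /= /GRing.scale /= mulr1.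
by split; [rewrite /derivable E; exact: cvgP H|rewrite /derive E; exact: cvg_lim H].
Qed.

Lemma cvg_is_derive (W : normedModType C) (f : C -> W) (x : C) (df : W) :
  is_derive x 1 f df -> h^-1 *: (f (h + x) - f x) @[h --> 0^'] --> df.
Proof.
have E : (fun h : C => h^-1 *: ((f \o shift x) (h *: 1) - f x)) =
    fun h => h^-1 *: (f (h + x) - f x) by apply/funext => h /=; rewrite /shift /= /GRing.scale /= mulr1.
by case; rewrite /derivable /derive E => c <-.
Qed.

Lemma has_derivative_family (X : lmodType C) (f : C -> X) (x : C) d (w : 'I_d -> X)
    (c : 'I_d -> C -> C) (dc : 'I_d -> C) :
  (forall t, f t = \sum_(j < d) c j t *: w j) ->
  (forall j, is_derive x 1 (c j) (dc j)) ->
  has_derivative f x (\sum_(j < d) dc j *: w j).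
Proof.
move=> fc cd; have [d' [e [M [ie wM]]]] := basis_of_family w.
exists d', e, (fun t => (\row_j c j t) *m M), ((\row_j dc j) *m M); split=> //.
- apply: (@filterE _ (nbhs x)) => t; rewrite fc -wM; apply: eq_bigr => j _; by rewrite mxE.
- apply: is_derive_cvg; rewrite [X in _ --> X]mulmx_sum_row.
  have -> : (fun h : C => h^-1 *: ((\row_j c j (h + x)) *m M - (\row_j c j x) *m M)) =
      fun h => \sum_(j < d) (\row_j (h^-1 * (c j (h + x) - c j x))) 0 j *: row j M.
    apply/funext => h; rewrite -mulmxBl scalemxAl mulmx_sum_row; apply: eq_bigr => j _.
    by rewrite !mxE.
  apply: cvg_row_lin; apply: cvg_row => j; rewrite mxE.
  have := cvg_is_derive (cd j); apply: cvg_trans; apply: near_eq_cvg; apply: nearW => h.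
  by rewrite mxE.
- by rewrite -wM; apply: eq_bigr => j _; rewrite mxE.
Qed.

Lemma is_derive_exp0 k : is_derive (0 : C) 1 (fun t : C => t ^+ k) (k == 1%N)%:R.
Proof.
have -> : (fun t : C => t ^+ k) = (id : C -> C) ^+ k by rewrite exprfctE.
apply: is_derive_eq.
case: k => [|[|k]] /=; rewrite ?mul0r ?scale0r ?expr0 ?mulr1 ?scale1r//.
by rewrite expr0n mulr0 scale0r.
Qed.

(** Only continuity at 0 matters: a negative power with nonzero coefficient is unbounded, and a
    constant off 0 extends by the same constant. *)
Lemma cdiff_pow (f : C -> C) (p : int) c : cdiff f 0 -> (forall z, z != 0 -> f z = z ^ p * c) ->
  (p < 0 -> c = 0) /\ (p = 0 -> f 0 = c).
Proof.
move=> /cdiff_cont cf fE; split=> [p0|p0]; last first.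
  apply/eqP; rewrite -subr_eq0 -nm_eq0; apply: contraT => n0.
  have e0 : 0 < nm (f 0 - c) by rewrite lt0r n0 nm_ge0.
  have [d d0 dP] := cf _ e0; have := dP (rc (d / 2)).
  rewrite subr0 nm_rc gtr0_norm ?divr_gt0// ltr_pdivrMr// ltr_pMr// ltr1n => /(_ isT).
  have r0 : rc (d / 2) != 0 by rewrite -nm_eq0 nm_rc normr_eq0 gt_eqF// divr_gt0.
  by rewrite fE// p0 expr0z mul1r nm_dist ltxx.
apply/eqP; rewrite -nm_eq0; apply: contraT => n0.
have c0 : 0 < nm c by rewrite lt0r n0 nm_ge0.
have [d d0 dP] := cf _ (@ltr01 R).
pose K := nm (f 0) + 1; have K0 : 0 < K by rewrite ltr_wpDl// nm_ge0.
(* The last bound forces |c| / t > K, whereas |f(t)| < K and |f(t)| = |c| t^p >= |c| / t because p <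
   0 and t <= 1. *)
pose t := Num.min (1 / 2) (Num.min (d / 2) (nm c / K / 2)).
have t0 : 0 < t by rewrite !lt_min !divr_gt0.
have t1 : t <= 1 by rewrite !ge_min; apply/orP; left; lra.
have td : t < d by rewrite !gt_min [X in [|| _, X | _]](_ : _ = true) ?orbT//; lra.
have tc : t < nm c / K.
  rewrite !gt_min [X in [|| _, _ | X]](_ : _ = true) ?orbT//.
  by rewrite ltr_pdivrMr// ltr_pMr ?divr_gt0// ltr1n.
have r0 : rc t != 0 by rewrite -nm_eq0 nm_rc normr_eq0 gt_eqF.
have := dP (rc t); rewrite subr0 nm_rc gtr0_norm// => /(_ td) H.
have fK : nm (f (rc t)) < K.
  by have := nmD (f (rc t) - f 0) (f 0); rewrite subrK /K; lra.
have : nm c = nm (f (rc t)) * t ^+ absz p.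
  have pE : p = - (absz p)%:Z by rewrite ltz0_abs// opprK.
  rewrite fE// {1}pE -exprnN nmM nmV nmX nm_rc gtr0_norm// mulrAC mulVf ?mul1r//.
  by rewrite expf_neq0// gt_eqF.
have tp : t ^+ absz p <= t.
  have ap : (0 < absz p)%N by rewrite absz_gt0 lt_eqF.
  by rewrite -(prednK ap) exprS ler_piMr ?exprn_ile1// ltW.
move=> E; have : nm c <= K * t.
  rewrite E; apply: ler_pM => //; [exact: nm_ge0|by rewrite exprn_ge0// ltW|exact: ltW].
by rewrite leNgt -ltr_pdivlMl// mulrC tc.
Qed.

End Derivatives.

(** * Linear extension from homogeneous vectors *)

Section DirectSumExtension.
Variables (R : realType) (V : graded R).
Local Notation C := (Cx R).
Local Notation dV := (dsum V).

Lemma dsum_ind (P : dV -> Prop) : (forall d a, homogeneous d a -> P a) ->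
  (forall a b, P a -> P b -> P (a + b)) -> forall a, P a.
Proof.
move=> Ph PD a; rewrite [a]dsum_decomp; apply: big_ind => //.
  by apply: (Ph 0) => k _; exact: lin0 (dval_linear k).
by move=> d _; apply: Ph; exact: dinj_homogeneous.
Qed.

Lemma dinj_family (F : gbar V) k l : dval (dinj (F k)) l = (l == k)%:R *: F l.
Proof.
have [->|lk] := eqVneq l k; first by rewrite dinj_in scale1r.
by rewrite dinj_out// scale0r.
Qed.

Definition dext (X : lmodType C) (G : forall d, V d -> X) (a : dV) : X :=
  \sum_(d <- dsupp a) G d (dval a d).

Lemma dext_wide (X : lmodType C) (G : forall d, V d -> X) (A : {fset int}) a :
  (forall d, linear (G d)) -> (dsupp a `<=` A)%fset -> dext G a = \sum_(d <- A) G d (dval a d).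
Proof.
move=> Gl sA; apply: big_fset_incl => // d _ /dsupp_out ->; exact: lin0.
Qed.

Lemma dext_linear (X : lmodType C) (G : forall d, V d -> X) :
  (forall d, linear (G d)) -> linear (dext G).
Proof.
move=> Gl k u v; pose w := k *: u + v; pose A := (dsupp w `|` (dsupp u `|` dsupp v))%fset; rewrite -/w.
rewrite !(@dext_wide _ _ A)// /w.
- rewrite scaler_sumr -big_split; apply: eq_bigr => d _.
  by rewrite dval_linear Gl.
- by rewrite /A fsubsetU// fsubsetUr orbT.
- by rewrite /A fsubsetU// fsubsetUl orbT.
- exact: fsubsetUl.
Qed.

Lemma dext_dinj (X : lmodType C) (G : forall d, V d -> X) k (v : V k) :
  (forall d, linear (G d)) -> dext G (dinj v) = G k v.
Proof.
move=> Gl; rewrite (@dext_wide _ _ [fset k]%fset)// ?big_seq_fset1 ?dinj_in//.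
apply/fsubsetP => l /dsuppP vl; rewrite inE; apply/eqP; apply: contrapT => /eqP lk.
by apply: vl; rewrite dinj_out.
Qed.

End DirectSumExtension.

Lemma gbar_sumE (R : realType) (V : graded R) (J : Type) (s : seq J) (f : J -> gbar V) l :
  (\sum_(j <- s) f j) l = \sum_(j <- s) f j l.
Proof. by elim: s => [|x s IH]; rewrite ?big_nil// !big_cons -IH. Qed.

Lemma eq_succ_int (l d : int) : (l == d + 1) = (d <= l) && (absz (l - d)%R == 1%N).
Proof. lia. Qed.

(** * Modes, vacuum and translation operator *)

Section Phi.
Variables (R : realType) (V : graded R) (M : geomVA V).
Local Notation C := (Cx R).
Local Notation dV := (dsum V).
Local Notation one_pt := (one_pt M).
Local Notation two_pt := (two_pt M).

Let one_neq0 : (1 : C) <> 0 := elimN eqP (oner_neq0 C).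

(* By equivariance [mu(a, z, b, 0)_l] is a monomial in [z] for homogeneous [a]
   and [b], so the modes can be read off at [z = 1]. *)
Definition mode_term d e n (u : V d) (v : V e) : dV :=
  dinj (two_pt (dinj u) 1 (dinj v) 0 (d + e + n)).

Lemma mode_term_linr d e n u : linear (@mode_term d e n u).
Proof.
move=> k v v'; rewrite /mode_term dinj_linear (two_pt_linr _ _ one_neq0).
exact: dinj_linear.
Qed.

Lemma mode_term_linl d e n v : linear (fun u => @mode_term d e n u v).
Proof.
move=> k u u'; rewrite /mode_term dinj_linear (two_pt_linl _ _ one_neq0).
exact: dinj_linear.
Qed.

Definition Ymu (a : dV) (n : int) (b : dV) : dV :=
  dext (fun d u => dext (fun e v => mode_term n u v) b) a.

Lemma Ymu_bilinear : Y_bilinear Ymu.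
Proof.
split=> [n b|a n].
  apply: dext_linear => d k u u'; rewrite /dext scaler_sumr -big_split; apply: eq_bigr => e _.
  exact: mode_term_linl.
move=> k b b'; rewrite /Ymu {1}/dext.
under eq_bigr => d _ do rewrite (dext_linear (fun e => @mode_term_linr _ e _ _)).
by rewrite big_split -scaler_sumr.
Qed.

Lemma YmuE d e n a b : homogeneous d a -> homogeneous e b ->
  Ymu a n b = dinj (two_pt a 1 b 0 (d + e + n)).
Proof.
move=> ha hb; rewrite -{1}(homogeneous_dinj ha) -{1}(homogeneous_dinj hb) /Ymu.
rewrite dext_dinj; last first.
  move=> d' k u u'; rewrite /dext scaler_sumr -big_split; apply: eq_bigr => e' _.
  exact: mode_term_linl.
rewrite dext_dinj; last by move=> e'; exact: mode_term_linr.
by rewrite /mode_term !homogeneous_dinj.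
Qed.

Lemma two_pt_scale d e a b z l : homogeneous d a -> homogeneous e b -> z != 0 ->
  two_pt a z b 0 l = z ^ (l - d - e) *: two_pt a 1 b 0 l.
Proof.
move=> ha hb z0; have zn : z <> 0 by apply/eqP.
have := two_pt_equivariant M a b l z0 one_neq0.
rewrite !(dmap_homogeneous _ ha) !(dmap_homogeneous _ hb) mulr1 mulr0.
have -> : two_pt (z ^ d *: a) z (z ^ e *: b) 0 l = (z ^ d * z ^ e) *: two_pt a z b 0 l.
  have E := linZ (two_pt_linl M (z ^ e *: b) zn) (z ^ d) a.
  have E' := linZ (two_pt_linr M a zn) (z ^ e) b.
  rewrite -scalerA -[RHS]/((z ^ d *: (z ^ e *: two_pt a z b 0)) l).
  by apply: (congr1 (fun v : gbar V => v l)); rewrite -E' -E.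
move=> E.
have zde : z ^ d * z ^ e != 0 by rewrite mulf_neq0// expfz_neq0.
apply: (scalerI zde); rewrite -E scalerA; congr (_ *: _).
by rewrite -!expfzDr//; congr (_ ^ _); lia.
Qed.

Lemma nhas_single (X : lmodType C) (I : choiceType) (b : I -> X) (i0 : I) :
  (forall i, i != i0 -> b i = 0) -> nhas [set tt] (fun i _ => b i) (fun=> b i0).
Proof.
move=> b0; apply: nhas_ext (nhas_fin (A := [fset i0]%fset) _ _) => //.
- by move=> x _; rewrite big_seq_fset1.
- by move=> q ? _; rewrite inE; exact: b0.
move=> q _; exists 1, (fun=> b q), (fun=> const_mx 1), 1; split=> [x _|x j _].
  by rewrite /lcomb big_ord1 mxE scale1r.
by rewrite mxE nm1.
Qed.

(** For homogeneous [a] and [b] only the exponent n = l - d - e contributes. The statement uses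
    [nhas], which is closed under addition, to reach general vectors. *)
Lemma Ymu_nhas a b z l : z != 0 ->
  nhas [set tt] (fun n _ => z ^ n *: dval (Ymu a n b) l) (fun=> two_pt a z b 0 l).
Proof.
move=> z0; have zn : z <> 0 by apply/eqP.
elim/dsum_ind: a => [d a ha|a a' IH IH'].
  elim/dsum_ind: b => [e b hb|b b' IH IH'].
    apply: nhas_ext (nhas_single (i0 := l - d - e) (b := fun n => z ^ n *: dval (Ymu a n b) l) _) => //.
      move=> _ _; rewrite (two_pt_scale _ ha hb z0) (YmuE _ ha hb).
      have -> : d + e + (l - d - e) = l by lia.
      by rewrite dinj_in.
    move=> n nl; rewrite (YmuE _ ha hb) dinj_out ?scaler0//.
    by apply: contra nl => /eqP ->; apply/eqP; lia.
  apply: nhas_ext (nhas_lc (g := fun=> 1) (r := 1) _ IH IH') => [n ? _|? _|? _].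
  - by rewrite (linD (proj2 Ymu_bilinear a n)) (linD (dval_linear l)) scale1r scalerDr.
  - by rewrite (linD (two_pt_linr M a zn)) scale1r.
  - by rewrite nm1.
apply: nhas_ext (nhas_lc (g := fun=> 1) (r := 1) _ IH IH') => [n ? _|? _|? _].
- by rewrite (linD (proj1 Ymu_bilinear n b)) (linD (dval_linear l)) scale1r scalerDr.
- by rewrite (linD (two_pt_linl M b zn)) scale1r.
- by rewrite nm1.
Qed.

Lemma Ymu_laurent a b l : is_laurent (fun z => two_pt a z b 0 l) (fun n => dval (Ymu a n b) l).
Proof. by move=> z z0; have [_ /(_ tt erefl)] := Ymu_nhas a b l z0. Qed.

Lemma const_mx_differentiable (z : C) :
  differentiable ((fun z : C => const_mx z : 'rV[C]_1) : C^o -> 'rV[C]_1) z.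
Proof.
rewrite (_ : (fun z : C => _) = fun z : C^o => z *: const_mx 1); first exact: differentiableZl.
by apply/funext => y; apply/rowP => i; rewrite !mxE mulr1.
Qed.

Lemma one_pt_cdiff a z l (phi : {scalar (V l)}) : cdiff (fun z => phi (one_pt a z l) : C) z.
Proof.
exact: (@holomorphic_curve _ _ _ _ (fun x => gmu M _ x l) (fun s => const_mx s : 'rV_1) z phi
  (scalar_linear phi) (gmu_holomorphic M _ l) (@conf1 _ _) (const_mx_differentiable z)).
Qed.

(** For homogeneous [a] and [b], z^N mu(a, z, b, 0)_l is a constant times z^(N + n); its holomorphic
    extension to 0 makes the constant vanish when N + n < 0. *)
Lemma Ymu_truncated a b : exists N : nat, forall n, n < - N%:Z -> Ymu a n b = 0.
Proof.
elim/dsum_ind: a => [d a ha|a a' [N HN] [N' HN']]; last first.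
  exists (maxn N N') => n nN; rewrite (linD (proj1 Ymu_bilinear n b)) HN ?HN' ?addr0//; lia.
elim/dsum_ind: b => [e b hb|b b' [N HN] [N' HN']]; last first.
  exists (maxn N N') => n nN; rewrite (linD (proj2 Ymu_bilinear a n)) HN ?HN' ?addr0//; lia.
have [N [g [hg gE]]] := gmu_meromorphicity M a b; exists (absz N) => n nN.
rewrite (YmuE _ ha hb); set l := d + e + n; suff -> : two_pt a 1 b 0 l = 0 by exact: lin0 (@dinj_linear _ _ _).
apply: functional_ext => phi; rewrite (lin0 (scalar_linear phi)).
have cg : cdiff (fun z => phi (g z l) : C) 0.
  apply: (@holomorphic_curve _ _ _ _ (fun z => g z l) id 0 phi (scalar_linear phi) (hg l) I).
  exact: ex_diff.
have gz (z : C) : z != 0 -> phi (g z l) = z ^ (N + n) * phi (two_pt a 1 b 0 l).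
  move=> z0; rewrite gE// -[(_ *: mu2 _ _ _ _ _) l]/(z ^ N *: two_pt a z b 0 l).
  rewrite (two_pt_scale _ ha hb z0) scalerA -expfzDr// (_ : l - d - e = n) ?linearZ//.
  by rewrite /l; lia.
by apply: (proj1 (cdiff_pow cg gz)); lia.
Qed.

Definition vac_mu : dV := dinj (no_pt M 0).

Lemma vac_muE : dval vac_mu = no_pt M.
Proof.
apply: functional_extensionality_dep => k; have [->|k0] := eqVneq k 0; first by rewrite dinj_in.
by rewrite dinj_out// no_pt_degree.
Qed.

Lemma vac_mu_homogeneous : homogeneous 0 vac_mu.
Proof. exact: dinj_homogeneous. Qed.

(** Associativity with no inserted points; mu of the empty tuple has only a component of degree 0,
    so the sum has a single term. *)
Lemma two_pt_vac a z u : z <> u -> two_pt a z vac_mu u = one_pt a z.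
Proof.
move=> zu; apply: functional_extensionality_dep => l.
apply: has_sum_unique (assoc_vacuum M a l zu).
suff /nhas_single[_ /(_ tt erefl)] : forall k, k != 0 -> two_pt a z (dinj (no_pt M k)) u l = 0 by [].
move=> k k0; rewrite no_pt_degree// (lin0 (@dinj_linear _ _ _)).
by rewrite (lin0 (two_pt_linr M a zu)).
Qed.

Lemma one_pt0 a : one_pt a 0 = a. Proof. exact: gmu_insertion. Qed.

Lemma Ymu_vacuum : Y_vacuum Ymu vac_mu.
Proof.
move=> n b; elim/dsum_ind: b => [e b hb|b b' IH IH']; last first.
  by rewrite (linD (proj2 Ymu_bilinear _ n)) IH IH'; case: eqP; rewrite ?addr0.
rewrite (YmuE _ vac_mu_homogeneous hb) two_pt_sym// two_pt_vac ?one_pt0; last by move/esym.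
case: eqP => [->|/eqP n0]; first by rewrite homogeneous_dinj// addr0 add0r.
rewrite hb ?(lin0 (@dinj_linear _ _ _))//; apply: contra n0 => /eqP; rewrite add0r => E.
by apply/eqP; lia.
Qed.

Lemma Ymu_creation : Y_creation Ymu vac_mu.
Proof.
move=> a; elim/dsum_ind: a => [d a ha|a a' [E H] [E' H']]; last first.
  split=> [|n n0]; first by rewrite (linD (proj1 Ymu_bilinear _ _)) E E'.
  by rewrite (linD (proj1 Ymu_bilinear _ _)) H// H'// addr0.
have key n (phi : {scalar (V (d + 0 + n))}) :=
  cdiff_pow (f := fun z => phi (one_pt a z (d + 0 + n))) (p := n)
    (c := phi (two_pt a 1 vac_mu 0 (d + 0 + n))) (@one_pt_cdiff _ _ _ phi).
have scale n (phi : {scalar (V (d + 0 + n))}) (z : C) : z != 0 ->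
    phi (one_pt a z (d + 0 + n)) = z ^ n * phi (two_pt a 1 vac_mu 0 (d + 0 + n)).
  move=> z0; have zn : z <> 0 by apply/eqP.
  rewrite -(two_pt_vac _ zn) (two_pt_scale _ ha vac_mu_homogeneous z0) linearZ.
  by rewrite (_ : d + 0 + n - d - 0 = n)//; lia.
split=> [|n n0]; rewrite (YmuE _ ha vac_mu_homogeneous); last first.
  suff -> : two_pt a 1 vac_mu 0 (d + 0 + n) = 0 by exact: lin0 (@dinj_linear _ _ _).
  apply: functional_ext => phi; rewrite (lin0 (scalar_linear phi)).
  exact: (proj1 (key n phi (scale n phi))).
have -> : two_pt a 1 vac_mu 0 (d + 0 + 0) = dval a (d + 0 + 0).
  by apply: functional_ext => phi; rewrite -(proj2 (key 0 phi (scale 0 phi)) erefl) one_pt0.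
by rewrite homogeneous_dinj// !addr0.
Qed.

(** The coefficient of z in Y(a, z)|0> = mu(a, z), hence the derivative of mu(a, z) at 0. In this
    form it lies in the direct sum by construction. *)
Definition Tmu (a : dV) : dV := Ymu a 1 vac_mu.

Lemma Tmu_linear : linear Tmu.
Proof. exact: (proj1 Ymu_bilinear). Qed.

Lemma Tmu_degree : T_degree Tmu.
Proof.
move=> d a ha; rewrite /Tmu (YmuE _ ha vac_mu_homogeneous) addr0.
exact: dinj_homogeneous.
Qed.

Lemma Ymu_degree : Y_degree Ymu.
Proof.
move=> d e k a b ha hb; rewrite /mode (YmuE _ ha hb).
rewrite (_ : e + (d - k - 1) = d + e + (- k - 1)); last by lia.
exact: dinj_homogeneous.
Qed.

(** Off 0 this is scaling, with creation excluding l < d. At 0 it is the insertion axiom, the case l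
    = d resting on 0^0 = 1. *)
Lemma one_pt_power d a l z : homogeneous d a ->
  one_pt a z l = (if l < d then 0 else z ^+ absz (l - d)) *: two_pt a 1 vac_mu 0 l.
Proof.
move=> ha; have E n := YmuE n ha vac_mu_homogeneous.
have [z0|z0] := eqVneq z 0; last first.
  have zn : z <> 0 by apply/eqP.
  rewrite -(two_pt_vac _ zn) (two_pt_scale _ ha vac_mu_homogeneous z0); case: ltP => ld.
    suff -> : two_pt a 1 vac_mu 0 l = 0 by rewrite !scaler0.
    have := E (l - d); rewrite (proj2 (Ymu_creation a)) ?subr_lt0//.
    move=> /(congr1 (fun v : dV => dval v l)).
    by rewrite (_ : d + 0 + (l - d) = l) ?dinj_in => [<-|]; [exact: lin0 (dval_linear l)|lia].
  by rewrite exprnP (_ : l - d - 0 = absz (l - d))//; lia.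
rewrite z0 one_pt0; case: ltP => ld; first by rewrite scale0r ha// lt_eqF.
have [->|ldn] := eqVneq l d.
  have := E 0; rewrite (proj1 (Ymu_creation a)) subrr expr0 scale1r => {1}->.
  by rewrite (_ : d + 0 + 0 = d) ?dinj_in// !addr0.
rewrite ha// expr0n (_ : (_ == 0)%N = false) ?scale0r//; apply/eqP => H.
by case/eqP: ldn; lia.
Qed.

Lemma Tmu_derivative a l : has_derivative (fun z => one_pt a z l) 0 (dval (Tmu a) l).
Proof.
pose F d : V l := two_pt (dinj (dval a d)) 1 vac_mu 0 l.
pose s : seq int := dsupp a.
have -> : dval (Tmu a) l = \sum_(j < size s)
    (if l < s`_j then 0 else (absz (l - s`_j)%R == 1%N)%:R : C) *: F s`_j.
  rewrite {1}[a]dsum_decomp (linear_sumf _ _ Tmu_linear) dval_sum -/s (big_nth 0) big_mkord.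
  apply: eq_bigr => j _; rewrite /Tmu (YmuE _ (dinj_homogeneous _) vac_mu_homogeneous).
  rewrite dinj_family /F addr0; congr (_ *: _).
  by rewrite eq_succ_int; case: ltP.
apply: (@has_derivative_family _ _ (fun z => one_pt a z l) 0 (size s) (fun j => F s`_j)
  (fun j t => if l < s`_j then 0 else t ^+ absz (l - s`_j)%R)).
  move=> t; rewrite {1}[a]dsum_decomp -/s.
  have -> : one_pt (\sum_(k <- s) dinj (dval a k)) t = \sum_(k <- s) one_pt (dinj (dval a k)) t.
    exact: linear_sumf (one_pt_linear M t).
  rewrite gbar_sumE (big_nth 0) big_mkord; apply: eq_bigr => j _.
  by rewrite (one_pt_power _ _ (dinj_homogeneous _)).
move=> j; case: ifP => _; first exact: is_derive_cst.
exact: is_derive_exp0.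
Qed.

End Phi.

(** * First-order expansions at 0 *)

Section Jets.
Variable R : realType.
Local Notation C := (Cx R).
Implicit Types (f g : C -> C) (a b c : C).

Lemma le_small (x K d : R) : 0 < d -> (forall t, 0 < t -> t < d -> x <= K * t) -> x <= 0.
Proof.
move=> d0 H; rewrite leNgt; apply/negP => x0.
pose K' := `|K| + 1; have K'0 : 0 < K' by rewrite ltr_wpDl.
pose t := Num.min (d / 2) (x / K' / 2).
have t0 : 0 < t by rewrite lt_min !divr_gt0.
have td : t < d by rewrite gt_min ltr_pdivrMr// ltr_pMr// ltr1n.
have tx : t < x / K' by rewrite gt_min orbC ltr_pdivrMr// ltr_pMr ?ltr1n ?divr_gt0.
have := H t t0 td; rewrite leNgt => /negP; apply; apply: le_lt_trans (_ : K' * t < x).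
  by rewrite ler_wpM2r ?ltW// /K' (le_lt_trans (ler_norm K))// ltrDl.
by rewrite -ltr_pdivlMl// mulrC.
Qed.

(** The expansion f(v) = a + b v + O(v^2) on a punctured neighbourhood; the value of [f] at 0 does
    not enter. *)
Definition jet f a b := exists d K : R, 0 < d /\ forall v, v != 0 -> nm v < d ->
  nm (f v - a - b * v) <= K * nm v ^+ 2.

Lemma jet_ge0 f a b : jet f a b -> exists d K : R, [/\ 0 < d, d <= 1, 0 <= K &
  forall v, v != 0 -> nm v < d -> nm (f v - a - b * v) <= K * nm v ^+ 2].
Proof.
move=> [d [K [d0 H]]]; exists (Num.min d 1), `|K|; split=> //.
- by rewrite lt_min d0 ltr01.
- by rewrite ge_min lexx orbT.
move=> v v0; rewrite lt_min => /andP[vd _]; apply: le_trans (H v v0 vd) _.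
by rewrite ler_wpM2r ?exprn_ge0 ?nm_ge0// ler_norm.
Qed.

Lemma jet_uniq f a b a' b' : jet f a b -> jet f a' b' -> a = a' /\ b = b'.
Proof.
move=> /jet_ge0[d [K [d0 d1 K0 H]]] /jet_ge0[d' [K' [d'0 d'1 K'0 H']]].
pose m := Num.min d d'; have m0 : 0 < m by rewrite lt_min d0.
have key (t : R) : 0 < t -> t < m -> nm ((a - a') + (b - b') * rc t) <= (K + K') * t ^+ 2.
  move=> t0; rewrite lt_min => /andP[td td'].
  have r0 : rc t != 0 by rewrite -nm_eq0 nm_rc normr_eq0 gt_eqF.
  have nt : nm (rc t) = t by rewrite nm_rc gtr0_norm.
  have := H (rc t) r0; have := H' (rc t) r0; rewrite nt => /(_ td') B /(_ td) A.
  have -> : (a - a') + (b - b') * rc t = (f (rc t) - a' - b' * rc t) - (f (rc t) - a - b * rc t) by ring.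
  by apply: le_trans (nmB _ _) _; lra.
have aa : a = a'.
  apply/eqP; rewrite -subr_eq0 -nm_eq0 eq_le nm_ge0 andbT.
  apply: (@le_small _ (K + K' + nm (b - b')) m m0) => t t0 tm.
  have tle : t ^+ 2 <= t.
    rewrite expr2 ler_piMr ?ltW//; apply: lt_le_trans tm _.
    by rewrite ge_min d1.
  have := key t t0 tm; have := nmB ((a - a') + (b - b') * rc t) ((b - b') * rc t).
  rewrite addrK nmM nm_rc gtr0_norm// => A B.
  have := ler_wpM2l (addr_ge0 K0 K'0) tle; nra.
split=> //; apply/eqP; rewrite -subr_eq0 -nm_eq0 eq_le nm_ge0 andbT.
apply: (@le_small _ (K + K') m m0) => t t0 tm.
have := key t t0 tm; rewrite aa subrr add0r nmM nm_rc gtr0_norm// expr2 mulrA.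
by rewrite ler_pM2r.
Qed.

Lemma jet_near f g a b d : 0 < d -> (forall v, v != 0 -> nm v < d -> f v = g v) ->
  jet f a b -> jet g a b.
Proof.
move=> d0 fg [d' [K [d'0 H]]]; exists (Num.min d d'), K; split; first by rewrite lt_min d0.
by move=> v v0; rewrite lt_min => /andP[vd vd']; rewrite -fg//; exact: H.
Qed.

Lemma jetM f g a b a' b' : jet f a b -> jet g a' b' ->
  jet (fun v => f v * g v) (a * a') (a * b' + b * a').
Proof.
move=> /jet_ge0[d [K [d0 d1 K0 H]]] /jet_ge0[d' [K' [d'0 d'1 K'0 H']]].
exists (Num.min d d'), (K * (K' + nm a' + nm b') + (nm a + nm b) * K' + nm (b * b')).
split; first by rewrite lt_min d0.
move=> v v0; rewrite lt_min => /andP[vd vd']; have A := H v v0 vd; have B := H' v v0 vd'.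
have v1 : nm v <= 1 by apply: ltW (lt_le_trans vd d1).
have vv1 : nm v ^+ 2 <= 1 by rewrite exprn_ile1 ?nm_ge0.
have gb : nm (g v) <= K' + nm a' + nm b'.
  have -> : g v = (g v - a' - b' * v) + (a' + b' * v) by ring.
  apply: le_trans (nmD _ _) _; rewrite -(addrA K'); apply: lerD.
    by apply: le_trans B _; rewrite ler_piMr.
  by apply: le_trans (nmD _ _) _; rewrite nmM lerD2l ler_piMr ?nm_ge0.
have fb : nm (a + b * v) <= nm a + nm b.
  by apply: le_trans (nmD _ _) _; rewrite nmM lerD2l ler_piMr ?nm_ge0.
have -> : f v * g v - a * a' - (a * b' + b * a') * v =
    (f v - a - b * v) * g v + (a + b * v) * (g v - a' - b' * v) + (b * b') * v ^+ 2 by ring.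
apply: le_trans (nmD _ _) _; rewrite [X in _ <= X]mulrDl lerD//; last by rewrite nmM nmX.
apply: le_trans (nmD _ _) _; rewrite [X in _ <= X]mulrDl lerD// nmM.
  by rewrite mulrAC ler_pM ?nm_ge0.
by rewrite -mulrA ler_pM ?nm_ge0.
Qed.

Lemma jet1D : jet (fun v => 1 + v) 1 1.
Proof. by exists 1, 0; split=> // v _ _; rewrite mul1r (addrC 1) addrK subrr nm0 mul0r. Qed.

Lemma nm_1D (v : C) : nm v < 1 / 2 -> 1 / 2 <= nm (1 + v).
Proof. by have := nmB (1 + v) v; rewrite addrK nm1; lra. Qed.

Lemma neq0_1D (v : C) : nm v < 1 / 2 -> 1 + v != 0.
Proof. by move=> /nm_1D v1; rewrite -nm_gt0; lra. Qed.

Lemma jet1DV : jet (fun v => (1 + v)^-1) 1 (-1).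
Proof.
exists (1 / 2), 2; split=> // v _ vh; have v1 := neq0_1D vh.
have -> : (1 + v)^-1 - 1 - -1 * v = v ^+ 2 * (1 + v)^-1.
  by apply: (mulfI v1); rewrite [RHS]mulrCA mulfV// mulr1 2!mulrBr mulfV//; ring.
rewrite nmM nmX nmV mulrC ler_wpM2r ?exprn_ge0 ?nm_ge0// -[X in _ <= X]invrK lef_pV2.
- by have := nm_1D vh; lra.
- by rewrite posrE nm_gt0.
- by rewrite posrE invr_gt0.
Qed.

Lemma jet1DX n : jet (fun v => (1 + v) ^+ n) 1 n%:R.
Proof.
elim: n => [|n IH].
  by exists 1, 0; split=> // v _ _; rewrite expr0 subrr mul0r subrr nm0 mul0r.
have := jetM jet1D IH; rewrite !mul1r -natr1.
by apply: (@jet_near _ _ _ _ 1) => // v _ _; rewrite exprS.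
Qed.

Lemma jet1DVX n : jet (fun v => (1 + v)^-1 ^+ n) 1 (- n%:R).
Proof.
elim: n => [|n IH].
  by exists 1, 0; split=> // v _ _; rewrite expr0 subrr oppr0 mul0r subrr nm0 mul0r.
have := jetM jet1DV IH; rewrite mul1r mul1r mulr1 -opprD natr1.
by apply: (@jet_near _ _ _ _ 1) => // v _ _; rewrite exprS.
Qed.

Lemma jet1Dz (s : int) : jet (fun v => (1 + v) ^ s) 1 s%:~R.
Proof.
case: s => n; first exact: jet1DX.
have := jet1DVX n.+1; rewrite NegzE mulrNz.
by apply: (@jet_near _ _ _ _ 1) => // v _ _; rewrite exprVn exprnN.
Qed.

(** The new variable differs from u by u^2 / (1 + u), which the remainder absorbs. *)
Lemma jet_subst f a b : jet f a b -> jet (fun u => f (u / (1 + u))) a b.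
Proof.
move=> /jet_ge0[d [K [d0 d1 K0 H]]]; have [d2 [K2 [d20 H2]]] := jet1DV.
exists (Num.min (d / 2) (1 / 2)), (4 * K + nm b * 2).
split=> [|u u0]; first by rewrite lt_min divr_gt0//=; lra.
rewrite lt_min => /andP[ud uh]; have u1 := neq0_1D uh.
have iv : nm (1 + u)^-1 <= 2.
  rewrite nmV -[X in _ <= X]invrK lef_pV2 ?posrE ?nm_gt0 ?invr_gt0//.
  by have := nm_1D uh; lra.
set v := u / (1 + u); have nv : nm v <= 2 * nm u.
  by rewrite nmM mulrC ler_wpM2r ?nm_ge0.
have v0 : v != 0 by rewrite mulf_neq0// invr_eq0.
have vd : nm v < d by apply: le_lt_trans nv _; lra.
have -> : f v - a - b * u = (f v - a - b * v) - b * (u ^+ 2 * (1 + u)^-1).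
  have -> : u ^+ 2 * (1 + u)^-1 = u - v.
    by apply: (mulIf u1); rewrite mulfVK// mulrBl mulfVK//; ring.
  by ring.
apply: le_trans (nmB _ _) _; rewrite [X in _ <= X]mulrDl lerD//.
  apply: le_trans (H v v0 vd) _.
  have : nm v ^+ 2 <= (2 * nm u) ^+ 2 by rewrite ler_pXn2r ?nnegrE ?nm_ge0// mulr_ge0 ?nm_ge0.
  rewrite exprMn => vu; rewrite [X in _ <= X](_ : _ = (2 ^+ 2 * nm u ^+ 2) * K); last by ring.
  by rewrite mulrC ler_wpM2r.
by rewrite 2!nmM nmX -mulrA ler_wpM2l ?nm_ge0// mulrC ler_wpM2r// exprn_ge0// nm_ge0.
Qed.

Lemma cvg_sum_scale (I : choiceType) (c : C) (f : I -> C) (s : C) :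
  partial_sum f @ totally --> s -> partial_sum (fun i => c * f i) @ totally --> c * s.
Proof.
move=> H; have := cvg_sum_lin (a := c) (b := 0) H H; rewrite mul0r addr0.
by rewrite (_ : (fun i => _) = fun i => c * f i)//; apply/funext => i; rewrite mul0r addr0.
Qed.

Lemma jet_series (h : C -> C) (c : int -> C) (rho : R) : 0 < rho ->
  (forall n, n < 0 -> c n = 0) ->
  (forall z, z != 0 -> nm z < rho -> partial_sum (fun n => z ^ n * c n : C) @ totally --> h z) ->
  jet h (c 0) (c 1).
Proof.
move=> r0 c0 H; have [K KP] := tail_bound r0 c0 H 2; exists (rho / 4), K.
split; first by rewrite divr_gt0.
move=> v v0 vr; have := KP v v0 vr.
by rewrite !big_ord_recl big_ord0 /= !add0r addr0 expr0z mul1r expr1z opprD addrA [v * _]mulrC.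
Qed.

End Jets.

Lemma addKr_int (e : int) : cancel (fun j => e + j) (fun k => k - e).
Proof. by move=> j; rewrite addrC addKr. Qed.

Lemma subKr_int (e : int) : cancel (fun k => k - e) (fun j => e + j).
Proof. by move=> j; rewrite addrC subrK. Qed.

(** * The translation axiom *)

Section Translation.
Variables (R : realType) (V : graded R) (M : geomVA V).
Local Notation C := (Cx R).
Local Notation dV := (dsum V).
Local Notation one_pt := (one_pt M).
Local Notation two_pt := (two_pt M).
Local Notation Ymu := (Ymu M).
Local Notation vac := (vac_mu M).
Local Notation Tmu := (Tmu M).

Lemma TmuE d a : homogeneous d a -> Tmu a = dinj (two_pt a 1 vac 0 (d + 1)).
Proof. by move=> ha; rewrite /Tmu (YmuE _ _ ha (vac_mu_homogeneous M)) addr0. Qed.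

Section Homogeneous.
Variables (l : int) (phi : {scalar (V l)}).
Let one_neq0 : (1 : C) <> 0 := elimN eqP (oner_neq0 C).

(* [mu(a, 1 + u, b, u)] is expanded around [u = 0] in two ways: by inserting
   [mu(a, 1, b, 0)] at [u], and by inserting [mu(b, u)] at [0]. *)
Lemma translate_left (a b : dV) :
  jet (fun u => phi (two_pt a (1 + u) b u l)) (phi (two_pt a 1 b 0 l))
    (phi (two_pt (dinj (two_pt a 1 b 0 (l - 1))) 1 vac 0 l)).
Proof.
pose c (j : int) : C := if j < 0 then 0 else phi (two_pt (dinj (two_pt a 1 b 0 (l - j))) 1 vac 0 l).
have cE : c 0 = phi (two_pt a 1 b 0 l).
  rewrite /c ltxx subr0; congr (phi _).
  have := one_pt_power M l 0 (dinj_homogeneous (two_pt a 1 b 0 l)).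
  by rewrite ltxx subrr expr0 scale1r => <-; rewrite one_pt0 dinj_in.
rewrite -cE -[X in jet _ _ X]/(c 1); apply: (jet_series (rho := 1)) => //.
  by move=> n; rewrite /c => ->.
move=> u u0 _; have := @has_sum_functional _ _ _ _ _ (assoc_translate M a b u l one_neq0) phi.
rewrite add0r => /(cvg_sum_bij (h := fun j => l - j) (g := fun k => l - k)).
have inv : cancel (fun j : int => l - j) (fun j => l - j) by move=> j; rewrite opprB addrC subrK.
move=> /(_ inv inv); rewrite (_ : _ \o _ = fun n => u ^ n * c n)//.
apply/funext => j /=; rewrite (one_pt_power M l u (dinj_homogeneous _)) /c.
rewrite (_ : (l < l - j) = (j < 0)); last by rewrite ltrBrDr gtrDl.
case: ltP => j0; first by rewrite scale0r linear0 mulr0.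
by rewrite linearZ /= opprB addrC subrK exprnP gez0_abs.
Qed.

(** Equivariance brings the first point from 1 + u to 1. The j-th term becomes (1 + u)^s v^j times a
    constant, with v = u / (1 + u), and the first-order term of the prefactor contributes [s]. *)
Lemma translate_right d e a b (s := l - d - e) : homogeneous d a -> homogeneous e b ->
  jet (fun u => phi (two_pt a (1 + u) b u l)) (phi (two_pt a 1 b 0 l))
    (phi (two_pt a 1 (dinj (two_pt b 1 vac 0 (e + 1))) 0 l) + s%:~R * phi (two_pt a 1 b 0 l)).
Proof.
move=> ha hb; pose w k := two_pt b 1 vac 0 k.
pose c (j : int) : C := if j < 0 then 0 else phi (two_pt a 1 (dinj (w (e + j))) 0 l).
have cE : c 0 = phi (two_pt a 1 b 0 l).
  rewrite /c ltxx addr0; congr (phi (two_pt _ _ _ _ _)).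
  have := one_pt_power M e 0 hb; rewrite ltxx subrr expr0 scale1r one_pt0 /w => <-.
  exact: homogeneous_dinj.
pose G u := phi (two_pt a (1 + u) b u l).
(* The prefactor is divided out and the function is written in the variable v, with inverse
   substitution u = v / (1 - v), so that it is a power series. *)
pose h v := (1 + v / (1 - v)) ^ (- s) * G (v / (1 - v)).
have hj : jet h (c 0) (c 1).
  apply: (jet_series (rho := 1 / 2)) => [|n|v v0 vh]; first by rewrite divr_gt0.
    by rewrite /c => ->.
  pose u := v / (1 - v).
  have v1 : 1 - v != 0 by apply: neq0_1D; rewrite nmN.
  have u1 : 1 + u = (1 - v)^-1.
    by apply: (mulIf v1); rewrite mulrDl mulfVK// mulVf// mul1r subrK.
  have u10 : 1 + u != 0 by rewrite u1 invr_eq0.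
  have vE : v = u / (1 + u) by rewrite u1 invrK /u mulfVK.
  have u10' : 1 + u <> 0 by apply/eqP.
  have lt : `|u| < `|1 + u - 0|.
    rewrite subr0 !nmE rc_lt u1 nmM -[X in _ < X]mul1r ltr_pM2r; first by lra.
    by rewrite nm_gt0 invr_eq0.
  have := @has_sum_functional _ _ _ _ _ (assoc_two M a b l u10' lt) phi; rewrite addr0.
  move=> /(cvg_sum_bij (h := fun j => e + j) (g := fun k => k - e)).
  move=> /(_ (@addKr_int e) (@subKr_int e)) /(@cvg_sum_scale _ _ ((1 + u) ^ (- s))).
  rewrite -[X in _ --> X]/(h v) (_ : (fun i => _) = fun n => v ^ n * c n)//.
  apply/funext => j /=; rewrite (one_pt_power M (e + j) u hb) /c.
  rewrite (_ : (e + j < e) = (j < 0)); last by rewrite gtrDl.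
  case: ltP => j0; first by rewrite scale0r (lin0 (@dinj_linear _ _ _)) (lin0 (two_pt_linr M a u10')) linear0 !mulr0.
  rewrite (linZ (@dinj_linear _ _ _)) (linZ (two_pt_linr M a u10')).
  rewrite -[(_ *: two_pt _ _ _ _) l]/(_ *: two_pt _ _ _ _ l).
  rewrite (two_pt_scale M l ha (dinj_homogeneous _) u10) !linearZ /= addrC addKr exprnP gez0_abs//.
  have -> : v ^ j = u ^ j * (1 + u) ^ (- j) by rewrite {1}vE expfzMl exprz_inv.
  have -> : (1 + u) ^ (- j) = (1 + u) ^ (- s) * (1 + u) ^ (l - d - (e + j)).
    by rewrite -expfzDr//; congr (_ ^ _); rewrite /s; lia.
  by ring.
rewrite -cE -[X in jet _ _ (X + _)]/(c 1).
have := jetM (jet1Dz R s) (jet_subst hj); rewrite !mul1r.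
apply: (@jet_near _ _ _ _ _ (1 / 2)) => [|u u0 uh]; first by rewrite divr_gt0.
have u1 := neq0_1D uh.
have -> : h (u / (1 + u)) = (1 + u) ^ (- s) * G u.
  rewrite /h (_ : u / (1 + u) / (1 - u / (1 + u)) = u)//.
  have -> : 1 - u / (1 + u) = (1 + u)^-1.
    by apply: (mulIf u1); rewrite mulrBl mulfVK// mulVf// mul1r addrK.
  by rewrite invrK mulfVK.
by rewrite mulrA -expfzDr// subrr expr0z mul1r.
Qed.

End Homogeneous.

Lemma Ymu_translation : Y_translation Ymu Tmu vac.
Proof.
split; first exact: Ymu_vacuum.
move=> a b n; elim/dsum_ind: a => [d a ha|a a' IH IH']; last first.
  rewrite !(linD (proj1 (Ymu_bilinear M) _ _)) (linD (Tmu_linear M)) scalerDr -IH -IH'.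
  by rewrite opprD addrACA.
elim/dsum_ind: b => [e b hb|b b' IH IH']; last first.
  rewrite (linD (Tmu_linear M)) !(linD (proj2 (Ymu_bilinear M) _ _)) (linD (Tmu_linear M)) scalerDr -IH -IH'.
  by rewrite opprD addrACA.
(* The common degree of the three terms; with it the exponent l - d - e of [translate_right] is n +
   1. *)
pose l := d + e + n + 1.
have E1 : Tmu (Ymu a n b) = dinj (two_pt (dinj (two_pt a 1 b 0 (l - 1))) 1 vac 0 l).
  rewrite (YmuE _ _ ha hb) (TmuE (dinj_homogeneous _)) -/l.
  by rewrite (_ : l - 1 = d + e + n)// /l addrK.
have E2 : Ymu a n (Tmu b) = dinj (two_pt a 1 (dinj (two_pt b 1 vac 0 (e + 1))) 0 l).
  rewrite (TmuE hb) (YmuE _ _ ha (dinj_homogeneous _)).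
  by rewrite (_ : d + (e + 1) + n = l)// /l; lia.
have E3 : Ymu a (n + 1) b = dinj (two_pt a 1 b 0 l) by rewrite (YmuE _ _ ha hb) addrA.
rewrite E1 E2 E3 -(linB (@dinj_linear _ _ _)) -(linZ (@dinj_linear _ _ _)); congr dinj.
apply: functional_ext => phi.
have [_] := jet_uniq (translate_left phi a b) (translate_right phi ha hb).
rewrite linearB linearZ /= => ->; rewrite addrAC subrr add0r.
by rewrite (_ : l - d - e = n + 1)// /l; lia.
Qed.

End Translation.

(** * Comparison of Laurent expansions at 0 and at infinity *)

Section LaurentCoefficients.
Variable R : realType.
Local Notation C := (Cx R).

(* Removing the polar part at [0] and the polynomial part at infinity leaves the
   multiples of [1/z] to be compared. *)
Lemma residue_match (H : C -> C) (c d : int -> C) (k j : nat) (r R0 : R) :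
  (forall z, z != 0 -> cdiff H z) -> 0 < r -> 0 < R0 ->
  (forall n, n < - k.+1%:Z -> c n = 0) -> (forall n, j%:Z < n -> d n = 0) ->
  (forall z, z != 0 -> nm z < r -> partial_sum (fun n => z ^ n * c n : C) @ totally --> H z) ->
  (forall z, R0 < nm z -> partial_sum (fun n => z ^ n * d n : C) @ totally --> H z) ->
  c (-1) = d (-1).
Proof.
move=> Hd r0 R00 c0 d0 Hc Hd'.
(* [P] collects the exponents from - k - 1 to - 2 at 0, and [Q] those from j down to 0 at
   infinity. *)
pose P (z : C) := \sum_(i < k) z ^ (- k.+1%:Z + i%:Z) * c (- k.+1%:Z + i%:Z).
pose Q (z : C) := \sum_(i < j.+1) z ^+ (j - i) * d (j%:Z - i%:Z).
have [K KP] := tail_bound r0 c0 Hc k.+1.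
have R0i : 0 < R0^-1 by rewrite invr_gt0.
have d0' n : n < - j%:Z -> d (- n) = 0 by move=> nj; apply: d0; rewrite ltrNr.
have Hd2 (w : C) : w != 0 -> nm w < R0^-1 ->
    partial_sum (fun n => w ^ n * d (- n) : C) @ totally --> H w^-1.
  move=> w0 wR; have wR' : R0 < nm w^-1.
    by rewrite nmV -[X in X < _]invrK ltf_pV2 ?posrE ?nm_gt0.
  have inv : cancel (fun n : int => - n) (fun n => - n) by move=> n; rewrite opprK.
  have := cvg_sum_bij inv inv (Hd' _ wR').
  rewrite (_ : _ \o _ = fun n => w ^ n * d (- n))//.
  by apply/funext => n /=; rewrite exprz_inv opprK.
have [L LP] := tail_bound (h := fun w => H w^-1) R0i d0' Hd2 j.+2.
have Qb z : nm z <= 1 -> nm (Q z) <= \sum_(i < j.+1) nm (d (j%:Z - i%:Z)).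
  move=> z1; rewrite /Q; elim/big_ind2: _ => [|x x' y y' xy xy'|i _]; first by rewrite nm0.
    by apply: le_trans (nmD _ _) _; exact: lerD.
  by rewrite nmM nmX ler_piMl ?nm_ge0// exprn_ile1 ?nm_ge0.
have Pb z : 1 <= nm z -> nm (P z) <= (\sum_(i < k) nm (c (- k.+1%:Z + i%:Z))) / nm z ^+ 2.
  move=> z1; have z0 : z != 0 by rewrite -nm_gt0; lra.
  rewrite mulr_suml /P; elim/big_ind2: _ => [|x x' y y' xy xy'|i _]; first by rewrite nm0.
    by apply: le_trans (nmD _ _) _; exact: lerD.
  have -> : - k.+1%:Z + i%:Z = - (k.+1 - i)%N%:Z by have := ltn_ord i; lia.
  rewrite nmM mulrC ler_wpM2l ?nm_ge0// -exprnN nmV nmX lef_pV2 ?posrE ?exprn_gt0 ?nm_gt0//.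
  by apply: ler_weXn2l => //; have := ltn_ord i; lia.
apply: (@laurent_match _ (fun z => H z - P z - Q z) _ _
  (K + \sum_(i < j.+1) nm (d (j%:Z - i%:Z))) (Num.min (r / 4) 1)
  (L + \sum_(i < k) nm (c (- k.+1%:Z + i%:Z))) (Num.max (R0 * 8) 1)).
- move=> z z0; apply: cdiffB; first apply: cdiffB; first exact: Hd.
    by apply: cdiff_sum => i _; apply: cdiffM; [exact: cdiff_expz|exact: cdiff_cst].
  by apply: cdiff_sum => i _; apply: cdiffM; [apply: cdiffX; exact: cdiff_id|exact: cdiff_cst].
- by rewrite lt_min divr_gt0//= ltr01.
- move=> z z0; rewrite lt_min => /andP[zr z1]; have := KP z z0 zr.
  rewrite addNr expr0z mulr1 big_ord_recr /= -/(P z).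
  have -> : - k.+1%:Z + k%:Z = -1 :> int by lia.
  rewrite exprN1 [z^-1 * _]mulrC => B.
  have -> : H z - P z - Q z - c (-1) * z^-1 = (H z - (P z + c (-1) * z^-1)) - Q z by ring.
  by apply: le_trans (nmB _ _) _; apply: lerD B (Qb z (ltW z1)).
- by rewrite lt_max ltr01 orbT.
- move=> z; rewrite ge_max => /andP[zR z1].
  have z0 : z != 0 by rewrite -nm_gt0; lra.
  have zi : nm z^-1 < R0^-1 / 4.
    rewrite nmV -invfM ltf_pV2 ?posrE ?nm_gt0 ?mulr_gt0//; lra.
  have := LP z^-1; rewrite invr_eq0 => /(_ z0 zi).
  rewrite big_ord_recr /= invrK.
  have -> : \sum_(i < j.+1) z^-1 ^ (- j%:Z + i%:Z) * d (- (- j%:Z + i%:Z)) = Q z.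
    apply: eq_bigr => i _; rewrite exprz_inv.
    have -> : - (- j%:Z + i%:Z) = j%:Z - i%:Z by lia.
    by have := ltn_ord i; rewrite ltnS => ij; rewrite subzn// exprnP.
  have -> : - j%:Z + j.+1%:Z = 1 :> int by lia.
  have -> : - j%:Z + j.+2%:Z = 2 :> int by lia.
  rewrite expr1z [z^-1 * _]mulrC nmV => B.
  have -> : H z - P z - Q z - d (-1) * z^-1 = (H z - (Q z + d (-1) * z^-1)) - P z by ring.
  apply: le_trans (nmB _ _) _; rewrite mulrDl; apply: lerD (Pb z z1).
  by apply: le_trans B _; rewrite -exprVn.
Qed.

(** Multiplication by z^(-(p + 1)) moves the coefficient of exponent p to exponent -1, where
    [residue_match] applies. *)
Lemma laurent_coef_match (H : C -> C) (c d : int -> C) (n0 n1 : int) (r R0 : R) :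
  (forall z, z != 0 -> cdiff H z) -> 0 < r -> 0 < R0 ->
  (forall n, n < n0 -> c n = 0) -> (forall n, n1 < n -> d n = 0) ->
  (forall z, z != 0 -> nm z < r -> partial_sum (fun n => z ^ n * c n : C) @ totally --> H z) ->
  (forall z, R0 < nm z -> partial_sum (fun n => z ^ n * d n : C) @ totally --> H z) ->
  c = d.
Proof.
move=> Hd r0 R00 c0 d0 Hc Hd'; apply/funext => p.
have shift (z : C) (e : int -> C) : z != 0 ->
    partial_sum (fun n => z ^ n * e n : C) @ totally --> H z ->
    partial_sum (fun n => z ^ n * e (n + (p + 1)) : C) @ totally --> z ^ (- (p + 1)) * H z.
  move=> z0 /(cvg_sum_bij (h := fun n => n + (p + 1)) (g := fun n => n - (p + 1))).
  move=> /(_ (@addrK _ _) (@subrK _ _)) /(@cvg_sum_scale _ _ (z ^ (- (p + 1)))).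
  rewrite (_ : (fun n => _) = fun n => z ^ n * e (n + (p + 1)))//.
  by apply/funext => n /=; rewrite mulrA -expfzDr// addrC addrK.
have E : -1 + (p + 1) = p by rewrite addrC addrK.
pose k := absz (n0 - (p + 1))%R; pose j := absz (n1 - (p + 1))%R.
have K1 z : z != 0 -> cdiff (fun z => z ^ (- (p + 1)) * H z) z.
  by move=> z0; apply: cdiffM; [exact: cdiff_expz|exact: Hd].
have K2 n : n < - k.+1%:Z -> c (n + (p + 1)) = 0.
  by move=> nn; apply: c0; move: nn; rewrite /k; lia.
have K3 n : j%:Z < n -> d (n + (p + 1)) = 0.
  by move=> nn; apply: d0; move: nn; rewrite /j; lia.
have K4 (z : C) : z != 0 -> nm z < r -> partial_sum (fun n => z ^ n * c (n + (p + 1)) : C) @ totally -->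
    z ^ (- (p + 1)) * H z.
  by move=> z0 zr; apply: shift => //; exact: Hc.
have K5 (z : C) : R0 < nm z -> partial_sum (fun n => z ^ n * d (n + (p + 1)) : C) @ totally -->
    z ^ (- (p + 1)) * H z.
  move=> zR; apply: shift; last exact: Hd'.
  by rewrite -nm_gt0; exact: lt_trans zR.
by have := residue_match K1 r0 R00 K2 K3 K4 K5; rewrite E.
Qed.

Definition fdiff (X : zmodType) (h : int -> X) : int -> X := fun p => h (p - 1) - h p.

Lemma fdiffE (X : zmodType) (h : int -> X) p : fdiff h p = h (p - 1) - h p.
Proof. by []. Qed.

Lemma fdiff_series (z : C) (e : int -> C) (s : C) : z != 0 ->
  partial_sum (fun n => z ^ n * e n : C) @ totally --> s ->
  partial_sum (fun n => z ^ n * fdiff e n : C) @ totally --> (z - 1) * s.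
Proof.
move=> z0 H; have := cvg_sum_bij (h := fun n => n - 1) (g := fun n => n + 1) (@subrK _ _) (@addrK _ _) H.
move=> /(cvg_sum_lin (a := z) (b := -1))/(_ H); rewrite mulN1r mulrBl mul1r.
rewrite (_ : (fun n => _) = fun n => z ^ n * fdiff e n)//.
apply/funext => n /=; rewrite mulrA (_ : z * z ^ (n - 1) = z ^ n).
  by rewrite mulN1r /fdiff mulrBr.
by rewrite -{1}(expr1z z) -expfzDr//; congr (_ ^ _); lia.
Qed.

Lemma iter_fdiff_series N (z : C) (e : int -> C) (s : C) : z != 0 ->
  partial_sum (fun n => z ^ n * e n : C) @ totally --> s ->
  partial_sum (fun n => z ^ n * iter N (@fdiff C) e n : C) @ totally --> (z - 1) ^+ N * s.
Proof.
move=> z0 H; elim: N => [|N IH]; first by rewrite mul1r.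
by rewrite exprS -mulrA; exact: fdiff_series.
Qed.

Lemma iter_fdiff_below N (X : zmodType) (e : int -> X) n0 : (forall n, n < n0 -> e n = 0) ->
  forall n, n < n0 -> iter N (@fdiff X) e n = 0.
Proof.
move=> e0; elim: N => [|N IH] n nn /=; first exact: e0.
by rewrite fdiffE !IH ?subrr//; lia.
Qed.

Lemma iter_fdiff_above N (X : zmodType) (e : int -> X) n0 : (forall n, n0 < n -> e n = 0) ->
  forall n, n0 + N%:Z < n -> iter N (@fdiff X) e n = 0.
Proof.
move=> e0; elim: N => [|N IH] n nn /=; first by apply: e0; lia.
by rewrite fdiffE !IH ?subrr//; lia.
Qed.

Lemma iter_fdiff_lin (X Y : lmodType C) (g : X -> Y) N (e : int -> X) p : linear g ->
  g (iter N (@fdiff X) e p) = iter N (@fdiff Y) (fun p => g (e p)) p.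
Proof.
by move=> gl; elim: N p => [|N IH] p //=; rewrite !fdiffE (linB gl) !IH.
Qed.

Lemma iter_fdiffB (X : zmodType) N (e e' : int -> X) p :
  iter N (@fdiff X) (fun p => e p - e' p) p = iter N (@fdiff X) e p - iter N (@fdiff X) e' p.
Proof.
by elim: N p => [|N IH] p //=; rewrite !fdiffE !IH !opprD !opprK addrACA.
Qed.

(** The operator (x - y)^N preserves the part of given total degree up to the shift by N. On such a
    part setting y = 1 loses nothing and turns it into (x - 1)^N. *)
Lemma iter_xsuby_fdiff (X : zmodType) N (G : int -> int -> X) p q :
  iter N (@mul_xsuby X) G p q = iter N (@fdiff X) (fun p' => G p' (p + q - N%:Z - p')) p.
Proof.
elim: N p q => [|N IH] p q /=; first by congr G; lia.
rewrite /mul_xsuby fdiffE !IH.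
have -> : p - 1 + q - N%:Z = p + q - N.+1%:Z by lia.
by have -> : p + (q - 1) - N%:Z = p + q - N.+1%:Z by lia.
Qed.

Lemma iter_xsubyD (X : zmodType) N (F G : int -> int -> X) p q :
  iter N (@mul_xsuby X) (fun p q => F p q + G p q) p q =
  iter N (@mul_xsuby X) F p q + iter N (@mul_xsuby X) G p q.
Proof.
elim: N p q => [|N IH] p q //=; rewrite /mul_xsuby !IH.
by rewrite opprD addrACA.
Qed.

End LaurentCoefficients.

(** * Locality of the modes *)

Section Locality.
Variables (R : realType) (V : graded R) (M : geomVA V).
Local Notation C := (Cx R).
Local Notation dV := (dsum V).
Local Notation two_pt := (two_pt M).
Local Notation three_pt := (three_pt M).
Local Notation Ymu := (Ymu M).

Lemma tri_differentiable (y z : C) (x : C) :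
  differentiable ((fun x : C => tri x y z) : C^o -> 'rV[C]_3) x.
Proof.
rewrite (_ : (fun x : C => _) = fun x : C^o => x *: tri 1 0 0 + tri 0 y z).
  by apply: differentiableD; [exact: differentiableZl|exact: differentiable_cst].
apply/funext => u; apply/rowP => i; rewrite !mxE.
by case: eqP => _; [rewrite mulr1 addr0|case: eqP => _; rewrite mulr0 add0r].
Qed.

Section Homogeneous.
Variables (d e f l : int) (a b c : dV) (phi : {scalar (V l)}).
Hypotheses (ha : homogeneous d a) (hb : homogeneous e b) (hc : homogeneous f c).
Let s := l - d - e - f.
Let F (x : C) : C := phi (three_pt a x b 1 c 0 l).

Let conf_x (x : C) : x != 0 -> x != 1 -> conf (tri x 1 0).
Proof. by move=> x0 x1; apply/conf_tri; split; apply/eqP => //; rewrite oner_neq0. Qed.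

Lemma three_pt_cdiff x : x != 0 -> x != 1 -> cdiff F x.
Proof.
move=> x0 x1; exact: (@holomorphic_curve _ _ _ _ (fun x => gmu M _ x l)
  (fun x => tri x 1 0) x phi (scalar_linear phi) (gmu_holomorphic M _ l) (conf_x x0 x1)
  (tri_differentiable _ _ x)).
Qed.

(** In degree [l] the exponents of x and y add up to [s], so at y = 1 the exponent [p] of x
    determines the one of y. *)
Definition coef_out p : C := phi (dval (Ymu a p (Ymu b (s - p) c)) l).
Definition coef_in p : C := phi (dval (Ymu b (s - p) (Ymu a p c)) l).

Lemma series_out x : 1 < nm x -> partial_sum (fun n => x ^ n * coef_out n : C) @ totally --> F x.
Proof.
move=> x1; have x0 : x != 0 by rewrite -nm_gt0; lra.
have x0' : x <> 0 by apply/eqP.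
have lt1 : `|1 : C| < `|x - 0| by rewrite subr0 !nmE rc_lt nm1.
have lt0 : `|0 : C| < `|x - 0| by rewrite subr0 !nmE rc_lt nm0; lra.
have n10 : (1 : C) <> 0 by apply/eqP; rewrite oner_neq0.
have := @has_sum_functional _ _ _ _ _ (assoc_three M a b c l x0' n10 lt1 lt0) phi; rewrite !addr0.
move=> /(cvg_sum_bij (h := fun p => l - d - p) (g := fun k => l - d - k)).
have inv : cancel (fun p : int => l - d - p) (fun p => l - d - p) by move=> j; lia.
move=> /(_ inv inv); rewrite (_ : _ \o _ = fun n => x ^ n * coef_out n)//.
apply/funext => p /=; rewrite (two_pt_scale M l ha (dinj_homogeneous _) x0) linearZ /=.
have -> : l - d - (l - d - p) = p by lia.
rewrite /coef_out (YmuE _ _ hb hc).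
have -> : e + f + (s - p) = l - d - p by rewrite /s; lia.
rewrite (YmuE _ _ ha (dinj_homogeneous _)).
have -> : d + (l - d - p) + p = l by lia.
by rewrite dinj_in.
Qed.

Lemma series_in x : x != 0 -> nm x < 1 ->
  partial_sum (fun n => x ^ n * coef_in n : C) @ totally --> F x.
Proof.
move=> x0 x1; have x0' : x <> 0 by apply/eqP.
have xn1 : x != 1 by apply/eqP => x11; move: x1; rewrite x11 nm1 ltxx.
have lt1 : `|x| < `|1 - 0 : C| by rewrite subr0 !nmE rc_lt nm1.
have lt0 : `|0 : C| < `|1 - 0 : C| by rewrite subr0 !nmE rc_lt nm0 nm1.
have n10 : (1 : C) <> 0 by apply/eqP; rewrite oner_neq0.
have := @has_sum_functional _ _ _ _ _ (assoc_three M b a c l n10 x0' lt1 lt0) phi.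
rewrite !addr0 -three_pt_swap01; last exact: conf_x.
move=> /(cvg_sum_bij (h := fun p => d + f + p) (g := fun k => k - (d + f))).
move=> /(_ (@addKr_int _) (@subKr_int _)); rewrite (_ : _ \o _ = fun n => x ^ n * coef_in n)//.
apply/funext => p /=; rewrite (two_pt_scale M _ ha hc x0).
have -> : d + f + p - d - f = p by lia.
rewrite (linZ (@dinj_linear _ _ _)) (linZ (two_pt_linr M b n10)).
rewrite -[(_ *: two_pt _ _ _ _) l]/(_ *: two_pt _ _ _ _ l) linearZ /=.
rewrite /coef_in (YmuE _ _ ha hc) (YmuE _ _ hb (dinj_homogeneous _)).
have -> : e + (d + f + p) + (s - p) = l by rewrite /s; lia.
by rewrite dinj_in.
Qed.

Definition coef_diag n : C := phi (two_pt c 0 (Ymu a n b) 1 l).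

(** Here [a] and [b] are inserted around 1 while [c] stays at 0; permutation invariance restores the
    order of the three points. *)
Lemma series_diag t : t != 0 -> nm t < 1 ->
  partial_sum (fun n => t ^ n * coef_diag n : C) @ totally --> F (1 + t).
Proof.
move=> t0 t1; have t0' : t <> 0 by apply/eqP.
have lt1 : `|t| < `|0 - 1 : C| by rewrite sub0r !nmE rc_lt nmN nm1.
have lt0 : `|0 : C| < `|0 - 1 : C| by rewrite sub0r !nmE rc_lt nmN nm0 nm1.
have n01 : (0 : C) <> 1 by apply/eqP; rewrite eq_sym oner_neq0.
have x0 : 1 + t != 0.
  by apply/eqP => /eqP; rewrite addr_eq0 => /eqP E; move: t1; rewrite -nmN -E nm1 ltxx.
have x1 : 1 + t != 1 by rewrite -subr_eq0 addrAC subrr add0r.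
have := @has_sum_functional _ _ _ _ _ (assoc_three M c a b l n01 t0' lt1 lt0) phi.
have c1 : conf (tri 0 (1 + t) 1).
  by apply/conf_tri; split; [apply/eqP; rewrite eq_sym|apply/eqP|exact: n01].
have c2 : conf (tri (1 + t) 0 1).
  by apply/conf_tri; split; [apply/eqP|exact: n01|apply/eqP].
rewrite (addrC t 1) (add0r 1).
have -> : three_pt c 0 a (1 + t) b 1 = three_pt a (1 + t) b 1 c 0.
  exact: etrans (three_pt_swap01 M c a b c1) (three_pt_swap12 M a c b c2).
move=> /(cvg_sum_bij (h := fun p => d + e + p) (g := fun k => k - (d + e))).
move=> /(_ (@addKr_int _) (@subKr_int _)); rewrite (_ : _ \o _ = fun n => t ^ n * coef_diag n)//.
apply/funext => p /=; rewrite (two_pt_scale M _ ha hb t0).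
have -> : d + e + p - d - e = p by lia.
rewrite (linZ (@dinj_linear _ _ _)) (linZ (two_pt_linr M c n01)).
rewrite -[(_ *: two_pt _ _ _ _) l]/(_ *: two_pt _ _ _ _ l) linearZ /=.
by rewrite /coef_diag (YmuE _ _ ha hb).
Qed.

(* [(x - 1)^N mu(a, x, b, 1, c, 0)] extends to [C \ {0}], and multiplying by
   [x - 1] acts on Laurent coefficients by [fdiff]. *)
Lemma coef_match (N : nat) : (forall n, n < - N%:Z -> Ymu a n b = 0) ->
  iter N (@fdiff C) coef_in = iter N (@fdiff C) coef_out.
Proof.
move=> N0; have n01 : (0 : C) <> 1 by apply/eqP; rewrite eq_sym oner_neq0.
(* The coefficients of t^N F(1 + t); the shift by [N] removes all negative exponents. *)
pose h n := coef_diag (n - N%:Z).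
have h0 n : n < 0 -> h n = 0.
  move=> n0; rewrite /h /coef_diag N0 ?(lin0 (two_pt_linr M c n01)) ?linear0//.
  by lia.
have hs (t : C) : t != 0 -> nm t < 1 ->
    partial_sum (fun n => t ^ n * h n : C) @ totally --> t ^+ N * F (1 + t).
  move=> t0 t1; have := series_diag t0 t1.
  move=> /(cvg_sum_bij (h := fun n => n - N%:Z) (g := fun n => n + N%:Z)).
  move=> /(_ (@subrK _ _) (@addrK _ _)) /(@cvg_sum_scale _ _ (t ^+ N)).
  rewrite (_ : (fun n => _) = fun n => t ^ n * h n)//.
  by apply/funext => n /=; rewrite mulrA exprnP -expfzDr// addrC subrK.
have [K KP] := tail_bound ltr01 h0 hs 2.
(* The singularity at 1 is filled by the constant term [h 0]. The derivative there is [h 1], since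
   the remainder after two terms is of second order. *)
pose H x := if x == 1 then h 0 else (x - 1) ^+ N * F x.
have Hn x : x != 1 -> H x = (x - 1) ^+ N * F x by rewrite /H => /negbTE ->.
have Hd x : x != 0 -> cdiff H x.
  move=> x0; have [->|x1] := eqVneq x 1; last first.
    apply: (@cdiff_near _ (fun x => (x - 1) ^+ N * F x) _ _ (nm (x - 1))).
    - by rewrite nm_gt0 subr_eq0.
    - move=> w wx; rewrite Hn//; apply/eqP => w1; move: wx.
      by rewrite w1 nm_dist ltxx.
    - apply: cdiffM; last exact: three_pt_cdiff.
      by apply: cdiffX; apply: cdiffB; [exact: cdiff_id|exact: cdiff_cst].
  exists (h 1) => eps e0; exists (Num.min (1 / 4) (eps / (`|K| + 1))).
    by rewrite lt_min !divr_gt0// ltr_wpDl.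
  move=> w; rewrite lt_min => /andP[w4 we].
  have [->|w1] := eqVneq w 1; first by rewrite !subrr mulr0 subrr nm0 mulr0.
  have w10 : w - 1 != 0 by rewrite subr_eq0.
  have E : 1 + (w - 1) = w by rewrite addrC subrK.
  have H1 : H 1 = h 0 by rewrite /H eqxx.
  have := KP (w - 1) w10 w4; rewrite !big_ord_recl big_ord0 /= !add0r addr0 expr0z mul1r expr1z.
  rewrite E [(w - 1) * h 1]mulrC opprD addrA Hn// H1 => B; apply: le_trans B _.
  rewrite -[nm (w - 1) ^ 2]/(nm (w - 1) * nm (w - 1)) mulrA ler_wpM2r ?nm_ge0//.
  have K1 : 0 < `|K| + 1 by rewrite ltr_wpDl.
  apply: le_trans (_ : (`|K| + 1) * nm (w - 1) <= _).
    by rewrite ler_wpM2r ?nm_ge0// (le_trans (ler_norm K))// lerDl.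
  by rewrite -ler_pdivlMl// mulrC ltW.
have [Nb Nb0] := Ymu_truncated M b c; have [Na Na0] := Ymu_truncated M a c.
have K2 n : n < - Na%:Z -> iter N (@fdiff C) coef_in n = 0.
  apply: iter_fdiff_below => {}n nn.
  by rewrite /coef_in Na0// (lin0 (proj2 (Ymu_bilinear M) _ _)) (lin0 (dval_linear l)) linear0.
have K3 n : s + Nb%:Z + N%:Z < n -> iter N (@fdiff C) coef_out n = 0.
  apply: iter_fdiff_above => {}n nn.
  rewrite /coef_out Nb0 ?(lin0 (proj2 (Ymu_bilinear M) _ _)) ?(lin0 (dval_linear l)) ?linear0//.
  by move: nn; clear; lia.
have n1 (z : C) : nm z != 1 -> z != 1 by apply: contra => /eqP ->; rewrite nm1.
have K4 (z : C) : z != 0 -> nm z < 1 ->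
    partial_sum (fun n => z ^ n * iter N (@fdiff C) coef_in n : C) @ totally --> H z.
  move=> z0 z1; rewrite Hn; last by apply: n1; rewrite lt_eqF.
  exact: iter_fdiff_series z0 (series_in z0 z1).
have K5 (z : C) : 1 < nm z ->
    partial_sum (fun n => z ^ n * iter N (@fdiff C) coef_out n : C) @ totally --> H z.
  move=> z1; rewrite Hn; last by apply: n1; rewrite gt_eqF.
  have z0 : z != 0 by rewrite -nm_gt0; exact: lt_trans ltr01 z1.
  exact: iter_fdiff_series z0 (series_out z1).
exact: laurent_coef_match Hd ltr01 ltr01 K2 K3 K4 K5.
Qed.

End Homogeneous.

Lemma Ymu_homogeneous d e n a b : homogeneous d a -> homogeneous e b ->
  homogeneous (d + e + n) (Ymu a n b).
Proof. by move=> ha hb; rewrite (YmuE _ _ ha hb); exact: dinj_homogeneous. Qed.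

Lemma Ymu_local d e a b (N : nat) : homogeneous d a -> homogeneous e b ->
  (forall n, n < - N%:Z -> Ymu a n b = 0) ->
  forall c p q, iter N (@mul_xsuby dV) (Y_commutator Ymu a b c) p q = 0.
Proof.
move=> ha hb N0 c p q; elim/dsum_ind: c => [f c hc|c c' IH IH']; last first.
  rewrite (_ : Y_commutator Ymu a b (c + c') =
    fun p q => Y_commutator Ymu a b c p q + Y_commutator Ymu a b c' p q).
    by rewrite iter_xsubyD IH IH' addr0.
  apply/funext => i; apply/funext => j; rewrite /Y_commutator.
  rewrite !(linD (proj2 (Ymu_bilinear M) _ _)) opprD addrACA.
  by [].
rewrite iter_xsuby_fdiff; set sg := p + q - N%:Z.
apply: dsum_eq => l; rewrite (iter_fdiff_lin _ _ _ (dval_linear l)) (lin0 (dval_linear l)).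
(* For homogeneous vectors the products along this antidiagonal live in one degree; in every other
   degree the whole sequence is 0. *)
have [lE|ln] := eqVneq l (d + e + f + sg); last first.
  have Z p' : dval (Y_commutator Ymu a b c p' (sg - p')) l = 0.
    rewrite /Y_commutator (linB (dval_linear l)).
    rewrite (@Ymu_homogeneous _ _ p' _ _ ha (@Ymu_homogeneous _ _ (sg - p') _ _ hb hc)); last by apply: contra ln => /eqP ->; apply/eqP; lia.
    rewrite (@Ymu_homogeneous _ _ (sg - p') _ _ hb (@Ymu_homogeneous _ _ p' _ _ ha hc)) ?subrr//.
    by apply: contra ln => /eqP ->; apply/eqP; lia.
  apply: (@iter_fdiff_below _ _ _ (p + 1)); last by lia.
  by move=> n _; exact: Z.
apply: functional_ext => phi; rewrite (iter_fdiff_lin _ _ _ (scalar_linear phi)) linear0.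
rewrite (_ : (fun p' => _) = fun p' => coef_out d e f a b c phi p' - coef_in d e f a b c phi p').
  by rewrite iter_fdiffB (coef_match phi ha hb hc N0) subrr.
apply/funext => p'; rewrite /coef_out /coef_in /Y_commutator (linB (dval_linear l)) linearB.
by have -> : l - d - e - f = sg by rewrite lE; lia.
Qed.

Lemma local_monotone a b c (N k : nat) :
  (forall p q, iter N (@mul_xsuby dV) (Y_commutator Ymu a b c) p q = 0) ->
  forall p q, iter (k + N) (@mul_xsuby dV) (Y_commutator Ymu a b c) p q = 0.
Proof.
move=> H p q; rewrite iterD (_ : iter N _ _ = fun _ _ => 0) ?iter_xsuby0//.
by apply/funext => i; apply/funext => j; exact: H.
Qed.

Lemma Ymu_locality : Y_locality Ymu.
Proof.
move=> a b; elim/dsum_ind: a => [d a ha|a a' [N HN] [N' HN']].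
  elim/dsum_ind: b => [e b hb|b b' [N HN] [N' HN']].
    by have [N N0] := Ymu_truncated M a b; exists N; exact: Ymu_local ha hb N0.
  exists (N' + N)%N => c p q.
  rewrite (_ : Y_commutator Ymu a (b + b') c =
    fun p q => Y_commutator Ymu a b c p q + Y_commutator Ymu a b' c p q).
    rewrite iter_xsubyD (local_monotone _ (HN c)) addnC (local_monotone _ (HN' c)) addr0//.
  apply/funext => i; apply/funext => j; rewrite /Y_commutator.
  rewrite !(linD (proj1 (Ymu_bilinear M) _ _)) (linD (proj2 (Ymu_bilinear M) _ _)).
  by rewrite opprD addrACA.
exists (N' + N)%N => c p q.
rewrite (_ : Y_commutator Ymu (a + a') b c =
  fun p q => Y_commutator Ymu a b c p q + Y_commutator Ymu a' b c p q).
  rewrite iter_xsubyD (local_monotone _ (HN c)) addnC (local_monotone _ (HN' c)) addr0//.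
apply/funext => i; apply/funext => j; rewrite /Y_commutator.
rewrite !(linD (proj1 (Ymu_bilinear M) _ _)) (linD (proj2 (Ymu_bilinear M) _ _)).
by rewrite opprD addrACA.
Qed.

Definition vertex_of_geom : vertexVA V :=
  VertexVA (Ymu_bilinear M) (Ymu_degree M) (Tmu_linear M) (Tmu_degree M) (vac_mu_homogeneous M)
    Ymu_locality (Ymu_translation M) (Ymu_creation M) (Ymu_vacuum M).

Lemma vertex_of_geomP : is_vertex_of_geom M vertex_of_geom.
Proof.
split; [exact: Ymu_laurent|exact: Tmu_derivative|exact: vac_muE].
Qed.

End Locality.

(** * The isomorphism of categories *)
Section Morphisms.
Variables (R : realType) (V V' : graded R) (M : geomVA V) (M' : geomVA V') (f : ghom V V').
Local Notation C := (Cx R).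
Local Notation dV := (dsum V).

Lemma dmap_ghom_linear : linear (dmap f).
Proof. by move=> c u v; apply: dsum_eq => l; exact: (gfun_linear f c (dval u l) (dval v l)). Qed.

Lemma dmap_ghom_homogeneous d a : homogeneous d a -> homogeneous d (dmap f a).
Proof.
move=> ha k kd; rewrite -[LHS]/(f k (dval a k)) ha//; exact: lin0 (@gfun_linear _ _ _ f k).
Qed.

Lemma geom_morphism_vertex : geom_morphism M M' f ->
  vertex_morphism (vertex_of_geom M) (vertex_of_geom M') f.
Proof.
move=> Hf; have n10 : (1 : C) <> 0 by apply/eqP; rewrite oner_neq0.
have H2 a b l : f l (two_pt M a 1 b 0 l) = two_pt M' (dmap f a) 1 (dmap f b) 0 l.
  have := congr1 (fun v : gbar V' => v l)
    (Hf _ (row_mx (const_mx a : 'rV_1) (const_mx b : 'rV_1)) _ (proj2 (conf2 1 0) n10)).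
  by rewrite map_row_mx !map_const_mx.
split=> /= [a b n|]; last first.
  rewrite /vac_mu (dmap_dinj f); congr dinj.
  have := congr1 (fun v : gbar V' => v 0) (Hf 0 (0 : 'rV_0) 0 (@conf0 R 0)).
  by rewrite (_ : map_mx (dmap f) 0 = 0)//; apply/rowP => -[].
elim/dsum_ind: a => [d a ha|a a' IH IH']; last first.
  by rewrite !(linD (proj1 (Ymu_bilinear _) _ _), linD dmap_ghom_linear) IH IH'.
elim/dsum_ind: b => [e b hb|b b' IH IH']; last first.
  by rewrite !(linD (proj2 (Ymu_bilinear _) _ _), linD dmap_ghom_linear) IH IH'.
rewrite (YmuE _ _ ha hb) (YmuE _ _ (dmap_ghom_homogeneous ha) (dmap_ghom_homogeneous hb)).
by rewrite (dmap_dinj f) H2.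
Qed.

Lemma vertex_morphism_geom : vertex_morphism (vertex_of_geom M) (vertex_of_geom M') f ->
  geom_morphism M M' f.
Proof.
move=> [HY H0]; apply: morphism_of_mu2 => [a b z z0|]; last first.
  rewrite -[gmu M 0 0]/(no_pt M) -[gmu M' 0 0]/(no_pt M') -!vac_muE.
  exact: (congr1 (@dval _ _) H0).
apply: functional_extensionality_dep => l.
apply: has_sum_unique (Ymu_laurent M' (dmap f a) (dmap f b) l z0).
have := has_sum_lin (@gfun_linear _ _ _ f l) (Ymu_laurent M a b l z0).
rewrite (_ : (fun n => _) = fun n => z ^ n *: dval (Ymu M' (dmap f a) n (dmap f b)) l)//.
apply/funext => n; rewrite (linZ (@gfun_linear _ _ _ f l)); congr (_ *: _).
exact: (congr1 (fun v : dsum V' => dval v l) (HY a b n)).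
Qed.

End Morphisms.

(** * The two constructions are mutually inverse *)

Section Inverse.
Variable R : realType.
Local Notation C := (Cx R).

Lemma geomVA_eq (V : graded R) (M M' : geomVA V) : @gmu _ _ M = @gmu _ _ M' -> M = M'.
Proof.
case: M => mu1 ? ? ? ? ? ? ? ?; case: M' => mu2 ? ? ? ? ? ? ? ? /= E.
by subst mu2; f_equal; exact: Prop_irrelevance.
Qed.

Lemma vertexVA_eq (V : graded R) (S S' : vertexVA V) :
  vY S = vY S' -> vT S = vT S' -> vvac S = vvac S' -> S = S'.
Proof.
case: S => Y T v ? ? ? ? ? ? ? ? ?; case: S' => Y' T' v' ? ? ? ? ? ? ? ? ? /= EY ET Ev.
by subst Y' T' v'; f_equal; exact: Prop_irrelevance.
Qed.

(** The identity map is a morphism of the vertex algebras, hence of the geometric ones, so the two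
    functions agree on configurations; elsewhere both are 0 by [gmu_diag]. *)
Lemma vertex_of_geom_inj (V : graded R) : injective (@vertex_of_geom R V).
Proof.
move=> M M' E; have : vertex_morphism (vertex_of_geom M) (vertex_of_geom M') (gid V).
  by rewrite E; exact: vertex_morphism_id.
move=> /vertex_morphism_geom H; apply: geomVA_eq.
apply: functional_extensionality_dep => n; apply/funext => a; apply/funext => z.
have [dz|cz] := pselect (diag z); first by rewrite !gmu_diag.
have -> : a = map_mx (dmap (gid V)) a by apply/rowP => i; rewrite mxE dmap_id.
by rewrite -H//; congr (gmu M _ z); apply/rowP => i; rewrite mxE dmap_id.
Qed.

Section Vertex.
Variables (V : graded R) (S : vertexVA V).
Local Notation dV := (dsum V).

Lemma corr_no_pt : corr S (0 : 'rV[dV]_0) 0 = dval (vvac S).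
Proof.
apply: functional_extensionality_dep => l.
have lt (i j : 'I_0) : (i < j)%N -> `|(0 : 'rV[C]_0) 0 j| < `|(0 : 'rV[C]_0) 0 i| by case: i.
have := proj2 (corr_is_correlation S (0 : 'rV[dV]_0)) 0 (@conf0 R 0) lt l.
set F := fun k : 'rV[int]_0 => _ => HF.
have F0 k : k \notin [fset 0]%fset -> F k = 0.
  by rewrite inE => /eqP[]; apply/rowP => -[].
rewrite (has_sum_unique HF (has_sum_fin F0)) big_seq_fset1 /F big_ord0 scale1r.
by rewrite (_ : enum 'I_0 = [::])//; apply: size0nil; rewrite size_enum_ord.
Qed.

Lemma opp_sub1_eq0 (x : int) : (- x - 1 == 0) = (x == -1).
Proof. lia. Qed.

(** The point (1, 0) lies in the ordered domain, where the defining series applies. The coordinate 0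
    selects the exponent 0 of the second variable, and the degree then fixes the first exponent. *)
Lemma corr_pair d e a b l : homogeneous d a -> homogeneous e b ->
  corr S (row_mx (const_mx a : 'rV_1) (const_mx b : 'rV_1))
    (row_mx (const_mx 1 : 'rV_1) (const_mx 0 : 'rV_1)) l = dval (vY S a (l - d - e) b) l.
Proof.
move=> ha hb; have n10 : (1 : C) <> 0 by apply/eqP; rewrite oner_neq0.
set ab := row_mx _ _; set z := row_mx _ _.
have lt (i j : 'I_(1 + 1)) : (i < j)%N -> `|z 0 j| < `|z 0 i|.
  rewrite /z; case: (@ord_split 1 1 i) => -[i' ->]; case: (@ord_split 1 1 j) => -[j' ->];
    rewrite !ord1 //= => _.
  by rewrite row_mxEl row_mxEr !mxE normr0 normr1 ltr01.
have := proj2 (corr_is_correlation S ab) z (proj2 (conf2 1 0) n10) lt l.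
set F := fun k : 'rV[int]_(1 + 1) => _ => HF.
have FE k : F k = 0 ^ (- k 0 (rshift 1 0) - 1) *:
    dval (mode (vY S) a (k 0 (lshift 1 0)) (mode (vY S) b (k 0 (rshift 1 0)) (vvac S))) l.
  rewrite /F big_split_ord /= !big_ord1 enum_row enum_I1 /= /ab /z.
  by rewrite !row_mxEl !row_mxEr !mxE exp1rz mul1r.
(* In terms of modes: d + e - l - 1 is the exponent l - d - e, and -1 is the exponent 0. *)
pose k0 : 'rV[int]_(1 + 1) := row_mx (const_mx (d + e - l - 1)) (const_mx (-1)).
have F0 k : k \notin [fset k0]%fset -> F k = 0.
  rewrite inE FE => kk; have [k1|k1] := eqVneq (k 0 (rshift 1 0)) (-1); last first.
    by rewrite exp0rz opp_sub1_eq0 (negbTE k1) scale0r.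
  rewrite k1 opprK subrr expr0z scale1r {2}/mode opprK subrr (proj1 (vY_creation S b)).
  rewrite (@Y_homogeneous _ _ S _ _ (- k 0 (lshift 1 0) - 1) _ _ ha hb)//.
  apply: contra kk => /eqP El; apply/eqP/rowP => i; rewrite /k0.
  case: (@ord_split 1 1 i) => -[j ->]; rewrite ord1.
    by rewrite row_mxEl mxE; lia.
  by rewrite row_mxEr mxE.
rewrite (has_sum_unique HF (has_sum_fin F0)) big_seq_fset1 FE /k0 row_mxEl row_mxEr !mxE.
rewrite opprK subrr expr0z scale1r {2}/mode opprK subrr (proj1 (vY_creation S b)) /mode.
by congr (dval (vY S a _ b) l); lia.
Qed.

Lemma vertex_of_geomK : vertex_of_geom (geom_of_vertex S) = S.
Proof.
have EY : Ymu (geom_of_vertex S) = vY S.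
  apply/funext => a; apply/funext => n; apply/funext => b.
  elim/dsum_ind: a => [d a ha|a a' IH IH']; last first.
    by rewrite (linD (proj1 (Ymu_bilinear _) n b)) IH IH' (linD (Y_linl S n b)).
  elim/dsum_ind: b => [e b hb|b b' IH IH']; last first.
    by rewrite (linD (proj2 (Ymu_bilinear _) a n)) IH IH' (linD (Y_linr S a n)).
  rewrite (YmuE _ _ ha hb) -(homogeneous_dinj (@Y_homogeneous _ _ S _ _ n _ _ ha hb)); congr dinj.
  apply: etrans (corr_pair _ ha hb) _.
  by have -> : d + e + n - d - e = n by lia.
have Ev : vac_mu (geom_of_vertex S) = vvac S.
  by rewrite /vac_mu /no_pt /= corr_no_pt (homogeneous_dinj (vvac_degree S)).
(* The operator T is determined by Y and the vacuum: the constant coefficient of [T, Y(a, x)]|0>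
   reads T a = Y a 1 |0>. *)
apply: vertexVA_eq => //=; apply/funext => a; rewrite /Tmu EY Ev.
have [T0 TY] := vY_translation S; have := TY a (vvac S) 0.
by rewrite (proj1 (vY_creation S a)) T0 (lin0 (Y_linr S a 0)) subr0 add0r scale1r.
Qed.

End Vertex.

(** A right inverse of an injective map is a two-sided inverse. *)
Lemma geom_of_vertexK (V : graded R) (M : geomVA V) : geom_of_vertex (vertex_of_geom M) = M.
Proof. by apply: vertex_of_geom_inj; exact: vertex_of_geomK. Qed.

End Inverse.

(** * Strict isomorphism of the categories *)

Section Functors.

Lemma functor_eq (A B : category) (F G : functor A B) (o : A -> B)
    (h : forall X Y, chom X Y -> chom (o X) (o Y)) h1 hM h1' hM' :
  F = @Functor A B o h h1 hM -> G = @Functor A B o h h1' hM' -> F = G.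
Proof. by move=> -> ->; f_equal; exact: Prop_irrelevance. Qed.

(** The two images of a morphism have different types until the objects are identified, hence
    heterogeneous equality. *)
Lemma fhom_JMeq (A B : category) (F G : functor A B) : F = G ->
  forall X Y (f : chom X Y), JMeq (fhom F f) (fhom G f).
Proof. by move=> ->. Qed.

(** Equality of functors includes equality of dependently typed actions on morphisms. Once the
    action on objects is replaced by the identity, faithfulness reduces the rest to an equation in
    [B], free of transports. *)
Lemma faithful_endofunctor (A B : category) (U : functor A B) (E : functor A A) :
  (forall X Y (f g : chom X Y), fhom U f = fhom U g -> f = g) ->
  (forall X, E X = X) -> functor_comp U E = U -> E = functor_id A.
Proof.
case: E => o h h1 hM Uf /= oE; have oid : o = id by apply/funext.
subst o => UE; have hE : h = fun X Y f => f.
  apply: functional_extensionality_dep => X; apply: functional_extensionality_dep => Y.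
  apply/funext => f; apply: Uf; exact: JMeq_eq (fhom_JMeq UE f).
by subst h; exact: (functor_eq erefl erefl).
Qed.

Variable R : realType.

(** Closed by [Defined], because the comparison with the forgetful functors and the formula on
    objects hold by computation. *)
Definition geom_to_vertex : functor (geomCat R) (vertexCat R).
Proof.
apply: (@Functor (geomCat R) (vertexCat R)
  (fun A => existT _ (projT1 A) (vertex_of_geom (projT2 A)))
  (fun A B f => exist _ (sval f) (geom_morphism_vertex (svalP f)))).
  by move=> A; exact: shom_eq.
by move=> A B D g f; exact: shom_eq.
Defined.

Lemma geom_of_vertex_morphism (V V' : graded R) (S : vertexVA V) (S' : vertexVA V') f :
  vertex_morphism S S' f -> geom_morphism (geom_of_vertex S) (geom_of_vertex S') f.
Proof. by move=> H; apply: vertex_morphism_geom; rewrite !vertex_of_geomK. Qed.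

Definition vertex_to_geom : functor (vertexCat R) (geomCat R).
Proof.
apply: (@Functor (vertexCat R) (geomCat R)
  (fun A => existT _ (projT1 A) (geom_of_vertex (projT2 A)))
  (fun A B f => exist _ (sval f) (geom_of_vertex_morphism (svalP f)))).
  by move=> A; exact: shom_eq.
by move=> A B D g f; exact: shom_eq.
Defined.

Lemma geom_to_vertex_isomorphism : is_isomorphism geom_to_vertex.
Proof.
exists vertex_to_geom; split.
  apply: (@faithful_endofunctor _ _ (geom_forget R)) => [X Y f g|[V M]|]; first exact: shom_eq.
    by rewrite /= geom_of_vertexK.
  exact: (functor_eq erefl erefl).
apply: (@faithful_endofunctor _ _ (vertex_forget R)) => [X Y f g|[V M]|]; first exact: shom_eq.
  by rewrite /= vertex_of_geomK.
exact: (functor_eq erefl erefl).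
Qed.

End Functors.

Theorem theorem4p2 (R : realType) :
  exists (Phi : forall V : graded R, geomVA V -> vertexVA V)
         (Psi : forall V : graded R, vertexVA V -> geomVA V)
         (F : functor (geomCat R) (vertexCat R)),
    (forall V : graded R, cancel (Phi V) (Psi V) /\ cancel (Psi V) (Phi V)) /\
    (forall (V : graded R) (M : geomVA V), is_vertex_of_geom M (Phi V M)) /\
    (forall (V : graded R) (S : vertexVA V) (m : nat) (a : 'rV[dsum V]_m),
       is_correlation S a (gmu (Psi V S) a) /\
       (forall g : 'rV[Cx R]_m -> gbar V, is_correlation S a g ->
          forall z : 'rV[Cx R]_m, conf z -> g z = gmu (Psi V S) a z)) /\
    (forall (V V' : graded R) (M : geomVA V) (M' : geomVA V') (f : ghom V V'),
       geom_morphism M M' f <-> vertex_morphism (Phi V M) (Phi V' M') f) /\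
    is_isomorphism F /\
    (forall (V : graded R) (M : geomVA V),
       fob F (existT (@geomVA R) V M) = existT (@vertexVA R) V (Phi V M)) /\
    functor_comp (vertex_forget R) F = geom_forget R.
Proof.
exists (@vertex_of_geom R), (@geom_of_vertex R), (geom_to_vertex R).
split; first by move=> V; split; [exact: geom_of_vertexK|exact: vertex_of_geomK].
split; first exact: vertex_of_geomP.
split.
  move=> V S m a; split; first exact: corr_is_correlation.
  by move=> g gc z cz; exact: correlation_unique.
split; first by move=> V V' M M' f; split; [exact: geom_morphism_vertex|exact: vertex_morphism_geom].
split; first exact: geom_to_vertex_isomorphism.
split=> //; exact: (functor_eq erefl erefl).
Qed.
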